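(* Let $I=\{(x,y)\in(\mathbb F_{p^2})^2\mid x^p+x+y^{p+1}=0\}$. The irreducible components of $\mathrm{Flag}^{\perp,F,V}_{\mathrm{id},6}$ are the following subvarieties $Y$, $Z$, $T_\infty$ and $T_{x,y}$ for $(x,y)\in I$ (given by their $\mathbb F$-valued points). - $Y$: all flags $\Phi\begin{pmatrix}0\\ G\end{pmatrix}$ with $G\in\mathrm{GL}_3(\mathbb F)$. $Y$ is isomorphic to the variety of full flags in $\mathbb F^3$ and has dimension $3$. - $Z$: all flags $$\Phi\begin{pmatrix}\begin{matrix}0&0\\0&0\\0&0\end{matrix}&\begin{matrix}\det B_1\\-\det B_2\\\det B_3\end{matrix}\\ B&u\end{pmatrix}\quad\text{and}\quad \Phi\begin{pmatrix}0\\ (B\ v)\end{pmatrix},$$ where $B$ is a $3\times2$-matrix of rank $2$ over $\mathbb F$ with $(\det B_1)^p\det B_3+(\det B_2)^{p+1}+\det B_1(\det B_3)^p=0$, $u\in\mathbb F^3$ is arbitrary, and $v\in\mathbb F^3$ is such that $(B\ v)\in\mathrm{GL}_3(\mathbb F)$. $Z$ has dimension $3$. - $T_\infty$: all flags $\Phi(e_4,\ ae_3+be_5+ce_6,\ e_5)$ with $(a,b,c)\in\mathbb F^3\setminus\mathbb F\cdot(0,1,0)$, and all flags $\Phi(e_4,\ e_5,\ \alpha e_3+\beta e_6)$ with $(\alpha,\beta)\in\mathbb F^2\setminus\{0\}$. - $T_{x,y}$: all flags $\Phi(x^pe_4+y^pe_5+e_6,\ a(e_1+ye_2+xe_3)+be_4+ce_5,\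 -ye_4+e_5)$ with $(a,b,c)\in\mathbb F^3\setminus\mathbb F\cdot(0,-y,1)$, and all flags $\Phi(x^pe_4+y^pe_5+e_6,\ -ye_4+e_5,\ \alpha(e_1+ye_2+xe_3)+\beta e_4)$ with $(\alpha,\beta)\in\mathbb F^2\setminus\{0\}$. Each of $T_\infty$ and $T_{x,y}$ is isomorphic to the blowing-up of $\mathbb P^2_{\mathbb F}$ in a closed point, and has dimension $2$. Moreover: (a) the $T_\zeta$ are pairwise disjoint, as $\zeta$ runs through $I\cup\{\infty\}$; (b) $Y\cap Z$ consists of the flags $\Phi\begin{pmatrix}0\\(B\ v)\end{pmatrix}$ with $B,v$ as in the definition of $Z$; it is isomorphic to $Z_0$ and has dimension $2$. Here $Z_0$ is the closed subvariety of the variety of flags $(W_1\subset W_2)$, $\dim W_j=j$, in $\mathbb F^3$ consisting of the flags spanned by the columns of matrices $B$ as in the definition of $Z$; (c) $Y\cap T_\infty$ consists of the flags in $Y$ with $W_1=\mathbb F e_4$, $Y\cap T_{x,y}$ consists of the flags in $Y$ with $W_1=\mathbb F(x^pe_4+y^pe_5+e_6)$, and both are isomorphic to $\mathbb P^1_{\mathbb F}$; (d) $Z\cap T_\infty$ consists of the flags $\Phi(e_4,e_5,\alpha e_3+\beta e_6)$ with $(\alpha,\beta)\neq0$, $Z\cap T_{x,y}$ consists of the flags $\Phi(x^pe_4+y^pe_5+e_6,\,-ye_4+e_5,\,\alpha(e_1+ye_2+xe_3)+\beta e_4)$ with $(\alpha,\beta)\ne0$, and both are isomorphic to $\mathbb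 P^1_{\mathbb F}$; (e) $Y\cap Z\cap T_\infty$ and $Y\cap Z\cap T_{x,y}$ each consist of exactly one point, namely $\Phi(e_4,e_5,e_6)$ and $\Phi(x^pe_4+y^pe_5+e_6,\,-ye_4+e_5,\,e_4)$, respectively.
   Context: Let $p$ be a prime and $\mathbb F$ an algebraic closure of $\mathbb F_p$ with Frobenius $\sigma(x)=x^p$. Varieties are reduced schemes of finite type over $\mathbb F$; subvarieties are reduced. On $\mathbb F^6$ with standard basis $e_1,\dots,e_6$ consider the alternating pairing with $\langle e_i,e_j\rangle=0=\langle e_{3+i},e_{3+j}\rangle$ and $\langle e_i,e_{3+j}\rangle=\delta_{ij}$ for $1\le i,j\le3$; the $\sigma$-linear map $F$ with $F(e_1)=e_6$, $F(e_2)=e_5$, $F(e_3)=e_4$, $F(e_4)=F(e_5)=F(e_6)=0$; and the $\sigma^{-1}$-linear map $V$ with $V(e_1)=-e_6$, $V(e_2)=-e_5$, $V(e_3)=-e_4$, $V(e_4)=V(e_5)=V(e_6)=0$. $\mathrm{Flag}^{\perp,F,V}_{\mathrm{id},6}$ is the reduced closed subvariety of the variety of full flags in $\mathbb F^6$ whose $\mathbb F$-valued points are the flags $(W_i)_{i=0}^6$, $\dim W_i=i$, with $W_{6-i}=W_i^\perp$ and $F(W_i),V(W_i)\subset W_i$ for all $i$. For a $6\times3$-matrix $C$ of rank $3$ with columns $c_1,c_2,c_3$ spanning a totally isotropic subspace, $\Phi(C)=\Phi(c_1,c_2,c_3)$ denotes the full symplectic flag $(W_i)_{i=0}^6$ with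 $W_j=\langle c_1,\dots,c_j\rangle$ for $0\le j\le 3$ and $W_{6-j}=W_j^\perp$. Matrices written in block form have an upper block consisting of rows $1$–$3$ and a lower block consisting of rows $4$–$6$. For a $3\times2$-matrix $B$, $B_i$ denotes the $2\times2$-matrix obtained from $B$ by deleting the $i$-th row. *)

(* Defs.v *)
From HB Require Import structures.
From mathcomp Require Import all_boot all_order all_algebra.
From mathcomp Require Import boolp classical_sets topology.
From mathcomp Require Import mpoly.

Set Implicit Arguments.
Unset Strict Implicit.
Unset Printing Implicit Defensive.

Import GRing.Theory.
Local Open Scope ring_scope.
Local Open Scope classical_set_scope.

(** * Varieties in the classical sense

    A reduced scheme of finite type over the algebraically closed field [F] is
    represented by the topological space of its [F]-valued points together
    with its sheaf of [F]-valued regular functions.  A function on an open set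
    [U] is encoded by a total function whose values outside [U] are ignored. *)

Record fspace (F : closedFieldType) := FSpace {
  fspace_top :> topologicalType;
  regular : set fspace_top -> (fspace_top -> F) -> Prop }.

Definition var_morphism (F : closedFieldType) (X Y : fspace F)
    (f : X -> Y) : Prop :=
  (forall U : set Y, open U -> open (f @^-1` U)) /\
  (forall (U : set Y) (g : Y -> F),
     open U -> regular U g -> regular (f @^-1` U) (g \o f)).

Definition isomorphic (F : closedFieldType) (X Y : fspace F) : Prop :=
  exists (f : X -> Y) (g : Y -> X),
    [/\ cancel f g, cancel g f, var_morphism f & var_morphism g].

(** Affine space of [n] x [k] matrices with its Zariski topology. *)

Definition zariski (F : closedFieldType) (n k : nat) : Type := 'M[F]_(n, k).

Definition peval (F : closedFieldType) (n k : nat)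
    (P : {mpoly F[n * k]}) (A : zariski F n k) : F :=
  P.@[fun i => mxvec A 0 i].

Definition zariski_open (F : closedFieldType) (n k : nat) :
    set_system (zariski F n k) :=
  [set U | exists S : set {mpoly F[n * k]},
     forall A, U A <-> exists2 P, S P & peval P A != 0].

Lemma zariski_openT (F : closedFieldType) (n k : nat) :
  @zariski_open F n k setT.
Proof.
exists [set P : {mpoly F[n * k]} | P = 1] => A; split=> // _; exists 1 => //.
by rewrite /peval meval1 oner_neq0.
Qed.

Lemma zariski_openI (F : closedFieldType) (n k : nat) :
  setI_closed (@zariski_open F n k).
Proof.
move=> U V [S hS] [S' hS'].
exists [set R : {mpoly F[n * k]} | exists P Q, [/\ S P, S' Q & R = P * Q]] => A.
split.
  move=> [/hS [P SP nP] /hS' [Q SQ nQ]]; exists (P * Q); first by exists P, Q.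
  by rewrite /peval mevalM mulf_neq0.
move=> [_ [P [Q [SP SQ ->]]]]; rewrite /peval mevalM mulf_eq0 negb_or.
by move=> /andP[nP nQ]; split; [apply/hS; exists P | apply/hS'; exists Q].
Qed.

Lemma zariski_open_bigU (F : closedFieldType) (n k : nat) (I : Type)
    (f : I -> set (zariski F n k)) :
  (forall i, zariski_open (f i)) -> zariski_open (\bigcup_i f i).
Proof.
move=> hf.
exists [set P : {mpoly F[n * k]} |
  exists i, forall A, peval P A != 0 -> f i A] => A; split.
  move=> [i _ fiA]; have [S hS] := hf i; have [P SP nP] := (hS A).1 fiA.
  by exists P => //; exists i => B nB; apply/hS; exists P.
by move=> [P [i hP] nP]; exists i => //; exact: hP.
Qed.

HB.instance Definition _ (F : closedFieldType) (n k : nat) :=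
  Choice.copy (zariski F n k) 'M[F]_(n, k).
HB.instance Definition _ (F : closedFieldType) (n k : nat) :=
  isOpenTopological.Build (zariski F n k) (@zariski_openT F n k)
    (@zariski_openI F n k) (@zariski_open_bigU F n k).

Definition affine (F : closedFieldType) (n k : nat) : fspace F :=
  @FSpace F (zariski F n k) (fun U f => forall A, U A ->
    exists P Q, peval Q A != 0 /\
      forall B, U B -> peval Q B != 0 -> f B = peval P B / peval Q B).

(** A (locally closed) subset with the induced reduced structure: regular
    functions are locally restrictions of regular functions. *)

Definition subvar (F : closedFieldType) (X : fspace F) (A : set X) : fspace F :=
  @FSpace F (set_type A) (fun U f => forall x, U x ->
    exists (V : set X) (g : X -> F),
      [/\ open V, regular V g, V (\val x) &
          forall y : A, V (\val y) -> U y /\ f y = g (\val y)]).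

(** The quotient structure along a (surjective) map [q : X -> T]. *)

Definition quot_type (X : topologicalType) (T : choiceType) (q : X -> T) : Type
  := T.
Definition quot_open (X : topologicalType) (T : choiceType) (q : X -> T) :
    set_system (quot_type q) := [set U | open (q @^-1` U)].

Lemma quot_openT (X : topologicalType) (T : choiceType) (q : X -> T) :
  @quot_open X T q setT.
Proof. by rewrite /quot_open /= preimage_setT; exact: openT. Qed.

Lemma quot_openI (X : topologicalType) (T : choiceType) (q : X -> T) :
  setI_closed (@quot_open X T q).
Proof. by move=> U V; rewrite /quot_open /= preimage_setI; exact: openI. Qed.

Lemma quot_open_bigU (X : topologicalType) (T : choiceType) (q : X -> T)
    (I : Type) (f : I -> set (quot_type q)) :
  (forall i, quot_open (f i)) -> quot_open (\bigcup_i f i).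
Proof.
move=> hf; rewrite /quot_open /= preimage_bigcup.
by apply: bigcup_open => i _; exact: hf.
Qed.

HB.instance Definition _ (X : topologicalType) (T : choiceType) (q : X -> T) :=
  Choice.copy (quot_type q) T.
HB.instance Definition _ (X : topologicalType) (T : choiceType) (q : X -> T) :=
  isOpenTopological.Build (quot_type q) (@quot_openT X T q) (@quot_openI X T q)
    (@quot_open_bigU X T q).

Definition quot (F : closedFieldType) (X : fspace F) (T : choiceType)
    (q : X -> T) : fspace F :=
  @FSpace F (quot_type q) (fun U f => regular (q @^-1` U) (f \o q)).

(** * Irreducibility and dimension *)

Definition irreducible (X : topologicalType) (A : set X) : Prop :=
  A !=set0 /\ forall C D : set X, closed C -> closed D ->
    A `<=` C `|` D -> A `<=` C \/ A `<=` D.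

Definition irreducible_component (X : topologicalType) (A C : set X) : Prop :=
  [/\ C `<=` A, irreducible C &
      forall D : set X, D `<=` A -> irreducible D -> C `<=` D -> D = C].

(** [closed_chain X d]: there is a strictly increasing chain of [d + 1]
    irreducible closed subsets [Z 0], ..., [Z d] of [X]. *)
Definition closed_chain (X : topologicalType) (d : nat) : Prop :=
  exists Z : nat -> set X,
    (forall i, (i <= d)%N -> closed (Z i) /\ irreducible (Z i)) /\
    (forall i, (i < d)%N -> Z i `<` Z i.+1).

Definition has_dim (X : topologicalType) (d : nat) : Prop :=
  closed_chain X d /\ forall m, closed_chain X m -> (m <= d)%N.

(** * Flag varieties *)

(** Flags [W_0 <= W_1 <= ... <= W_k] in [F^n] with [dim W_i = i]; for [k = n]
    these are the full flags. *)

Definition is_flag (F : closedFieldType) (n k : nat)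
    (W : k.+1.-tuple {vspace 'cV[F]_n}) : bool :=
  [forall i : 'I_k.+1, \dim (tnth W i) == i] &&
  [forall i : 'I_k.+1, forall j : 'I_k.+1,
     (i <= j)%N ==> (tnth W i <= tnth W j)%VS].

Record flag (F : closedFieldType) (n k : nat) := Flag {
  flag_tuple : k.+1.-tuple {vspace 'cV[F]_n};
  flag_tupleP : is_flag flag_tuple }.

HB.instance Definition _ (F : closedFieldType) (n k : nat) :=
  [isSub for @flag_tuple F n k].
HB.instance Definition _ (F : closedFieldType) (n k : nat) :=
  [Choice of flag F n k by <:].

Definition flag_nth (F : closedFieldType) (n k : nat) (W : flag F n k)
    (i : nat) : {vspace 'cV[F]_n} := nth 0%VS (flag_tuple W) i.
Coercion flag_nth : flag >-> Funclass.

Definition span_cols (F : closedFieldType) (n k : nat) (C : 'M[F]_(n, k))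
    (j : nat) : {vspace 'cV[F]_n} :=
  <<take j [seq col i C | i <- enum 'I_k]>>%VS.

Definition span_tuple (F : closedFieldType) (n k : nat) (C : 'M[F]_(n, k)) :
    k.+1.-tuple {vspace 'cV[F]_n} := [tuple span_cols C i | i < k.+1].

Lemma free_cols (F : closedFieldType) (n k : nat) (C : 'M[F]_(n, k)) :
  \rank C = k -> free [seq col i C | i <- enum 'I_k].
Proof.
move=> rC.
have -> : [seq col i C | i <- enum 'I_k] = [tuple col i C | i < k] by [].
apply/freeP => a h i.
have hC : row_free C^T by rewrite /row_free mxrank_tr rC.
have : (\row_j a j) *m C^T = 0.
  rewrite -[LHS]trmxK trmx_mul trmxK -[RHS]trmxK trmx0; congr (_^T).
  rewrite -[RHS]h; apply/matrixP => x y; rewrite mxE summxE.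
  by apply: eq_bigr => j _; rewrite -tnth_nth tnth_mktuple !mxE mulrC.
by move/eqP; rewrite mulmx_free_eq0 // => /eqP/rowP/(_ i); rewrite !mxE.
Qed.

Lemma span_tupleP (F : closedFieldType) (n k : nat) (C : 'M[F]_(n, k)) :
  \rank C = k -> is_flag (span_tuple C).
Proof.
move=> rC; have fC := free_cols rC; apply/andP; split.
  apply/forallP => i; rewrite tnth_mktuple /span_cols.
  set s := [seq _ | _ <- _] in fC *.
  have ss : size s = k by rewrite size_map size_enum_ord.
  have /eqP -> : free (take i s).
    by apply: (@catl_free _ _ (drop i s)); rewrite cat_take_drop.
  by rewrite size_takel // ss -ltnS.
apply/forallP => i; apply/forallP => j; apply/implyP => ij.
rewrite !tnth_mktuple /span_cols; apply: sub_span => x.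
by rewrite -(minn_idPl ij) take_min; exact: mem_take.
Qed.

Definition flag_of (F : closedFieldType) (n k : nat) (C : 'M[F]_(n, k))
    (rC : \rank C = k) : flag F n k := Flag (span_tupleP rC).

Definition full_rank (F : closedFieldType) (n k : nat) : set (affine F n k) :=
  [set C : 'M[F]_(n, k) | \rank C = k].

(** The flag variety as the quotient of the matrices of rank [k] under
    [C |-> (<c_1, ..., c_j>)_j]; for [k = n] this is [GL_n / B]. *)
Definition flag_variety (F : closedFieldType) (n k : nat) : fspace F :=
  @quot F (subvar (@full_rank F n k)) (flag F n k)
    (fun C => flag_of (set_valP C)).

(** [P^m], the space of lines in [F^(m+1)]. *)
Definition proj_space (F : closedFieldType) (m : nat) : fspace F :=
  flag_variety F m.+1 1.

(** * Blowing-ups of the projective plane *)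

(** [P^2 x P^1] as the quotient of [(F^3 - 0) x (F^2 - 0)], so that its closed
    subsets are the zero loci of bihomogeneous polynomials. *)

Definition nonzero_pairs (F : closedFieldType) : set (affine F (3 + 2) 1) :=
  [set v : 'M[F]_(3 + 2, 1) |
     \rank (usubmx v) = 1%N /\ \rank (dsubmx v) = 1%N].

Definition P2xP1 (F : closedFieldType) : fspace F :=
  @quot F (subvar (@nonzero_pairs F)) (flag F 3 1 * flag F 2 1)%type
    (fun v => (flag_of (set_valP v).1, flag_of (set_valP v).2)).

(** The graph of the projection [P^2 - {z} -> P^1] given by the two linear
    forms which are the rows of [L] and whose common zero is [z]; the points
    with [q = z] are excluded since the image of [z] has dimension 0. *)
Definition projection_graph (F : closedFieldType) (L : 'M[F]_(2, 3)) :
    set (P2xP1 F) :=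
  [set ql : flag F 3 1 * flag F 2 1 |
     (linfun (mulmx L : 'cV[F]_3 -> 'cV[F]_2) @: (ql.1 : flag F 3 1) 1%N)%VS
     = (ql.2 : flag F 2 1) 1%N].

(** [X] is isomorphic to the blowing-up of [P^2] in the point [z], that is, to
    the closure of the graph of the projection from [z]. *)
Definition iso_blowup (F : closedFieldType) (z : proj_space F 2) (X : fspace F) :
    Prop :=
  exists L : 'M[F]_(2, 3),
    lker (linfun (mulmx L : 'cV[F]_3 -> 'cV[F]_2)) = (z : flag F 3 1) 1%N /\
    isomorphic X (subvar (closure (projection_graph L))).

(** * The variety of symplectic flags stable under [F] and [V] *)

Notation flag6 F := (flag_variety F 6 6).

(** The standard basis, numbered from 1 to 6. *)
Definition e (F : closedFieldType) (i : nat) : 'cV[F]_6 :=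
  \col_(j < 6) (j.+1 == i)%:R.
Arguments e {F} i.

Definition coord6 (F : closedFieldType) (v : 'cV[F]_6) (i : nat) : F :=
  v (inord i.-1) 0.

Definition pairing (F : closedFieldType) (v w : 'cV[F]_6) : F :=
  \sum_(1 <= i < 4)
    (coord6 v i * coord6 w (3 + i)%N - coord6 v (3 + i)%N * coord6 w i).

(** [U' = U^⊥] *)
Definition is_perp (F : closedFieldType) (U U' : {vspace 'cV[F]_6}) : Prop :=
  forall w, w \in U' <-> forall v, v \in U -> pairing v w = 0.

(** The inverse of the Frobenius, for [F] of characteristic [p]. *)
Definition frob_inv (F : closedFieldType) (p : nat) (x : F) : F :=
  xget 0 [set y | y ^+ p = x].

Definition Fmap (F : closedFieldType) (p : nat) (v : 'cV[F]_6) : 'cV[F]_6 :=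
  coord6 v 1 ^+ p *: e 6 + coord6 v 2 ^+ p *: e 5 + coord6 v 3 ^+ p *: e 4.

Definition Vmap (F : closedFieldType) (p : nat) (v : 'cV[F]_6) : 'cV[F]_6 :=
  - (frob_inv p (coord6 v 1) *: e 6 + frob_inv p (coord6 v 2) *: e 5
     + frob_inv p (coord6 v 3) *: e 4).

Definition FlagFV (F : closedFieldType) (p : nat) : set (flag6 F) :=
  [set W : flag F 6 6 |
     forall i, (i <= 6)%N ->
       [/\ is_perp (W i) (W (6 - i)%N),
           forall v, v \in W i -> Fmap p v \in W i &
           forall v, v \in W i -> Vmap p v \in W i]].

(** [is_Phi C W]: the flag [W] is [Phi C].  Since [W] is a flag, this forces
    [C] to have rank 3 and (by the case [j = 3]) isotropic column space. *)
Definition is_Phi (F : closedFieldType) (C : 'M[F]_(6, 3)) (W : flag F 6 6) :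
    Prop :=
  forall j, (j <= 3)%N -> W j = span_cols C j /\ is_perp (W j) (W (6 - j)%N).

Definition lower (F : closedFieldType) (G : 'M[F]_3) : 'M[F]_(6, 3) :=
  @col_mx F 3 3 3 0 G.

Definition cols3 (F : closedFieldType) (c1 c2 c3 : 'cV[F]_6) : 'M[F]_(6, 3) :=
  row_mx c1 (row_mx c2 c3).

(** * The components *)

Definition Yset (F : closedFieldType) : set (flag6 F) :=
  [set W | exists G : 'M[F]_3, G \in unitmx /\ is_Phi (lower G) W].

(** [det B_i], where [B_i] is [B] with the [i]-th row (from 1) deleted. *)
Definition detB (F : closedFieldType) (B : 'M[F]_(3, 2)) (i : nat) : F :=
  \det (row' (inord i.-1) B : 'M[F]_2).

Definition admissible (F : closedFieldType) (p : nat) (B : 'M[F]_(3, 2)) :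
    Prop :=
  \rank B = 2%N /\
  detB B 1 ^+ p * detB B 3 + detB B 2 ^+ p.+1 + detB B 1 * detB B 3 ^+ p = 0.

Definition minors (F : closedFieldType) (B : 'M[F]_(3, 2)) : 'cV[F]_3 :=
  \col_(i < 3) [:: detB B 1; - detB B 2; detB B 3]`_i.

Definition Zup (F : closedFieldType) (p : nat) : set (flag6 F) :=
  [set W | exists (B : 'M[F]_(3, 2)) (u : 'cV[F]_3),
     admissible p B /\ is_Phi (@block_mx F 3 3 2 1 0 (minors B) B u) W].

Definition Zlow (F : closedFieldType) (p : nat) : set (flag6 F) :=
  [set W | exists (B : 'M[F]_(3, 2)) (v : 'cV[F]_3),
     [/\ admissible p B, (row_mx B v : 'M[F]_3) \in unitmx &
         is_Phi (lower (row_mx B v)) W]].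

Definition Zset (F : closedFieldType) (p : nat) : set (flag6 F) :=
  Zup p `|` Zlow p.

Definition Z0 (F : closedFieldType) (p : nat) : set (flag_variety F 3 2) :=
  [set W : flag F 3 2 | exists B : 'M[F]_(3, 2), admissible p B /\
     forall j, (j <= 2)%N -> W j = span_cols B j].

Definition Tinf_up (F : closedFieldType) : set (flag6 F) :=
  [set W | exists a b c : F, (forall t, (a, b, c) <> (0, t, 0)) /\
     is_Phi (cols3 (e 4) (a *: e 3 + b *: e 5 + c *: e 6) (e 5)) W].

Definition Tinf_low (F : closedFieldType) : set (flag6 F) :=
  [set W | exists al be : F, (al, be) <> (0, 0) /\
     is_Phi (cols3 (e 4) (e 5) (al *: e 3 + be *: e 6)) W].

(** The vectors [x^p e_4 + y^p e_5 + e_6], [e_1 + y e_2 + x e_3] and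
    [- y e_4 + e_5]. *)
Definition fvec (F : closedFieldType) (p : nat) (x y : F) : 'cV[F]_6 :=
  x ^+ p *: e 4 + y ^+ p *: e 5 + e 6.
Definition wvec (F : closedFieldType) (x y : F) : 'cV[F]_6 :=
  e 1 + y *: e 2 + x *: e 3.
Definition gvec (F : closedFieldType) (y : F) : 'cV[F]_6 := - y *: e 4 + e 5.

Definition Txy_up (F : closedFieldType) (p : nat) (x y : F) : set (flag6 F) :=
  [set W | exists a b c : F, (forall t, (a, b, c) <> (0, t * - y, t)) /\
     is_Phi (cols3 (fvec p x y) (a *: wvec x y + b *: e 4 + c *: e 5) (gvec y))
       W].

Definition Txy_low (F : closedFieldType) (p : nat) (x y : F) : set (flag6 F) :=
  [set W | exists al be : F, (al, be) <> (0, 0) /\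
     is_Phi (cols3 (fvec p x y) (gvec y) (al *: wvec x y + be *: e 4)) W].

(** [F_{p^2}] is the set of solutions of [x ^ (p ^ 2) = x] in [F]. *)
Definition Iset (F : closedFieldType) (p : nat) (xy : F * F) : Prop :=
  [/\ xy.1 ^+ (p ^ 2) = xy.1, xy.2 ^+ (p ^ 2) = xy.2 &
      xy.1 ^+ p + xy.1 + xy.2 ^+ p.+1 = 0].

(** Indices: [None] stands for infinity. *)
Definition Iinf (F : closedFieldType) (p : nat) (zeta : option (F * F)) : Prop :=
  if zeta is Some xy then Iset p xy else True.

Definition Tset (F : closedFieldType) (p : nat) (zeta : option (F * F)) :
    set (flag6 F) :=
  match zeta with
  | None => @Tinf_up F `|` @Tinf_low F
  | Some (x, y) => Txy_up p x y `|` Txy_low p x y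
  end.

Arguments flag_variety F n k : clear implicits.
Arguments FlagFV F p : clear implicits.
Arguments Yset F : clear implicits.
Arguments Zset F p : clear implicits.
Arguments Zlow F p : clear implicits.
Arguments Z0 F p : clear implicits.
Arguments Tset F p zeta : clear implicits.
Arguments Tinf_low F : clear implicits.
Arguments Txy_low F p x y : clear implicits.

(* Main.v *)
(* A symplectic flag is determined by its isotropic half W_1 < W_2 < W_3.  Put
   L = <e_4, e_5, e_6>; F and V vanish on L and map into L, so stability forces
   W_1 <= L.  If W_2 <= L, then either W_3 = L, which gives Y, or the image of
   W_3 modulo L is spanned by the normal vector of W_2, and the stability of W_3
   is the Hermitian equation of Z.  If some c in W_2 is not in L, then F c and
   V c both lie in the line W_1; hence they are proportional, the ratios of the
   coordinates of c lie in F_{p^2}, and W_1 is the line of F c.  This gives the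
   finitely many T_zeta.

   Each piece is closed and is the image of an irreducible parameter space; for Z
   this is a family over the affine cone of the Hermitian curve, whose
   irreducibility follows by expanding one coordinate as a power series in the
   other.  Morphisms between sets of flags are given locally by polynomial maps
   of matrices, compatible with the action of triangular matrices: Y and its
   intersection with Z become sets of flags in F^3, and T_zeta becomes the set of
   flags (V_1 < V_2) with V_2 containing a fixed line e, which is the incidence
   variety of V_1 and V_2/e in P^2 x P^1 and so the blowing-up.

   Only the fourfold of all flags with W_2 <= L needs a chart and a bound for the
   length of chains (by counting monomials).  All other dimensions follow from
   strict inclusions between irreducible closed sets. *)

Require Import Defs.
From HB Require Import structures.
From mathcomp Require Import all_boot all_order all_algebra.
From mathcomp Require Import boolp classical_sets topology mpoly ring zify separable.

Set Implicit Arguments.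
Unset Strict Implicit.
Unset Printing Implicit Defensive.

Import GRing.Theory.
Local Open Scope ring_scope.
Local Open Scope classical_set_scope.


(** * Irreducible sets and chains *)

(** A space is here only a topology with a sheaf of functions, so every isomorphism is exhibited by
    polynomial formulas on representing matrices, and such a formula is often valid only where some
    minor is nonzero. Hence morphisms are handled as relations with local formulas, adjugates
    replace inverses, and sets of flags are given by properties of matrices invariant under upper
    triangular ones. The field F_{p^2} arises because the coordinates of F c are p-th powers and
    those of V c are negatives of p-th roots, so that proportionality reads a^(1/p) = k a^p. The
    equations of I and of Z have one source, <c, F c> = 0 for c in the isotropic space W_3. By <F v,
    w> = <v, V w>^p, a member of a symplectic flag is F-stable exactly if its complement is
    V-stable. All upper bounds for dimensions descend from the number 4: Y and Z are proper in the
    fourfold, Y ∩ Z is proper in Y, and T_zeta is isomorphic to a proper closed set of flags in F^3,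
    a variety isomorphic to Y. The lower bounds grow from a chain of length one in P^1. *)

Lemma preimage_closed (X Y : topologicalType) (f : X -> Y) (D : set Y) :
  (forall U : set Y, open U -> open (f @^-1` U)) -> closed D ->
  closed (f @^-1` D).
Proof.
move=> cf cD; rewrite -[f @^-1` D]setCK; apply: open_closedC.
by rewrite preimage_setC; apply: cf; exact: closed_openC.
Qed.

Lemma subsetNP (T : Type) (A B : set T) : ~ (A `<=` B) -> exists2 x, A x & ~ B x.
Proof.
move=> h; apply: contrapT => n; apply: h => x Ax; apply: contrapT => nB.
by apply: n; exists x.
Qed.

Section Irreducible.
Variables (X Y : topologicalType).
Implicit Types A B C D : set X.

Lemma irreducible_openP A : irreducible A <-> A !=set0 /\
  forall U V : set X, open U -> open V -> A `&` U !=set0 -> A `&` V !=set0 ->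
    A `&` (U `&` V) !=set0.
Proof.
split=> -[A0 h]; split=> //.
  move=> U V oU oV [x [Ax Ux]] [y [Ay Vy]]; apply: contrapT => n.
  have := h (~` U) (~` V) (open_closedC oU) (open_closedC oV).
  case=> [z Az|/(_ x Ax)//|/(_ y Ay)//].
  apply: contrapT => /not_orP[/contrapT Uz /contrapT Vz].
  by apply: n; exists z.
move=> C D cC cD sA; apply: contrapT => /not_orP[/subsetNP[x Ax nx] /subsetNP[y Ay ny]].
have [] := h (~` C) (~` D) (closed_openC cC) (closed_openC cD).
- by exists x.
- by exists y.
by move=> z [Az [nCz nDz]]; case: (sA _ Az).
Qed.

(** Continuity is needed only along [A]: the preimage of a closed set has to agree with a closed set
    on [A] alone. *)
Lemma irreducible_image_in (f : X -> Y) A :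
  (forall D : set Y, closed D ->
     exists2 D' : set X, closed D' & forall x, A x -> D' x <-> D (f x)) ->
  irreducible A -> irreducible (f @` A).
Proof.
move=> cf [[a Aa] h]; split; first by exists (f a); exists a.
move=> C D cC cD sA.
have [C' cC' hC'] := cf _ cC; have [D' cD' hD'] := cf _ cD.
have [x Ax|sC|sD] := h C' D' cC' cD'.
- by have [/(hC' x Ax)|/(hD' x Ax)] := sA (f x) (ex_intro2 _ _ x Ax erefl);
    [left|right].
- by left=> _ [x Ax <-]; apply/hC' => //; exact: sC.
- by right=> _ [x Ax <-]; apply/hD' => //; exact: sD.
Qed.

Lemma irreducible_image (f : X -> Y) A :
  (forall U : set Y, open U -> open (f @^-1` U)) ->
  irreducible A -> irreducible (f @` A).
Proof.
move=> cf; apply: irreducible_image_in => D cD; exists (f @^-1` D) => //.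
exact: preimage_closed.
Qed.

Lemma irreducible_openI A U : irreducible A -> open U -> A `&` U !=set0 ->
  irreducible (A `&` U).
Proof.
move=> /irreducible_openP[A0 h] oU nU; apply/irreducible_openP; split=> //.
move=> V W oV oW nV nW; rewrite -setIA [U `&` _]setIA.
apply: h; [exact: openI | exact: oW | by rewrite setIA |].
by case: nW => x [[Ax Ux] Wx]; exists x.
Qed.

Lemma closure_min A C : closed C -> A `<=` C -> closure A `<=` C.
Proof. by move=> cC sAC; rewrite [C](closure_id _).1 //; exact: closureS. Qed.

Lemma irreducible_set1 (x : X) : irreducible [set x].
Proof.
split; first by exists x.
by move=> C D _ _ /(_ x erefl)[Cx|Dx]; [left|right] => _ ->.
Qed.

Lemma closed_exists_seq (I : eqType) (s : seq I) (C : I -> set X) :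
  (forall i, i \in s -> closed (C i)) ->
  closed [set x | exists i, i \in s /\ C i x].
Proof.
elim: s => [_|i s IH cC].
  have -> : [set x | exists i, i \in [::] /\ C i x] = set0.
    by apply/seteqP; split=> x // [i []].
  exact: closed0.
have -> : [set x | exists j, j \in i :: s /\ C j x] =
    C i `|` [set x | exists j, j \in s /\ C j x].
  apply/seteqP; split=> x /=.
    by move=> [j []]; rewrite in_cons => /orP[/eqP ->|js] Cx; [left|right; exists j].
  move=> [Cx|[j [js Cx]]]; first by exists i; rewrite mem_head.
  by exists j; rewrite in_cons js orbT.
apply: closedU; first by apply: cC; rewrite mem_head.
by apply: IH => j js; apply: cC; rewrite in_cons js orbT.
Qed.

Lemma irreducible_bigcup (I : eqType) (s : seq I) (C : I -> set X) A : irreducible A ->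
  (forall i, i \in s -> closed (C i)) ->
  A `<=` [set x | exists i, i \in s /\ C i x] ->
  exists i, i \in s /\ A `<=` C i.
Proof.
move=> [[a Aa] h]; elim: s => [_ /(_ a Aa) [i []]//|i s IH cC sA].
have cs : closed [set x | exists i, i \in s /\ C i x].
  by apply: closed_exists_seq => j js; apply: cC; rewrite in_cons js orbT.
have ci : closed (C i) by apply: cC; rewrite mem_head.
have [x /sA [j []]|sC|sD] := h _ _ ci cs.
- by rewrite in_cons => /orP[/eqP ->|js] Cx; [left|right; exists j].
- by exists i; rewrite mem_head.
have [j js|j [js sj]] := IH _ sD; first by apply: cC; rewrite in_cons js orbT.
by exists j; rewrite in_cons js orbT.
Qed.

(** Gluing of two charts with a common point: a closed set containing the part of [A] in one chart
    contains a nonempty open part of the other chart, hence all of it. *)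
Lemma irreducible_open2 A U V : open U -> open V -> A `<=` U `|` V ->
  irreducible (A `&` U) -> irreducible (A `&` V) -> A `&` (U `&` V) !=set0 ->
  irreducible A.
Proof.
move=> oU oV sA iU iV [x [Ax [Ux Vx]]]; split; first by exists x.
have key (U' V' C D : set X) : open U' -> open V' -> closed C -> closed D ->
    irreducible (A `&` U') -> irreducible (A `&` V') -> A `<=` U' `|` V' ->
    A `<=` C `|` D -> U' x -> V' x -> A `&` U' `<=` C -> A `<=` C \/ A `<=` D.
  move=> oU' oV' cC cD iU' iV' sUV sCD Ux' Vx' sC.
  have [y [Ay Vy]|sVC|sVU] := iV'.2 C (~` U') cC (open_closedC oU').
  - by case: (pselect (U' y)) => [Uy|]; [left; exact: sC|right].
  - by left=> y Ay; case: (sUV _ Ay) => ?; [exact: sC|exact: sVC].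
  - by have := sVU x (conj Ax Vx').
move=> C D cC cD sCD.
have sCD' : A `<=` D `|` C by rewrite setUC.
have sU : A `&` U `<=` C `|` D by move=> y [/sCD].
have [sC|sD] := iU.2 C D cC cD sU; first exact: (key U V).
by apply/or_comm; apply: (key U V).
Qed.

End Irreducible.

(** Separate continuity suffices, so no topology on a product is involved. Each slice lies in [C] or
    in [D] by irreducibility of [B]; the points whose slice lies in a given closed set form an
    intersection of closed sets, and irreducibility of [A] makes the choice uniform. *)
Lemma irreducible_image2 (X Y T : topologicalType) (f : X -> Y -> T)
    (A : set X) (B : set Y) :
  (forall y U, open U -> open [set x | U (f x y)]) ->
  (forall x U, open U -> open [set y | U (f x y)]) ->
  irreducible A -> irreducible B -> irreducible [set f x y | x in A & y in B].
Proof.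
move=> cx cy [[a Aa] iA] iB; have [[b Bb] _] := iB.
split; first by exists (f a b); exists a => //; exists b.
move=> C D cC cD sCD.
have cl (E : set T) : closed E -> closed [set x | forall y, B y -> E (f x y)].
  move=> cE.
  have -> : [set x | forall y, B y -> E (f x y)] =
      ~` (\bigcup_(y in B) [set x | (~` E) (f x y)]).
    apply/seteqP; split=> x /=; first by move=> h [y By]; apply; exact: h.
    by move=> h y By; apply: contrapT => n; apply: h; exists y.
  by apply: open_closedC; apply: bigcup_open => y By; apply: cx; exact: closed_openC.
have [x Ax|sC|sD] := iA _ _ (cl C cC) (cl D cD).
- have iS : irreducible (f x @` B) by apply: irreducible_image iB => U; exact: cy.
  have [_ [y By <-]|h|h] := iS.2 C D cC cD.
  + by apply: sCD; exists x => //; exists y.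
  + by left=> y By; apply: h; exists y.
  + by right=> y By; apply: h; exists y.
- by left=> _ [x Ax [y By <-]]; apply: sC.
- by right=> _ [x Ax [y By <-]]; apply: sD.
Qed.

(** An irreducible subset of a finite union of closed sets lies in one of them, so the absence of
    inclusions makes each [C i] maximal. *)
Lemma irreducible_components_of (X : topologicalType) (I : eqType) (s : seq I)
    (C : I -> set X) (A : set X) :
  (forall i, i \in s -> closed (C i)) ->
  (forall i, i \in s -> irreducible (C i)) ->
  (forall i j, i \in s -> j \in s -> C i `<=` C j -> i = j) ->
  A = [set x | exists i, i \in s /\ C i x] ->
  forall D, irreducible_component A D <-> exists i, i \in s /\ D = C i.
Proof.
move=> cC iC nC ->; set A' := [set x | _] => D; split.
  move=> [sD iD mD]; have [i [si sDi]] := @irreducible_bigcup _ _ _ _ _ iD cC sD.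
  exists i; split=> //; rewrite (mD (C i)) //; last exact: iC.
  by move=> x Cx; exists i.
move=> [i [si ->]]; split; [by move=> x Cx; exists i|exact: iC|].
move=> E sE iE sCE; have [j [sj sEj]] := @irreducible_bigcup _ _ _ _ _ iE cC sE.
apply/seteqP; split=> //; suff -> : i = j by [].
by apply: nC => //; exact: subset_trans sEj.
Qed.

Lemma closed_chain_homeo (X Y : topologicalType) (f : X -> Y) (g : Y -> X) d :
  cancel f g -> cancel g f ->
  (forall U : set Y, open U -> open (f @^-1` U)) ->
  (forall U : set X, open U -> open (g @^-1` U)) ->
  closed_chain X d -> closed_chain Y d.
Proof.
move=> fK gK cf cg [Z [iZ sZ]].
have eqg i : g @^-1` Z i = f @` Z i.
  by apply/seteqP; split=> [y Zy|_ [x Zx <-]]; [exists (g y)|rewrite /= fK].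
exists (fun i => g @^-1` Z i); split=> i li.
  have [cl ir] := iZ i li; split.
    exact: preimage_closed.
  by rewrite eqg; apply: irreducible_image.
have [s n] := sZ i li; split; first by move=> y; apply: s.
by move=> h; apply: n => x Zx; have := h (f x); rewrite /= fK; apply.
Qed.

(** * Induced structures on subsets and chains of closed subsets *)

Section Subvar.
Variables (F : closedFieldType) (X : fspace F).
Implicit Type A : set X.

Lemma open_subvar A (U : set (subvar A)) :
  open U <-> exists2 V : set X, open V & forall x, U x <-> V (val x).
Proof.
split=> [[V oV <-]|[V oV h]]; first by exists V.
by exists V => //; apply/seteqP; split=> x /h.
Qed.

Lemma closed_subvar A (K : set X) : closed K ->
  closed [set x : subvar A | K (val x)].
Proof.
move=> cK; rewrite -[[set _ | _]]setCK; apply: open_closedC.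
by apply/open_subvar; exists (~` K) => //; exact: closed_openC.
Qed.

Lemma irreducible_subvar A : irreducible A <-> irreducible [set: subvar A].
Proof.
have eA : A = (fun x : subvar A => val x) @` [set: subvar A].
  apply/seteqP; split=> [x Ax|_ [x _ <-]]; last exact: set_valP.
  by exists (SigSub (mem_set Ax)).
split; last first.
  move=> h; rewrite eA; apply: irreducible_image h => U oU.
  by apply/open_subvar; exists U.
move=> /irreducible_openP[[a Aa] h]; apply/irreducible_openP; split.
  by exists (SigSub (mem_set Aa)).
move=> U V /open_subvar[U' oU' hU] /open_subvar[V' oV' hV] [x [_ Ux]] [y [_ Vy]].
have [] := h U' V' oU' oV'.
- by exists (val x); split; [exact: set_valP|apply/hU].
- by exists (val y); split; [exact: set_valP|apply/hV].
move=> z [Az [Uz Vz]]; exists (SigSub (mem_set Az)); split=> //.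
by split; [apply/hU|apply/hV].
Qed.

Lemma irreducible_subvar_in A B : B `<=` A -> irreducible B ->
  irreducible [set x : subvar A | B (val x)].
Proof.
move=> sBA /irreducible_openP[[b Bb] h]; apply/irreducible_openP; split.
  by exists (SigSub (mem_set (sBA _ Bb))).
move=> U V /open_subvar[U' oU' hU] /open_subvar[V' oV' hV] [x [Bx Ux]] [y [By Vy]].
have [] := h U' V' oU' oV'.
- by exists (val x); split=> //; apply/hU.
- by exists (val y); split=> //; apply/hV.
move=> z [Bz [Uz Vz]]; exists (SigSub (mem_set (sBA _ Bz))); split=> //.
by split; [apply/hU|apply/hV].
Qed.

(* A proper closed subset of an irreducible set has smaller dimension, since
   the whole set can be appended to every chain. *)
Lemma closed_chain_proper A B m : A `<=` B -> ~ (B `<=` A) -> closed A ->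
  irreducible B -> closed_chain (subvar A) m -> closed_chain (subvar B) m.+1.
Proof.
move=> sAB nBA cA iB [Z [iZ sZ]].
pose Z' i : set X := [set x | exists2 z : subvar A, Z i z & val z = x].
have irr i : (i <= m)%N -> irreducible (Z' i).
  move=> im; have -> : Z' i = (fun x : subvar A => val x) @` Z i.
    by apply/seteqP; split=> x [z Zz <-]; exists z.
  by apply: irreducible_image (iZ i im).2 => U oU; apply/open_subvar; exists U.
have cl i : (i <= m)%N -> exists2 K, closed K & forall x, Z' i x <-> K x /\ A x.
  move=> im; have /closed_openC/open_subvar[V oV hV] := (iZ i im).1.
  exists (~` V); first exact: open_closedC.
  move=> x; split=> [[z Zz <-]|[nV Ax]].
    by split; [move=> /hV|exact: set_valP].
  exists (SigSub (mem_set Ax)) => //; apply: contrapT => n; apply: nV.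
  exact/(hV (SigSub (mem_set Ax))).
(* The new top member, at index [m.+1], is all of [B]; the old members stay closed in [B] because
   [A] is closed. *)
exists (fun i => if (i <= m)%N then [set x : subvar B | Z' i (val x)] else setT).
split=> i; rewrite leq_eqVlt => /predU1P[].
- move=> ->; rewrite ltnn; split; first exact: closedT.
  exact/irreducible_subvar.
- rewrite ltnS => im; rewrite im; split.
    have [K cK hK] := cl i im.
    have -> : [set x : subvar B | Z' i (val x)] =
        [set x : subvar B | (K `&` A) (val x)].
      by apply/seteqP; split=> x /hK.
    by apply: closed_subvar; exact: closedI.
  apply: irreducible_subvar_in; last exact: irr.
  by move=> x [z _ <-]; apply: sAB; exact: set_valP.
- move=> [->]; rewrite ltnn leqnn; split=> // h.
  have [b Bb nb] := subsetNP nBA; have [z _ zb] := h (SigSub (mem_set Bb)) I.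
  by apply: nb; rewrite -[b]zb; exact: set_valP.
- rewrite ltnS => im; rewrite im ltnW //; have [s n] := sZ i im; split.
    by move=> x [z Zz zx]; exists z => //; exact: s.
  move=> h; apply: n => z Zz.
  have Bz : B (val z) by apply: sAB; exact: set_valP.
  have [|z' Zz' /val_inj <-//] := h (SigSub (mem_set Bz)).
  by exists z.
Qed.

End Subvar.

(** * Polynomial functions and maps *)

Section PolyFun.
Variable F : closedFieldType.

Definition polyfun (n k : nat) (f : 'M[F]_(n, k) -> F) : Prop :=
  exists P : {mpoly F[n * k]}, forall A, f A = peval P A.

Definition polymap (n k n' k' : nat) (h : 'M[F]_(n, k) -> 'M[F]_(n', k')) : Prop :=
  forall i j, polyfun (fun A => h A i j).

Section Closure.
Variables (n k : nat).
Implicit Types f g : 'M[F]_(n, k) -> F.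

Lemma polyfun_ext f g : f =1 g -> polyfun f -> polyfun g.
Proof. by move=> e [P h]; exists P => A; rewrite -e. Qed.

Lemma polyfun_const (c : F) : polyfun (fun _ : 'M[F]_(n, k) => c).
Proof. by exists c%:MP => A; rewrite /peval mevalC. Qed.

Lemma polyfun_entry i j : polyfun (fun A : 'M[F]_(n, k) => A i j).
Proof. by exists ('X_(mxvec_index i j)) => A; rewrite /peval mevalXU mxvecE. Qed.

Lemma polyfunD f g : polyfun f -> polyfun g -> polyfun (fun A => f A + g A).
Proof. by move=> [P p] [Q q]; exists (P + Q) => A; rewrite /peval mevalD p q. Qed.

Lemma polyfunM f g : polyfun f -> polyfun g -> polyfun (fun A => f A * g A).
Proof. by move=> [P p] [Q q]; exists (P * Q) => A; rewrite /peval mevalM p q. Qed.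

Lemma polyfunN f : polyfun f -> polyfun (fun A => - f A).
Proof. by move=> [P p]; exists (- P) => A; rewrite /peval mevalN p. Qed.

Lemma polyfunB f g : polyfun f -> polyfun g -> polyfun (fun A => f A - g A).
Proof. by move=> hf hg; apply: polyfunD => //; exact: polyfunN. Qed.

Lemma polyfunX f m : polyfun f -> polyfun (fun A => f A ^+ m).
Proof. by move=> [P p]; exists (P ^+ m) => A; rewrite /peval rmorphXn p. Qed.

Lemma polyfun_sum (I : Type) (r : seq I) (h : I -> 'M[F]_(n, k) -> F) :
  (forall i, polyfun (h i)) -> polyfun (fun A => \sum_(i <- r) h i A).
Proof.
move=> ph; elim: r => [|i r IH].
  by apply: polyfun_ext (polyfun_const 0) => A; rewrite big_nil.
by apply: polyfun_ext (polyfunD (ph i) IH) => A; rewrite big_cons.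
Qed.

Lemma polyfun_prod (I : Type) (r : seq I) (h : I -> 'M[F]_(n, k) -> F) :
  (forall i, polyfun (h i)) -> polyfun (fun A => \prod_(i <- r) h i A).
Proof.
move=> ph; elim: r => [|i r IH].
  by apply: polyfun_ext (polyfun_const 1) => A; rewrite big_nil.
by apply: polyfun_ext (polyfunM (ph i) IH) => A; rewrite big_cons.
Qed.

Lemma polyfun_det m (h : 'M[F]_(n, k) -> 'M[F]_m) :
  polymap h -> polyfun (fun A => \det (h A)).
Proof.
move=> ph; apply: polyfun_sum => s; apply: polyfunM; first exact: polyfun_const.
by apply: polyfun_prod => i; exact: ph.
Qed.

Lemma polymap_id : polymap (fun A : 'M[F]_(n, k) => A).
Proof. by move=> i j; exact: polyfun_entry. Qed.

Lemma polymap_const n' k' (B : 'M[F]_(n', k')) : polymap (fun _ : 'M[F]_(n, k) => B).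
Proof. by move=> i j; exact: polyfun_const. Qed.

Lemma polymapM n' k' l (h : 'M[F]_(n, k) -> 'M[F]_(n', k'))
    (h' : 'M[F]_(n, k) -> 'M[F]_(k', l)) :
  polymap h -> polymap h' -> polymap (fun A => h A *m h' A).
Proof.
move=> p q i j; apply: (@polyfun_ext (fun A => \sum_l h A i l * h' A l j)).
  by move=> A; rewrite mxE.
by apply: polyfun_sum => l'; apply: polyfunM; [exact: p|exact: q].
Qed.

Lemma polymap_mx n' k' (h : 'I_n' -> 'I_k' -> 'M[F]_(n, k) -> F) :
  (forall i j, polyfun (h i j)) -> polymap (fun A => \matrix_(i, j) h i j A).
Proof.
by move=> p i j; apply: polyfun_ext (p i j) => A; rewrite mxE.
Qed.

Lemma polymap_mxsub n' k' n'' k'' (f : 'I_n'' -> 'I_n') (g : 'I_k'' -> 'I_k')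
    (h : 'M[F]_(n, k) -> 'M[F]_(n', k')) :
  polymap h -> polymap (fun A => mxsub f g (h A)).
Proof. by move=> p i j; apply: polyfun_ext (p (f i) (g j)) => A; rewrite mxE. Qed.

Lemma polymap_tr n' k' (h : 'M[F]_(n, k) -> 'M[F]_(n', k')) :
  polymap h -> polymap (fun A => (h A)^T).
Proof. by move=> p i j; apply: polyfun_ext (p j i) => A; rewrite mxE. Qed.

Lemma polymap_row_mx n' k1 k2 (h : 'M[F]_(n, k) -> 'M[F]_(n', k1))
    (h' : 'M[F]_(n, k) -> 'M[F]_(n', k2)) :
  polymap h -> polymap h' -> polymap (fun A => row_mx (h A) (h' A)).
Proof.
move=> p q i j; rewrite -[j]splitK; case: (fintype.split j) => j' /=.
  by apply: polyfun_ext (p i j') => A; rewrite row_mxEl.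
by apply: polyfun_ext (q i j') => A; rewrite row_mxEr.
Qed.

Lemma polymap_col_mx n1 n2 k' (h : 'M[F]_(n, k) -> 'M[F]_(n1, k'))
    (h' : 'M[F]_(n, k) -> 'M[F]_(n2, k')) :
  polymap h -> polymap h' -> polymap (fun A => col_mx (h A) (h' A)).
Proof.
move=> p q i j; rewrite -[i]splitK; case: (fintype.split i) => i' /=.
  by apply: polyfun_ext (p i' j) => A; rewrite col_mxEu.
by apply: polyfun_ext (q i' j) => A; rewrite col_mxEd.
Qed.

Lemma polymap_adj m (h : 'M[F]_(n, k) -> 'M[F]_m) :
  polymap h -> polymap (fun A => \adj (h A)).
Proof.
move=> p i j; apply: (@polyfun_ext (fun A => cofactor (h A) j i)).
  by move=> A; rewrite mxE.
apply: polyfunM; first exact: polyfun_const.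
apply: polyfun_det => a b; apply: polyfun_ext (p (lift j a) (lift i b)) => A.
by rewrite !mxE.
Qed.

Lemma polyfun_comp n' k' (h : 'M[F]_(n, k) -> 'M[F]_(n', k'))
    (f : 'M[F]_(n', k') -> F) :
  polymap h -> polyfun f -> polyfun (fun A => f (h A)).
Proof.
move=> ph [P hP].
have /choice [Q hQ] (i : 'I_(n' * k')) :
    exists R : {mpoly F[n * k]}, forall A, mxvec (h A) 0 i = peval R A.
  case/mxvec_indexP: i => i j; have [R hR] := ph i j.
  by exists R => A; rewrite mxvecE hR.
exists (P \mPo [tuple Q i | i < n' * k']) => A.
rewrite hP /peval comp_mpoly_meval; apply: meval_eq => i.
by rewrite tnth_mktuple hQ.
Qed.

(** Restriction to a parametrised curve reduces questions of density to polynomials in one variable,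
    which have finitely many roots. *)
Lemma polyfun_curve (c : F -> 'M[F]_(n, k)) f :
  (forall i j, exists p : {poly F}, forall t, c t i j = p.[t]) -> polyfun f ->
  exists p : {poly F}, forall t, f (c t) = p.[t].
Proof.
move=> pc [P hP].
have /choice [Q hQ] (i : 'I_(n * k)) :
    exists p : {poly F}, forall t, mxvec (c t) 0 i = p.[t].
  case/mxvec_indexP: i => i j; have [p hp] := pc i j.
  by exists p => t; rewrite mxvecE hp.
exists (mmap polyC Q P) => t; rewrite hP /peval mevalE /mmap horner_sum.
apply: eq_bigr => m _; rewrite hornerCM; congr (_ * _).
by rewrite /mmap1 horner_prod; apply: eq_bigr => i _; rewrite horner_exp hQ.
Qed.

End Closure.

Lemma polymap_comp n k n' k' n'' k'' (h : 'M[F]_(n, k) -> 'M[F]_(n', k'))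
    (h' : 'M[F]_(n', k') -> 'M[F]_(n'', k'')) :
  polymap h -> polymap h' -> polymap (fun A => h' (h A)).
Proof. by move=> p q i j; apply: polyfun_comp p (q i j). Qed.

Section Zariski.
Variables (n k : nat).
Local Notation A := (affine F n k).

Lemma open_affineP (U : set A) : open U <-> forall x, U x ->
  exists f : 'M[F]_(n, k) -> F,
    [/\ polyfun f, f x != 0 & forall y, f y != 0 -> U y].
Proof.
split=> [[S hS] x /hS [P SP nP]|h].
  exists (peval P); split=> //; first by exists P.
  by move=> y ny; apply/hS; exists P.
exists [set P : {mpoly F[n * k]} | forall y, peval P y != 0 -> U y] => x; split.
  by move=> /h [f [[P hP] nf sf]]; exists P; [move=> y; rewrite -hP; exact: sf|rewrite -hP].
by move=> [P hP nP]; exact: hP.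
Qed.

Lemma open_polyfun (f : 'M[F]_(n, k) -> F) : polyfun f ->
  open [set x : A | f x != 0].
Proof. by move=> pf; apply/open_affineP => x nx; exists f. Qed.

(** The line through a point of [U] and a point of [V] leaves each of these open sets for finitely
    many parameters only, and an algebraically closed field is infinite. *)
Lemma irreducible_affine : irreducible [set: A].
Proof.
apply/irreducible_openP; split; first by exists (0 : 'M[F]_(n, k)).
move=> U V /open_affineP oU /open_affineP oV [x [_ /oU[f [pf fx sf]]]].
move=> [y [_ /oV[g [pg gy sg]]]].
have pc : forall i j, exists p : {poly F}, forall t,
    ((x : 'M[F]_(n, k)) + t *: ((y : 'M[F]_(n, k)) - x)) i j = p.[t].
  move=> i j; exists ((x i j)%:P + 'X * (y i j - x i j)%:P) => t.
  by rewrite !mxE hornerD hornerM hornerX !hornerC.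
have [p hp] := polyfun_curve pc pf; have [q hq] := polyfun_curve pc pg.
have np : p != 0.
  by apply: contra fx => /eqP p0; have := hp 0; rewrite scale0r addr0 p0 horner0 => ->.
have nq : q != 0.
  apply: contra gy => /eqP q0; have := hq 1.
  by rewrite scale1r addrC subrK q0 horner0 => ->.
have /closed_nonrootP [t] : p * q != 0 by rewrite mulf_neq0.
rewrite rootM negb_or => /andP[nt mt].
exists ((x : 'M[F]_(n, k)) + t *: ((y : 'M[F]_(n, k)) - x)); split=> //.
by split; [apply: sf; rewrite hp|apply: sg; rewrite hq].
Qed.

End Zariski.

Lemma open_polymap n k n' k' (h : 'M[F]_(n, k) -> 'M[F]_(n', k'))
    (U : set (affine F n' k')) : polymap h -> open U ->
  open ((h : affine F n k -> affine F n' k') @^-1` U).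
Proof.
move=> ph /open_affineP oU; apply/open_affineP => x /oU [f [pf fx sf]].
exists (fun A => f (h A)); split=> //; first exact: polyfun_comp pf.
by move=> y /sf.
Qed.

(** This exhibits full rank as an open polynomial condition; the rows selected by [f] also serve to
    complete isotropic triples of vectors. *)
Lemma full_rankP n k (C : 'M[F]_(n, k)) : reflect
  (exists f : 'I_k -> 'I_n, \det (rowsub f C) != 0) (\rank C == k).
Proof.
apply: (iffP idP) => [rC|[f df]].
  have fC : row_full C by [].
  by exists (fullrankfun fC); rewrite -unitfE -unitmxE; exact: fullrowsub_unit.
rewrite eqn_leq rank_leq_col /=.
have := mxrankM_maxr (rowsub f 1%:M) C.
by rewrite -rowsubE mxrank_unit // unitmxE unitfE.
Qed.

Lemma open_full_rank n k : open (@full_rank F n k).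
Proof.
apply/open_affineP => x /eqP/full_rankP [f df].
exists (fun A => \det (rowsub f A)); split=> //.
  by apply: polyfun_det; apply: polymap_mxsub; exact: polymap_id.
by move=> y dy; apply/eqP/full_rankP; exists f.
Qed.

End PolyFun.

(** * Chains of primes in a polynomial ring *)

Section Krull.
Variables (F : fieldType) (d : nat).
Local Notation R := {mpoly F[d]}.

(** Nested pairs rather than functions on ['I_m], so that induction on [m] splits off the exponent
    of the last factor. *)
Fixpoint exponents (N m : nat) : finType :=
  if m is m'.+1 then ('I_N * exponents N m')%type else unit.

Lemma card_exponents N m : #|exponents N m| = (N ^ m)%N.
Proof.
by elim: m => [|m IH] /=; rewrite ?card_unit // card_prod card_ord IH expnS.
Qed.

Fixpoint power_product (f : nat -> R) N m : exponents N m -> R :=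
  if m is m'.+1 return exponents N m -> R then
    fun a => f m' ^+ a.1 * power_product f a.2
  else fun=> 1.

(** [van i] stands for the ideal of the i-th member of a chain of irreducible sets: a decreasing
    sequence of ideals, proper and prime up to index [M], where [f i] separates two consecutive
    ones. *)
Variables (M : nat) (van : nat -> R -> Prop) (f : nat -> R).
Hypothesis van0 : forall i, van i 0.
Hypothesis vanD : forall i P Q, van i P -> van i Q -> van i (P + Q).
Hypothesis vanM : forall i P Q, van i P -> van i (Q * P).
Hypothesis van1 : forall i, (i <= M)%N -> ~ van i 1.
Hypothesis van_prime : forall i P Q, (i <= M)%N -> van i (P * Q) ->
  van i P \/ van i Q.
Hypothesis vanS : forall i P, (i < M)%N -> van i.+1 P -> van i P.
Hypothesis vanf : forall i, (i < M)%N -> van i (f i).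
Hypothesis nvanf : forall i, (i < M)%N -> ~ van i.+1 (f i).

(** Modulo the larger ideal [van m] only the term of exponent 0 survives, so [G ord0] vanishes. The
    remaining sum has a factor [f m] outside the prime [van m.+1]; it is cancelled and the argument
    is repeated. *)
Lemma van_powers m N (G : 'I_N -> R) : (m < M)%N ->
  (forall j, van m (G j) -> G j = 0) ->
  van m.+1 (\sum_(j < N) f m ^+ j * G j) -> forall j, G j = 0.
Proof.
move=> mM; elim: N G => [|N IH] G G0; first by move=> _ [].
rewrite big_ord_recl expr0 mul1r.
under eq_bigr do rewrite /= exprS -mulrA.
rewrite -big_distrr /= => vs.
have z0 : G ord0 = 0.
  apply: G0; have := vanS mM vs; set S := (\sum_(_ < _) _) => vs'.
  rewrite -[G ord0](addrK (f m * S)); apply: vanD => //.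
  by rewrite mulrC -mulNr; apply: vanM; exact: vanf.
move: vs; rewrite z0 add0r => /(van_prime mM)[/(nvanf mM)//|vs] j.
have [j' ->|-> //] := unliftP ord0 j.
by apply: (IH (fun j => G (lift ord0 j))) => // i; exact: G0.
Qed.

(** Sorted by powers of [f m], the sum has coefficients that are combinations of products of earlier
    functions; by induction such a combination lies in [van m] only if it is trivial. *)
Lemma power_products_free m N (c : exponents N m -> F) : (m <= M)%N ->
  van m (\sum_a c a *: power_product f a) -> forall a, c a = 0.
Proof.
elim: m c => [|m IH] c mM; set S := \sum_a _ => vs.
  case; apply: contrapT => /eqP nc; apply: (@van1 0%N) => //.
  have := vanM (c tt)^-1%:MP vs; rewrite /S /= (big_pred1 tt); last by case.
  by rewrite mul_mpolyC scalerA mulVf // scale1r.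
pose G j := \sum_r c (j, r) *: power_product f (r : exponents N m).
have eS : S = \sum_(j < N) f m ^+ j * G j.
  rewrite /G; under [RHS]eq_bigr do rewrite big_distrr /=.
  by rewrite pair_bigA; apply: eq_bigr => -[j r] _ /=; rewrite scalerAr.
have cG j : van m (G j) -> forall r, c (j, r) = 0 by apply: IH; exact: ltnW.
have G0 j : van m (G j) -> G j = 0.
  by move=> /cG h; rewrite /G big1 // => r _; rewrite h scale0r.
case=> j r; apply: cG; rewrite (van_powers mM G0) // -?eS //.
Qed.

Lemma msizeM_leq (p q : R) : (msize (p * q)%R <= (msize p + msize q).-1)%N.
Proof.
have [->|np] := eqVneq p 0; first by rewrite mul0r msize0.
have [->|nq] := eqVneq q 0; first by rewrite mulr0 msize0.
by rewrite msizeM.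
Qed.

Lemma msize_power_product N m D (a : exponents N m) :
  (forall i, (i < m)%N -> (msize (f i) <= D.+1)%N) ->
  (msize (power_product f a) <= (N * m * D).+1)%N.
Proof.
elim: m a => [|m IH] /= a hD; first by rewrite msize1.
have le1 k (p : R) E : (msize p <= E.+1)%N -> (msize (p ^+ k) <= (k * E).+1)%N.
  move=> hp; elim: k => [|k IHk]; first by rewrite expr0 msize1.
  rewrite exprS; apply: leq_trans (msizeM_leq _ _) _.
  rewrite mulSn; move: IHk hp; set x := mmeasure _ _; set y := mmeasure _ _; lia.
apply: leq_trans (msizeM_leq _ _) _.
have := le1 a.1 (f m) D (hD m (ltnSn m)).
have := IH a.2 (fun i h => hD i (leqW h)).
have la : (a.1 * D <= N * D)%N by rewrite leq_mul2r ltnW ?orbT.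
have -> : (N * m.+1 * D = N * m * D + N * D)%N by rewrite mulnS mulnDl addnC.
set x := mmeasure _ _; set y := mmeasure _ _; lia.
Qed.

Lemma card_bmnm K : (#|{: 'X_{1..d < K.+1}}| <= K.+1 ^ d)%N.
Proof.
pose h (m : 'X_{1..d < K.+1}) : {ffun 'I_d -> 'I_K.+1} := [ffun i => inord (m i)].
have /leq_card : injective h.
  move=> m1 m2 /ffunP e; apply/val_inj/mnmP => i; have := e i; rewrite !ffunE.
  have lt (m : 'X_{1..d < K.+1}) : (m i < K.+1)%N.
    by apply: leq_ltn_trans (bmdeg m); rewrite mdegE (bigD1 i) //= leq_addr.
  by move=> /(congr1 val) /=; rewrite !inordK.
by rewrite card_ffun !card_ord.
Qed.

(* The f_i are algebraically independent, and the power products with all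
   exponents below N are N^M polynomials of degree O(N) in d variables. *)
Lemma prime_chain_length : (M <= d)%N.
Proof.
rewrite leqNgt; apply/negP => ltdM.
pose D := \max_(i < M) msize (f i).
have hD i : (i < M)%N -> (msize (f i) <= D.+1)%N.
  by move=> iM; apply: leqW; exact: (leq_bigmax (Ordinal iM)).
have bound N : (N ^ M <= (N * M * D).+1 ^ d)%N.
  rewrite leqNgt; apply/negP => lt.
  set K := (N * M * D).+1 in lt *.
  pose A : 'M[F]_(#|exponents N M|, #|{: 'X_{1..d < K}}|) :=
    \matrix_(i, j) (power_product f (enum_val i : exponents N M))@_(enum_val j : 'X_{1..d < K}).
  (* The rows of [A] list the coefficients of the power products; with more products than monomials
     they would be linearly dependent. *)
  have : kermx A != 0.
    rewrite kermx_eq0 /row_free; apply: contraL lt => /eqP rA.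
    rewrite -leqNgt -card_exponents; apply: leq_trans (card_bmnm _).
    by rewrite -{1}rA rank_leq_col.
  case/rowV0Pn => u /sub_kermxP uA /negP; apply; apply/eqP/rowP => i.
  rewrite mxE -[i]enum_valK.
  pose c a := u 0 (enum_rank a).
  apply: (@power_products_free M N c) => //.
  suff -> : \sum_a c a *: power_product f a = 0 by exact: van0.
  apply/mpolyP => m; rewrite mcoeff0 raddf_sum /=.
  have [lt'|ge] := ltnP (mdeg m) K; last first.
    apply: big1 => a _; rewrite mcoeffZ memN_msupp_eq0 ?mulr0 //.
    by apply: msize_mdeg_ge; apply: leq_trans ge; exact: msize_power_product.
  have := congr1 (fun v : 'rV_ _ => v 0 (enum_rank (BMultinom lt'))) uA.
  rewrite !mxE => h; rewrite -[RHS]h (reindex_onto enum_val enum_rank) /=; last first.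
    by move=> a _; rewrite enum_rankK.
  apply: eq_big => [a|a _]; first by rewrite enum_valK eqxx.
  by rewrite mcoeffZ /c enum_valK mxE enum_rankK.
(* As N >= 1, N M D + 1 is at most N E, so the bound gives N^M <= N^d E^d; the choice N > E^d
   contradicts this as soon as M > d. *)
pose E := (M * D).+1; pose N := (E ^ d).+1.
have := bound N; apply/negP; rewrite -ltnNge.
apply: (@leq_ltn_trans (N ^ d * E ^ d)).
  have mono a b k : (a <= b -> a ^ k <= b ^ k)%N.
    by move=> ab; elim: k => // k IHk; rewrite !expnS leq_mul.
  by rewrite -expnMn mono // /E mulnS mulnA -[X in (X <= _)%N]add1n leq_add2r.
apply: (@leq_trans (N ^ d.+1)); last by rewrite leq_pexp2l.
by rewrite expnSr ltn_pmul2l ?expn_gt0 // /N.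
Qed.

End Krull.

(** * Charts and morphisms of quotients *)

Lemma mem_set_val (T : Type) (A : set T) (x : set_type A) : A (val x).
Proof. exact: set_valP. Qed.

Definition elt (T : Type) (A : set T) (x : T) (h : A x) : set_type A :=
  SigSub (mem_set h).

Lemma open_local (X : topologicalType) (U : set X) :
  (forall x, U x -> exists V, [/\ open V, V x & V `<=` U]) -> open U.
Proof.
move=> h; rewrite openE => x /h [V [oV Vx sV]].
by rewrite /interior nbhsE; exists V.
Qed.

Section ChartDim.
Variables (F : closedFieldType) (X : topologicalType) (d : nat).

(** A point of the smallest member lies in all of them, so one chart around it sees the whole chain.
    Polynomials in the coordinates that vanish on [Z i] form a prime ideal. Since the chart and the
    complement of [Z i] both meet the irreducible set [Z i.+1], they meet inside it, and this yields
    a polynomial separating the two ideals. *)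
Lemma chart_chain_le :
  (forall x : X, exists (U : set X) (phi : X -> 'M[F]_(d, 1)),
    [/\ open U, U x,
        forall f, polyfun f -> open (U `&` [set z | f (phi z) != 0]) &
        forall (K : set X) z, closed K -> U z -> ~ K z ->
          exists f, [/\ polyfun f, f (phi z) != 0 &
            forall k, U k -> K k -> f (phi k) = 0]]) ->
  forall m, closed_chain X m -> (m <= d)%N.
Proof.
move=> chart m [Z [iZ sZ]].
have [[x Zx] _] := (iZ 0%N (leq0n m)).2.
have [U [phi [oU Ux cphi sep]]] := chart x.
have Zi i : (i <= m)%N -> Z i x.
  by elim: i => // i IH im; apply: (sZ i im).1; apply: IH; exact: ltnW.
pose van i (P : {mpoly F[d * 1]}) :=
  forall z, U z -> Z i z -> @peval F d 1 P (phi z) = 0.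
have oP (P : {mpoly F[d * 1]}) :
    open (U `&` [set z | @peval F d 1 P (phi z) != 0]).
  by apply: (cphi (@peval F d 1 P)); exists P.
have /choice [f hf] i : exists P, (i < m)%N -> van i P /\ ~ van i.+1 P.
  case: (ltnP i m) => [im|]; last by exists 0.
  have [cZi _] := iZ i (ltnW im); have [_ irr] := iZ i.+1 im.
  have [sub /subsetNP [y Zy nZy]] := sZ i im.
  have [z [Zz [Uz nZz]]] : Z i.+1 `&` (U `&` ~` Z i) !=set0.
    move/irreducible_openP: irr => [_]; apply=> //; first exact: closed_openC.
      by exists x; split=> //; exact: Zi.
    by exists y.
  have [g [[P hP] gz gK]] := sep _ z cZi Uz nZz.
  exists P => _; split=> [k Uk Zk|]; first by rewrite -hP gK.
  by move=> /(_ z Uz Zz); rewrite -hP => g0; rewrite g0 eqxx in gz.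
rewrite -[X in (_ <= X)%N]muln1; apply: (@prime_chain_length F (d * 1) m van f).
- by move=> i z _ _; rewrite /peval meval0.
- by move=> i P Q hP hQ z Uz Zz; rewrite /peval mevalD [X in X + _]hP // [X in _ + X]hQ // addr0.
- by move=> i P Q hP z Uz Zz; rewrite /peval mevalM [X in _ * X]hP // mulr0.
- move=> i im /(_ x Ux (Zi i im)); rewrite /peval meval1 => /eqP.
  by rewrite oner_eq0.
- move=> i P Q im hPQ; apply: contrapT => /not_orP[nP nQ].
  have wit R : ~ van i R -> Z i `&` (U `&` [set z | @peval F d 1 R (phi z) != 0]) !=set0.
    move=> nR; apply: contrapT => n; apply: nR => z Uz Zz; apply: contrapT => /eqP nz.
    by apply: n; exists z.
  move/irreducible_openP: (iZ i im).2 => [_ h].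
  have [z [Zz [[Uz Pz] [_ Qz]]]] := h _ _ (oP P) (oP Q) (wit P nP) (wit Q nQ).
  have := hPQ z Uz Zz; rewrite /peval mevalM => /eqP.
  by rewrite mulf_eq0 (negPf Pz) (negPf Qz).
- by move=> i P im hP z Uz Zz; apply: hP => //; exact: (sZ i im).1.
- by move=> i im; exact: (hf i im).1.
- by move=> i im; exact: (hf i im).2.
Qed.

End ChartDim.

(** * Morphisms of quotients given by local polynomial formulas *)

Section Presentation.
Variable F : closedFieldType.

(* A relation that is locally given by polynomial maps between matrices
   representing the points. *)
Definition polynomially_related
    (n1 k1 n2 k2 : nat) (S1 : set (affine F n1 k1)) (S2 : set (affine F n2 k2))
    (T1 T2 : choiceType) (q1 : subvar S1 -> T1) (q2 : subvar S2 -> T2)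
    (A1 : set T1) (A2 : set T2) (R : T1 -> T2 -> Prop) :=
  forall t, A1 t -> exists (C0 : subvar S1) (psi : 'M[F]_(n1, k1) -> 'M[F]_(n2, k2)),
  [/\ q1 C0 = t, polymap psi, S2 (psi (val C0)),
      forall (C C' : subvar S1) (h : S2 (psi (val C))), q1 C = q1 C' ->
        exists h' : S2 (psi (val C')), q2 (elt h') = q2 (elt h) &
      forall (C : subvar S1) (h : S2 (psi (val C))), A1 (q1 C) ->
        A2 (q2 (elt h)) /\ R (q1 C) (q2 (elt h))].

Section Morphism.
Variables (n1 k1 n2 k2 : nat) (S1 : set (affine F n1 k1)) (S2 : set (affine F n2 k2)).
Variables (T1 T2 : choiceType) (q1 : subvar S1 -> T1) (q2 : subvar S2 -> T2).
Hypothesis oS2 : open S2.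
Variables (A1 : set (quot q1)) (A2 : set (quot q2)) (R : T1 -> T2 -> Prop).
Hypothesis rel : polynomially_related q1 q2 A1 A2 R.
Hypothesis Runiq : forall t s s', A1 t -> A2 s -> A2 s' -> R t s -> R t s' -> s = s'.

(** Both conditions are local. Near a point, [psi] descends to a map [ft] on a saturated open set of
    the ambient quotient, and uniqueness of the related point identifies it with [f] on [A1]. The
    ambient open set is essential: regular functions on a subvariety are local restrictions of
    ambient ones, and [ft] extends [f] off [A1]. *)
Lemma var_morphism_related (f : subvar A1 -> subvar A2) :
  (forall x, R (val x) (val (f x))) -> var_morphism f.
Proof.
move=> Rf.
have loc (x : subvar A1) (V2 : set (quot q2)) : open V2 -> V2 (val (f x)) ->
    exists (psi : 'M[F]_(n1, k1) -> 'M[F]_(n2, k2)) (ft : T1 -> T2)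
      (V1 : set (quot q1)),
    [/\ polymap psi, open V1 /\ V1 (val x),
        forall y : subvar A1, V1 (val y) -> V2 (val (f y)) /\ ft (val y) = val (f y),
        forall C : subvar S1, V1 (q1 C) ->
          exists h : S2 (psi (val C)), V2 (q2 (elt h)) /\ ft (q1 C) = q2 (elt h) &
        forall (C : subvar S1) (h : S2 (psi (val C))), V2 (q2 (elt h)) -> V1 (q1 C)].
  move=> oV2 V2fx; have [C0 [psi [qC0 ppsi SC0 inv ok]]] := rel (mem_set_val x).
  (* The graph of the map induced by [psi]. The default value in [ft] below is taken only where this
     graph has no point. *)
  pose G t s := exists (C : subvar S1) (h : S2 (psi (val C))),
    q1 C = t /\ q2 (elt h) = s.
  have Gf t s s' : G t s -> G t s' -> s = s'.
    move=> [C [h [qC <-]]] [C' [h' [qC' <-]]].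
    have [h'' <-] := inv C C' h (etrans qC (esym qC')).
    by congr (q2 _); apply: val_inj.
  pose ft t := xget (q2 (elt SC0)) [set s | G t s].
  have ftE C (h : S2 (psi (val C))) : ft (q1 C) = q2 (elt h).
    rewrite /ft; case: xgetP => [s _ Gs|/(_ (q2 (elt h)))[]]; last by exists C, h.
    by apply: Gf Gs _; exists C, h.
  have Rft (y : subvar A1) C (h : S2 (psi (val C))) : q1 C = val y ->
      q2 (elt h) = val (f y).
    move=> qC; have [] := ok C h; first by rewrite qC; exact: mem_set_val.
    by rewrite qC => A2s Rs; apply: (Runiq (mem_set_val y)) Rs (Rf y) => //; exact: mem_set_val.
  exists psi, ft, [set t | exists C h, q1 C = t /\ V2 (q2 (@elt _ S2 (psi (val C)) h))].
  split=> //.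
  - split; last first.
      by exists C0, SC0; split=> //; rewrite (Rft x).
    have /open_subvar [W2 oW2 hW2] := oV2.
    apply/open_subvar; exists ((psi : affine F n1 k1 -> affine F n2 k2) @^-1` (S2 `&` W2)).
      by apply: open_polymap => //; exact: openI.
    move=> C; split=> [[C' [h' [qC' V2h]]]|[Sh Wh]].
      have [h e] := inv C' C h' qC'; split=> //.
      by apply/(hW2 (elt h)); rewrite /preimage /= e.
    by exists C, Sh; split=> //; apply/(hW2 (elt Sh)).
  - by move=> y [C [h [qC V2h]]]; rewrite -(Rft y C h qC) -qC ftE.
  - move=> C [C' [h' [qC' V2h]]]; have [h e] := inv C' C h' qC'.
    by exists h; rewrite e; split=> //; rewrite -qC' ftE.
  - by move=> C h V2h; exists C, h.
split=> [U /open_subvar[V2 oV2 hV2]|U g oU regU].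
  apply: open_local => x /hV2 /(loc x V2 oV2) [psi [ft [V1 [_ [oV1 V1x] h _ _]]]].
  exists [set y : subvar A1 | V1 (val y)]; split=> //.
    by apply/open_subvar; exists V1.
  by move=> y /h [/hV2].
move=> x Ux; have [V2 [g2 [oV2 rV2 V2fx hV2]]] := regU _ Ux.
have [psi [ft [V1 [ppsi [oV1 V1x] h1 h2 h3]]]] := loc x V2 oV2 V2fx.
(* The regular extension of the pulled back function is the composite with [ft], not with [f], which
   is defined on [A1] only. *)
exists V1, (g2 \o ft); split=> //; last first.
  by move=> y /h1 [V2fy e]; have [Ufy gE] := hV2 _ V2fy; rewrite /= gE e.
move=> C V1C; have [h [V2h fth]] := h2 C V1C.
have [V4 [g4 [oV4 rV4 V4h hV4]]] := rV2 (elt h) V2h.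
exists [set D : 'M_(n1, k1) | S2 (psi D) /\ V4 (psi D)], (g4 \o psi); split=> //.
- exact: (open_polymap ppsi (openI oS2 oV4)).
- move=> D [SD VD]; have [P [Q [nQ hPQ]]] := rV4 _ VD.
  have [P' hP'] : polyfun (fun D => @peval F n2 k2 P (psi D)).
    by apply: polyfun_comp ppsi _; exists P.
  have [Q' hQ'] : polyfun (fun D => @peval F n2 k2 Q (psi D)).
    by apply: polyfun_comp ppsi _; exists Q.
  exists P', Q'; rewrite -hQ'; split=> // B [SB VB]; rewrite -hQ' -hP' => nB.
  exact: hPQ.
- move=> C' [SC' VC']; have [V2C' gC'] := hV4 (elt SC') VC'.
  split; first exact: (h3 C' SC').
  have V1C' : V1 (q1 C') by exact: (h3 C' SC').
  have [h' [_ fth']] := h2 C' V1C'; rewrite /= fth' -gC' /=.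
  by congr (g2 (q2 _)); apply: val_inj.
Qed.

End Morphism.

Section Isomorphism.
Variables (n1 k1 n2 k2 : nat) (S1 : set (affine F n1 k1)) (S2 : set (affine F n2 k2)).
Variables (T1 T2 : choiceType) (q1 : subvar S1 -> T1) (q2 : subvar S2 -> T2).
Hypotheses (oS1 : open S1) (oS2 : open S2).
Variables (A1 : set (quot q1)) (A2 : set (quot q2)) (R : T1 -> T2 -> Prop).

Lemma isomorphic_related :
  polynomially_related q1 q2 A1 A2 R ->
  polynomially_related q2 q1 A2 A1 (fun s t => R t s) ->
  (forall t s s', A1 t -> A2 s -> A2 s' -> R t s -> R t s' -> s = s') ->
  (forall t t' s, A1 t -> A1 t' -> A2 s -> R t s -> R t' s -> t = t') ->
  isomorphic (subvar A1) (subvar A2).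
Proof.
move=> r12 r21 u12 u21.
have /choice [f hf] (x : subvar A1) : exists y : subvar A2, R (val x) (val y).
  have [C0 [psi [qC0 _ SC0 _ ok]]] := r12 _ (mem_set_val x).
  have [|As Rs] := ok C0 SC0; first by rewrite qC0; exact: mem_set_val.
  by exists (elt As); rewrite -qC0.
have /choice [g hg] (y : subvar A2) : exists x : subvar A1, R (val x) (val y).
  have [C0 [psi [qC0 _ SC0 _ ok]]] := r21 _ (mem_set_val y).
  have [|As Rs] := ok C0 SC0; first by rewrite qC0; exact: mem_set_val.
  by exists (elt As); rewrite -qC0.
exists f, g; split.
- by move=> x; apply: val_inj; apply: u21 (hg (f x)) (hf x); exact: mem_set_val.
- by move=> y; apply: val_inj; apply: u12 (hf (g y)) (hg y); exact: mem_set_val.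
- exact: (var_morphism_related oS2 r12 u12).
- apply: (var_morphism_related oS1 r21 _ hg) => s t t' As At At'.
  exact: u21.
Qed.

End Isomorphism.

Lemma isomorphic_sym (X Y : fspace F) : isomorphic X Y -> isomorphic Y X.
Proof. by move=> [f [g [? ? ? ?]]]; exists g, f. Qed.

Lemma isomorphic_trans (X Y Z : fspace F) :
  isomorphic X Y -> isomorphic Y Z -> isomorphic X Z.
Proof.
have cmp (A B C : fspace F) (f : A -> B) (g : B -> C) :
    var_morphism f -> var_morphism g -> var_morphism (g \o f).
  move=> [cf rf] [cg rg]; split=> [U oU|U h oU rU]; first exact: (cf _ (cg _ oU)).
  by apply: (rf (g @^-1` U) (h \o g)); [exact: cg|exact: rg].
move=> [f [f' [fK f'K mf mf']]] [g [g' [gK g'K mg mg']]].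
exists (g \o f), (f' \o g'); split; [exact: can_comp|exact: can_comp|exact: cmp|exact: cmp].
Qed.

Lemma isomorphic_setT n k (S : set (affine F n k)) (T : choiceType)
    (q : subvar S -> T) : isomorphic (subvar [set: quot q]) (quot q).
Proof.
exists (fun x => val x), (fun x => @elt (quot q) setT x I); split.
- by move=> x; apply: val_inj.
- by [].
- split=> [U oU|U g oU rU]; first by apply/open_subvar; exists U.
  by move=> x Ux; exists U, g; split.
- split=> [U /open_subvar[V oV hV]|U g oU rU].
    rewrite (_ : _ @^-1` _ = V) //; apply/seteqP; split=> x.
      by move=> /hV.
    by move=> Vx; apply/hV.
  move=> C UC; have [V [g' [oV rV VC hV]]] := rU _ UC.
  have [V3 [g3 [oV3 rV3 V3C hV3]]] := rV C VC.
  exists V3, g3; split=> // C' /hV3 [VC' gC'].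
  by have [UC' gg] := hV (@elt (quot q) setT (q C') I) VC'; split=> //; apply: etrans gg gC'.
Qed.

End Presentation.

(** * Flag varieties *)

Section Flags.
Variable F : closedFieldType.

Section Columns.
Variables (n k : nat).
Implicit Types C : 'M[F]_(n, k).

Lemma span_cols0 C : span_cols C 0 = 0%VS.
Proof. by rewrite /span_cols take0 span_nil. Qed.

Lemma span_colsS C (j : 'I_k) :
  span_cols C j.+1 = (span_cols C j + <[col j C]>)%VS.
Proof.
have jk : (j < size (enum 'I_k))%N by rewrite size_enum_ord.
have js : (j < size [seq col i C | i <- enum 'I_k])%N by rewrite size_map.
rewrite /span_cols (take_nth 0 js).
by rewrite -cats1 span_cat span_seq1 (nth_map j _ _ jk) nth_ord_enum.
Qed.

Lemma span_cols_oversize C j : (k <= j)%N -> span_cols C j = span_cols C k.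
Proof. by move=> kj; rewrite /span_cols !take_oversize // size_map size_enum_ord. Qed.

Lemma mem_span_cols C j v : v \in span_cols C j <->
  exists a : 'cV[F]_k, v = C *m a /\ forall i : 'I_k, (j <= i)%N -> a i 0 = 0.
Proof.
elim: j v => [|j IH] v.
  rewrite span_cols0 memv0; split=> [/eqP ->|[a [-> a0]]].
    by exists 0; rewrite mulmx0; split=> // i _; rewrite mxE.
  by rewrite (_ : a = 0) ?mulmx0 //; apply/colP => i; rewrite a0 // mxE.
have [kj|jk] := leqP k j.
  rewrite span_cols_oversize ?(leqW kj) // -(span_cols_oversize _ kj) IH.
  by split=> -[a [-> _]]; exists a; split=> // i; rewrite leqNgt (leq_trans (ltn_ord i)) // leqW.
rewrite (span_colsS C (Ordinal jk)) /=; split.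
  move=> /memv_addP[u /IH [a [-> a0]] [w /vlineP [c ->] ->]].
  exists (a + c *: delta_mx (Ordinal jk) 0); rewrite mulmxDr -scalemxAr -colE.
  split=> // i ji; rewrite !mxE a0 ?(ltnW ji) // -val_eqE /= gtn_eqF //.
  by rewrite mulr0 addr0.
move=> [a [-> a0]]; pose c := a (Ordinal jk) 0.
pose b := a - c *: delta_mx (Ordinal jk) 0.
have -> : a = b + c *: delta_mx (Ordinal jk) 0 by rewrite subrK.
rewrite mulmxDr -scalemxAr -colE; apply: memv_add; last by rewrite memvZ ?memv_line.
apply/IH; exists b; split=> // i; rewrite leq_eqVlt => /predU1P[ij|ji].
  have -> : i = Ordinal jk by apply: val_inj.
  by rewrite !mxE !eqxx mulr1 subrr.
by rewrite !mxE a0 // -val_eqE /= gtn_eqF // mulr0 subr0.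
Qed.

Lemma mem_col_span C (i : 'I_k) j : (i < j)%N -> col i C \in span_cols C j.
Proof.
move=> ij; apply/mem_span_cols; exists (delta_mx i 0); rewrite -colE; split=> // l jl.
by rewrite mxE -val_eqE /= gtn_eqF // (leq_trans ij).
Qed.

Lemma span_cols_subP C j (U : {vspace 'cV[F]_n}) :
  (span_cols C j <= U)%VS <-> forall i : 'I_k, (i < j)%N -> col i C \in U.
Proof.
split=> [/subvP s i ij|h]; first by apply: s; exact: mem_col_span.
apply/subvP => v /mem_span_cols [a [-> a0]].
have -> : C *m a = \sum_i a i 0 *: col i C.
  apply/colP => x; rewrite !mxE summxE; apply: eq_bigr => i _.
  by rewrite !mxE mulrC.
apply: memv_suml => i _; have [ij|ji] := ltnP i j; first by rewrite memvZ ?h.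
by rewrite a0 // scale0r mem0v.
Qed.

Lemma rank_injP C : \rank C = k <-> forall a : 'cV[F]_k, C *m a = 0 -> a = 0.
Proof.
have -> : \rank C = k <-> kermx C^T = 0.
  split=> [r|/eqP]; first by apply/eqP; rewrite kermx_eq0 /row_free mxrank_tr r.
  by rewrite kermx_eq0 /row_free mxrank_tr => /eqP.
split=> [k0 a Ca|h].
  have : (a^T <= kermx C^T)%MS by apply/sub_kermxP; rewrite -trmx_mul Ca trmx0.
  by rewrite k0 submx0 => /eqP a0; rewrite -[a]trmxK a0 trmx0.
apply/eqP/rowV0P => v /sub_kermxP vC.
suff v0 : v^T = 0 by rewrite -[v]trmxK v0 trmx0.
by apply: h; rewrite -[C]trmxK -trmx_mul vC trmx0.
Qed.

End Columns.

Section FlagTheory.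
Variables (n k : nat).
Implicit Types (W : flag F n k) (C : 'M[F]_(n, k)).

Lemma flag_dim W j : (j <= k)%N -> \dim (W j) = j.
Proof.
move=> jk; have /andP[/forallP/(_ (inord j)) /eqP h _] := flag_tupleP W.
by rewrite /flag_nth; rewrite (tnth_nth 0%VS) inordK in h.
Qed.

Lemma flag_sub W i j : (i <= j)%N -> (j <= k)%N -> (W i <= W j)%VS.
Proof.
move=> ij jk; have /andP[_ /forallP/(_ (inord i)) /forallP/(_ (inord j))] := flag_tupleP W.
by rewrite !(tnth_nth 0%VS) !inordK ?ltnS ?(leq_trans ij) // ij.
Qed.

Lemma flag_eqP W W' : (forall j, (j <= k)%N -> W j = W' j) -> W = W'.
Proof.
move=> h; apply/val_inj/eq_from_tnth => i /=; rewrite !(tnth_nth 0%VS).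
by apply: h; rewrite -ltnS.
Qed.

Definition represents C W := forall j, (j <= k)%N -> W j = span_cols C j.

Lemma represents_flag_of C (rC : \rank C = k) : represents C (flag_of rC).
Proof. by move=> j jk; rewrite /flag_nth /= (nth_mktuple _ _ (Ordinal _)). Qed.

Lemma represents_inj C W W' : represents C W -> represents C W' -> W = W'.
Proof. by move=> h h'; apply: flag_eqP => j jk; rewrite h ?h'. Qed.

Lemma represents_rank C W : represents C W -> \rank C = k.
Proof.
move=> h; have := flag_dim W (leqnn k); rewrite h // /span_cols take_oversize; last first.
  by rewrite size_map size_enum_ord.
move=> d; have : free [tuple col i C | i < k].
  by rewrite /free /= d size_map size_enum_ord.
move/freeP => fr; apply/rank_injP => a Ca; apply/colP => i; rewrite mxE.
apply: (fr (fun i => a i 0)); rewrite -[RHS]Ca; apply/colP => x.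
rewrite mxE summxE; apply: eq_bigr => j _.
by rewrite -tnth_nth tnth_mktuple !mxE mulrC.
Qed.

Lemma flag_of_represents C W : represents C W -> exists rC, @flag_of F n k C rC = W.
Proof.
move=> h; have rC := represents_rank h; exists rC.
exact: represents_inj (represents_flag_of rC) h.
Qed.

Lemma represents_cols C W : \rank C = k ->
  (forall j : 'I_k, col j C \in W j.+1) -> represents C W.
Proof.
move=> rC h j jk; apply/esym/eqP; rewrite eqEdim.
rewrite flag_dim // -(represents_flag_of rC) // flag_dim // leqnn andbT.
rewrite represents_flag_of //; apply/span_cols_subP => i ij.
by apply: subvP (h i); exact: flag_sub.
Qed.

Lemma represents_col C W (i : 'I_k) j : represents C W -> (i < j <= k)%N ->
  col i C \in W j.
Proof. by move=> h /andP[ij jk]; rewrite h //; exact: mem_col_span. Qed.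

Lemma flag_represented W : exists C, represents C W.
Proof.
have /choice [c hc] (j : 'I_k) : exists v, v \in W j.+1 /\ v \notin W j.
  apply: contrapT => no; have : (W j.+1 <= W j)%VS.
    apply/subvP => v vW; apply: contrapT => /negP nv; apply: no.
    by exists v.
  by move/dimvS; rewrite !flag_dim ?(ltnW (ltn_ord j)) ?ltnn // ltnn.
pose C : 'M[F]_(n, k) := \matrix_(i, j) c j i 0.
have colC j : col j C = c j by apply/colP => i; rewrite !mxE.
exists C => j; elim: j => [|j IH] jk.
  by rewrite span_cols0; apply/eqP; rewrite -dimv_eq0 flag_dim.
rewrite (span_colsS C (Ordinal jk)) /= colC -IH ?(ltnW jk) //.
have [cin cnot] := hc (Ordinal jk).
apply/esym/eqP; rewrite eqEdim; apply/andP; split.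
  by rewrite subv_add flag_sub // -memvE.
rewrite flag_dim // ltnNge; apply: contra cnot => le.
have : (W j == W j + <[c (Ordinal jk)]>)%VS.
  by rewrite eqEdim addvSl (leq_trans le) // flag_dim // ltnW.
move/eqP => e; rewrite /= e; apply: subvP (memv_line _); exact: addvSr.
Qed.

Definition uptri (b : 'M[F]_k) := forall i j : 'I_k, (j < i)%N -> b i j = 0.

Lemma represents_uptri C C' W : represents C W -> represents C' W ->
  exists b, [/\ C' = C *m b, uptri b & b \in unitmx].
Proof.
move=> h h'.
have /choice [a ha] (j : 'I_k) : exists a : 'cV[F]_k,
    col j C' = C *m a /\ forall i : 'I_k, (j < i)%N -> a i 0 = 0.
  have cj : col j C' \in W j.+1 by apply: represents_col h' _; rewrite ltnSn ltn_ord.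
  by move: cj; rewrite h // => /mem_span_cols.
pose b : 'M[F]_k := \matrix_(i, j) a j i 0.
have CE : C' = C *m b.
  apply/matrixP => x j; have [/colP/(_ x) e _] := ha j.
  move: e; rewrite !mxE => ->; apply: eq_bigr => i _; by rewrite mxE.
exists b; split=> //; first by move=> i j ji; rewrite mxE (ha j).2.
rewrite -row_free_unit /row_free; apply/eqP/rank_injP => v bv.
by apply: (rank_injP C').1 (represents_rank h') _ _; rewrite CE -mulmxA bv mulmx0.
Qed.

Lemma uptri_represents C W b : represents C W -> uptri b -> b \in unitmx ->
  represents (C *m b) W.
Proof.
move=> h ub ib; apply: represents_cols.
  apply/rank_injP => a; rewrite -mulmxA => /((rank_injP C).1 (represents_rank h)).
  by move=> ba; rewrite -[a]mul1mx -(mulVmx ib) -mulmxA ba mulmx0.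
move=> j; rewrite h //; apply/mem_span_cols; exists (col j b).
split; first by rewrite !colE mulmxA.
by move=> i ji; rewrite mxE ub.
Qed.

End FlagTheory.

Section FlagVariety.
Variables (n k : nat).
Local Notation X := (flag_variety F n k).

Definition flag_quot (C : subvar (@full_rank F n k)) : flag F n k :=
  flag_of (set_valP C).

Lemma flag_quotP (C : subvar (@full_rank F n k)) (W : flag F n k) :
  flag_quot C = W <-> represents (val C : 'M[F]_(n, k)) W.
Proof.
split=> [<-|h]; first exact: represents_flag_of.
by apply: represents_inj h; exact: represents_flag_of.
Qed.

Lemma open_flagP (D : set X) :
  (forall (W : flag F n k) C, represents C W -> D W ->
     exists f : 'M[F]_(n, k) -> F, [/\ polyfun f, f C != 0 &
       forall C' W', represents C' W' -> f C' != 0 -> D W']) -> open D.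
Proof.
move=> h; apply/open_subvar.
exists [set C : 'M[F]_(n, k) | exists f : 'M[F]_(n, k) -> F,
  [/\ polyfun f, f C != 0 & forall C' W', represents C' W' -> f C' != 0 -> D W']].
  apply/open_affineP => C [f [pf fC hf]]; exists f; split=> // C' fC'.
  by exists f.
move=> C; split=> [DC|[f [pf fC hf]]]; last exact: hf (represents_flag_of _) fC.
by apply: (h _ _ _ DC); exact: represents_flag_of.
Qed.

(* It suffices to test on one representative whether a flag lies in [D]. *)
Lemma closed_flag (D : set X) (P : set ('M[F]_(n, k) -> F)) :
  (forall f, P f -> polyfun f) ->
  (forall (W : flag F n k) C, represents C W -> D W <-> forall f, P f -> f C = 0) ->
  closed D.
Proof.
move=> pP hD; rewrite -openC; apply: open_flagP => W C rC nD.
have [f Pf fC] : exists2 f, P f & f C != 0.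
  apply: contrapT => n0; apply: nD; apply/(hD W C rC) => f Pf.
  by apply: contrapT => /eqP nf; apply: n0; exists f.
exists f; split=> //; first exact: pP.
by move=> C' W' rC' nf DW'; move/eqP: nf; apply; apply: (hD W' C' rC').1.
Qed.

Definition flag_set (S : set 'M[F]_(n, k)) : set X :=
  [set W | exists2 C, S C & represents C W].

Definition uptri_invariant (S : set 'M[F]_(n, k)) :=
  forall C b, S C -> uptri b -> b \in unitmx -> S (C *m b).

Lemma flag_set_inv (S : set 'M[F]_(n, k)) C (W : flag F n k) :
  uptri_invariant S -> represents C W -> flag_set S W <-> S C.
Proof.
move=> inv rC; split=> [[C' SC' rC']|SC]; last by exists C.
by have [b [-> ub ib]] := represents_uptri rC' rC; exact: inv.
Qed.

Lemma rank_uptri (C : 'M[F]_(n, k)) b : b \in unitmx -> \rank C = k -> \rank (C *m b) = k.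
Proof. by move=> ib rC; rewrite mxrankMfree // row_free_unit. Qed.

Lemma open_flag_preimage (U : set X) : open U ->
  exists2 V : set (affine F n k), open V &
    forall C W, represents C W -> V C <-> U W.
Proof.
move=> /open_subvar[V oV hV]; exists V => // C W rC.
have [rk e] := flag_of_represents rC.
have := hV (@elt _ (@full_rank F n k) C rk).
rewrite /preimage /=; set W' := flag_of _.
have -> : W' = W by apply: represents_inj rC; exact: represents_flag_of.
by move=> [h1 h2]; split.
Qed.

Lemma irreducible_flag_set (S : set (affine F n k)) :
  S `<=` @full_rank F n k -> irreducible S -> irreducible (flag_set S).
Proof.
move=> fS /irreducible_openP[[C SC] h]; apply/irreducible_openP; split.
  by exists (flag_of (fS _ SC)), C => //; exact: represents_flag_of.
move=> U V /open_flag_preimage[U' oU' hU] /open_flag_preimage[V' oV' hV].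
move=> [W1 [[C1 S1 r1] U1]] [W2 [[C2 S2 r2] V2]].
have [] := h U' V' oU' oV'.
- by exists C1; split=> //; apply/(hU _ _ r1).
- by exists C2; split=> //; apply/(hV _ _ r2).
move=> C3 [S3 [U3 V3]]; have r3 := represents_flag_of (fS _ S3).
exists (flag_of (fS _ S3)); split; first by exists C3.
by split; [apply/(hU _ _ r3)|apply/(hV _ _ r3)].
Qed.

End FlagVariety.

Lemma isomorphic_flag n1 k1 n2 k2 (A1 : set (flag_variety F n1 k1))
    (A2 : set (flag_variety F n2 k2)) (R : flag F n1 k1 -> flag F n2 k2 -> Prop) :
  polynomially_related (@flag_quot n1 k1) (@flag_quot n2 k2) A1 A2 R ->
  polynomially_related (@flag_quot n2 k2) (@flag_quot n1 k1) A2 A1 (fun s t => R t s) ->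
  (forall t s s', A1 t -> A2 s -> A2 s' -> R t s -> R t s' -> s = s') ->
  (forall t t' s, A1 t -> A1 t' -> A2 s -> R t s -> R t' s -> t = t') ->
  isomorphic (subvar A1) (subvar A2).
Proof.
by move=> r12 r21 u12 u21; apply: isomorphic_related r12 r21 u12 u21; exact: open_full_rank.
Qed.

(* For maps between flag varieties the independence of the representative is
   checked on right multiplication by invertible upper triangular matrices. *)
Lemma polynomially_related_flag n1 k1 n2 k2 (A1 : set (flag_variety F n1 k1))
    (A2 : set (flag_variety F n2 k2)) (R : flag F n1 k1 -> flag F n2 k2 -> Prop) :
  (forall W C, A1 W -> represents C W ->
     exists psi : 'M[F]_(n1, k1) -> 'M[F]_(n2, k2),
     [/\ polymap psi, \rank (psi C) = k2,
         forall D b, \rank D = k1 -> \rank (psi D) = k2 -> uptri b ->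
           b \in unitmx -> exists2 b', psi (D *m b) = psi D *m b' &
             uptri b' /\ b' \in unitmx &
         forall W' D, A1 W' -> represents D W' -> \rank (psi D) = k2 ->
           exists2 W'', represents (psi D) W'' & A2 W'' /\ R W' W'']) ->
  polynomially_related (@flag_quot n1 k1) (@flag_quot n2 k2) A1 A2 R.
Proof.
move=> h W AW; have [C rC] := flag_represented W.
have [psi [ppsi rpsi inv ok]] := h W C AW rC.
exists (@elt _ (@full_rank F n1 k1) C (represents_rank rC)), psi; split=> //.
- exact/flag_quotP.
- move=> D D' hD e.
  have rD := (flag_quotP D _).1 erefl; have rD' := (flag_quotP D' _).1 (esym e).
  have [b [DE ub ib]] := represents_uptri rD rD'.
  have [b' e' [ub' ib']] := inv (val D) b (represents_rank rD) hD ub ib.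
  have rp := uptri_represents (represents_flag_of hD) ub' ib'.
  rewrite -e' -DE in rp; exists (represents_rank rp).
  by apply/flag_quotP; exact: rp.
- move=> D hD AD; have rD := (flag_quotP D _).1 erefl.
  have [W'' rW'' [A2W RW]] := ok _ (val D) AD rD hD.
  by have -> : flag_quot (elt hD) = W'' by exact/flag_quotP.
Qed.

End Flags.

(** * Symplectic flags *)

Section Symplectic.
Variable F : closedFieldType.
Implicit Types (U : {vspace 'cV[F]_6}) (v w : 'cV[F]_6).

(** The Gram matrix of the pairing in the standard basis. *)
Definition Jmx : 'M[F]_(3 + 3) := block_mx 0 1%:M (- 1%:M) 0.

Lemma coord6l v (i : 'I_3) : coord6 v i.+1 = v (lshift 3 i) 0.
Proof.
rewrite /coord6; congr (v _ 0); apply: val_inj.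
by case: i => -[|[|[|//]]] lti; rewrite /= inordK.
Qed.

Lemma coord6r v (i : 'I_3) : coord6 v (3 + i.+1) = v (rshift 3 i) 0.
Proof.
rewrite /coord6; congr (v _ 0); apply: val_inj.
by case: i => -[|[|[|//]]] lti; rewrite /= inordK.
Qed.

Lemma JmxM m (A : 'M[F]_(3 + 3, m)) : Jmx *m A = col_mx (dsubmx A) (- usubmx A).
Proof.
rewrite -{1}[A]vsubmxK /Jmx mul_block_col.
by rewrite !mul0mx add0r addr0 mulNmx !mul1mx.
Qed.

Lemma JmxEl m (A : 'M[F]_(3 + 3, m)) i j :
  (Jmx *m A) (lshift 3 i) j = A (rshift 3 i) j.
Proof. by rewrite JmxM col_mxEu mxE. Qed.

Lemma JmxEr m (A : 'M[F]_(3 + 3, m)) i j :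
  (Jmx *m A) (rshift 3 i) j = - A (lshift 3 i) j.
Proof. by rewrite JmxM col_mxEd !mxE. Qed.

Lemma pairingE v w : pairing v w = (v^T *m Jmx *m w) 0 0.
Proof.
rewrite /pairing big_add1 big_mkord -mulmxA.
rewrite mxE (@big_split_ord _ _ _ 3 3) /= -big_split /=; apply: eq_bigr => i _.
rewrite coord6l coord6r coord6l coord6r.
by rewrite (JmxEl (w : 'M_(3 + 3, 1))) (JmxEr (w : 'M_(3 + 3, 1))) !mxE mulrN.
Qed.

Lemma trJmx : Jmx^T = - Jmx.
Proof. by rewrite /Jmx tr_block_mx opp_block_mx !trmx0 !oppr0 linearN /= trmx1 opprK. Qed.

Lemma JmxN : Jmx *m (- Jmx) = 1%:M.
Proof.
rewrite /Jmx opp_block_mx mulmx_block !oppr0 opprK !mulmx0 !mul0mx !add0r !addr0.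
by rewrite mul1mx mulNmx mulmxN mul1mx opprK -scalar_mx_block.
Qed.

Lemma pairing_mul m l (A : 'M[F]_(6, m)) (B : 'M[F]_(6, l)) (a : 'cV_m) (b : 'cV_l) :
  pairing (A *m a) (B *m b) =
  \sum_i \sum_j a i 0 * (A^T *m Jmx *m B) i j * b j 0.
Proof.
rewrite pairingE trmx_mul.
have -> : a^T *m A^T *m Jmx *m (B *m b) = a^T *m ((A^T *m Jmx *m B) *m b).
  by rewrite !mulmxA.
rewrite mxE; apply: eq_bigr => i _; rewrite [a^T _ _]mxE [X in _ * X]mxE big_distrr /=.
by apply: eq_bigr => j _; rewrite mulrA.
Qed.

Lemma pairingC v w : pairing v w = - pairing w v.
Proof.
rewrite !pairingE; have -> : v^T *m Jmx *m w = - (w^T *m Jmx *m v)^T.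
  by rewrite !trmx_mul trmxK trJmx mulNmx mulmxN opprK mulmxA.
by rewrite !mxE.
Qed.

Lemma pairing_col m l (A : 'M[F]_(6, m)) (B : 'M[F]_(6, l)) i j :
  pairing (col i A) (col j B) = (A^T *m Jmx *m B) i j.
Proof.
rewrite pairingE !mxE; apply: eq_bigr => x _; rewrite !mxE; congr (_ * _).
by apply: eq_bigr => y _; rewrite !mxE.
Qed.

Lemma pairingZl c v w : pairing (c *: v) w = c * pairing v w.
Proof. by rewrite !pairingE linearZ /= -!scalemxAl mxE. Qed.

Lemma pairingDl v v' w : pairing (v + v') w = pairing v w + pairing v' w.
Proof. by rewrite !pairingE linearD /= !mulmxDl mxE. Qed.

Lemma pairingZr c v w : pairing v (c *: w) = c * pairing v w.
Proof. by rewrite pairingC pairingZl -mulrN -pairingC. Qed.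

Lemma pairingDr v w w' : pairing v (w + w') = pairing v w + pairing v w'.
Proof. by rewrite pairingC pairingDl opprD -!pairingC. Qed.

(** The complement is the kernel of [A^T *m Jmx], for a basis [A] of [U]; this map is onto because
    [A] has full rank and [Jmx] is invertible. The dimension reduces every later proof of [is_perp]
    to one inclusion. *)
Lemma perp_space U : exists K : {vspace 'cV[F]_6},
  (forall w, w \in K <-> forall v, v \in U -> pairing v w = 0) /\
  (\dim K + \dim U = 6)%N.
Proof.
pose A : 'M[F]_(6, \dim U) := \matrix_(i, l) (vbasis U)`_l i 0.
have colA l : col l A = (vbasis U)`_l by apply/colP => i; rewrite !mxE.
have AE (a : 'cV_(\dim U)) : A *m a = \sum_l a l 0 *: (vbasis U)`_l.
  apply/colP => x; rewrite mxE summxE; apply: eq_bigr => l _.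
  by rewrite !mxE mulrC.
have rA : \rank A = \dim U.
  have /freeP fr := basis_free (vbasisP U).
  apply/rank_injP => a; rewrite AE => /(fr (fun l => a l 0)) h.
  by apply/colP => i; rewrite mxE.
pose f := linfun (mulmx (A^T *m Jmx) : 'cV_6 -> 'cV_(\dim U)).
exists (lker f); split.
  move=> w; rewrite memv_ker lfunE /=; split=> [/eqP f0 v vU|h].
    have [a ->] : exists a, v = A *m a.
      exists (\col_l coord (vbasis U) l v); rewrite AE {1}(coord_vbasis vU).
      by apply: eq_bigr => l _; rewrite mxE.
    by rewrite pairingE trmx_mul -!mulmxA (mulmxA A^T) f0 mulmx0 mxE.
  apply/eqP/colP => l; have lt : (l < size (vbasis U))%N by rewrite size_tuple.
  have := h _ (vbasis_mem (mem_nth 0 lt)).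
  by rewrite -colA pairingE tr_col -!row_mul mxE => ->; rewrite mxE.
have dU : \dim (f @: fullv) = \dim U.
  suff -> : (f @: fullv)%VS = fullv by rewrite dimvf /dim /= muln1.
  apply/vspaceP => y; rewrite memvf; have rf : row_free (A^T *m Jmx).
    rewrite /row_free mxrankMfree ?mxrank_tr ?rA //.
    by rewrite row_free_unit; case/mulmx1_unit: JmxN.
  have [B AB] := row_freeP rf.
  have -> : y = f (B *m y) by rewrite lfunE /= mulmxA AB mul1mx.
  by rewrite memv_img ?memvf.
have := limg_ker_dim f fullv; rewrite capfv dU => ->.
by rewrite dimvf /dim /= muln1.
Qed.

Lemma is_perp_of U U' : (forall v w, v \in U -> w \in U' -> pairing v w = 0) ->
  (\dim U' + \dim U = 6)%N -> is_perp U U'.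
Proof.
move=> h d; have [K [hK dK]] := perp_space U.
suff -> : U' = K by exact: hK.
apply/eqP; rewrite eqEdim; apply/andP; split.
  by apply/subvP => w wU'; apply/hK => v vU; exact: h.
by rewrite -(leq_add2r (\dim U)) d dK.
Qed.

Lemma is_perp_sym U U' : (\dim U + \dim U' = 6)%N -> is_perp U U' -> is_perp U' U.
Proof.
move=> d h; apply: is_perp_of => // v w vU' wU.
by rewrite pairingC ((h v).1 vU' w wU) oppr0.
Qed.

Definition symplectic (W : flag F 6 6) : Prop :=
  forall j, (j <= 6)%N -> is_perp (W j) (W (6 - j)%N).

Lemma symplectic_half (W : flag F 6 6) :
  (forall j, (j <= 3)%N -> is_perp (W j) (W (6 - j)%N)) -> symplectic W.
Proof.
move=> h j j6; have [j3|j3] := leqP j 3; first exact: h.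
have e : j = (6 - (6 - j))%N by rewrite subKn.
suff : is_perp (W (6 - (6 - j))%N) (W (6 - j)%N) by rewrite -e.
apply: is_perp_sym; first by rewrite !flag_dim ?leq_subr // subnKC ?leq_subr.
by apply: h; exact: leq_trans (leq_sub2l 6%N j3) _.
Qed.

Lemma is_PhiP (C : 'M[F]_(6, 3)) (W : flag F 6 6) :
  is_Phi C W <-> symplectic W /\ forall j, (j <= 3)%N -> W j = span_cols C j.
Proof.
split=> [h|[sW h] j j3].
  by split=> [|j /h []//]; apply: symplectic_half => j /h [].
by split; [exact: h | apply: sW; exact: leq_trans j3 _].
Qed.

Lemma span_cols_lsubmx n (D : 'M[F]_(n, 3 + 3)) j : (j <= 3)%N ->
  span_cols (lsubmx D) j = span_cols D j.
Proof.
move=> j3; apply/eqP; rewrite eqEsubv; apply/andP; split.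
  apply/span_cols_subP => i ij; have -> : col i (lsubmx D) = col (lshift 3 i) D.
    by apply/colP => x; rewrite !mxE.
  exact: mem_col_span.
apply/span_cols_subP => i ij; have i3 : (i < 3)%N by apply: leq_trans j3.
have -> : col i D = col (Ordinal i3) (lsubmx D).
  by apply/colP => x; rewrite !mxE; congr (D _ _); apply: val_inj.
exact: mem_col_span.
Qed.

Lemma rank_lsubmx n (D : 'M[F]_(n, 3 + 3)) : \rank D = 6 -> \rank (lsubmx D) = 3.
Proof.
move=> rD; apply/rank_injP => a Da.
have /((rank_injP D).1 rD) : D *m col_mx a 0 = 0.
  by rewrite -[D]hsubmxK mul_row_col Da mulmx0 addr0.
by rewrite -[RHS]col_mx0 => /eq_col_mx[].
Qed.

Lemma trunc_ex (W : flag F 6 6) : exists W3 : flag F 6 3,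
  forall j, (j <= 3)%N -> W j = W3 j.
Proof.
have [C rC] := flag_represented W; have r3 := rank_lsubmx (represents_rank rC).
exists (flag_of r3) => j j3; rewrite (represents_flag_of r3) // span_cols_lsubmx //.
by rewrite rC // (leq_trans j3).
Qed.

Definition trunc (W : flag F 6 6) : flag F 6 3 := projT1 (cid (trunc_ex W)).

Lemma truncE W j : (j <= 3)%N -> trunc W j = W j.
Proof. by move=> j3; rewrite /trunc; case: cid => W3 /= h; rewrite h. Qed.

Lemma represents_lsubmx (D : 'M[F]_(6, 3 + 3)) (W : flag F 6 6) :
  represents D W -> represents (lsubmx D) (trunc W).
Proof.
by move=> h j j3; rewrite truncE // span_cols_lsubmx // h // (leq_trans j3).
Qed.

Lemma trunc_inj W W' : symplectic W -> symplectic W' -> trunc W = trunc W' -> W = W'.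
Proof.
move=> sW sW' e.
have low j : (j <= 3)%N -> W j = W' j by move=> j3; rewrite -!truncE // e.
apply: flag_eqP => j j6; have [j3|j3] := leqP j 3; first exact: low.
have j3' : (6 - j <= 3)%N by exact: leq_trans (leq_sub2l 6%N j3) _.
have := sW (6 - j)%N (leq_subr _ _); have := sW' (6 - j)%N (leq_subr _ _).
rewrite subKn // -low // => h' h; apply/vspaceP => w.
by apply/idP/idP => [/h/h'|/h'/h].
Qed.

Definition isotropic (C : 'M[F]_(6, 3)) : Prop := C^T *m Jmx *m C = 0.

Definition Phi_set (S : set 'M[F]_(6, 3)) : set (flag6 F) :=
  [set W | exists2 C, S C & is_Phi C W].

Lemma Phi_setP (S : set 'M[F]_(6, 3)) (W : flag F 6 6) :
  Phi_set S W <-> symplectic W /\ flag_set S (trunc W).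
Proof.
split=> [[C SC /is_PhiP[sW h]]|[sW [C SC h]]].
  by split=> //; exists C => // j j3; rewrite truncE // h.
by exists C => //; apply/is_PhiP; split=> // j j3; rewrite -truncE // h.
Qed.

(** With columns numbered from 0, column [i] lies in W_(i+1), and column [l] lies in W_(5-i) exactly
    if i + l <= 4. Hence the flag is symplectic if and only if the Gram matrix vanishes strictly
    above the antidiagonal. *)
Lemma closed_symplectic : closed (symplectic : set (flag6 F)).
Proof.
apply: (@closed_flag _ _ _ _ [set f | exists i l : 'I_6,
    (i + l <= 4)%N /\ f = fun C => (C^T *m Jmx *m C) i l]).
  move=> _ [i [l [_ ->]]].
  have pm : polymap (fun C : 'M[F]_6 => C^T *m Jmx *m C).
    apply: polymapM; last exact: polymap_id.
    by apply: polymapM; [apply: polymap_tr; exact: polymap_id|exact: polymap_const].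
  exact: pm.
move=> W C rC; split=> [sW _ [i [l [il ->]]]|h j j6].
  have := sW i.+1 (ltn_ord i) => /(_ (col l C))[/(_ _)h _].
  have cl : col l C \in W (6 - i.+1)%N.
    apply: represents_col rC _; rewrite leq_subr andbT ltn_subRL.
    by rewrite addSn ltnS (leq_ltn_trans il).
  have ci : col i C \in W i.+1 by apply: represents_col rC _; rewrite ltnSn ltn_ord.
  have := h cl _ ci; by rewrite pairing_col.
apply: is_perp_of; last by rewrite !flag_dim ?leq_subr // subnK.
move=> v w; rewrite !rC ?leq_subr // => /mem_span_cols[a [-> a0]] /mem_span_cols[b [-> b0]].
rewrite pairing_mul big1 // => i _; rewrite big1 // => l _.
have [ij|/a0 ->] := ltnP i j; last by rewrite !mul0r.
have [lj|/b0 ->] := ltnP l (6 - j); last by rewrite mulr0.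
rewrite (h (fun C => (C^T *m Jmx *m C) i l)) ?mulr0 ?mul0r //; exists i, l; split=> //.
have : (i.+1 + l.+1 <= j + (6 - j))%N by exact: leq_add.
by rewrite subnKC // addSn addnS !ltnS.
Qed.

Lemma closed_trunc (D : set (flag_variety F 6 3)) : closed D ->
  closed ([set W : flag F 6 6 | D (trunc W)] : set (flag6 F)).
Proof.
move=> cD; rewrite -openC.
have [V oV hV] := open_flag_preimage (closed_openC cD).
have pm : polymap (fun C : 'M[F]_(6, 3 + 3) => lsubmx C).
  move=> i j; apply: (@polyfun_ext _ _ _ (fun C => C i (lshift 3 j))).
    by move=> C; rewrite mxE.
  exact: polyfun_entry.
apply: open_flagP => W C rC DW.
have VC : V (lsubmx (C : 'M_(6, 3 + 3))) by apply/(hV _ _ (represents_lsubmx rC)).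
have /open_affineP/(_ C VC) [f [pf fC hf]] := open_polymap pm oV.
exists f; split=> // C' W' rC' /hf; rewrite /preimage /= => VC'.
exact: (hV _ _ (represents_lsubmx rC')).1 VC'.
Qed.

Lemma closed_Phi_set (S : set 'M[F]_(6, 3)) (D : set (flag_variety F 6 3)) :
  closed D -> (forall W, symplectic W -> D (trunc W) <-> flag_set S (trunc W)) ->
  closed (Phi_set S).
Proof.
move=> cD h.
have -> : Phi_set S = (symplectic : set (flag6 F)) `&` [set W : flag F 6 6 | D (trunc W)].
  apply/seteqP; split=> W; first by move=> /Phi_setP[sW fW]; split=> //; exact/(h W sW).
  by move=> [sW DW]; apply/(Phi_setP S W); split=> //; apply/h.
apply: closedI; [exact: closed_symplectic | exact: closed_trunc].
Qed.

Section Extension.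
Variable f : 'I_3 -> 'I_6.

Definition colrev n (A : 'M[F]_(n, 3)) : 'M[F]_(n, 3) := \matrix_(i, j) A i (rev_ord j).

(* The added columns [d_1, d_2, d_3] satisfy [<c_i, d_j> = 0] for [i + j <> 4],
   so that appending them to an isotropic matrix gives a symplectic flag. *)
Definition sympl_ext (D : 'M[F]_(6, 3)) : 'M[F]_(6, 3 + 3) :=
  row_mx D (colrev (- Jmx *m (rowsub f 1%:M)^T *m (\adj (rowsub f D))^T)).

Lemma polymap_sympl_ext : polymap sympl_ext.
Proof.
apply: polymap_row_mx; first exact: polymap_id.
have pm : polymap (fun D : 'M[F]_(6, 3) =>
    - Jmx *m (rowsub f 1%:M)^T *m (\adj (rowsub f D))^T).
  apply: polymapM; first exact: polymap_const.
  by apply/polymap_tr/polymap_adj/polymap_mxsub; exact: polymap_id.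
by move=> i j; apply: polyfun_ext (pm i (rev_ord j)) => A; rewrite [RHS]mxE.
Qed.

(** [- Jmx] cancels [Jmx], and the transposed selection of rows turns [D^T] into the transpose of
    [rowsub f D]. The adjugate takes the place of the inverse to keep the entries polynomial, at the
    price of the determinant as a factor. *)
Lemma sympl_ext_gram (D : 'M[F]_(6, 3)) :
  D^T *m Jmx *m colrev (- Jmx *m (rowsub f 1%:M)^T *m (\adj (rowsub f D))^T) =
  colrev (\det (rowsub f D))%:M.
Proof.
have colrevM m (A : 'M[F]_(m, 6)) (B : 'M[F]_(6, 3)) : A *m colrev B = colrev (A *m B).
  by apply/matrixP => i j; rewrite !mxE; apply: eq_bigr => x _; rewrite mxE.
rewrite colrevM; congr colrev.
rewrite !mulmxA -(mulmxA D^T) JmxN mulmx1 -trmx_mul -rowsubE -trmx_mul.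
by rewrite mul_adj_mx tr_scalar_mx.
Qed.

Lemma sympl_ext_rank (D : 'M[F]_(6, 3)) : isotropic D ->
  rowsub f D \in unitmx -> \rank (sympl_ext D) = 6.
Proof.
move=> iD; rewrite unitmxE unitfE => uD.
apply/rank_injP => a; rewrite -[a]vsubmxK mul_row_col.
set a1 := usubmx a; set a2 := dsubmx a => h.
have a20 : a2 = 0.
  have := congr1 (mulmx (D^T *m Jmx)) h; rewrite mulmxDr mulmx0 !mulmxA iD mul0mx add0r.
  rewrite sympl_ext_gram => /colP e; apply/colP => i; have := e (rev_ord i).
  rewrite !mxE (bigD1 i) //= big1 => [|j nj].
    by rewrite addr0 !mxE eqxx mulr1n => /eqP; rewrite mulf_eq0 (negPf uD) => /eqP.
  by rewrite !mxE (inj_eq rev_ord_inj) eq_sym (negPf nj) mul0r.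
move: h; rewrite a20 mulmx0 addr0 => Da.
have -> : a1 = 0.
  have : rowsub f D *m a1 = 0 by rewrite rowsubE -mulmxA Da mulmx0.
  move=> e; rewrite -[a1]mul1mx -(@mulVmx _ _ (rowsub f D)) ?unitmxE ?unitfE //.
  by rewrite -mulmxA e mulmx0.
by rewrite col_mx0.
Qed.

(** Independence of the added columns makes the adjugate invertible. If the minor were zero, adj X X
    = 0 would give X = 0 and hence a zero adjugate. *)
Lemma sympl_ext_unit (D : 'M[F]_(6, 3)) :
  \rank (sympl_ext D) = 6 -> rowsub f D \in unitmx.
Proof.
move=> r; have inj := (rank_injP (sympl_ext D)).1 r.
have uadj : \adj (rowsub f D) \in unitmx.
  rewrite -unitmx_tr -row_free_unit /row_free; apply/eqP/rank_injP => a ha.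
  have /inj : sympl_ext D *m col_mx 0 (\col_i a (rev_ord i) 0) = 0.
    rewrite mul_row_col mulmx0 add0r.
    have <- : - Jmx *m (rowsub f 1%:M)^T *m (\adj (rowsub f D))^T *m a = 0.
      by rewrite -mulmxA ha mulmx0.
    apply/matrixP => i j; rewrite !mxE [RHS](reindex_inj rev_ord_inj) /=.
    by apply: eq_bigr => x _; rewrite !mxE (ord1 j).
  rewrite -[RHS]col_mx0 => /eq_col_mx[_ /colP e]; apply/colP => i.
  by have := e (rev_ord i); rewrite !mxE rev_ordK.
rewrite unitmxE unitfE; apply: contraL uadj => /eqP d0.
apply/negP => u; have := mul_adj_mx (rowsub f D); rewrite d0 => e0.
have D0 : rowsub f D = 0.
  rewrite -[LHS]mul1mx -(mulVmx u) -mulmxA e0.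
  by rewrite -scalemx1 scale0r mulmx0.
move: u; rewrite D0; have -> : \adj (0 : 'M[F]_3) = 0.
  apply/matrixP => i j; rewrite !mxE /cofactor (_ : row' _ _ = 0) ?det0 ?mulr0 //.
  by apply/matrixP => x y; rewrite !mxE.
by rewrite unitmxE det0 unitr0.
Qed.

End Extension.

(** The matrices [b] and 1 represent the same flag, so the transition matrix from [b] to 1, which is
    the inverse, is upper triangular. *)
Lemma uptri_invmx k (b : 'M[F]_k) : uptri b -> b \in unitmx -> uptri (invmx b).
Proof.
move=> ub ib; have r1 := represents_flag_of (mxrank1 F k).
have rb := uptri_represents r1 ub ib; rewrite mul1mx in rb.
have [b' [e ub' _]] := represents_uptri rb r1.
by rewrite (_ : invmx b = b') // -[b']mul1mx -(mulVmx ib) -mulmxA -e mulmx1.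
Qed.

Lemma sympl_ext_uptri f (D : 'M[F]_(6, 3)) (b : 'M_3) :
  \rank (sympl_ext f D) = 6 -> uptri b -> b \in unitmx ->
  exists2 b', sympl_ext f (D *m b) = sympl_ext f D *m b' & uptri b' /\ b' \in unitmx.
Proof.
move=> /sympl_ext_unit uD ub ib; have uib := uptri_invmx ub ib.
(* From adj(X b) = det b b^-1 adj X: transposition and reversal of the columns turn b^-1 into its
   reflection in the antidiagonal, again upper triangular. *)
pose b2 : 'M[F]_3 := \matrix_(i, j) (\det b * invmx b (rev_ord j) (rev_ord i)).
exists (block_mx b 0 0 b2).
  rewrite /sympl_ext mul_row_block !mulmx0 add0r addr0; congr row_mx.
  have -> : rowsub f (D *m b) = rowsub f D *m b by rewrite rowsubE mulmxA -rowsubE.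
  set X := rowsub f D in uD *.
  have -> : \adj (X *m b) = \det b *: (invmx b *m \adj X).
    have uXb : X *m b \in unitmx by rewrite unitmx_mul uD.
    rewrite -[LHS](mulmxK uXb) -[RHS](mulmxK uXb); congr (_ *m _).
    rewrite mul_adj_mx -scalemxAl -mulmxA (mulmxA _ X) mul_adj_mx.
    by rewrite mul_scalar_mx -scalemxAr (mulVmx ib) scalerA det_mulmx mulrC scalemx1.
  have -> : (\det b *: (invmx b *m \adj X))^T = (\adj X)^T *m (\det b *: (invmx b)^T).
    by rewrite linearZ /= trmx_mul -scalemxAr.
  rewrite mulmxA; set Y := _ *m (\adj X)^T.
  apply/matrixP => i j; rewrite !mxE (reindex_inj rev_ord_inj) /=.
  by apply: eq_bigr => x _; rewrite !mxE.
split; last first.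
  rewrite unitmxE det_ublock unitrM -!unitmxE ib /=.
  pose b3 : 'M[F]_3 := \matrix_(i, j) ((\det b)^-1 * b (rev_ord j) (rev_ord i)).
  suff /mulmx1_unit[] : b2 *m b3 = 1%:M by [].
  apply/matrixP => i j; have := congr1 (fun M : 'M_3 => M (rev_ord j) (rev_ord i)) (mulmxV ib).
  rewrite !mxE (inj_eq rev_ord_inj) eq_sym => <-; rewrite [RHS](reindex_inj rev_ord_inj) /=.
  have db : \det b != 0 by rewrite -unitfE -unitmxE.
  by apply: eq_bigr => x _; rewrite !mxE mulrACA mulfV // mul1r mulrC.
move=> i j; rewrite -[i]splitK -[j]splitK.
case: (fintype.split i) => i'; case: (fintype.split j) => j' /=.
- by rewrite block_mxEul => /ub.
- by rewrite block_mxEur mxE.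
- by rewrite block_mxEdl mxE.
- rewrite block_mxEdr mxE ltn_add2l => ji; rewrite uib ?mulr0 //=.
  by apply: ltn_sub2l => //; exact: leq_ltn_trans ji (ltn_ord i').
Qed.

Lemma lsubmx_mul_ublock n m1 m2 (D : 'M[F]_(n, m1 + m2)) (b : 'M_(m1 + m2)) :
  dlsubmx b = 0 -> lsubmx (D *m b) = lsubmx D *m ulsubmx b.
Proof.
move=> b0; rewrite -{1}[D]hsubmxK -{1}[b]submxK b0 mul_row_block mulmx0 addr0.
by rewrite row_mxKl.
Qed.

Lemma ulsubmx_unit m1 m2 (b : 'M[F]_(m1 + m2)) :
  dlsubmx b = 0 -> b \in unitmx -> ulsubmx b \in unitmx.
Proof.
by move=> b0; rewrite -{1}[b]submxK b0 unitmxE det_ublock unitrM -unitmxE => /andP[].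
Qed.

Lemma antidiag_block (d : F) (X : 'M[F]_3) (i l : 'I_(3 + 3)) : (i + l <= 4)%N ->
  block_mx 0 (colrev d%:M) (- (colrev d%:M)^T) X i l = 0.
Proof.
rewrite -[i]splitK -[l]splitK.
case: (fintype.split i) => i'; case: (fintype.split l) => l' /= il.
- by rewrite block_mxEul mxE.
- rewrite block_mxEur !mxE; case: eqP => // e; move: il; rewrite e /=.
  by case: l' {e} => -[|[|[|]]].
- rewrite block_mxEdl !mxE; case: eqP => [e|]; last by rewrite oppr0.
  by move: il; rewrite e /=; case: i' {e} => -[|[|[|]]].
- by move: il; rewrite addnACA; case: (i' + l')%N.
Qed.

(** One direction forgets the last three columns; the other appends those of [sympl_ext f], with [f]
    depending on the point. All geometry of symplectic flags is thereby transferred to 6 x 3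
    matrices. *)
Lemma trunc_isomorphic (S : set 'M[F]_(6, 3)) :
  (forall C, S C -> isotropic C) ->
  isomorphic (subvar (Phi_set S)) (subvar (flag_set S)).
Proof.
move=> iS; apply: (@isomorphic_flag _ _ _ _ _ _ _ (fun W W3 => trunc W = W3)).
- apply: polynomially_related_flag => W C WS rC.
  exists (fun D : 'M_(6, 3 + 3) => lsubmx D); split.
  + move=> i j; apply: (@polyfun_ext _ _ _ (fun C => C i (lshift 3 j))).
      by move=> D; rewrite mxE.
    exact: polyfun_entry.
  + exact: rank_lsubmx (represents_rank rC).
  + move=> D b rD rD' ub ib.
    have b0 : dlsubmx (b : 'M_(3 + 3)) = 0.
      apply/matrixP => i j; rewrite !mxE ub //=.
      by rewrite (leq_trans (ltn_ord j)) // leq_addr.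
    exists (ulsubmx (b : 'M_(3 + 3))); first exact: lsubmx_mul_ublock.
    by split; [move=> i j ij; rewrite !mxE ub|exact: ulsubmx_unit].
  + move=> W' D /Phi_setP[_ SW'] rD _; exists (trunc W'); last by [].
    exact: represents_lsubmx.
- apply: polynomially_related_flag => W3 C [C' SC' rC'] rC.
  have isoD W' D : flag_set S W' -> represents D W' -> isotropic D.
    move=> [D' SD' rD'] rD; have [b [-> _ _]] := represents_uptri rD' rD.
    by rewrite /isotropic trmx_mul -!mulmxA (mulmxA D'^T) (mulmxA (D'^T *m _)) (iS _ SD') mul0mx
      mulmx0.
  have /eqP/full_rankP[f df] := represents_rank rC.
  exists (sympl_ext f); split.
  + exact: polymap_sympl_ext.
  + by apply: sympl_ext_rank; [apply: isoD rC; exists C'|rewrite unitmxE unitfE].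
  + by move=> D b _ rD ub ib; exact: sympl_ext_uptri.
  + move=> W' D SW' rD rE; have rW := represents_flag_of rE.
    exists (flag_of rE) => //.
    have tr : trunc (flag_of rE) = W'.
      apply: represents_inj rD; have := represents_lsubmx rW.
      by rewrite /sympl_ext row_mxKl.
    split=> //; apply/Phi_setP; rewrite tr; split=> // {tr}.
    move=> j j6; apply: is_perp_of; last by rewrite !flag_dim ?leq_subr // subnK.
    move=> v w; rewrite !rW ?leq_subr // => /mem_span_cols[a [-> a0]] /mem_span_cols[b [-> b0]].
    rewrite pairing_mul big1 // => i _; rewrite big1 // => l _.
    have [ij|/a0 ->] := ltnP i j; last by rewrite !mul0r.
    have [lj|/b0 ->] := ltnP l (6 - j); last by rewrite mulr0.
    have il : (i + l <= 4)%N.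
      have : (i.+1 + l.+1 <= j + (6 - j))%N by exact: leq_add.
      by rewrite subnKC // addSn addnS !ltnS.
    suff -> : ((sympl_ext f D)^T *m Jmx *m sympl_ext f D) i l = 0 by rewrite mulr0 mul0r.
    have DD : D^T *m Jmx *m D = 0 by exact: (isoD W').
    have gr := sympl_ext_gram f D; move: gr; set X := colrev _ => gr.
    have gr' : X^T *m Jmx *m D = - (colrev (\det (rowsub f D))%:M)^T.
      by rewrite -gr !trmx_mul trmxK trJmx mulNmx mulmxN opprK mulmxA.
    rewrite /sympl_ext -/X tr_row_mx mul_col_mx mul_col_row DD gr gr'.
    exact: antidiag_block il.
- by move=> W W3 W3' _ _ _ <- <-.
- by move=> W W' W3 /Phi_setP[sW _] /Phi_setP[sW' _] _ e e'; apply: trunc_inj => //; rewrite e.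
Qed.

Lemma irreducible_isomorphic (X Y : fspace F) : isomorphic X Y ->
  irreducible [set: Y] -> irreducible [set: X].
Proof.
move=> [f [g [fK gK _ [cg _]]]] iY.
have -> : [set: X] = g @` [set: Y].
  by apply/seteqP; split=> // x _; exists (f x).
exact: irreducible_image.
Qed.

End Symplectic.

(** * The Hermitian curve *)

Section Frobenius.
Variables (R : comNzRingType) (p : nat).
Hypothesis charRp : p \in [pchar R].

Let p_prime : prime p. Proof. by case/andP: charRp. Qed.

Lemma expr_addp (x y : R) : (x + y) ^+ p = x ^+ p + y ^+ p.
Proof. by apply: exprDn_pchar; rewrite pnatE. Qed.

Lemma exprNp (x : R) : (- x) ^+ p = - x ^+ p.
Proof.
by apply/eqP; rewrite -addr_eq0 -expr_addp addNr expr0n gtn_eqF ?prime_gt0.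
Qed.

End Frobenius.

Section HermitianCurve.
Variables (F : closedFieldType) (p : nat).
Hypothesis charFp : p \in [pchar F].

Let p_prime : prime p. Proof. by case/andP: charFp. Qed.
Let p_gt1 : (1 < p)%N. Proof. exact: prime_gt1. Qed.
Let p_gt0 : (0 < p)%N. Proof. exact: prime_gt0. Qed.

Lemma natrSp : p.+1%:R = 1 :> F.
Proof. by rewrite -add1n natrD (pcharf0 charFp) addr0. Qed.

Lemma closed_expr n (c : F) : (0 < n)%N -> exists y, y ^+ n = c.
Proof.
move=> n0; have /closed_rootP [y] : size ('X^n - c%:P) != 1%N.
  by rewrite size_XnsubC // eqSS -lt0n.
by rewrite /root !hornerE ?hornerXn subr_eq0 => /eqP; exists y.
Qed.

Local Notation eval2 r x y := (r : {poly {poly F}}).[y%:P].[x].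

(* The curve [x^p + x + y^(p+1) = 0], monic in the outer variable [y]. *)
Definition hcurve : {poly {poly F}} := 'X^(p.+1) + ('X^p + 'X)%:P.

Lemma eval2_hcurve x y : eval2 hcurve x y = x ^+ p + x + y ^+ p.+1.
Proof.
rewrite /hcurve hornerD hornerXn hornerC -polyC_exp hornerD hornerC hornerD.
by rewrite hornerXn hornerX addrC.
Qed.

Lemma size_hcurve : size hcurve = p.+2.
Proof.
rewrite /hcurve size_polyDl ?size_polyXn //.
by apply: leq_ltn_trans (size_polyC_leq1 _) _.
Qed.

Lemma hcurve_monic : hcurve \is monic.
Proof.
rewrite monicE /hcurve lead_coefDl ?lead_coefXn // size_polyXn.
by apply: leq_ltn_trans (size_polyC_leq1 _) _.
Qed.

(** In [F] the integer p + 1 equals 1, so X^(p+1) - c has derivative X^p, which is coprime to it for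
    nonzero c. *)
Lemma roots_uniq (c : F) : c != 0 ->
  exists s : seq F, [/\ uniq s, size s = p.+1 & forall y, y \in s -> y ^+ p.+1 = c].
Proof.
move=> c0; have [s hs] := closed_field_poly_normal ('X^(p.+1) - c%:P).
have m1 : lead_coef ('X^(p.+1) - c%:P : {poly F}) = 1.
  by apply/eqP; rewrite -monicE monicXnsubC.
rewrite m1 scale1r in hs; exists s; split.
- rewrite -separable_prod_XsubC -hs unlock derivB derivXn derivC subr0 /=.
  rewrite -scaler_nat natrSp scale1r coprimep_expr //.
  have := coprimep_XsubC ('X^(p.+1) - c%:P) 0; rewrite polyC0 subr0 => ->.
  by rewrite /root !hornerE expr0n /= sub0r oppr_eq0.
- by have := congr1 (fun q : {poly F} => size q) hs; rewrite size_XnsubC // size_prod_XsubC => -[].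
- move=> y ys; have : root ('X^(p.+1) - c%:P) y by rewrite hs root_prod_XsubC.
  by rewrite /root !hornerE ?hornerXn subr_eq0 => /eqP.
Qed.

Lemma poly_vanish (q : {poly F}) : (forall x, q.[x] = 0) -> q = 0.
Proof.
move=> h; apply/eqP; apply: contraT => /closed_nonrootP[x].
by rewrite /root h eqxx.
Qed.

(** If x^p + x is nonzero, the fibre over x has p + 1 points, too many for a nonzero polynomial of
    degree at most p in y. The degenerate fibres are absorbed by multiplying each coefficient with
    X^p + X. *)
Lemma curve_vanish (r : {poly {poly F}}) : (size r <= p.+1)%N ->
  (forall x y, x ^+ p + x + y ^+ p.+1 = 0 -> eval2 r x y = 0) -> r = 0.
Proof.
move=> sr van; apply/polyP => i; rewrite coef0.
have n0 : 'X^p + 'X != 0 :> {poly F}.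
  rewrite -size_poly_eq0 size_polyDl size_polyXn ?size_polyX //.
suff : r`_i * ('X^p + 'X) = 0.
  by move/eqP; rewrite mulf_eq0 (negPf n0) orbF => /eqP.
apply: poly_vanish => x; rewrite hornerM !hornerE ?hornerXn.
have [-> |c0] := eqVneq (x ^+ p + x) 0; first by rewrite mulr0.
have [s [us ss hs]] : exists s : seq F,
    [/\ uniq s, size s = p.+1 & forall y, y \in s -> y ^+ p.+1 = - (x ^+ p + x)].
  by apply: roots_uniq; rewrite oppr_eq0.
pose rx := map_poly (horner_eval x) r.
suff rx0 : rx = 0.
  by have := congr1 (fun q : {poly F} => q`_i) rx0; rewrite coef_map coef0 /= /horner_eval => ->;
    rewrite mul0r.
apply/eqP; apply: contraT => nrx.
have : (size s < size rx)%N.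
  apply: max_poly_roots => //; apply/allP => y ys; rewrite /root.
  have := van x y; rewrite hs // addrN => /(_ erefl) e.
  have := horner_map (horner_eval x) r y%:P.
  by rewrite /= /horner_eval hornerC e => ->.
by rewrite ss ltnNge (leq_trans (size_poly _ _)).
Qed.

(* Truncations of the power series [x(y)] solving the equation of the curve. *)
Fixpoint xi (n : nat) : {poly F} :=
  if n is m.+1 then - 'X^(p.+1) - xi m ^+ p else 0.

Lemma charFpX : p \in [pchar {poly F}].
Proof. by rewrite pchar_poly. Qed.

(** Additivity of the Frobenius makes the iteration converge fast: if [e] is the error of one step,
    the next one has error [- e ^+ p], so the order of vanishing is multiplied by p. *)
Lemma xi_error n : 'X^(p ^ n) %| xi n ^+ p + xi n + 'X^(p.+1).
Proof.
elim: n => [|n IH].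
  rewrite /= expr0n gtn_eqF // !add0r expn0 expr1 -['X]expr1 dvdp_exp2l //.
set e := _ + _ in IH.
have -> : xi n.+1 ^+ p + xi n.+1 + 'X^(p.+1) = - e ^+ p.
  have -> : xi n.+1 = xi n - e by rewrite /e /=; ring.
  by rewrite (expr_addp charFpX) (exprNp charFpX) /e; ring.
by rewrite dvdpNr expnSr exprM dvdp_exp2r.
Qed.

Lemma xi_order n : exists u : {poly F}, xi n.+1 = 'X^(p.+1) * u /\ u.[0] = -1.
Proof.
have [w hw] : exists w, xi n = 'X^(p.+1) * w.
  elim: n => [|n [w /= ->]]; first by exists 0; rewrite mulr0.
  exists (- 1 - 'X^(p.+1 * p.-1) * w ^+ p) => /=.
  rewrite mulrBr mulrN1 mulrA -exprD exprMn -exprM -mulnS prednK //.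
exists (- 1 - 'X^(p.+1 * p.-1) * w ^+ p); rewrite /= hw; split.
  by rewrite mulrBr mulrN1 mulrA -exprD exprMn -exprM -mulnS prednK.
rewrite !hornerE ?hornerXn expr0n muln_eq0 /= -subn1 subn_eq0 leqNgt p_gt1 /=.
by rewrite mul0r subr0.
Qed.

Lemma X_order (q : {poly F}) : q != 0 ->
  exists m s, q = 'X^m * s /\ s.[0] != 0.
Proof.
move=> q0; have [m [s]] := multiplicity_XsubC q 0.
by rewrite q0 /= polyC0 subr0 => rs ->; exists m, s; rewrite mulrC.
Qed.

Lemma X_dvd_mul (q1 q2 : {poly F}) v1 v2 : 'X^((v1 + v2).+1) %| q1 * q2 ->
  'X^(v1.+1) %| q1 \/ 'X^(v2.+1) %| q2.
Proof.
have [->|/X_order [m1 [s1 [-> n1]]]] := eqVneq q1 0; first by rewrite dvdp0; left.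
have [->|/X_order [m2 [s2 [-> n2]]]] := eqVneq q2 0; first by rewrite dvdp0; right.
have [l1|l1] := ltnP v1 m1; first by left; rewrite dvdp_mulr // dvdp_exp2l.
have [l2|l2] := ltnP v2 m2; first by right; rewrite dvdp_mulr // dvdp_exp2l.
move=> h; have : 'X^((m1 + m2).+1) %| 'X^m1 * s1 * ('X^m2 * s2).
  by apply: dvdp_trans h; rewrite dvdp_exp2l // ltnS leq_add.
rewrite mulrACA -exprD exprSr dvdp_mul2l ?expf_neq0 ?polyX_eq0 //.
rewrite -['X]subr0 dvdp_XsubCl /root hornerM mulf_eq0.
by rewrite (negPf n1) (negPf n2).
Qed.

(** Restriction to the truncated branch of the curve through the origin: the inner variable x
    becomes [xi n] and the outer variable y becomes ['X]. *)
Definition ev_xi n (r : {poly {poly F}}) : {poly F} :=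
  (map_poly (comp_poly (xi n)) r).['X].

Lemma ev_xiM n r1 r2 : ev_xi n (r1 * r2) = ev_xi n r1 * ev_xi n r2.
Proof. by rewrite /ev_xi rmorphM hornerM. Qed.

Lemma ev_xi_hcurve n : ev_xi n hcurve = xi n ^+ p + xi n + 'X^(p.+1).
Proof.
rewrite /ev_xi /hcurve rmorphD /= map_polyXn map_polyC /= !hornerE ?hornerXn addrC.
by rewrite rmorphD /= rmorphXn /= comp_polyX.
Qed.

(* The orders at [y = 0] of the terms [r_i(xi) y^i] are pairwise distinct
   modulo [p + 1], so that no cancellation occurs. *)
Lemma ev_xi_order (r : {poly {poly F}}) : r != 0 -> (size r <= p.+1)%N ->
  exists v, forall n, ~~ ('X^(v.+1) %| ev_xi n.+1 r).
Proof.
move=> r0 sr.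
have /choice [as_ has] (i : nat) : exists ms : nat * {poly F},
    r`_i != 0 -> r`_i = 'X^(ms.1) * ms.2 /\ ms.2.[0] != 0.
  have [->|/X_order [m [s h]]] := eqVneq r`_i 0; first by exists (0%N, 0).
  by exists (m, s).
pose ord (i : 'I_p.+1) := (p.+1 * (as_ i).1 + i)%N.
have [i0 ni0] : exists i0 : 'I_p.+1, r`_i0 != 0.
  have lt : ((size r).-1 < p.+1)%N by rewrite prednK // lt0n size_poly_eq0.
  by exists (Ordinal lt); rewrite /= -/(lead_coef r) lead_coef_eq0.
have [i1 ni1 min1] := @arg_minnP _ i0 (fun i : 'I_p.+1 => r`_i != 0) ord ni0.
exists (ord i1) => n; have [u [xiE u0]] := xi_order n.
apply: contraTN isT => /dvdpP [q qE]; apply/negP => _.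
have : (ev_xi n.+1 r)`_(ord i1) = 0.
  by rewrite qE coefMXn ltnSn.
have -> : ev_xi n.+1 r = \sum_(i < p.+1) (r`_i \Po xi n.+1) * 'X^i.
  rewrite /ev_xi (@horner_coef_wide _ p.+1); last exact: leq_trans (size_poly _ _) sr.
  by apply: eq_bigr => i _; rewrite coef_map.
have term (i : 'I_p.+1) : r`_i != 0 -> (r`_i \Po xi n.+1) * 'X^i =
    'X^(ord i) * (u ^+ (as_ i).1 * ((as_ i).2 \Po xi n.+1)).
  move=> ni; have [{1}-> _] := has i ni.
  by rewrite comp_polyM comp_Xn_poly xiE exprMn -exprM /ord exprD; ring.
rewrite coef_sum (bigD1 i1) //= big1 ?addr0; last first.
  move=> i ii1; have [->|ni] := eqVneq r`_i 0; first by rewrite comp_poly0 mul0r coef0.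
  rewrite term // mulrC coefMXn; case: ltnP => // le; move: ii1.
  have e : ord i1 = ord i by apply/eqP; rewrite eqn_leq le min1.
  have := congr1 (fun x => x %% p.+1)%N e.
  by rewrite /ord !(mulnC p.+1) !modnMDl !modn_small // => /val_inj ->; rewrite eqxx.
rewrite term // mulrC coefMXn ltnn subnn -horner_coef0 hornerM horner_exp u0 horner_comp.
rewrite xiE hornerM hornerXn expr0n mul0r => /eqP.
by rewrite mulf_eq0 expf_eq0 oppr_eq0 oner_eq0 andbF /= (negPf (has i1 ni1).2).
Qed.

(** Along the branch, nonzero [r1] and [r2] have orders at most [v1] and [v2] for every truncation,
    whereas a multiple of [hcurve] has order at least p^(n+1); n = v1 + v2 is already large
    enough. *)
Lemma hcurve_prime (r1 r2 k : {poly {poly F}}) :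
  (size r1 <= p.+1)%N -> (size r2 <= p.+1)%N -> r1 * r2 = k * hcurve ->
  r1 = 0 \/ r2 = 0.
Proof.
move=> s1 s2 e.
have [|n1] := eqVneq r1 0; first by left.
have [|n2] := eqVneq r2 0; first by right.
have [v1 h1] := ev_xi_order n1 s1; have [v2 h2] := ev_xi_order n2 s2.
pose n := (v1 + v2)%N.
have : 'X^((v1 + v2).+1) %| ev_xi n.+1 r1 * ev_xi n.+1 r2.
  rewrite -ev_xiM e ev_xiM dvdp_mull // ev_xi_hcurve.
  by apply: dvdp_trans (xi_error _); rewrite dvdp_exp2l // ltnW // ltn_expl.
by case/X_dvd_mul => h; [have := h1 n|have := h2 n]; rewrite h.
Qed.

(** Division by the monic [hcurve] leaves remainders of degree at most p in y, the range in which
    vanishing on the curve means vanishing identically. *)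
Lemma curve_prime (P Q : {poly {poly F}}) :
  (forall x y, x ^+ p + x + y ^+ p.+1 = 0 -> eval2 P x y * eval2 Q x y = 0) ->
  (forall x y, x ^+ p + x + y ^+ p.+1 = 0 -> eval2 P x y = 0) \/
  (forall x y, x ^+ p + x + y ^+ p.+1 = 0 -> eval2 Q x y = 0).
Proof.
have red (R : {poly {poly F}}) : exists k r, [/\ R = k * hcurve + r, (size r <= p.+1)%N &
    forall x y, x ^+ p + x + y ^+ p.+1 = 0 -> eval2 R x y = eval2 r x y].
  exists (Pdiv.Ring.rdivp R hcurve), (Pdiv.Ring.rmodp R hcurve).
  have e := Pdiv.RingMonic.rdivp_eq hcurve_monic R; split=> //.
    by rewrite -ltnS -size_hcurve Pdiv.Ring.ltn_rmodpN0 // monic_neq0 // hcurve_monic.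
  move=> x y h; rewrite {1}e hornerD hornerM hornerD hornerM.
  by rewrite -/(eval2 hcurve x y) eval2_hcurve h mulr0 add0r.
have [kP [rP [_ sP vP]]] := red P; have [kQ [rQ [_ sQ vQ]]] := red Q.
move=> h; have [k [r [e sr vr]]] := red (rP * rQ).
have r0 : r = 0.
  apply: curve_vanish => // x y xy; rewrite -vr // !hornerM -vP // -vQ //.
  exact: h.
move: e; rewrite r0 addr0 => /(hcurve_prime sP sQ) [z|z].
  by left=> x y xy; rewrite vP // z !horner0.
by right=> x y xy; rewrite vQ // z !horner0.
Qed.

Definition caff : set (affine F 2 1) :=
  [set c : 'M[F]_(2, 1) | c 0 0 ^+ p + c 0 0 + c 1 0 ^+ p.+1 = 0].

Lemma irreducible_caff : irreducible caff.
Proof.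
have rep (f : 'M[F]_(2, 1) -> F) : polyfun f -> exists r : {poly {poly F}},
    forall c, f c = eval2 r (c 0 0) (c 1 0).
  move=> [P hP].
  have /choice [Q hQ] (i : 'I_(2 * 1)) : exists q : {poly {poly F}},
      forall c : 'M[F]_(2, 1), mxvec c 0 i = eval2 q (c 0 0) (c 1 0).
    case/mxvec_indexP: i => i j; rewrite (ord1 j).
    case: (unliftP 0 i) => [i' ->|->].
      exists 'X => c; rewrite mxvecE hornerX hornerC (ord1 i').
      by congr (c _ 0); apply: val_inj.
    by exists 'X%:P => c; rewrite mxvecE hornerC hornerX.
  exists (mmap (fun a : F => a%:P%:P) Q P) => c.
  rewrite hP /peval mevalE /mmap !horner_sum; apply: eq_bigr => m _.
  rewrite !hornerCM; congr (_ * _).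
  rewrite /mmap1 !horner_prod; apply: eq_bigr => i _.
  by rewrite !horner_exp hQ.
apply/irreducible_openP; split.
  by exists (0 : 'M_(2, 1)); rewrite /caff /= !mxE !expr0n gtn_eqF // !addr0.
move=> U V /open_affineP oU /open_affineP oV [a [Ca /oU[f [pf fa sf]]]].
move=> [b [Cb /oV[g [pg gb sg]]]].
have [P hP] := rep f pf; have [Q hQ] := rep g pg.
apply: contrapT => no.
have [] := @curve_prime P Q.
- move=> x y xy; pose c : 'M[F]_(2, 1) := \col_(i < 2) [:: x; y]`_i.
  have [cx cy] : c 0 0 = x /\ c 1 0 = y by rewrite !mxE.
  rewrite -[x]cx -[y]cy -hP -hQ; apply: contrapT => /eqP; rewrite mulf_eq0 negb_or.
  move=> /andP[fc gc]; apply: no; exists c; split; first by rewrite /caff /= cx cy.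
  by split; [exact: sf|exact: sg].
- by move/(_ _ _ Ca); rewrite -hP => /eqP; rewrite (negPf fa).
- by move/(_ _ _ Cb); rewrite -hQ => /eqP; rewrite (negPf gb).
Qed.

(** The value of [pairing c (Fmap p c)] for a vector [c] with upper half [m]. *)
Definition herm (m : 'M[F]_(3, 1)) : F :=
  m 0 0 ^+ p * m 2%:R 0 + m 1 0 ^+ p.+1 + m 0 0 * m 2%:R 0 ^+ p.

Definition hcone : set (affine F 3 1) := [set m : 'M[F]_(3, 1) | m != 0 /\ herm m = 0].

(** On the cone the vanishing of the first and last coordinates forces the middle one to vanish, so
    the charts where one of them is nonzero cover it. Each chart is the image of nonzero scalars
    times the affine curve; the equation is symmetric in the two coordinates, hence [rev_ord] in the
    second chart. *)
Lemma irreducible_hcone : irreducible hcone.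
Proof.

pose L : set (affine F 1 1) := [set l : 'M[F]_(1, 1) | l 0 0 != 0].
have iL : irreducible L.
  have -> : L = setT `&` [set l : 'M[F]_(1, 1) | l 0 0 != 0] by rewrite setTI.
  apply: irreducible_openI.
  - exact: irreducible_affine.
  - by apply: (@open_polyfun _ _ _ (fun l : 'M_(1, 1) => l 0 0)); exact: polyfun_entry.
  - by exists (1%:M : 'M_(1, 1)); split=> //=; rewrite mxE oner_neq0.
have chart (s : 'I_3 -> 'I_3) (f := fun (l : 'M[F]_(1, 1)) (c : 'M[F]_(2, 1)) =>
      \col_(i < 3) (l 0 0 * [:: 1; c 1 0; c 0 0]`_(s i))) :
    irreducible [set (f l c : affine F 3 1) | l in L & c in caff].
  apply: irreducible_image2; [| | exact: iL | exact: irreducible_caff].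
  - move=> c U oU; apply: (open_polymap (h := fun l => f l c)) => //.
    apply: polymap_mx => i j; apply: polyfunM; first exact: polyfun_entry.
    exact: polyfun_const.
  - move=> l U oU; apply: (open_polymap (h := fun c => f l c)) => //.
    apply: polymap_mx => i j; apply: polyfunM; first exact: polyfun_const.
    by case: (s i) => -[|[|[|//]]] ? /=;
      [exact: polyfun_const|exact: polyfun_entry|exact: polyfun_entry].
have oU i : open [set m : affine F 3 1 | (m : 'M_(3, 1)) i 0 != 0].
  by apply: (@open_polyfun _ _ _ (fun m : 'M_(3, 1) => m i 0)); exact: polyfun_entry.
apply: (@irreducible_open2 (affine F 3 1) hcone [set m : 'M[F]_(3, 1) | m 0 0 != 0]
                               [set m : 'M[F]_(3, 1) | m 2%:R 0 != 0]) => //.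
- move=> m [nm hm]; apply: contrapT => /not_orP[/= /negP/negPn/eqP m0 /negP/negPn/eqP m2].
  move/eqP: nm; apply; apply/colP => i; rewrite mxE.
  move: hm; rewrite /herm m0 m2 mulr0 mul0r add0r addr0 => /eqP.
  rewrite expf_eq0 /= => /eqP m1.
  by case: i => -[|[|[|//]]] lti; [rewrite -[RHS]m0|rewrite -[RHS]m1|rewrite -[RHS]m2];
    congr (m _ 0); apply: val_inj.
- rewrite (_ : _ `&` _ = [set (\col_(i < 3) (l 0 0 * [:: 1; c 1 0; c 0 0]`_i) : affine F 3 1) |
      l in L & c in caff]); first exact: (chart id).
  apply/seteqP; split.
    move=> m [[nm hm] /= m0]; exists (m 0 0)%:M; first by rewrite /L /= mxE mulr1n.
    exists (\col_(i < 2) [:: m 2%:R 0 / m 0 0; m 1 0 / m 0 0]`_i).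
      rewrite /caff /= !mxE /=; move: hm; rewrite /herm => hm.
      have e : m 0 0 ^+ p.+1 != 0 by rewrite expf_neq0.
      apply: (mulIf e); rewrite mul0r -[RHS]hm !exprMn !exprVn !exprSr.
      have := expf_neq0 p m0; set a := _ ^+ p; set b := m 1 0 ^+ p; set c := _ ^+ p => a0.
      by field; rewrite m0 a0.
    apply/colP => i; rewrite !mxE /=.
    case: i => -[|[|[|//]]] lti /=; rewrite ?mulr1n ?mulr1 ?(mulrC (m 0 0)) ?divfK //;
      by congr (m _ 0); apply: val_inj.
  move=> _ [l l0 [c Cc <-]]; split; last by rewrite /= mxE /= mulr1.
  split; first by apply/eqP => /colP/(_ 0); rewrite !mxE /= mulr1; apply/eqP.
  rewrite /herm !mxE /= mulr1.
  transitivity (l 0 0 ^+ p.+1 * (c 0 0 ^+ p + c 0 0 + c 1 0 ^+ p.+1)).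
    by rewrite !exprMn !exprS; ring.
  by rewrite Cc mulr0.
- rewrite (_ : _ `&` _ = [set (\col_(i < 3) (l 0 0 * [:: 1; c 1 0;
  c 0 0]`_(rev_ord i)) : affine F 3 1) |
      l in L & c in caff]); first exact: (chart (@rev_ord 3)).
  apply/seteqP; split.
    move=> m [[nm hm] /= m0]; exists (m 2%:R 0)%:M; first by rewrite /L /= mxE mulr1n.
    exists (\col_(i < 2) [:: m 0 0 / m 2%:R 0; m 1 0 / m 2%:R 0]`_i).
      rewrite /caff /= !mxE /=; move: hm; rewrite /herm => hm.
      have e : m 2%:R 0 ^+ p.+1 != 0 by rewrite expf_neq0.
      apply: (mulIf e); rewrite mul0r -[RHS]hm !exprMn !exprVn !exprSr.
      have := expf_neq0 p m0; set a := _ ^+ p; set b := m 1 0 ^+ p; set c := _ ^+ p => a0.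
      by field; rewrite m0 a0.
    apply/colP => i; rewrite !mxE /=.
    case: i => -[|[|[|//]]] lti /=; rewrite ?mulr1n ?mulr1 ?(mulrC (m 2%:R 0)) ?divfK //;
      by congr (m _ 0); apply: val_inj.
  move=> _ [l l0 [c Cc <-]]; split; last by rewrite /= mxE /= mulr1.
  split; first by apply/eqP => /colP/(_ 2%:R); rewrite !mxE /= mulr1; apply/eqP.
  rewrite /herm !mxE /= mulr1.
  transitivity (l 0 0 ^+ p.+1 * (c 0 0 ^+ p + c 0 0 + c 1 0 ^+ p.+1)).
    by rewrite !exprMn !exprS; ring.
  by rewrite Cc mulr0.
(* The point (1, y, 1) with y^(p+1) = -2 lies in both charts. *)
- have [y hy] := @closed_expr p.+1 (- 1 - 1) isT.
  exists (\col_(i < 3) [:: 1; y; 1]`_i); split; last by rewrite /= !mxE /= oner_neq0.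
  split; first by apply/eqP => /colP/(_ 0); rewrite !mxE /=; apply/eqP; rewrite oner_neq0.
  by rewrite /herm !mxE /= hy !expr1n mul1r; ring.
Qed.

End HermitianCurve.

(** * Coordinates and the operators F and V *)

Section Coordinates.
Variable F : closedFieldType.
Implicit Types (v w : 'cV[F]_6).

Lemma coord6D v w k : coord6 (v + w) k = coord6 v k + coord6 w k.
Proof. by rewrite /coord6 mxE. Qed.

Lemma coord6Z c v k : coord6 (c *: v) k = c * coord6 v k.
Proof. by rewrite /coord6 mxE. Qed.

Lemma coord6N v k : coord6 (- v) k = - coord6 v k.
Proof. by rewrite /coord6 mxE. Qed.

Lemma coord60 k : coord6 (0 : 'cV[F]_6) k = 0.
Proof. by rewrite /coord6 mxE. Qed.

Lemma coord6e i k : (0 < k <= 6)%N -> coord6 (e i) k = (k == i)%:R :> F.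
Proof. by case: k => // k /= k6; rewrite /coord6 mxE inordK. Qed.

Lemma coord6P v w : (forall k, (0 < k <= 6)%N -> coord6 v k = coord6 w k) -> v = w.
Proof.
move=> h; apply/colP => i; have := h i.+1 (ltn_ord i).
by rewrite /coord6 /= inord_val.
Qed.

Lemma coord6P' v w :
  [/\ coord6 v 1 = coord6 w 1, coord6 v 2 = coord6 w 2 & coord6 v 3 = coord6 w 3] ->
  [/\ coord6 v 4 = coord6 w 4, coord6 v 5 = coord6 w 5 & coord6 v 6 = coord6 w 6] ->
  v = w.
Proof.
by move=> [? ? ?] [? ? ?]; apply: coord6P => -[|[|[|[|[|[|[|k]]]]]]].
Qed.

Lemma coord6Pe v w : coord6 v 1 = coord6 w 1 -> coord6 v 2 = coord6 w 2 ->
  coord6 v 3 = coord6 w 3 -> coord6 v 4 = coord6 w 4 -> coord6 v 5 = coord6 w 5 ->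
  coord6 v 6 = coord6 w 6 -> v = w.
Proof. by move=> *; apply: coord6P'. Qed.

Lemma pairing6 v w : pairing v w =
  coord6 v 1 * coord6 w 4 - coord6 v 4 * coord6 w 1 +
  (coord6 v 2 * coord6 w 5 - coord6 v 5 * coord6 w 2) +
  (coord6 v 3 * coord6 w 6 - coord6 v 6 * coord6 w 3).
Proof. by rewrite /pairing big_nat_recr //= big_nat_recr //= big_nat1. Qed.

Lemma coord6_usubmx k (C : 'M[F]_(3 + 3, k)) j (i : 'I_3) :
  coord6 (col j C) i.+1 = usubmx C i j.
Proof. by rewrite coord6l !mxE. Qed.

Lemma coord6_dsubmx k (C : 'M[F]_(3 + 3, k)) j (i : 'I_3) :
  coord6 (col j C) (3 + i.+1) = dsubmx C i j.
Proof. by rewrite coord6r !mxE. Qed.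

Lemma mx6P k (A B : 'M[F]_(6, k)) : (forall j, col j A = col j B) -> A = B.
Proof.
by move=> h; apply/matrixP => i j; have /colP/(_ i) := h j; rewrite !mxE.
Qed.

Lemma ord3P (P : 'I_3 -> Prop) : P 0 -> P 1 -> P 2%:R -> forall i, P i.
Proof.
move=> h0 h1 h2 [[|[|[|//]]] lti].
- by have -> : Ordinal lti = 0 by apply: val_inj.
- by have -> : Ordinal lti = 1 by apply: val_inj.
- by have -> : Ordinal lti = 2%:R by apply: val_inj.
Qed.

Lemma mul_cols3 n (C : 'M[F]_(n, 3)) (a : 'cV[F]_3) :
  C *m a = a 0 0 *: col 0 C + a 1 0 *: col 1 C + a 2%:R 0 *: col 2%:R C.
Proof.
apply/colP => i; rewrite !mxE !big_ord_recl big_ord0 addr0 !(mulrC (C i _)) addrA.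
by congr (_ + _ * _ + _ * _); rewrite ?mxE; congr (_ _ _); apply: val_inj.
Qed.

Definition vec3 (x y z : F) : 'cV[F]_3 := \col_(i < 3) [:: x; y; z]`_i.

Lemma vec3E x y z : ((vec3 x y z 0 0 = x) * (vec3 x y z 1 0 = y) * (vec3 x y z 2%:R 0 = z))%type.
Proof. by rewrite /vec3 !mxE. Qed.

Lemma vec3P (m : 'cV[F]_3) : m = vec3 (m 0 0) (m 1 0) (m 2%:R 0).
Proof. by apply/colP; apply: ord3P; rewrite vec3E. Qed.

Lemma rank3P n (C : 'M[F]_(n, 3)) : \rank C = 3 <->
  forall x y z, x *: col 0 C + y *: col 1 C + z *: col 2%:R C = 0 -> [/\ x = 0, y = 0 & z = 0].
Proof.
rewrite rank_injP; split=> [h x y z e|h a].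
  have /colP a0 : vec3 x y z = 0 by apply: h; rewrite mul_cols3 !vec3E.
  by move: (a0 0) (a0 1) (a0 2%:R); rewrite !vec3E !mxE.
by rewrite mul_cols3 => /h [z0 z1 z2]; apply/colP; apply: ord3P; rewrite mxE.
Qed.

Lemma uptri_cols n (C : 'M[F]_(n, 3)) (b : 'M_3) : uptri b ->
  [/\ col 0 (C *m b) = b 0 0 *: col 0 C,
      col 1 (C *m b) = b 0 1 *: col 0 C + b 1 1 *: col 1 C &
      col 2%:R (C *m b) = b 0 2%:R *: col 0 C + b 1 2%:R *: col 1 C + b 2%:R 2%:R *: col 2%:R C].
Proof.
move=> ub; have cE j : col j (C *m b) = C *m col j b by rewrite !colE mulmxA.
rewrite !cE !mul_cols3 !mxE (ub 1 0) // (ub 2%:R 0) // (ub 2%:R 1) //.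
by rewrite !scale0r !addr0.
Qed.

Lemma uptri_diag (b : 'M[F]_3) : uptri b -> b \in unitmx ->
  [/\ b 0 0 != 0, b 1 1 != 0 & b 2%:R 2%:R != 0].
Proof.
move=> ub; rewrite unitmxE unitfE -det_tr det_trig; last first.
  by apply/is_trig_mxP => i j ij; rewrite mxE ub.
rewrite !big_ord_recl big_ord0 mulr1 !mxE !mulf_eq0 !negb_or => /and3P[h0 h1 h2].
split=> //; first by rewrite (_ : 1 = lift ord0 ord0) //; apply: val_inj.
by rewrite (_ : 2%:R = lift ord0 (lift ord0 ord0)) //; apply: val_inj.
Qed.

Lemma isotropicP (C : 'M[F]_(6, 3)) :
  isotropic C <-> forall i j, pairing (col i C) (col j C) = 0.
Proof.
split=> [h i j|h]; first by rewrite pairing_col h mxE.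
by apply/matrixP => i j; rewrite -pairing_col h mxE.
Qed.

Lemma symplectic_isotropic (W : flag F 6 6) C : symplectic W ->
  represents C (trunc W) -> isotropic C.
Proof.
move=> sW rC; apply/isotropicP => i j.
have cW k : col k C \in W 3 by rewrite -truncE //; apply: represents_col rC _; rewrite ltn_ord.
exact: (sW 3 isT (col j C)).1 (cW j) _ (cW i).
Qed.

Lemma isotropic_mulmx (C : 'M[F]_(6, 3)) b : isotropic C -> isotropic (C *m b).
Proof.
rewrite /isotropic trmx_mul => h.
have -> : b^T *m C^T *m Jmx F *m (C *m b) = b^T *m (C^T *m Jmx F *m C) *m b.
  by rewrite !mulmxA.
by rewrite h mulmx0 mul0mx.
Qed.

Lemma pairing_W3 (W : flag F 6 6) v w : symplectic W -> v \in W 3 -> w \in W 3 ->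
  pairing v w = 0.
Proof. by move=> sW vW wW; exact: (sW 3 isT w).1 wW _ vW. Qed.

(* [v] lies in the Lagrangian subspace [<e_4, e_5, e_6>], on which [F] and [V]
   vanish. *)
Definition up0 v := [/\ coord6 v 1 = 0, coord6 v 2 = 0 & coord6 v 3 = 0].

Lemma up0Z c v : up0 v -> up0 (c *: v).
Proof. by case=> h1 h2 h3; split; rewrite coord6Z ?h1 ?h2 ?h3 mulr0. Qed.

Lemma up0D v w : up0 v -> up0 w -> up0 (v + w).
Proof. by case=> h1 h2 h3 [k1 k2 k3]; split; rewrite coord6D ?h1 ?h2 ?h3 ?k1 ?k2 ?k3 addr0. Qed.

(* The normal vector of the plane spanned by the lower halves. *)
Definition nrm v w : 'cV[F]_3 :=
  vec3 (coord6 v 5 * coord6 w 6 - coord6 v 6 * coord6 w 5)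
       (coord6 v 6 * coord6 w 4 - coord6 v 4 * coord6 w 6)
       (coord6 v 4 * coord6 w 5 - coord6 v 5 * coord6 w 4).

Lemma nrm_uptri a b d v w : nrm (a *: v) (b *: v + d *: w) = (a * d) *: nrm v w.
Proof.
apply/colP; apply: ord3P; rewrite /nrm [RHS]mxE !vec3E !coord6D !coord6Z; ring.
Qed.

(** The three identities are the components of x × (a × b) = (b·x) a - (a·x) b; they make x parallel
    to n. *)
Lemma perp_cross (a1 a2 a3 b1 b2 b3 x1 x2 x3 : F)
    (n := vec3 (a2 * b3 - a3 * b2) (a3 * b1 - a1 * b3) (a1 * b2 - a2 * b1)) :
  a1 * x1 + a2 * x2 + a3 * x3 = 0 -> b1 * x1 + b2 * x2 + b3 * x3 = 0 -> n != 0 ->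
  exists s, vec3 x1 x2 x3 = s *: n.
Proof.
move=> ha hb nn.
have e12 : x1 * n 1 0 - x2 * n 0 0 = 0.
  transitivity (a3 * (b1 * x1 + b2 * x2 + b3 * x3) - b3 * (a1 * x1 + a2 * x2 + a3 * x3)).
    by rewrite /n !vec3E; ring.
  by rewrite ha hb !mulr0 subr0.
have e23 : x2 * n 2%:R 0 - x3 * n 1 0 = 0.
  transitivity (a1 * (b1 * x1 + b2 * x2 + b3 * x3) - b1 * (a1 * x1 + a2 * x2 + a3 * x3)).
    by rewrite /n !vec3E; ring.
  by rewrite ha hb !mulr0 subr0.
have e31 : x3 * n 0 0 - x1 * n 2%:R 0 = 0.
  transitivity (a2 * (b1 * x1 + b2 * x2 + b3 * x3) - b2 * (a1 * x1 + a2 * x2 + a3 * x3)).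
    by rewrite /n !vec3E; ring.
  by rewrite ha hb !mulr0 subr0.
move/eqP: e12; rewrite subr_eq0 => /eqP e12.
move/eqP: e23; rewrite subr_eq0 => /eqP e23.
move/eqP: e31; rewrite subr_eq0 => /eqP e31.
have sol i s : n i 0 != 0 -> (forall j, vec3 x1 x2 x3 j 0 * n i 0 = s * n j 0 * n i 0) ->
    exists s, vec3 x1 x2 x3 = s *: n.
  by move=> ni h; exists s; apply/colP => j; rewrite [RHS]mxE; apply: (mulIf ni).
have [n0|n0] := eqVneq (n 0 0) 0; last first.
  apply: (sol 0 (x1 / n 0 0)) => //; apply: ord3P; rewrite !(vec3E x1 x2 x3).
  - by rewrite divfK.
  - by rewrite -e12 mulrAC divfK // mulrC.
  - by rewrite e31 mulrAC divfK.
have [n1|n1] := eqVneq (n 1 0) 0; last first.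
  apply: (sol 1 (x2 / n 1 0)) => //; apply: ord3P; rewrite !(vec3E x1 x2 x3).
  - by rewrite e12 mulrAC divfK.
  - by rewrite divfK.
  - by rewrite -e23 mulrAC divfK // mulrC.
have [n2|n2] := eqVneq (n 2%:R 0) 0; last first.
  apply: (sol 2%:R (x3 / n 2%:R 0)) => //; apply: ord3P; rewrite !(vec3E x1 x2 x3).
  - by rewrite -e31 mulrAC divfK // mulrC.
  - by rewrite e23 mulrAC divfK.
  - by rewrite divfK.
by case/eqP: nn; apply/colP; apply: ord3P; rewrite [RHS]mxE.
Qed.

Lemma nrm_neq0 (C : 'M[F]_(6, 3)) : \rank C = 3 -> up0 (col 0 C) -> up0 (col 1 C) ->
  nrm (col 0 C) (col 1 C) != 0.
Proof.
move=> /rank3P h [u1 u2 u3] [v1 v2 v3]; apply/eqP => /colP n0.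
move: (n0 0) (n0 1) (n0 2%:R); rewrite /nrm !vec3E !mxE => /eqP; rewrite subr_eq0 => /eqP e1.
move=> /eqP; rewrite subr_eq0 => /eqP e2 /eqP; rewrite subr_eq0 => /eqP e3.
set a := col 0 C in h u1 u2 u3 e1 e2 e3 *; set b := col 1 C in h v1 v2 v3 e1 e2 e3 *.
have z k (ck := (coord6 b k, coord6 a k)) : (3 < k <= 6)%N -> ck.1 *: a - ck.2 *: b = 0.
  move=> hk; apply: coord6P'; split; rewrite coord6D coord6N !coord6Z coord60 /ck /=
    ?u1 ?u2 ?u3 ?v1 ?v2 ?v3 ?mulr0 ?subr0 //;
  by case: k hk {ck} => [|[|[|[|[|[|[|k]]]]]]] //= _; apply/eqP;
    rewrite subr_eq0 mulrC ?e1 ?e2 ?e3 -?e1 -?e2 -?e3 mulrC.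
have zk k : (3 < k <= 6)%N -> coord6 a k = 0.
  move=> /z; rewrite -scaleNr => e; have [|_ /eqP + _] := h (coord6 b k) (- coord6 a k) 0.
    by rewrite scale0r addr0.
  by rewrite oppr_eq0 => /eqP.
have a0 : a = 0.
  by apply: coord6P'; split; rewrite coord60 // zk.
have [|/eqP] := h 1 0 0; first by rewrite a0 scaler0 !scale0r !addr0.
by rewrite oner_eq0.
Qed.

Lemma span_cols1 n k (C : 'M[F]_(n, k.+1)) : span_cols C 1 = <[col 0%R C]>%VS.
Proof. by rewrite (span_colsS C ord0) span_cols0 add0v; congr (<[col _ _]>%VS); apply: val_inj. Qed.

Lemma span_cols2 n k (C : 'M[F]_(n, k.+2)) :
  span_cols C 2 = (<[col 0%R C]> + <[col 1%R C]>)%VS.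
Proof.
rewrite (span_colsS C (lift ord0 ord0)) span_cols1.
by congr (_ + <[col _ _]>)%VS; apply: val_inj.
Qed.

Lemma span_cols3 n k (C : 'M[F]_(n, k.+3)) :
  span_cols C 3 = (<[col 0%R C]> + <[col 1%R C]> + <[col 2%:R%R C]>)%VS.
Proof.
rewrite (span_colsS C (lift ord0 (lift ord0 ord0))) span_cols2.
by congr (_ + <[col _ _]>)%VS; apply: val_inj.
Qed.

Lemma col_cols3 (c1 c2 c3 : 'cV[F]_6) : ((col 0 (cols3 c1 c2 c3) = c1) *
  (col 1 (cols3 c1 c2 c3) = c2) * (col 2%:R (cols3 c1 c2 c3) = c3))%type.
Proof.
rewrite /cols3; split; first split; apply/colP => i; rewrite mxE.
- have -> : (0 : 'I_3) = lshift 2 (0 : 'I_1) by apply: val_inj.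
  by rewrite (@row_mxEl _ 6 1 2).
- have -> : (1 : 'I_3) = rshift 1 (lshift 1 (0 : 'I_1)) by apply: val_inj.
  by rewrite (@row_mxEr _ 6 1 2) (@row_mxEl _ 6 1 1).
- have -> : (2%:R : 'I_3) = rshift 1 (rshift 1 (0 : 'I_1)) by apply: val_inj.
  by rewrite (@row_mxEr _ 6 1 2) (@row_mxEr _ 6 1 1).
Qed.

Lemma cols3P (C : 'M[F]_(6, 3)) : C = cols3 (col 0 C) (col 1 C) (col 2%:R C).
Proof. by apply: mx6P; apply: ord3P; rewrite col_cols3. Qed.

End Coordinates.

Ltac coords := rewrite !(coord6D, coord6Z, coord6N, coord60, coord6e) //=.

(** * The semilinear operators F and V *)

Section FrobeniusMaps.
Variables (F : closedFieldType) (p : nat).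
Hypothesis charFp : p \in [pchar F].
Implicit Types (v w : 'cV[F]_6).

Let p_prime : prime p. Proof. by case/andP: charFp. Qed.
Let p_gt0 : (0 < p)%N. Proof. exact: prime_gt0. Qed.

Lemma exprp_inj (x y : F) : x ^+ p = y ^+ p -> x = y.
Proof.
move=> e; apply/eqP; rewrite -subr_eq0.
have : (x - y) ^+ p = 0 by rewrite expr_addp // exprNp // e subrr.
by move/eqP; rewrite expf_eq0 => /andP[].
Qed.

Lemma frob_invK (x : F) : frob_inv p x ^+ p = x.
Proof.
have [y hy] := @closed_expr F p x p_gt0.
by rewrite /frob_inv; case: xgetP => [z _ //|/(_ y)].
Qed.

Lemma frob_inv_eq (x y : F) : y ^+ p = x -> frob_inv p x = y.
Proof. by move=> e; apply: exprp_inj; rewrite frob_invK. Qed.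

Lemma frob_inv0 : frob_inv p (0 : F) = 0.
Proof. by apply: frob_inv_eq; rewrite expr0n gtn_eqF. Qed.

Lemma coord6_Fmap v : ((coord6 (Fmap p v) 1 = 0) * (coord6 (Fmap p v) 2 = 0) *
  (coord6 (Fmap p v) 3 = 0) * (coord6 (Fmap p v) 4 = coord6 v 3 ^+ p) *
  (coord6 (Fmap p v) 5 = coord6 v 2 ^+ p) * (coord6 (Fmap p v) 6 = coord6 v 1 ^+ p))%type.
Proof.
by rewrite /Fmap !coord6D !coord6Z !coord6e //= !mulr0 !mulr1 !add0r !addr0.
Qed.

Lemma coord6_Vmap v : ((coord6 (Vmap p v) 1 = 0) * (coord6 (Vmap p v) 2 = 0) *
  (coord6 (Vmap p v) 3 = 0) * (coord6 (Vmap p v) 4 = - frob_inv p (coord6 v 3)) *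
  (coord6 (Vmap p v) 5 = - frob_inv p (coord6 v 2)) *
  (coord6 (Vmap p v) 6 = - frob_inv p (coord6 v 1)))%type.
Proof.
by rewrite /Vmap !coord6N !coord6D !coord6Z !coord6e //= !mulr0 !mulr1 !add0r !addr0 oppr0.
Qed.

Lemma Fmap_up0 v : up0 v -> Fmap p v = 0.
Proof.
case=> v1 v2 v3; apply: coord6P'; rewrite !coord6_Fmap !coord60 //.
by rewrite v1 v2 v3 expr0n gtn_eqF.
Qed.

Lemma Vmap_up0 v : up0 v -> Vmap p v = 0.
Proof.
case=> v1 v2 v3; apply: coord6P'; rewrite !coord6_Vmap !coord60 //.
by rewrite v1 v2 v3 frob_inv0 oppr0.
Qed.

Lemma up0_Fmap v : up0 (Fmap p v).
Proof. by split; rewrite coord6_Fmap. Qed.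

Lemma Fmap_eq0 v : Fmap p v = 0 -> up0 v.
Proof.
move=> e; have := coord6_Fmap v; rewrite e !coord60 => -[[[_ h3] h2] h1].
by split; apply/eqP; [move/eqP: h1|move/eqP: h2|move/eqP: h3];
  rewrite eq_sym expf_eq0 => /andP[].
Qed.

Lemma FmapZ c v : Fmap p (c *: v) = c ^+ p *: Fmap p v.
Proof. by rewrite /Fmap !coord6Z !exprMn !scalerDr !scalerA. Qed.

Lemma FmapD v w : Fmap p (v + w) = Fmap p v + Fmap p w.
Proof.
apply: coord6P'; rewrite !(coord6D (Fmap p v)) !coord6_Fmap ?addr0 //.
by rewrite !coord6D !expr_addp.
Qed.

Lemma pairing_Fmap v w : pairing (Fmap p v) w = pairing v (Vmap p w) ^+ p.
Proof.
rewrite !pairing6 !coord6_Fmap !coord6_Vmap !mul0r !mulr0 !sub0r !subr0.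
rewrite !(expr_addp charFp) !exprMn !(exprNp charFp) !frob_invK; ring.
Qed.

(* [F] and [V] are adjoint, so stability passes to orthogonal complements. *)
Lemma FlagFV_half (W : flag F 6 6) : symplectic W ->
  (forall j, (0 < j <= 3)%N -> forall v, v \in W j -> Fmap p v \in W j /\ Vmap p v \in W j) ->
  FlagFV F p W.
Proof.
move=> sW h3.
have h j : (j <= 3)%N -> forall v, v \in W j -> Fmap p v \in W j /\ Vmap p v \in W j.
  case: j => [_ v|j j3]; last exact: h3.
  have -> : W 0%N = 0%VS by apply/eqP; rewrite -dimv_eq0 flag_dim.
  rewrite memv0 => /eqP ->; have z : up0 (0 : 'cV[F]_6) by split; rewrite coord60.
  by rewrite Fmap_up0 // Vmap_up0 // mem0v.
have stab j : (j <= 6)%N -> forall v, v \in W j -> Fmap p v \in W j /\ Vmap p v \in W j.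
  move=> j6; have [/h //|j3] := leqP j 3.
  have j3' : (6 - j <= 3)%N by exact: leq_trans (leq_sub2l 6%N j3) _.
  have perp := sW (6 - j)%N (leq_subr _ _); rewrite subKn // in perp.
  move=> v vW; have vp := (perp v).1 vW.
  split; apply/perp => u uW; have [Fu Vu] := h _ j3' u uW.
    by rewrite pairingC pairing_Fmap pairingC vp // oppr0 expr0n gtn_eqF // oppr0.
  apply/eqP; have : pairing u (Vmap p v) ^+ p = 0 by rewrite -pairing_Fmap vp.
  by move/eqP; rewrite expf_eq0 => /andP[].
by move=> j j6; split; [exact: sW|move=> v /(stab j j6)[]|move=> v /(stab j j6)[]].
Qed.

Lemma Fmap_scale c v v' : coord6 v 1 = c * coord6 v' 1 -> coord6 v 2 = c * coord6 v' 2 ->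
  coord6 v 3 = c * coord6 v' 3 -> Fmap p v = c ^+ p *: Fmap p v'.
Proof.
by move=> h1 h2 h3; rewrite /Fmap h1 h2 h3 !exprMn !scalerDr !scalerA.
Qed.

Lemma Vmap_scale c v v' : coord6 v 1 = c * coord6 v' 1 -> coord6 v 2 = c * coord6 v' 2 ->
  coord6 v 3 = c * coord6 v' 3 -> Vmap p v = frob_inv p c *: Vmap p v'.
Proof.
move=> h1 h2 h3; rewrite /Vmap h1 h2 h3.
have fM (a b : F) : frob_inv p (a * b) = frob_inv p a * frob_inv p b.
  by apply: frob_inv_eq; rewrite exprMn !frob_invK.
by rewrite !fM scalerN !scalerDr !scalerA.
Qed.

Lemma hermZ c (m : 'cV[F]_3) : herm p (c *: m) = c ^+ p.+1 * herm p m.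
Proof. by rewrite /herm !mxE !exprMn !exprS; ring. Qed.

End FrobeniusMaps.

(** * The sets Y and Z *)

Section ComponentSets.
Variable F : closedFieldType.
Implicit Types (W : flag F 6 6) (C T : 'M[F]_(6, 3)).

Lemma uptri_ex n (C C' : 'M[F]_(n, 3)) a b d x y z :
  a != 0 -> d != 0 -> z != 0 -> col 0 C' = a *: col 0 C ->
  col 1 C' = b *: col 0 C + d *: col 1 C ->
  col 2%:R C' = x *: col 0 C + y *: col 1 C + z *: col 2%:R C ->
  exists t, [/\ C' = C *m t, uptri t & t \in unitmx].
Proof.
move=> a0 d0 z0 e0 e1 e2.
pose t : 'M[F]_3 := \matrix_(i, j) [:: vec3 a 0 0; vec3 b d 0; vec3 x y z]`_j i 0.
have ut : uptri t.
  by apply: ord3P; apply: ord3P => // _; rewrite mxE /= vec3E.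
have [c0 c1 c2] := uptri_cols C ut.
exists t; split=> //.
  apply/matrixP => i j.
  suff e : col j C' = col j (C *m t) by have /colP/(_ i) := e; rewrite !mxE.
  move: j; apply: ord3P; rewrite ?c0 ?c1 ?c2 ?e0 ?e1 ?e2 ![t _ _]mxE /= !vec3E //.
rewrite unitmxE unitfE -det_tr det_trig; last first.
  by apply/is_trig_mxP => i j ij; rewrite mxE ut.
rewrite !big_ord_recl big_ord0 mulr1; do ![rewrite ?mxE /=].
by rewrite !mulf_neq0.
Qed.

Lemma mem_W1 W C v : represents C (trunc W) ->
  v \in W 1 <-> exists x, v = x *: col 0 C.
Proof.
move=> rC; rewrite -truncE // rC // span_cols1; split=> [/vlineP//|[x ->]].
by rewrite memvZ ?memv_line.
Qed.

Lemma mem_W2 W C v : represents C (trunc W) ->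
  v \in W 2 <-> exists x y, v = x *: col 0 C + y *: col 1 C.
Proof.
move=> rC; rewrite -truncE // rC // span_cols2; split.
  by move=> /memv_addP[_ /vlineP[x ->] [_ /vlineP[y ->] ->]]; exists x, y.
by move=> [x [y ->]]; rewrite memv_add // memvZ ?memv_line.
Qed.

Lemma mem_W3 W C v : represents C (trunc W) ->
  v \in W 3 <-> exists x y z, v = x *: col 0 C + y *: col 1 C + z *: col 2%:R C.
Proof.
move=> rC; rewrite -truncE // rC // span_cols3; split.
  move=> /memv_addP[_ /memv_addP[_ /vlineP[x ->] [_ /vlineP[y ->] ->]] [_ /vlineP[z ->] ->]].
  by exists x, y, z.
by move=> [x [y [z ->]]]; rewrite !memv_add // memvZ ?memv_line.
Qed.

Lemma is_Phi_represents W C : symplectic W -> represents C (trunc W) -> is_Phi C W.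
Proof. by move=> sW rC; apply/is_PhiP; split=> // j j3; rewrite -truncE // rC. Qed.

Lemma is_Phi_symplectic W C : is_Phi C W -> symplectic W /\ represents C (trunc W).
Proof. by move=> /is_PhiP[sW h]; split=> // j j3; rewrite truncE // h. Qed.

Lemma col_in_W3 W C j : represents C (trunc W) -> col j C \in W 3.
Proof. by move=> rC; rewrite -truncE //; apply: represents_col rC _; rewrite ltn_ord. Qed.

Definition SY : set 'M[F]_(6, 3) := [set C | \rank C = 3 /\ forall j, up0 (col j C)].

Lemma SY_inv : uptri_invariant SY.
Proof.
move=> C b [rC uC] ub ib; split; first exact: rank_uptri.
have [c0 c1 c2] := uptri_cols C ub.
by apply: ord3P; rewrite ?c0 ?c1 ?c2; repeat first [exact: up0Z (uC _) | apply: up0D].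
Qed.

Lemma up0_col k (C : 'M[F]_(3 + 3, k)) j : up0 (col j C) <-> forall i, usubmx C i j = 0.
Proof.
have e (i : 'I_3) := coord6_usubmx C j i.
split=> [[h1 h2 h3]|h]; last by split; [rewrite (e 0)|rewrite (e 1)|rewrite (e 2%:R)].
by apply: ord3P; rewrite -e.
Qed.

Lemma lower_unit (G : 'M[F]_3) : \rank (lower G) = 3 -> G \in unitmx.
Proof.
move=> rG; rewrite -row_free_unit /row_free; apply/eqP/rank_injP => a ha.
apply: (rank_injP (lower G)).1 rG _ _.
by rewrite /lower (@mul_col_mx _ 3 3) ha mul0mx (@col_mx0 _ 3 3).
Qed.

Lemma YsetP W : Yset F W <-> Phi_set SY W.
Proof.
split=> [[G [uG hP]]|[C [rC uC] hP]].
  exists (lower G) => //; have [_ /represents_rank rk] := is_Phi_symplectic hP.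
  by split=> // j; apply/up0_col => i; rewrite /lower col_mxKu mxE.
have CE : C = lower (dsubmx (C : 'M_(3 + 3, 3))).
  have z : usubmx (C : 'M_(3 + 3, 3)) = 0.
    by apply/matrixP => i j; rewrite [RHS]mxE; exact: (up0_col (C : 'M_(3 + 3, 3)) j).1 (uC j) i.
  by rewrite /lower -z (@vsubmxK _ 3 3).
exists (dsubmx (C : 'M_(3 + 3, 3))); rewrite -CE; split=> //.
by apply: lower_unit; rewrite -CE.
Qed.

Lemma Yset_up0 W v : Yset F W -> v \in W 3 -> up0 v.
Proof.
move=> /YsetP[C [rC uC] hP]; have [_ rp] := is_Phi_symplectic hP.
move=> /(mem_W3 _ rp)[x [y [z ->]]].
by repeat first [exact: up0Z (uC _) | apply: up0D].
Qed.

Lemma Yset_intro W : symplectic W -> (forall v, v \in W 3 -> up0 v) -> Yset F W.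
Proof.
move=> sW h; have [C rC] := flag_represented (trunc W).
apply/YsetP; exists C; last exact: is_Phi_represents.
by split; [exact: represents_rank rC|move=> j; apply: h; exact: col_in_W3].
Qed.

(* The flags with [W_2 <= <e_4, e_5, e_6>]: an irreducible fourfold containing
   both [Y] and [Z], used to bound their dimensions. *)
Definition SZ' : set 'M[F]_(6, 3) :=
  [set C | [/\ \rank C = 3, isotropic C, up0 (col 0 C) & up0 (col 1 C)]].

Variable p : nat.
Hypothesis charFp : p \in [pchar F].

Definition SZ : set 'M[F]_(6, 3) :=
  [set C | SZ' C /\ herm p (nrm (col 0 C) (col 1 C)) = 0].

Lemma SZ'_inv : uptri_invariant SZ'.
Proof.
move=> C b [rC iC u0 u1] ub ib; have [c0 c1 c2] := uptri_cols C ub.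
split; [exact: rank_uptri | exact: isotropic_mulmx | by rewrite c0; exact: up0Z |].
by rewrite c1; apply: up0D; exact: up0Z.
Qed.

Lemma SZ_inv : uptri_invariant SZ.
Proof.
move=> C b [SC hC] ub ib; split; first exact: SZ'_inv.
by have [-> -> _] := uptri_cols C ub; rewrite nrm_uptri hermZ hC mulr0.
Qed.

Lemma det_mx2 (A : 'M[F]_2) : \det A = A 0 0 * A 1 1 - A 0 1 * A 1 0.
Proof.
rewrite (expand_det_row _ ord0) !big_ord_recl big_ord0 addr0 /cofactor !det_mx11 !mxE.
rewrite /= expr0 mul1r expr1 mulN1r mulrN.
by congr (A _ _ * A _ _ - A _ _ * A _ _); apply: val_inj.
Qed.

Lemma detB_formula (B : 'M[F]_(3, 2)) :
  [/\ detB B 1 = B 1 0 * B 2%:R 1 - B 2%:R 0 * B 1 1,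
      detB B 2 = B 0 0 * B 2%:R 1 - B 2%:R 0 * B 0 1 &
      detB B 3 = B 0 0 * B 1 1 - B 1 0 * B 0 1].
Proof.
rewrite /detB !det_mx2 !mxE; split; rewrite [X in _ - X]mulrC.
- by congr (B _ _ * B _ _ - B _ _ * B _ _); apply: val_inj; rewrite /= inordK.
- by congr (B _ _ * B _ _ - B _ _ * B _ _); apply: val_inj; rewrite /= inordK.
- by congr (B _ _ * B _ _ - B _ _ * B _ _); apply: val_inj; rewrite /= inordK.
Qed.

Lemma minorsE (B : 'M[F]_(3, 2)) : minors B = vec3 (detB B 1) (- detB B 2) (detB B 3).
Proof. by []. Qed.

Lemma rank_minors (B : 'M[F]_(3, 2)) : minors B != 0 -> \rank B = 2.
Proof.
move=> nB; apply/rank_injP => a /colP h.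
have e i : a 0 0 * B i 0 + a 1 0 * B i 1 = 0.
  have := h i; rewrite !mxE !big_ord_recl big_ord0 addr0 => <-.
  by rewrite !(mulrC (B i _)); congr (_ * B i _ + a _ 0 * B i _); apply: val_inj.
have [d1 d2 d3] := detB_formula B.
have z0 : a 0 0 *: minors B = 0.
  rewrite minorsE d1 d2 d3; apply/colP; apply: ord3P; rewrite !mxE /=.
  - transitivity ((a 0 0 * B 1 0 + a 1 0 * B 1 1) * B 2%:R 1 - (a 0 0 * B 2%:R 0 + a 1 0 * B 2%:R
    1) * B 1 1); first ring.
    by rewrite !e !mul0r subr0.
  - transitivity (- ((a 0 0 * B 0 0 + a 1 0 * B 0 1) * B 2%:R 1 - (a 0 0 * B 2%:R 0 + a 1 0 * B
    2%:R 1) * B 0 1)); first ring.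
    by rewrite !e !mul0r subr0 oppr0.
  - transitivity ((a 0 0 * B 0 0 + a 1 0 * B 0 1) * B 1 1 - (a 0 0 * B 1 0 + a 1 0 * B 1 1) * B 0
    1); first ring.
    by rewrite !e !mul0r subr0.
have z1 : a 1 0 *: minors B = 0.
  rewrite minorsE d1 d2 d3; apply/colP; apply: ord3P; rewrite !mxE /=.
  - transitivity ((a 0 0 * B 2%:R 0 + a 1 0 * B 2%:R 1) * B 1 0 - (a 0 0 * B 1 0 + a 1 0 * B 1 1) *
    B 2%:R 0); first ring.
    by rewrite !e !mul0r subr0.
  - transitivity (- ((a 0 0 * B 2%:R 0 + a 1 0 * B 2%:R 1) * B 0 0 - (a 0 0 * B 0 0 + a 1 0 * B 0
    1) * B 2%:R 0)); first ring.
    by rewrite !e !mul0r subr0 oppr0.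
  - transitivity ((a 0 0 * B 1 0 + a 1 0 * B 1 1) * B 0 0 - (a 0 0 * B 0 0 + a 1 0 * B 0 1) * B 1
    0); first ring.
    by rewrite !e !mul0r subr0.
move/eqP: z0; rewrite scaler_eq0 (negPf nB) orbF => /eqP a0.
move/eqP: z1; rewrite scaler_eq0 (negPf nB) orbF => /eqP a1.
apply/colP => i; rewrite [RHS]mxE; case: (unliftP 0 i) => [j ->|-> //].
by rewrite -a1; congr (a _ 0); apply: val_inj; rewrite (ord1 j).
Qed.

Lemma admissibleP (B : 'M[F]_(3, 2)) :
  admissible p B <-> \rank B = 2 /\ herm p (minors B) = 0.
Proof.
have e : detB B 1 ^+ p * detB B 3 + detB B 2 ^+ p.+1 + detB B 1 * detB B 3 ^+ p =
    herm p (minors B).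
  rewrite /herm minorsE !vec3E; congr (_ + _ + _).
  by rewrite !exprS (exprNp charFp) mulrNN.
by rewrite /admissible e.
Qed.

Definition stack (a b : 'cV[F]_3) : 'cV[F]_6 := @col_mx F 3 3 1 a b.

Lemma coord6_stack (a b : 'cV[F]_3) (v := stack a b) :
  ((coord6 v 1 = a 0 0) * (coord6 v 2 = a 1 0) * (coord6 v 3 = a 2%:R 0) *
   (coord6 v 4 = b 0 0) * (coord6 v 5 = b 1 0) * (coord6 v 6 = b 2%:R 0))%type.
Proof.
have l (i : 'I_3) : coord6 v i.+1 = a i 0 by rewrite coord6l /v /stack (@col_mxEu _ 3 3).
have r (i : 'I_3) : coord6 v (3 + i.+1) = b i 0 by rewrite coord6r /v /stack (@col_mxEd _ 3 3).
by do !split; [exact: (l 0)|exact: (l 1)|exact: (l 2%:R)|exact: (r 0)|exact: (r 1)|exact: (r 2%:R)].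
Qed.

Lemma block_cols3 (a u : 'cV[F]_3) (B : 'M[F]_(3, 2)) :
  @block_mx F 3 3 2 1 0 a B u =
  cols3 (stack 0 (col 0 B)) (stack 0 (col 1 B)) (stack a u).
Proof.
apply: mx6P; apply: ord3P; rewrite col_cols3; apply/colP => i; rewrite mxE.
- have -> : (0 : 'I_3) = lshift 1 (0 : 'I_2) by apply: val_inj.
  rewrite -[i](@splitK 3 3); case: (@fintype.split 3 3 i) => i' /=.
    by rewrite (@block_mxEul _ 3 3 2 1) (@col_mxEu _ 3 3) !mxE.
  by rewrite (@block_mxEdl _ 3 3 2 1) (@col_mxEd _ 3 3) !mxE.
- have -> : (1 : 'I_3) = lshift 1 (1 : 'I_2) by apply: val_inj.
  rewrite -[i](@splitK 3 3); case: (@fintype.split 3 3 i) => i' /=.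
    by rewrite (@block_mxEul _ 3 3 2 1) (@col_mxEu _ 3 3) !mxE.
  by rewrite (@block_mxEdl _ 3 3 2 1) (@col_mxEd _ 3 3) !mxE.
- have -> : (2%:R : 'I_3) = rshift 2 (0 : 'I_1) by apply: val_inj.
  rewrite -[i](@splitK 3 3); case: (@fintype.split 3 3 i) => i' /=.
    by rewrite (@block_mxEur _ 3 3 2 1) (@col_mxEu _ 3 3).
  by rewrite (@block_mxEdr _ 3 3 2 1) (@col_mxEd _ 3 3).
Qed.

Lemma nrm_minors (B : 'M[F]_(3, 2)) :
  nrm (stack 0 (col 0 B)) (stack 0 (col 1 B)) = minors B.
Proof.
have [d1 d2 d3] := detB_formula B.
rewrite minorsE d1 d2 d3 /nrm !coord6_stack !mxE.
apply/colP; apply: ord3P; rewrite !vec3E //; ring.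
Qed.

Lemma up0_stack (b : 'cV[F]_3) : up0 (stack 0 b).
Proof. by split; rewrite coord6_stack mxE. Qed.

Lemma lower_block (B : 'M[F]_(3, 2)) (v : 'cV[F]_3) :
  lower (row_mx B v) = @block_mx F 3 3 2 1 0 0 B v.
Proof. by rewrite /lower /block_mx row_mx0. Qed.

Lemma Z_block_SZ W (a u : 'cV[F]_3) (B : 'M[F]_(3, 2)) :
  admissible p B -> is_Phi (@block_mx F 3 3 2 1 0 a B u) W -> Phi_set SZ W.
Proof.
move=> /admissibleP[_ hB] hP; exists (@block_mx F 3 3 2 1 0 a B u) => //.
have [sW rp] := is_Phi_symplectic hP.
have iso := symplectic_isotropic sW rp; have rk := represents_rank rp.
move: iso rk; rewrite block_cols3 => iso rk.
by split; [split=> //|]; rewrite ?col_cols3 ?nrm_minors //; exact: up0_stack.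
Qed.

(** For a first and second column in <e_4, e_5, e_6>, isotropy says that the upper half of the third
    is orthogonal, for the ordinary dot product, to both lower halves, hence a multiple of their
    cross product [minors B]. This is where the last column in the definition of Z comes from;
    [s = 0] is the case of a flag in Y. *)
Lemma SZ_normal C : SZ' C -> exists (s : F) (u : 'cV[F]_3) (B : 'M[F]_(3, 2)),
  [/\ nrm (col 0 C) (col 1 C) = minors B, minors B != 0 &
      C = @block_mx F 3 3 2 1 0 (s *: minors B) B u].
Proof.
move=> [rC iC u0 u1]; have nn := nrm_neq0 rC u0 u1.
pose c k := vec3 (coord6 (col k C) 4) (coord6 (col k C) 5) (coord6 (col k C) 6).
pose B : 'M[F]_(3, 2) := row_mx (c 0) (c 1).
have B0 : col 0 B = c 0.
  apply/colP => i; rewrite mxE (_ : 0 = lshift 1 (0 : 'I_1)); last exact: val_inj.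
  by rewrite (@row_mxEl _ 3 1 1).
have B1 : col 1 B = c 1.
  apply/colP => i; rewrite mxE (_ : 1 = rshift 1 (0 : 'I_1)); last exact: val_inj.
  by rewrite (@row_mxEr _ 3 1 1).
have up k : up0 (col k C) -> col k C = stack 0 (c k).
  by move=> [h1 h2 h3]; apply: coord6P'; rewrite !coord6_stack ?vec3E ?mxE.
have nB : nrm (col 0 C) (col 1 C) = minors B by rewrite -nrm_minors B0 B1 -!up.
have [s hs] : exists s, vec3 (coord6 (col 2%:R C) 1) (coord6 (col 2%:R C) 2) (coord6 (col 2%:R C)
  3) =
    s *: nrm (col 0 C) (col 1 C).
  have iso := (isotropicP C).1 iC; case: u0 u1 => [a1 a2 a3] [b1 b2 b3].
  apply: perp_cross => //.
    have := iso 0 2%:R; rewrite pairing6 a1 a2 a3 !mul0r !sub0r => e.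
    by apply: oppr_inj; rewrite oppr0 -e; ring.
  have := iso 1 2%:R; rewrite pairing6 b1 b2 b3 !mul0r !sub0r => e.
  by apply: oppr_inj; rewrite oppr0 -e; ring.
exists s, (c 2%:R), B; rewrite -nB; split=> //.
rewrite block_cols3 B0 B1 -!up // -hs [LHS]cols3P; congr cols3.
by apply: coord6P'; rewrite !coord6_stack !vec3E.
Qed.

Lemma ZsetP W : Zset F p W <-> Phi_set SZ W.
Proof.
split.
  case=> [[B [u [aB hP]]]|[B [v [aB uB hP]]]]; first exact: Z_block_SZ hP.
  by apply: (@Z_block_SZ _ 0 v B) => //; rewrite -lower_block.
move=> [C [SC hC] hP]; have [s [u [B [nB n0 CE]]]] := SZ_normal SC.
have aB : admissible p B.
  by apply/admissibleP; split; [exact: rank_minors | rewrite -nB].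
have [sW rp] := is_Phi_symplectic hP; have rk := represents_rank rp.
have [s0|s0] := eqVneq s 0.
  right; exists B, u; rewrite lower_block; split=> //; last first.
    by move: hP; rewrite CE s0 scale0r.
  by apply: lower_unit; rewrite lower_block -(scale0r (minors B)) -s0 -CE.
(* Dividing the third column by [s] normalises its upper half to [minors B]. *)
left; exists B, (s^-1 *: u); split=> //; apply: is_Phi_represents => //.
have [t [-> ut it]] : exists t, [/\ @block_mx F 3 3 2 1 0 (minors B) B (s^-1 *: u) = C *m t,
    uptri t & t \in unitmx].
  apply: (@uptri_ex _ _ _ 1 0 1 0 0 s^-1); rewrite ?oner_neq0 ?invr_neq0 //
    CE !block_cols3 !col_cols3 ?scale1r ?scale0r ?add0r //.
  by rewrite /stack (@scale_col_mx _ 3 3) scalerA mulVf // scale1r.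
exact: uptri_represents.
Qed.

Lemma YZsetP W : Zlow F p W <-> Yset F W /\ Zset F p W.
Proof.
split=> [[B [v [aB uB hP]]]|[/YsetP[C [rC uC] hP] /ZsetP/Phi_setP[sW]]].
  split; first by exists (row_mx B v).
  by right; exists B, v.
have [_ rp] := is_Phi_symplectic hP; move/(flag_set_inv SZ_inv rp) => [SC hC].
have [s [u [B [nB n0 CE]]]] := SZ_normal SC.
have aB : admissible p B.
  by apply/admissibleP; split; [exact: rank_minors | rewrite -nB].
have s0 : s = 0.
  apply/eqP; apply: contraT => s0.
  have [] := uC 2%:R; rewrite CE block_cols3 col_cols3 !coord6_stack => h0 h1 h2.
  have z : s *: minors B = 0 by apply/colP; apply: ord3P; rewrite [RHS]mxE.
  by move/eqP: z; rewrite scaler_eq0 (negPf s0) (negPf n0).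
exists B, u; rewrite lower_block; split=> //; last by move: hP; rewrite CE s0 scale0r.
by apply: lower_unit; rewrite lower_block -(scale0r (minors B)) -s0 -CE.
Qed.

Lemma Zset_intro W C : symplectic W -> represents C (trunc W) ->
  up0 (col 0 C) -> up0 (col 1 C) -> herm p (nrm (col 0 C) (col 1 C)) = 0 -> Zset F p W.
Proof.
move=> sW rp u0 u1 hC; apply/ZsetP; exists C; last exact: is_Phi_represents.
by split=> //; split=> //; [exact: represents_rank rp|exact: symplectic_isotropic rp].
Qed.

Lemma Zset_elim W C : represents C (trunc W) -> Zset F p W ->
  [/\ up0 (col 0 C), up0 (col 1 C) & herm p (nrm (col 0 C) (col 1 C)) = 0].
Proof.
by move=> rp /ZsetP/Phi_setP[sW] /(flag_set_inv SZ_inv rp)[[_ _ u0 u1] hC].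
Qed.

Lemma Yset_sub_FlagFV W : Yset F W -> FlagFV F p W.
Proof.
move=> YW; have /YsetP/Phi_setP[sW _] := YW.
apply: FlagFV_half => // j /andP[_ j3] v vW.
have uv : up0 v by apply: (Yset_up0 YW); apply: subvP vW; exact: flag_sub.
by rewrite (Fmap_up0 charFp) // (Vmap_up0 charFp) // mem0v.
Qed.

Lemma pairing_up0 (v w : 'cV[F]_6) : up0 v -> up0 w -> pairing v w = 0.
Proof.
by move=> [a1 a2 a3] [b1 b2 b3]; rewrite pairing6 a1 a2 a3 b1 b2 b3 !mul0r !mulr0; ring.
Qed.

(** F vanishes on W_2 and has isotropic image, and W_3 is its own complement, so F-stability of W_3
    amounts to <c, F c> = 0 for the third vector c. Stability under V follows by adjointness. *)
Lemma Zset_sub_FlagFV W : Zset F p W -> FlagFV F p W.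
Proof.
move=> ZW; have /ZsetP[C [SC hC] hP] := ZW; have [sW rp] := is_Phi_symplectic hP.
have [rC iC u0 u1] := SC; have [s [u [B [nB n0 CE]]]] := SZ_normal SC.
set c := col 2%:R C.
have cFc : pairing c (Fmap p c) = 0.
  transitivity (herm p (s *: minors B)); last by rewrite hermZ -nB hC mulr0.
  have -> : c = stack (s *: minors B) u by rewrite /c CE block_cols3 col_cols3.
  by rewrite pairing6 !coord6_Fmap !coord6_stack /herm exprS; ring.
have xFv x v : x \in W 3 -> v \in W 3 -> pairing x (Fmap p v) = 0.
  move=> /(mem_W3 _ rp)[x1 [x2 [x3 ->]]] /(mem_W3 _ rp)[v1 [v2 [v3 ->]]].
  rewrite -/c !(FmapD charFp) !FmapZ.
  rewrite (Fmap_up0 charFp u0) (Fmap_up0 charFp u1) !scaler0 !add0r.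
  have uF : up0 (v3 ^+ p *: Fmap p c) by apply: up0Z; exact: up0_Fmap.
  rewrite !pairingDl !pairingZl (pairing_up0 u0 uF) (pairing_up0 u1 uF).
  by rewrite pairingZr cFc !mulr0 !addr0.
apply: FlagFV_half => // j /andP[j0 j3] v vW.
have [j2|j2] := leqP j 2.
  have : v \in W 2 by apply: subvP vW; exact: flag_sub.
  move=> /(mem_W2 _ rp)[x [y e]].
  have uv : up0 v by rewrite e; apply: up0D; exact: up0Z.
  by rewrite (Fmap_up0 charFp) // (Vmap_up0 charFp) // mem0v.
have j3' : j = 3 by apply/eqP; rewrite eqn_leq j3.
rewrite j3' in vW *; have perp := sW 3 isT.
split; apply/perp => x xW; first exact: xFv.
have : pairing x (Vmap p v) ^+ p = 0.
  by rewrite -(pairing_Fmap charFp) pairingC xFv ?oppr0.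
by move/eqP; rewrite expf_eq0 => /andP[_ /eqP].
Qed.

End ComponentSets.

(** * The sets T *)

Section Tforms.
Variable F : closedFieldType.
Implicit Types (W : flag F 6 6) (C T : 'M[F]_(6, 3)).

(* With respect to a basis [f, g, w, h, ...] as in [Tbasis] below, the flags of
   [T_zeta] are those with [W_1 = <f>] and [W_3 <= <f, g, w, h>]; the quadratic
   equation is isotropy, because [<w, h> = 1] is the only nonzero pairing. *)
Definition Tform : set 'M[F]_(6, 3) := [set T | [/\ \rank T = 3,
  forall k, (1 < k <= 6)%N -> coord6 (col 0 T) k = 0,
  forall j, coord6 (col j T) 5 = 0 /\ coord6 (col j T) 6 = 0 &
  coord6 (col 1 T) 3 * coord6 (col 2%:R T) 4 =
  coord6 (col 2%:R T) 3 * coord6 (col 1 T) 4]].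

Lemma Tform_inv : uptri_invariant Tform.
Proof.
move=> T b [rT h0 h56 hm] ub ib; have [c0 c1 c2] := uptri_cols T ub.
split; first exact: rank_uptri.
- by move=> k hk; rewrite c0 coord6Z h0 ?mulr0.
- have h5 j : coord6 (col j T) 5 = 0 := (h56 j).1.
  have h6 j : coord6 (col j T) 6 = 0 := (h56 j).2.
  by apply: ord3P; rewrite ?c0 ?c1 ?c2 ?coord6D !coord6Z !h5 !h6 !mulr0 ?addr0.
- rewrite c1 c2 !coord6D !coord6Z !(h0 3) // !(h0 4) // !mulr0 !add0r.
  transitivity (b 1 1 * b 1 2%:R * (coord6 (col 1 T) 3 * coord6 (col 1 T) 4) +
    b 1 1 * b 2%:R 2%:R * (coord6 (col 1 T) 3 * coord6 (col 2%:R T) 4)); first ring.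
  by rewrite hm; ring.
Qed.

Definition Tu (al be r : F) : 'M[F]_(6, 3) :=
  cols3 (e 1) (r *: e 2 + al *: e 3 + be *: e 4) (e 2).

Definition Tl (al be : F) : 'M[F]_(6, 3) := cols3 (e 1) (e 2) (al *: e 3 + be *: e 4).

Local Notation c6e := (coord6D, coord6Z, coord6e) (only parsing).

Lemma pair_neq0 (al be : F) : (al, be) <> (0, 0) <-> (al != 0) || (be != 0).
Proof.
split=> [h|]; first by rewrite -negb_and; apply/negP => /andP[/eqP a0 /eqP b0]; apply: h;
  rewrite a0 b0.
by move=> h [a0 b0]; move: h; rewrite a0 b0 eqxx.
Qed.

Lemma rank_Tu al be r : (al, be) <> (0, 0) -> \rank (Tu al be r) = 3.
Proof.
move=> /pair_neq0 h; apply/rank3P => x y z; rewrite !col_cols3 => E.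
have E' k := congr1 (fun v => coord6 v k) E.
move: (E' 1%N) (E' 2%N) (E' 3%N) (E' 4%N).
coords; rewrite !(mulr0, mulr1, addr0, add0r).
move=> x0 e2 /eqP; rewrite mulf_eq0 => e3 /eqP; rewrite mulf_eq0 => e4.
have y0 : y = 0.
  case/orP: h => n; [move: e3|move: e4]; rewrite (negPf n) orbF => /eqP //.
by move: e2; rewrite y0 mul0r add0r => z0.
Qed.

Lemma rank_Tl al be : (al, be) <> (0, 0) -> \rank (Tl al be) = 3.
Proof.
move=> /pair_neq0 h; apply/rank3P => x y z; rewrite !col_cols3 => E.
have E' k := congr1 (fun v => coord6 v k) E.
move: (E' 1%N) (E' 2%N) (E' 3%N) (E' 4%N).
coords; rewrite !(mulr0, mulr1, addr0, add0r).
move=> x0 y0 /eqP; rewrite mulf_eq0 => e3 /eqP; rewrite mulf_eq0 => e4.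
split=> //; case/orP: h => n; [move: e3|move: e4]; rewrite (negPf n) orbF => /eqP //.
Qed.

Lemma Tform_Tu al be r : (al, be) <> (0, 0) -> Tform (Tu al be r).
Proof.
move=> h; split; first exact: rank_Tu.
- by move=> k /andP[k1 k6]; rewrite col_cols3 coord6e ?k6 ?(ltnW k1) // gtn_eqF.
- by apply: ord3P; rewrite !col_cols3 ?coord6D ?coord6Z !coord6e //= !mulr0 !addr0.
- by rewrite !col_cols3 !coord6D !coord6Z !coord6e //= !mulr0 !mul0r.
Qed.

Lemma Tform_Tl al be : (al, be) <> (0, 0) -> Tform (Tl al be).
Proof.
move=> h; split; first exact: rank_Tl.
- by move=> k /andP[k1 k6]; rewrite col_cols3 coord6e ?k6 ?(ltnW k1) // gtn_eqF.
- by apply: ord3P; rewrite !col_cols3 ?coord6D ?coord6Z !coord6e //= !mulr0 !addr0.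
- by rewrite !col_cols3 !coord6D !coord6Z !coord6e //= !mulr0 !mul0r.
Qed.

(** The second column decides. If its third and fourth coordinates are not both zero, the quadratic
    equation makes those of the third column a multiple of them, and subtraction leaves a multiple
    of [e 2] modulo [e 1]. Otherwise the second column itself reduces to [e 2]. *)
Lemma Tform_normal T : Tform T ->
  (exists al be r t, [/\ (al, be) <> (0, 0), T = Tu al be r *m t, uptri t & t \in unitmx]) \/
  (exists al be t, [/\ (al, be) <> (0, 0), T = Tl al be *m t, uptri t & t \in unitmx]).
Proof.
move=> [/rank3P rT h0 h56 hm].
set c0 := col 0 T in rT h0 *; set c1 := col 1 T in rT hm *; set c2 := col 2%:R T in rT hm *.
pose a := coord6 c0 1.
have E0 : c0 = a *: e 1.
  by apply: coord6Pe; coords; rewrite ?mulr1 ?mulr0 // h0.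
have expand j : col j T = coord6 (col j T) 1 *: e 1 + coord6 (col j T) 2 *: e 2 +
    coord6 (col j T) 3 *: e 3 + coord6 (col j T) 4 *: e 4.
  have [h5 h6] := h56 j.
  by apply: coord6Pe; coords; rewrite ?h5 ?h6 !(mulr0, mulr1, addr0, add0r).
have a0 : a != 0.
  apply/eqP => a0; have [|/eqP] := rT 1 0 0; last by rewrite oner_eq0.
  by rewrite E0 a0 !scale0r scaler0 !addr0.
set x := coord6 c1 1; set r2 := coord6 c1 2; set w2 := coord6 c1 3 in hm *;
  set h2 := coord6 c1 4 in hm *.
set y := coord6 c2 1; set r3 := coord6 c2 2; set w3 := coord6 c2 3 in hm *;
  set h3 := coord6 c2 4 in hm *.
have E1 : c1 = x *: e 1 + r2 *: e 2 + w2 *: e 3 + h2 *: e 4 := expand 1.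
have E2 : c2 = y *: e 1 + r3 *: e 2 + w3 *: e 3 + h3 *: e 4 := expand 2%:R.
have [nz|z] := pselect ((w2, h2) <> (0, 0)); [left|right].
  have [s' hs] : exists s, w3 = s * w2 /\ h3 = s * h2.
    case/pair_neq0/orP: nz => n.
      exists (w3 / w2); split; first by rewrite divfK.
      by apply: (mulfI n); rewrite hm; field.
    exists (h3 / h2); split; last by rewrite divfK.
    by apply: (mulfI n); rewrite mulrC -hm; field.
  (* Otherwise [q], [- s'], 1 would be the coefficients of a linear relation between the columns.
     The later values of [q] have the same purpose. *)
  have z0 : r3 - s' * r2 != 0.
    apply/eqP => z; pose q := (s' * x - y) / a.
    have hq : q * a = s' * x - y by rewrite divfK.
    have [|_ _ /eqP] := rT q (- s') 1; last by rewrite oner_eq0.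
    rewrite E0 E1 E2 hs.1 hs.2; apply: coord6Pe; coords.
    - by transitivity (q * a - (s' * x - y)); [ring|rewrite hq subrr].
    - by rewrite -z; ring.
    - by ring.
    - by ring.
    - by ring.
    - by ring.
  have [|||t [TE ut it]] := @uptri_ex F 6 (Tu w2 h2 r2) T a x 1 y s' (r3 - s' * r2) a0 (oner_neq0
    _) z0.
  - by rewrite col_cols3.
  - by rewrite !col_cols3 -/c1 E1 scale1r !addrA.
  - rewrite !col_cols3 -/c2 E2 hs.1 hs.2; apply: coord6Pe; coords; ring.
  - by exists w2, h2, r2, t.
move/contrapT: z => [w20 h20]; rewrite w20 h20 !scale0r !addr0 in E1.
have r20 : r2 != 0.
  apply/eqP => z; pose q := - x / a; have hq : q * a = - x by rewrite divfK.
  have [|_ /eqP + _] := rT q 1 0; last by rewrite oner_eq0.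
  rewrite E0 E1 z; apply: coord6Pe; coords; last 5 first; try by ring.
  by transitivity (q * a + x); [ring|rewrite hq addNr].
have nz3 : (w3, h3) <> (0, 0).
  move=> [w30 h30]; rewrite w30 h30 !scale0r !addr0 in E2.
  pose q := (r3 * x / r2 - y) / a; have hq : q * a = r3 * x / r2 - y by rewrite divfK.
  have [|_ _ /eqP] := rT q (- (r3 / r2)) 1; last by rewrite oner_eq0.
  rewrite E0 E1 E2; apply: coord6Pe; coords; try by ring.
    by transitivity (q * a - (r3 * x / r2 - y)); [field|rewrite hq subrr].
  by field.
have [|||t [TE ut it]] := @uptri_ex F 6 (Tl w3 h3) T a x r2 y r3 1 a0 r20 (oner_neq0 _).
- by rewrite col_cols3.
- by rewrite !col_cols3.
- by rewrite !col_cols3 -/c2 E2 scale1r !addrA.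
- by exists w3, h3, t.
Qed.


Lemma represents_uptri_inv n (C : 'M[F]_(n, 3)) t (W3 : flag F n 3) :
  uptri t -> t \in unitmx -> represents (C *m t) W3 -> represents C W3.
Proof.
move=> ut it h; have it' : invmx t \in unitmx by rewrite unitmx_inv.
by have := uptri_represents h (uptri_invmx ut it) it'; rewrite -mulmxA mulmxV // mulmx1.
Qed.

Lemma pairing_self (v : 'cV[F]_6) : pairing v v = 0.
Proof. by rewrite pairing6; ring. Qed.

Section TBasis.
Variable p : nat.
Hypothesis charFp : p \in [pchar F].
Variables f g w h k1 k2 : 'cV[F]_6.

Definition basis6 : 'M[F]_6 := \matrix_(i, j) ([:: f; g; w; h; k1; k2]`_j : 'cV_6) i 0.

(* The properties common to [T_infty] and [T_{x,y}]; [k1] and [k2] only complete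
   the basis.  [Tb_herm] characterises [W_2 = <f, g>] among the planes
   [<f, r g + b h>] by the equation of [Z]. *)
Record Tbasis : Prop := {
  Tb_free : forall a : 'cV[F]_6, basis6 *m a = 0 -> a = 0;
  Tb_upf : up0 f; Tb_upg : up0 g; Tb_uph : up0 h;
  Tb_low : forall v, up0 v -> exists a b c, v = a *: f + b *: g + c *: h;
  Tb_fw : pairing f w = 0; Tb_gw : pairing g w = 0; Tb_wh : pairing w h = 1;
  Tb_perp : forall v, pairing f v = 0 -> pairing g v = 0 ->
    exists a b c d, v = a *: f + b *: g + c *: w + d *: h;
  Tb_F : Fmap p w = f; Tb_V : Vmap p w = - f;
  Tb_herm : forall r b, herm p (nrm f (r *: g + b *: h)) = 0 <-> b = 0 }.

Hypothesis TB : Tbasis.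

Lemma basis6_mul (a : 'cV[F]_6) : basis6 *m a =
  coord6 a 1 *: f + coord6 a 2 *: g + coord6 a 3 *: w + coord6 a 4 *: h +
  coord6 a 5 *: k1 + coord6 a 6 *: k2.
Proof.
apply/colP => i; rewrite !mxE !big_ord_recl big_ord0 addr0 !mxE /= !addrA.
by rewrite /coord6; congr (_ + _ + _ + _ + _ + _); rewrite mulrC; congr (a _ 0 * _);
  apply: val_inj; rewrite /= inordK.
Qed.

Lemma basis6_e : ((basis6 *m e 1 = f) * (basis6 *m e 2 = g) * (basis6 *m e 3 = w) *
  (basis6 *m e 4 = h))%type.
Proof.
by do !split; rewrite basis6_mul; coords; rewrite !(scale0r, scale1r, addr0, add0r).
Qed.

Lemma basis6_unit : basis6 \in unitmx.
Proof. by rewrite -row_free_unit /row_free; apply/eqP/rank_injP; exact: (Tb_free TB). Qed.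

Lemma col_mul n m k (A : 'M[F]_(n, m)) (B : 'M[F]_(m, k)) j : col j (A *m B) = A *m col j B.
Proof. by rewrite !colE mulmxA. Qed.

Lemma basis6_Tu al be r :
  basis6 *m Tu al be r = cols3 f (r *: g + al *: w + be *: h) g.
Proof.
by apply: mx6P; apply: ord3P; rewrite col_mul !col_cols3 ?mulmxDr -?scalemxAr !basis6_e.
Qed.

Lemma basis6_Tl al be : basis6 *m Tl al be = cols3 f g (al *: w + be *: h).
Proof.
by apply: mx6P; apply: ord3P; rewrite col_mul !col_cols3 ?mulmxDr -?scalemxAr !basis6_e.
Qed.

Definition TE : set 'M[F]_(6, 3) := [set C | exists2 T, Tform T & C = basis6 *m T].

Lemma TE_inv : uptri_invariant TE.
Proof.
move=> _ b [T hT ->] ub ib; exists (T *m b); last by rewrite mulmxA.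
exact: Tform_inv.
Qed.

Definition Tup : set (flag6 F) := [set W | exists al be r, (al, be) <> (0, 0) /\
  is_Phi (cols3 f (r *: g + al *: w + be *: h) g) W].

Definition Tlow : set (flag6 F) := [set W | exists al be, (al, be) <> (0, 0) /\
  is_Phi (cols3 f g (al *: w + be *: h)) W].

Lemma Tset_gen W : (Tup `|` Tlow) W <-> Phi_set TE W.
Proof.
split.
  case=> [[al [be [r [nz hP]]]]|[al [be [nz hP]]]].
    exists (basis6 *m Tu al be r); last by rewrite basis6_Tu.
    by exists (Tu al be r) => //; exact: Tform_Tu.
  exists (basis6 *m Tl al be); last by rewrite basis6_Tl.
  by exists (Tl al be) => //; exact: Tform_Tl.
move=> [_ [T hT ->] hP]; have [sW rp] := is_Phi_symplectic hP.
have [[al [be [r [t [nz TE' ut it]]]]]|[al [be [t [nz TE' ut it]]]]] := Tform_normal hT.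
  left; exists al, be, r; split=> //; apply: is_Phi_represents => //.
  by rewrite -basis6_Tu; apply: represents_uptri_inv ut it _; rewrite -mulmxA -TE'.
right; exists al, be; split=> //; apply: is_Phi_represents => //.
by rewrite -basis6_Tl; apply: represents_uptri_inv ut it _; rewrite -mulmxA -TE'.
Qed.

Lemma pairing_fghw a b c d a' b' c' d' :
  pairing (a *: f + b *: g + c *: w + d *: h) (a' *: f + b' *: g + c' *: w + d' *: h) =
  c * d' - d * c'.
Proof.
have wf : pairing w f = 0 by rewrite pairingC (Tb_fw TB) oppr0.
have wg : pairing w g = 0 by rewrite pairingC (Tb_gw TB) oppr0.
have hw : pairing h w = -1 by rewrite pairingC (Tb_wh TB).
have [uf ug uh] := And3 (Tb_upf TB) (Tb_upg TB) (Tb_uph TB).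
rewrite !(pairingDl, pairingDr, pairingZl, pairingZr) !pairing_self wf wg hw.
rewrite (Tb_fw TB) (Tb_gw TB) (Tb_wh TB).
rewrite (pairing_up0 uf ug) (pairing_up0 uf uh) (pairing_up0 ug uf) (pairing_up0 ug uh).
by rewrite (pairing_up0 uh uf) (pairing_up0 uh ug); ring.
Qed.

(** An intrinsic criterion. Orthogonality to [f] and [g] confines W_3 to <f, g, w, h>; in these
    coordinates the equation of [Tform] is isotropy of W_3. *)
Lemma TE_intro W : symplectic W -> W 1%N = <[f]>%VS ->
  (forall v, v \in W 3 -> pairing g v = 0) -> Phi_set TE W.
Proof.
move=> sW W1 pg; have [C rC] := flag_represented (trunc W).
exists C; last exact: is_Phi_represents.
have fW : f \in W 3 by apply: subvP (memv_line f); rewrite -W1; exact: flag_sub.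
have ub := basis6_unit; pose T := invmx basis6 *m C.
have CE : C = basis6 *m T by rewrite mulmxA mulmxV // mul1mx.
have cT j v : col j C = basis6 *m v -> col j T = v.
  by move=> E; rewrite col_mul E mulmxA mulVmx // mul1mx.
have colT j : exists a b c d, col j C = a *: f + b *: g + c *: w + d *: h /\
    col j T = a *: e 1 + b *: e 2 + c *: e 3 + d *: e 4.
  have cW := @col_in_W3 F W C j rC.
  have [a [b [c [d E]]]] := Tb_perp TB (pairing_W3 sW fW cW) (pg _ cW).
  exists a, b, c, d; split=> //; apply: cT.
  by rewrite !mulmxDr -!scalemxAr !basis6_e.
exists T => //; split.
- by rewrite eqmxMfull ?(represents_rank rC) // row_full_unit unitmx_inv.
- have : col 0 C \in W 1 by apply/(mem_W1 _ rC); exists 1; rewrite scale1r.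
  rewrite W1 => /vlineP[x E] k /andP[lk1 lk6].
  rewrite (cT 0 (x *: e 1)); last by rewrite -scalemxAr !basis6_e.
  by rewrite coord6Z coord6e ?lk6 ?(ltnW lk1) // gtn_eqF // mulr0.
- by move=> j; have [a [b [c [d [_ ->]]]]] := colT j; coords; rewrite !mulr0 !addr0.
- have [a [b [c [d [E1 ->]]]]] := colT 1; have [a' [b' [c' [d' [E2 ->]]]]] := colT 2%:R.
  have := pairing_W3 sW (col_in_W3 1 rC) (col_in_W3 2%:R rC).
  rewrite E1 E2 pairing_fghw => /eqP; rewrite subr_eq0 => /eqP E.
  by coords; rewrite !(mulr0, mulr1, addr0, add0r) E mulrC.
Qed.

Lemma TE_elim W : Phi_set TE W -> [/\ symplectic W, W 1%N = <[f]>%VS, g \in W 3 &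
  forall v, v \in W 3 -> exists a b c d, v = a *: f + b *: g + c *: w + d *: h].
Proof.
move=> hW; have [sW _] := (Phi_setP TE W).1 hW.
have W1 C : represents C (trunc W) -> W 1%N = <[col 0%R C]>%VS.
  by move=> rC; rewrite -truncE // rC // span_cols1.
case/Tset_gen: hW => [[al [be [r [nz /is_Phi_symplectic[_ rp]]]]]|[al [be [nz /is_Phi_symplectic[_
  rp]]]]].
  split=> //; first by rewrite (W1 _ rp) col_cols3.
    by rewrite -(@col_cols3 F f (r *: g + al *: w + be *: h) g).2; exact: col_in_W3.
  move=> v /(mem_W3 _ rp)[x [y [z ->]]]; rewrite !col_cols3.
  exists x, (y * r + z), (y * al), (y * be).
  by rewrite !scalerDr !scalerA scalerDl !addrA [LHS]addrC !addrA;
    do 3?[rewrite [in LHS](addrC (z *: g)) ?addrA]; apply: coord6Pe; coords; ring.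
split=> //; first by rewrite (W1 _ rp) col_cols3.
  by rewrite -(@col_cols3 F f g (al *: w + be *: h)).1.2; exact: col_in_W3.
move=> v /(mem_W3 _ rp)[x [y [z ->]]]; rewrite !col_cols3.
by exists x, y, (z * al), (z * be); rewrite scalerDr !scalerA !addrA.
Qed.

(** F and V kill [f], [g], [h] and send [w] to [f] and [- f], so they map all of W_3 into W_1. *)
Lemma TE_sub_FlagFV W : Phi_set TE W -> FlagFV F p W.
Proof.
move=> /TE_elim[sW W1 gW hW]; apply: (FlagFV_half charFp) => // j /andP[j0 j3] v vW.
have fW : f \in W j by apply: subvP (memv_line f); rewrite -W1; apply: flag_sub => //;
  exact: leq_trans j3 _.
have vW3 : v \in W 3 by apply: subvP vW; exact: flag_sub.
have [a [b [c [d E]]]] := hW v vW3.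
have [[f1 f2 f3] [g1 g2 g3] [h1 h2 h3]] := And3 (Tb_upf TB) (Tb_upg TB) (Tb_uph TB).
have vc k : coord6 f k = 0 -> coord6 g k = 0 -> coord6 h k = 0 -> coord6 v k = c * coord6 w k.
  by move=> z1 z2 z3; rewrite E !coord6D !coord6Z z1 z2 z3 !mulr0 !add0r addr0.
rewrite (@Fmap_scale F p c v w) ?(@Vmap_scale F p charFp c v w) ?vc // (Tb_F TB) (Tb_V TB).
by rewrite scalerN memvN !memvZ.
Qed.

End TBasis.

End Tforms.

(** * Classification of the stable flags *)

Section Classification.
Variables (F : closedFieldType) (p : nat).
Hypothesis charFp : p \in [pchar F].
Implicit Types (W : flag F 6 6) (C T : 'M[F]_(6, 3)).

Let p_prime : prime p. Proof. by case/andP: charFp. Qed.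
Let p_gt0 : (0 < p)%N. Proof. exact: prime_gt0. Qed.

Lemma vline_scale (k : F) (v : 'cV[F]_6) : k != 0 -> <[k *: v]>%VS = <[v]>%VS.
Proof.
move=> k0; apply/vspaceP => u; apply/vlineP/vlineP => -[x ->].
  by exists (x * k); rewrite scalerA.
by exists (x / k); rewrite scalerA divfK.
Qed.

(** The full flag is read off from the inverse isomorphism of [trunc_isomorphic], applied to a
    single matrix. *)
Lemma Phi_exists C : isotropic C -> \rank C = 3 -> exists W, is_Phi C W.
Proof.
move=> iC rC; have [|f [g _]] := @trunc_isomorphic F [set C]; first by move=> _ ->.
have [C' -> hP] : Phi_set [set C] (val (g (elt (ex_intro2 _ _ C erefl (represents_flag_of rC) :
  flag_set [set C] (flag_of rC))))).
  exact: mem_set_val.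
by eexists; exact: hP.
Qed.

Lemma is_Phi_unique C W W' : is_Phi C W -> is_Phi C W' -> W = W'.
Proof.
move=> /is_Phi_symplectic[sW rW] /is_Phi_symplectic[sW' rW'].
by apply: trunc_inj => //; exact: represents_inj rW rW'.
Qed.

Section Generic.
Variables f g w h k1 k2 : 'cV[F]_6.
Hypothesis TB : Tbasis p f g w h k1 k2.

Lemma TE_isotropic C : TE f g w h k1 k2 C -> isotropic C.
Proof.
move=> [T [_ h0 h56 hm] ->].
have cE j : col j (basis6 f g w h k1 k2 *m T) = coord6 (col j T) 1 *: f +
    coord6 (col j T) 2 *: g + coord6 (col j T) 3 *: w + coord6 (col j T) 4 *: h.
  by rewrite col_mul basis6_mul (h56 j).1 (h56 j).2 !scale0r !addr0.
have z i j : pairing (col i (basis6 f g w h k1 k2 *m T)) (col j (basis6 f g w h k1 k2 *m T)) =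
    coord6 (col i T) 3 * coord6 (col j T) 4 - coord6 (col i T) 4 * coord6 (col j T) 3.
  by rewrite !cE (pairing_fghw TB).
have z3 := h0 3%N isT; have z4 := h0 4%N isT.
apply/isotropicP => i j; rewrite z; move: i j; apply: ord3P; apply: ord3P;
  rewrite ?z3 ?z4; try by ring.
- by rewrite hm; ring.
- by rewrite -hm; ring.
Qed.

Lemma f_neq0 : f != 0.
Proof.
apply/eqP => f0; have [[[e1 _] _] _] := basis6_e f g w h k1 k2.
have := congr1 (fun v => coord6 v 1) (Tb_free TB (etrans e1 f0)).
by coords => /eqP; rewrite oner_eq0.
Qed.

Lemma up0_w al v : up0 v -> up0 (al *: w + v) -> al = 0.
Proof.
move=> uv /(Fmap_up0 charFp); rewrite (FmapD charFp) FmapZ (Tb_F TB) (Fmap_up0 charFp uv).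
rewrite addr0 => /eqP; rewrite scaler_eq0 (negPf f_neq0) orbF expf_eq0.
by move=> /andP[_ /eqP].
Qed.

(** For W_3 = <e_4, e_5, e_6> orthogonality to [g] is automatic, so only the condition on W_1
    remains. *)
Lemma Y_TE W : Yset F W /\ Phi_set (TE f g w h k1 k2) W <-> Yset F W /\ W 1%N = <[f]>%VS.
Proof.
split=> [[YW /TE_elim[_ W1 _ _]]//|[YW W1]]; split=> //.
have /YsetP/Phi_setP[sW _] := YW; apply: (TE_intro TB) => // v /(Yset_up0 YW).
exact: pairing_up0 (Tb_upg TB).
Qed.

(** In the first family of T, a plane W_2 inside <e_4, e_5, e_6> has no component along [w], and
    then the Hermitian equation removes the component along [h] by [Tb_herm]; this contradicts that
    the two components are not both zero. *)
Lemma Z_TE W : Zset F p W /\ Phi_set (TE f g w h k1 k2) W <-> Tlow f g w h W.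
Proof.
split.
  move=> [ZW /Tset_gen[|//]] [al [be [r [nz hP]]]].
  have [sW rp] := is_Phi_symplectic hP.
  have [] := Zset_elim charFp rp ZW; rewrite !col_cols3 => _ u1 hC.
  have al0 : al = 0.
    apply: (@up0_w al (r *: g + be *: h)).
      by apply: up0D; apply: up0Z; [exact: Tb_upg TB|exact: Tb_uph TB].
    by rewrite addrA (addrC (al *: w)).
  move: hC; rewrite al0 scale0r addr0 => /(Tb_herm TB) be0.
  by case: nz; rewrite al0 be0.
move=> lW; split; last by apply/Tset_gen; right.
have [al [be [nz hP]]] := lW; have [sW rp] := is_Phi_symplectic hP.
apply: (Zset_intro charFp sW rp); rewrite ?col_cols3; [exact: Tb_upf TB|exact: Tb_upg TB|].
by have := (Tb_herm TB 1 0).2 erefl; rewrite scale1r scale0r addr0.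
Qed.

Lemma YZ_TE : exists W, is_Phi (cols3 f g h) W /\
  forall W', (Yset F W' /\ Zset F p W') /\ Phi_set (TE f g w h k1 k2) W' <-> W' = W.
Proof.
have nz1 : ((0, 1) : F * F) <> (0, 0) by move=> [] /eqP; rewrite oner_eq0.
have cE : cols3 f g h = basis6 f g w h k1 k2 *m Tl 0 1.
  by rewrite basis6_Tl scale0r scale1r add0r.
have hT : TE f g w h k1 k2 (cols3 f g h).
  by exists (Tl 0 1) => //; exact: Tform_Tl.
have rk : \rank (cols3 f g h) = 3.
  by rewrite cE eqmxMfull ?rank_Tl // row_full_unit (basis6_unit TB).
have [W hP] := Phi_exists (TE_isotropic hT) rk.
exists W; split=> // W'; split.
  move=> [[YW' ZW'] TW']; have [al [be [nz hP']]] := (Z_TE W').1 (conj ZW' TW').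
  have [sW' rp'] := is_Phi_symplectic hP'.
  have al0 : al = 0.
    apply: (@up0_w al (be *: h)); first by apply: up0Z; exact: Tb_uph TB.
    apply: (Yset_up0 YW'); have := col_in_W3 2%:R rp'; by rewrite col_cols3.
  have be0 : be != 0 by apply/eqP => b0; apply: nz; rewrite al0 b0.
  apply: is_Phi_unique hP; apply: is_Phi_represents => //.
  have [||||t [tE ut it]] := @uptri_ex F 6 (cols3 f g (al *: w + be *: h)) (cols3 f g h) 1 0 1 0 0
    be^-1
    (oner_neq0 _) (oner_neq0 _); rewrite ?col_cols3; first by rewrite invr_neq0.
  - by rewrite scale1r.
  - by rewrite scale0r scale1r add0r.
  - by rewrite al0 !scale0r !add0r scalerA mulVf // scale1r.
  by rewrite tE; exact: uptri_represents.
move=> ->; have [sW rp] := is_Phi_symplectic hP.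
have TW : Phi_set (TE f g w h k1 k2) W by exists (cols3 f g h).
have ZW : Zset F p W.
  apply: ((Z_TE W).2 _).1; exists 0, 1; split=> //.
  by rewrite scale0r scale1r add0r.
split=> //; split=> //; apply: Yset_intro => // v /(mem_W3 _ rp)[a [b [c ->]]].
by rewrite !col_cols3; do !apply: up0D; apply: up0Z;
  [exact: Tb_upf TB|exact: Tb_upg TB|exact: Tb_uph TB].
Qed.

(** The flag with W_2 = <f, w> and W_3 = <f, w, g> has W_2 outside <e_4, e_5, e_6>. *)
Lemma TE_not_YZ : exists W, [/\ Phi_set (TE f g w h k1 k2) W, ~ Yset F W & ~ Zset F p W].
Proof.
have nz1 : ((1, 0) : F * F) <> (0, 0) by move=> [] /eqP; rewrite oner_eq0.
have rk : \rank (basis6 f g w h k1 k2 *m Tu 1 0 0) = 3.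
  by rewrite eqmxMfull ?rank_Tu // row_full_unit (basis6_unit TB).
have hT : TE f g w h k1 k2 (basis6 f g w h k1 k2 *m Tu 1 0 0).
  by exists (Tu 1 0 0) => //; exact: Tform_Tu.
have [W hP] := Phi_exists (TE_isotropic hT) rk.
have [sW rp] := is_Phi_symplectic hP.
have nu : ~ up0 (col 1 (basis6 f g w h k1 k2 *m Tu 1 0 0)).
  rewrite basis6_Tu col_cols3 scale0r add0r => u.
  have u0 : up0 (0 *: h) by apply: up0Z; exact: Tb_uph TB.
  by have /eqP := up0_w u0 u; rewrite oner_eq0.
exists W; split; first by exists (basis6 f g w h k1 k2 *m Tu 1 0 0).
  by move=> YW; apply: nu; apply: (Yset_up0 YW); exact: col_in_W3.
by move=> ZW; apply: nu; have [] := Zset_elim charFp rp ZW.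
Qed.

End Generic.

Lemma Tbasis_inf : Tbasis p (e 4) (e 5) (e 3) (e 6) (e 1) (e 2 : 'cV[F]_6).
Proof.
have ue i : (3 < i <= 6)%N -> up0 (e i : 'cV[F]_6).
  by case: i => [|[|[|[|[|[|[|i]]]]]]] // _; split; coords.
split.
- move=> a E; have E' k := congr1 (fun v => coord6 v k) E.
  move: (E' 1%N) (E' 2%N) (E' 3%N) (E' 4%N) (E' 5%N) (E' 6%N).
  rewrite basis6_mul; coords; rewrite !(mulr0, mulr1, addr0, add0r) => *.
  by apply: coord6Pe; rewrite coord60.
- exact: ue.
- exact: ue.
- exact: ue.
- move=> v [v1 v2 v3]; exists (coord6 v 4), (coord6 v 5), (coord6 v 6).
  by apply: coord6Pe; coords; rewrite ?v1 ?v2 ?v3 !(mulr0, mulr1, addr0, add0r).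
- by rewrite pairing6; coords; rewrite !(mulr0, mul0r); ring.
- by rewrite pairing6; coords; rewrite !(mulr0, mul0r); ring.
- by rewrite pairing6; coords; ring.
- move=> v; rewrite !pairing6; coords.
  rewrite !(mulr0, mul0r, mul1r, addr0, add0r, subr0, sub0r, oppr0) => /eqP;
    rewrite oppr_eq0 => /eqP v1.
  move=> /eqP; rewrite oppr_eq0 => /eqP v2.
  exists (coord6 v 4), (coord6 v 5), (coord6 v 3), (coord6 v 6).
  by apply: coord6Pe; coords; rewrite ?v1 ?v2 !(mulr0, mulr1, addr0, add0r).
- by apply: coord6Pe; rewrite coord6_Fmap; coords; rewrite ?expr0n ?expr1n ?gtn_eqF.
- apply: coord6Pe; rewrite coord6_Vmap; coords; rewrite ?(frob_inv0 charFp) ?oppr0 //.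
  by rewrite (@frob_inv_eq _ _ charFp 1 1) // expr1n.
- move=> r b; rewrite /herm /nrm !vec3E; coords.
  rewrite !(mulr0, mul0r, mul1r, mulr1, addr0, add0r, subr0, sub0r,
    oppr0) expr0n gtn_eqF // mul0r add0r.
  split=> [/eqP|->]; last by rewrite oppr0 exprS mul0r.
  by rewrite expf_eq0 oppr_eq0 /= => /eqP.
Qed.

(** Membership of x and y in F_{p^2} makes x^p and y^p their p-th roots, whence V w = - f; the
    equation of I is <f, w> = 0. *)
Lemma Tbasis_xy x y : Iset p (x, y) ->
  Tbasis p (fvec p x y) (gvec y) (wvec x y) (e 4) (e 2) (e 3 : 'cV[F]_6).
Proof.
move=> [/= hx hy hxy].
have hx' : (x ^+ p) ^+ p = x by rewrite -exprM -[RHS]hx.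
have hy' : (y ^+ p) ^+ p = y by rewrite -exprM -[RHS]hy.
have uf : up0 (fvec p x y) by split; rewrite /fvec; coords; rewrite !(mulr0, addr0).
have ug : up0 (gvec y) by split; rewrite /gvec; coords; rewrite !(mulr0, addr0).
have uh : up0 (e 4 : 'cV[F]_6) by split; coords.
have wE : ((coord6 (wvec x y) 1 = 1) * (coord6 (wvec x y) 2 = y) * (coord6 (wvec x y) 3 = x) *
    (coord6 (wvec x y) 4 = 0) * (coord6 (wvec x y) 5 = 0) * (coord6 (wvec x y) 6 = 0))%type.
  by rewrite /wvec; coords; rewrite !(mulr0, mulr1, addr0, add0r).
have fE : ((coord6 (fvec p x y) 1 = 0) * (coord6 (fvec p x y) 2 = 0) * (coord6 (fvec p x y) 3 = 0) *
    (coord6 (fvec p x y) 4 = x ^+ p) * (coord6 (fvec p x y) 5 = y ^+ p) * (coord6 (fvec p x y) 6 =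
      1))%type.
  by rewrite /fvec; coords; rewrite !(mulr0, mulr1, addr0, add0r).
have gE : ((coord6 (gvec y) 1 = 0) * (coord6 (gvec y) 2 = 0) * (coord6 (gvec y) 3 = 0) *
    (coord6 (gvec y) 4 = - y) * (coord6 (gvec y) 5 = 1) * (coord6 (gvec y) 6 = 0))%type.
  by rewrite /gvec; coords; rewrite !(mulr0, mulr1, addr0, add0r).
split=> //.
- move=> a E; have E' k := congr1 (fun v => coord6 v k) E.
  move: (E' 1%N) (E' 2%N) (E' 3%N) (E' 4%N) (E' 5%N) (E' 6%N).
  rewrite basis6_mul !coord6D !coord6Z !fE !gE !wE; coords.
  rewrite !(mulr0, mulr1, addr0, add0r) => a3; rewrite a3 !mul0r !add0r => a5 a6.
  rewrite ?addr0 => + + a1; rewrite a1 !mul0r !add0r => + a2; rewrite a2 mul0r add0r => a4.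
  by apply: coord6Pe; rewrite coord60.
- move=> v [v1 v2 v3]; pose a := coord6 v 6; pose b := coord6 v 5 - a * y ^+ p.
  exists a, b, (coord6 v 4 - a * x ^+ p + b * y).
  by apply: coord6Pe; rewrite !coord6D !coord6Z !fE !gE; coords; rewrite ?v1 ?v2 ?v3 /b /a; ring.
- rewrite pairing6 !fE !wE; transitivity (- (x ^+ p + x + y ^+ p.+1)); last by rewrite hxy oppr0.
  by rewrite exprSr; ring.
- by rewrite pairing6 !gE !wE; ring.
- by rewrite pairing6 !wE; coords; ring.
- move=> v; rewrite !pairing6 !fE !gE => hf hg.
  have v2 : coord6 v 2 = y * coord6 v 1.
    by apply/eqP; rewrite -subr_eq0 -oppr_eq0 -[X in _ == X]hg; apply/eqP; ring.
  have v3 : coord6 v 3 = x * coord6 v 1.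
    apply/eqP; rewrite -subr_eq0; apply/eqP.
    transitivity (- (0 * coord6 v 4 - x ^+ p * coord6 v 1 + (0 * coord6 v 5 - y ^+ p * coord6 v 2) +
       (0 * coord6 v 6 - 1 * coord6 v 3)) - (x ^+ p + x + y ^+ p.+1) * coord6 v 1).
      by rewrite v2 exprSr; ring.
    by rewrite hf hxy mul0r oppr0 addr0.
  pose a := coord6 v 6; pose b := coord6 v 5 - a * y ^+ p.
  exists a, b, (coord6 v 1), (coord6 v 4 - a * x ^+ p + b * y).
  by apply: coord6Pe; rewrite !coord6D !coord6Z !fE !gE !wE; coords; rewrite ?v2 ?v3 /b /a; ring.
- by apply: coord6Pe; rewrite coord6_Fmap !fE ?wE // expr1n.
- apply: coord6Pe; rewrite coord6_Vmap coord6N !fE ?wE ?oppr0 //; congr (- _);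
    apply: (frob_inv_eq charFp) => //; exact: expr1n.
- move=> r b; have -> : herm p (nrm (fvec p x y) (r *: gvec y + b *: e 4)) = b ^+ p.+1.
    have E k : coord6 (r *: gvec y + b *: e 4) k = r * coord6 (gvec y) k + b * coord6 (e 4 :
      'cV[F]_6) k.
      by rewrite coord6D !coord6Z.
    rewrite /herm /nrm !vec3E !E !fE !gE; coords.
    rewrite !(mulr0, mul0r, mul1r, mulr1, addr0, add0r, subr0, sub0r).
    have hx2 : x ^+ p = - x - y ^+ p.+1 by apply/eqP; rewrite -subr_eq0 -hxy; apply/eqP; ring.
    rewrite !exprS !(expr_addp charFp, exprNp charFp, exprMn).
    by rewrite hx' hy' hx2 exprS; ring.
  by split=> [/eqP|->]; [rewrite expf_eq0 /= => /eqP|rewrite exprS mul0r].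
Qed.

(** Uniform names for the adapted basis at infinity and at (x, y), so that one argument serves both
    kinds of T_zeta. *)
Definition Tf (z : option (F * F)) : 'cV[F]_6 := if z is Some xy then fvec p xy.1 xy.2 else e 4.
Definition Tg (z : option (F * F)) : 'cV[F]_6 := if z is Some xy then gvec xy.2 else e 5.
Definition Tw (z : option (F * F)) : 'cV[F]_6 := if z is Some xy then wvec xy.1 xy.2 else e 3.
Definition Th (z : option (F * F)) : 'cV[F]_6 := if z is Some xy then e 4 else e 6.
Definition Tk1 (z : option (F * F)) : 'cV[F]_6 := if z is Some xy then e 2 else e 1.
Definition Tk2 (z : option (F * F)) : 'cV[F]_6 := if z is Some xy then e 3 else e 2.

Lemma TbasisP z : Iinf p z -> Tbasis p (Tf z) (Tg z) (Tw z) (Th z) (Tk1 z) (Tk2 z).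
Proof. by case: z => [[x y]|_]; [exact: Tbasis_xy|exact: Tbasis_inf]. Qed.

Definition TZ z := TE (Tf z) (Tg z) (Tw z) (Th z) (Tk1 z) (Tk2 z).

Lemma TsetP z W : Tset F p z W <-> Phi_set (TZ z) W.
Proof.
rewrite -Tset_gen; case: z => [[x y]|]; split; (case=> h; [left|by right]).
(* As e_5 = g + y e_4, the coefficient of [h] becomes b + c y, and the excluded multiples of (0, -y,
   1) become the multiples of [g]. *)
- have [a [b [c [hn hP]]]] := h; exists a, (b + c * y), c; split.
    move=> [a0 bc]; apply: (hn c); rewrite a0; congr (_, _, _).
    by apply/eqP; rewrite mulrN -addr_eq0 bc.
  move: hP; congr (is_Phi (cols3 _ _ _) _); rewrite /= /gvec.
  by apply: coord6Pe; coords; ring.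
- have [al [be [r [nz hP]]]] := h; exists al, (be - r * y), r; split.
    move=> t [a0 b0 r0]; apply: nz; rewrite a0; congr (_, _).
    by rewrite -[be](subrK (r * y)) b0 r0; ring.
  move: hP; congr (is_Phi (cols3 _ _ _) _); rewrite /= /gvec.
  by apply: coord6Pe; coords; ring.
- have [a [b [c [hn hP]]]] := h; exists a, c, b; split.
    by move=> [a0 c0]; apply: (hn b); rewrite a0 c0.
  by have <- : a *: e 3 + b *: e 5 + c *: e 6 = b *: e 5 + a *: e 3 + c *: e 6 :> 'cV[F]_6
    by rewrite (addrC (a *: _)).
- have [al [be [r [nz hP]]]] := h; exists al, r, be; split.
    by move=> t [a0 _ b0]; apply: nz; rewrite a0 b0.
  by have -> : al *: e 3 + r *: e 5 + be *: e 6 = r *: e 5 + al *: e 3 + be *: e 6 :> 'cV[F]_6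
    by rewrite (addrC (al *: _)).
Qed.

Lemma Tf_inj z z' : <[Tf z]>%VS = <[Tf z']>%VS -> z = z'.
Proof.
move=> E; have /vlineP[k] : Tf z \in <[Tf z']>%VS by rewrite -E memv_line.
have c x y : ((coord6 (fvec p x y : 'cV[F]_6) 4 = x ^+ p) *
    (coord6 (fvec p x y : 'cV[F]_6) 5 = y ^+ p) * (coord6 (fvec p x y : 'cV[F]_6) 6 = 1))%type.
  by rewrite /fvec; coords; rewrite !(mulr0, mulr1, addr0, add0r).
case: z z' {E} => [[x y]|] [[x' y']|] //= E; have E' i := congr1 (fun v => coord6 v i) E;
  move: (E' 4%N) (E' 5%N) (E' 6%N); rewrite !coord6Z ?c ?coord6e //=.
- rewrite mulr1 => + + k1; rewrite -k1 !mul1r.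
  by move=> /(exprp_inj charFp) -> /(exprp_inj charFp) ->.
- by rewrite mulr0 => _ _ /eqP; rewrite oner_eq0.
- by rewrite mulr1 => + _ k0; rewrite -k0 mul0r => /eqP; rewrite oner_eq0.
Qed.

Lemma FlagFV_classify W : FlagFV F p W ->
  [\/ Yset F W, Zset F p W | exists2 z, Iinf p z & Tset F p z W].
Proof.
move=> FVW; have sW : symplectic W by move=> j /FVW[].
have FW j v : (j <= 6)%N -> v \in W j -> Fmap p v \in W j by move=> /FVW[_ h _]; exact: h.
have VW j v : (j <= 6)%N -> v \in W j -> Vmap p v \in W j by move=> /FVW[_ _ h]; exact: h.
have [C rC] := flag_represented (trunc W).
have c0W : col 0 C \in W 1 by apply/(mem_W1 _ rC); exists 1; rewrite scale1r.
have c1W : col 1 C \in W 2 by apply/(mem_W2 _ rC); exists 0, 1; rewrite scale0r scale1r add0r.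
have cW j := @col_in_W3 F W C j rC.
have iC := symplectic_isotropic sW rC; have rk := represents_rank rC.
set c0 := col 0 C in c0W *; set c1 := col 1 C in c1W *; set c2 := col 2%:R C.
(* F c_0 is a multiple of c_0. Either F c_0 = 0, or c_0 is a multiple of a vector in the image of F;
   both place it in <e_4, e_5, e_6>. *)
have u0 : up0 c0.
  have /(mem_W1 _ rC)[l E] := FW 1%N c0 isT c0W.
  have [l0|l0] := eqVneq l 0; first by apply: (Fmap_eq0 (p := p)); rewrite E l0 scale0r.
  by rewrite -[c0]scale1r -(mulVf l0) -scalerA -E; apply: up0Z; exact: up0_Fmap.
have upZ (k : F) v : k != 0 -> up0 (k *: v) -> up0 v.
  by move=> k0 /(up0Z k^-1); rewrite scalerA mulVf // scale1r.
have upDr u v : up0 u -> up0 (u + v) -> up0 v.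
  move=> uu /(up0D (up0Z (-1) uu)); by rewrite scaleN1r addrA addNr add0r.
have [u1|nu1] := pselect (up0 c1).
  have SC : SZ' C by split.
  have [s [u [B [nB n0 CE]]]] := SZ_normal SC.
  have c2E : c2 = stack (s *: minors B) u by rewrite /c2 CE block_cols3 col_cols3.
  (* The third vector lies in <e_4, e_5, e_6> exactly if s = 0; otherwise <c_2, F c_2> = s^(p+1)
     [herm p (minors B)] and s cancels. *)
  have [s0|s0] := eqVneq s 0.
    constructor 1; apply: Yset_intro => // v /(mem_W3 _ rC)[x [y [z ->]]].
    have u2 : up0 c2 by rewrite c2E s0 scale0r; exact: up0_stack.
    by do !apply: up0D; exact: up0Z.
  constructor 2; apply: (Zset_intro charFp sW rC) => //.
  have : pairing c2 (Fmap p c2) = 0 by exact: pairing_W3 sW (cW 2%:R) (FW 3%N _ isT (cW 2%:R)).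
  have -> : pairing c2 (Fmap p c2) = herm p (s *: minors B).
    by rewrite c2E pairing6 !coord6_Fmap !coord6_stack /herm exprS; ring.
  by rewrite hermZ -nB => /eqP; rewrite mulf_eq0 expf_eq0 (negPf s0) andbF => /eqP.
constructor 3.
have /(mem_W2 _ rC)[l [m FE]] := FW 2%N c1 isT c1W.
(* F c_1 and c_0 lie in <e_4, e_5, e_6> but c_1 does not, so c_1 cannot occur in F c_1. *)
have m0 : m = 0.
  apply/eqP; apply: contrapT => /negP m0; apply: nu1; apply: (upZ m) => //.
  by apply: upDr (up0Z l u0) _; rewrite -FE; exact: up0_Fmap.
rewrite m0 scale0r addr0 in FE.
have l0 : l != 0.
  by apply/eqP => l0; apply: nu1; apply: (Fmap_eq0 (p := p)); rewrite FE l0 scale0r.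
have /(mem_W2 _ rC)[l' [m' VE]] := VW 2%N c1 isT c1W.
have m'0 : m' = 0.
  apply/eqP; apply: contrapT => /negP m0'; apply: nu1; apply: (upZ m') => //.
  apply: upDr (up0Z l' u0) _; rewrite -VE; by split; rewrite coord6_Vmap.
rewrite m'0 scale0r addr0 in VE.
(* V c_1 = (l'/l) F c_1 reads -a^(1/p) = (l'/l) a^p for each upper coordinate a. The p-th power is a
   = mu a^(p^2) with a common factor, so quotients of coordinates are fixed by the p^2-th power. *)
pose mu := (- (l' / l)) ^+ p.
have VF : Vmap p c1 = (l' / l) *: Fmap p c1 by rewrite FE scalerA divfK.
have root2 a : - frob_inv p a = l' / l * a ^+ p -> a = mu * a ^+ (p ^ 2).
  move=> E; rewrite -{1}(frob_invK charFp a) -[frob_inv p a]opprK E -mulNr exprMn.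
  by rewrite -exprM.
have [mu1 mu2 mu3] : [/\ coord6 c1 1 = mu * coord6 c1 1 ^+ (p ^ 2),
    coord6 c1 2 = mu * coord6 c1 2 ^+ (p ^ 2) & coord6 c1 3 = mu * coord6 c1 3 ^+ (p ^ 2)].
  have V' i := congr1 (fun v => coord6 v i) VF.
  by split; apply: root2; [have := V' 6%N|have := V' 5%N|have := V' 4%N];
    rewrite coord6Z coord6_Vmap coord6_Fmap.
(* This is <c_1, F c_1> = 0; divided by the power p + 1 of the first coordinate it becomes the
   equation of I. *)
have hc1 : coord6 c1 1 * coord6 c1 3 ^+ p + coord6 c1 2 * coord6 c1 2 ^+ p +
    coord6 c1 3 * coord6 c1 1 ^+ p = 0.
  have := pairing_W3 sW (cW 1) (FW 3%N _ isT (cW 1)); rewrite -/c1 pairing6 !coord6_Fmap.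
  by move=> <-; ring.
(* Write F c_2 in W_3: the upper half of its part along c_1 and c_2 vanishes. If c_2 occurs, this
   solves for the upper half of c_2; if not, F c_2 is proportional to F c_1, and p-th roots give the
   claim. *)
have [nu hnu] : exists nu, [/\ coord6 c2 1 = nu * coord6 c1 1, coord6 c2 2 = nu * coord6 c1 2 &
    coord6 c2 3 = nu * coord6 c1 3].
  have /(mem_W3 _ rC)[l3 [m3 [n3 E3]]] := FW 3%N c2 isT (cW 2%:R).
  rewrite -/c0 -/c1 -/c2 in E3.
  have um : up0 (m3 *: c1 + n3 *: c2).
    by apply: upDr (up0Z l3 u0) _; rewrite addrA -E3; exact: up0_Fmap.
  have [n30|n30] := eqVneq n3 0.
    have m30 : m3 = 0.
      apply/eqP; apply: contrapT => /negP m3n; apply: nu1; apply: (upZ m3) => //.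
      by move: um; rewrite n30 scale0r addr0.
    have E4 : Fmap p c2 = (l3 / l) *: Fmap p c1.
      by rewrite E3 n30 m30 !scale0r !addr0 FE scalerA divfK.
    have F' i := congr1 (fun v => coord6 v i) E4.
    exists (frob_inv p (l3 / l)); split; apply: (exprp_inj charFp);
      rewrite exprMn (frob_invK charFp); [have := F' 6%N|have := F' 5%N|have := F' 4%N];
      by rewrite coord6Z !coord6_Fmap.
  exists (- m3 / n3); case: um; rewrite !coord6D !coord6Z => h1 h2 h3.
  have sol a b : m3 * a + n3 * b = 0 -> b = - m3 / n3 * a.
    move=> /eqP; rewrite addrC addr_eq0 => /eqP E; apply: (mulfI n30); rewrite E; by field.
  by split; apply: sol.
have W1 : W 1%N = <[c0]>%VS by rewrite -truncE // rC // span_cols1.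
(* Pairing with a vector of <e_4, e_5, e_6> sees only upper halves, and on W_3 these are all
   multiples of that of c_1. *)
have gW g : up0 g -> pairing g c1 = 0 -> forall v, v \in W 3 -> pairing g v = 0.
  move=> ug gc1 v /(mem_W3 _ rC)[x [y [z ->]]].
  rewrite !pairingDr !pairingZr -/c0 -/c1 -/c2 gc1 (pairing_up0 ug u0).
  have -> : pairing g c2 = nu * pairing g c1.
    case: ug hnu => g1 g2 g3 [h1 h2 h3]; rewrite !pairing6 g1 g2 g3 h1 h2 h3; ring.
  by rewrite gc1 !mulr0 !addr0.
have W1f f (k : F) : k != 0 -> Fmap p c1 = k *: f -> W 1%N = <[f]>%VS.
  move=> k0 E; rewrite W1; have -> : c0 = (l^-1 * k) *: f.
    by rewrite -scalerA -E FE scalerA mulVf // scale1r.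
  by rewrite vline_scale // mulf_neq0 ?invr_neq0.
(* If the first coordinate vanishes, the equation forces the second to vanish too, which is the
   point at infinity; otherwise x and y are the quotients by the first. *)
have [a10|a10] := eqVneq (coord6 c1 1) 0.
  have a20 : coord6 c1 2 = 0.
    move: hc1; rewrite a10 mul0r expr0n gtn_eqF // mulr0 add0r addr0 -exprS => /eqP.
    by rewrite expf_eq0 => /eqP.
  have a30 : coord6 c1 3 != 0 by apply/eqP => a30; apply: nu1.
  exists None => //; apply/TsetP; apply: (TE_intro (TbasisP (z := None) I)) => //.
    apply: (W1f _ (coord6 c1 3 ^+ p)); first by rewrite expf_neq0.
    by apply: coord6Pe; rewrite coord6_Fmap /=; coords;
      rewrite ?a10 ?a20 ?expr0n ?gtn_eqF // ?mulr0 ?mulr1.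
  apply: gW; first by split; rewrite /=; coords.
  by rewrite pairing6 /=; coords; rewrite a20; ring.
have mu0 : mu != 0 by apply/eqP => m00; move: a10; rewrite mu1 m00 mul0r eqxx.
pose x := coord6 c1 3 / coord6 c1 1; pose y := coord6 c1 2 / coord6 c1 1.
have div2 a : a = mu * a ^+ (p ^ 2) -> (a / coord6 c1 1) ^+ (p ^ 2) = a / coord6 c1 1.
  move=> E; rewrite exprMn exprVn [in RHS]E [in X in _ = _ / X]mu1 invfM.
  by rewrite mulrACA mulfV // mul1r.
have Ixy : Iinf p (Some (x, y)).
  split; rewrite /= ?div2 // /x /y.
  have a1p : coord6 c1 1 ^+ p.+1 != 0 by rewrite expf_neq0.
  apply: (mulIf a1p); rewrite mul0r -[RHS]hc1 !exprMn !exprVn !exprS.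
  have := expf_neq0 p a10; set q := _ ^+ p => q0.
  by field; rewrite a10 q0.
exists (Some (x, y)) => //; apply/TsetP; apply: (TE_intro (TbasisP Ixy)) => //.
  apply: (W1f _ (coord6 c1 1 ^+ p)); first by rewrite expf_neq0.
  apply: coord6Pe; rewrite coord6_Fmap /= /fvec; coords; rewrite !(mulr0, mulr1, addr0, add0r) //.
    by rewrite -exprMn /x mulrC divfK.
  by rewrite -exprMn /y mulrC divfK.
apply: gW; first exact: Tb_upg (TbasisP Ixy).
by rewrite pairing6 /= /gvec; coords; rewrite /y; field.
Qed.

Lemma FlagFV_union : FlagFV F p = [set W | [\/ Yset F W, Zset F p W |
  exists2 z, Iinf p z & Tset F p z W]].
Proof.
apply/seteqP; split=> W; first exact: FlagFV_classify.
case=> [/(Yset_sub_FlagFV charFp)|/(Zset_sub_FlagFV charFp)|[z Iz /TsetP]] //.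
exact: (TE_sub_FlagFV charFp (TbasisP Iz)).
Qed.

(** The coordinates are roots of X^(p^2) - X. Finiteness is what makes the union of the T_zeta
    accessible to the description of irreducible components. *)
Lemma finite_Iinf : exists s : seq (option (F * F)), forall z, z \in s <-> Iinf p z.
Proof.
have [rs hrs] := closed_field_poly_normal ('X^(p ^ 2) - 'X : {poly F}).
have p2 : (1 < p ^ 2)%N by rewrite -{1}(expn0 p) ltn_exp2l // prime_gt1.
have lc : lead_coef ('X^(p ^ 2) - 'X : {poly F}) != 0.
  by rewrite lead_coefDl ?lead_coefXn ?oner_neq0 // size_polyN size_polyX size_polyXn.
have mem x : x ^+ (p ^ 2) = x -> x \in rs.
  move=> hx; rewrite -root_prod_XsubC -(rootZ _ _ lc) -hrs /root.
  by rewrite hornerD hornerN hornerX hornerXn hx subrr.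
exists (None :: [seq Some xy | xy <- [seq (a, b) | a <- rs, b <- rs] & `[< Iset p xy >]]).
case=> [[x y]|]; last by rewrite mem_head.
rewrite in_cons /=; split.
  by move=> /mapP[xy]; rewrite mem_filter => /andP[/asboolP h _] [->].
move=> h; apply/mapP; exists (x, y) => //; rewrite mem_filter; apply/andP; split;
  first exact/asboolP.
by case: h => /= hx hy _; apply: allpairs_f; exact: mem.
Qed.

Lemma Tset_disjoint z z' : Iinf p z -> Iinf p z' -> z <> z' ->
  Tset F p z `&` Tset F p z' = set0.
Proof.
move=> Iz Iz' n; apply/seteqP; split=> W // [/TsetP/TE_elim[_ W1 _ _]].
move=> /TsetP/TE_elim[_ W1' _ _]; apply: n; apply: Tf_inj.
by rewrite -W1 -W1'.
Qed.

Lemma Phi_exists3 (c1 c2 c3 : 'cV[F]_6) : pairing c1 c2 = 0 -> pairing c1 c3 = 0 ->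
  pairing c2 c3 = 0 ->
  (forall x y z, x *: c1 + y *: c2 + z *: c3 = 0 -> [/\ x = 0, y = 0 & z = 0]) ->
  exists W, is_Phi (cols3 c1 c2 c3) W.
Proof.
move=> h12 h13 h23 fr; apply: Phi_exists; last by apply/rank3P; rewrite !col_cols3.
by apply/isotropicP; apply: ord3P; apply: ord3P; rewrite !col_cols3 ?pairing_self //;
  rewrite pairingC ?h12 ?h13 ?h23 oppr0.
Qed.

Lemma e_free i j k : uniq [:: i; j; k] -> all (fun i => 0 < i <= 6)%N [:: i; j; k] ->
  forall x y z, x *: e i + y *: e j + z *: e k = 0 :> 'cV[F]_6 -> [/\ x = 0, y = 0 & z = 0].
Proof.
rewrite /= !inE negb_or !andbT => /andP[/andP[ij ik] jk] /and3P[hi hj hk] x y z E.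
have E' l := congr1 (fun v => coord6 v l) E.
move: (E' i) (E' j) (E' k); rewrite !(coord6D, coord6Z, coord60) !coord6e // !eqxx.
rewrite ![_ == i]eq_sym [k == j]eq_sym (negPf ij) (negPf ik) (negPf jk).
by rewrite !(mulr0, mulr1, addr0, add0r).
Qed.

(** The plane <e_4, e_6> has normal vector (0, -1, 0), where the Hermitian form does not vanish. The
    line of e_5 is no W_1 of a T_zeta, since the line at infinity is that of e_4 and the others have
    a nonzero sixth coordinate. *)
Lemma Y_witnesses : (exists W, Yset F W /\ ~ Zset F p W) /\
  (exists W, Yset F W /\ forall z, ~ (Iinf p z /\ Tset F p z W)).
Proof.
have pe i j : (3 < i <= 6)%N -> (3 < j <= 6)%N -> pairing (e i : 'cV[F]_6) (e j) = 0.
  have ue k : (3 < k <= 6)%N -> up0 (e k : 'cV[F]_6).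
    by case: k => [|[|[|[|[|[|[|k]]]]]]] // _; split; coords.
  by move=> hi hj; apply: pairing_up0; exact: ue.
have Y_of i j k W : [&& (3 < i <= 6)%N, (3 < j <= 6)%N & (3 < k <= 6)%N] ->
    is_Phi (cols3 (e i) (e j) (e k)) W -> Yset F W.
  move=> /and3P[hi hj hk] hP; have [sW rp] := is_Phi_symplectic hP.
  have ue l : (3 < l <= 6)%N -> up0 (e l : 'cV[F]_6).
    by case: l => [|[|[|[|[|[|[|l]]]]]]] // _; split; coords.
  apply: Yset_intro => // v /(mem_W3 _ rp)[x [y [z ->]]]; rewrite !col_cols3.
  by do !apply: up0D; apply: up0Z; exact: ue.
split.
  have [|||W hP] := @Phi_exists3 (e 4) (e 6) (e 5) _ _ _ (@e_free 4 6 5 isT isT); rewrite ?pe //.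
  exists W; split; first exact: Y_of hP.
  have [_ rp] := is_Phi_symplectic hP => /(Zset_elim charFp rp)[_ _].
  rewrite !col_cols3 /herm /nrm !vec3E; coords.
  rewrite !(mulr0, mul0r, mul1r, mulr1, addr0, add0r, subr0, sub0r).
  by rewrite oppr0 mul0r addr0 => /eqP; rewrite expf_eq0 oppr_eq0 oner_eq0 andbF.
have [|||W hP] := @Phi_exists3 (e 5) (e 4) (e 6) _ _ _ (@e_free 5 4 6 isT isT); rewrite ?pe //.
exists W; split; first exact: Y_of hP.
have [_ rp] := is_Phi_symplectic hP.
move=> z [Iz /TsetP/TE_elim[_ W1 _ _]].
have : e 5 \in W 1 by apply/(mem_W1 _ rp); exists 1; rewrite scale1r !col_cols3.
rewrite W1 => /vlineP[k E]; have E' l := congr1 (fun v => coord6 v l) E.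
move: (E' 5%N) (E' 6%N); case: z {Iz W1 E E'} => [[x y]|] /=; rewrite /fvec; coords.
  rewrite !(mulr0, mulr1, addr0, add0r) => + k0; rewrite -k0 mul0r => /eqP.
  by rewrite oner_eq0.
by rewrite mulr0 => /eqP; rewrite oner_eq0.
Qed.

(** The normal vector of <e_5, e_4> is (0, 0, -1), a zero of the Hermitian form; e_3 in W_3 excludes
    Y, and W_1 = <e_5> excludes every T_zeta. *)
Lemma Z_witness : exists W, [/\ Zset F p W, ~ Yset F W & forall z, ~ (Iinf p z /\ Tset F p z W)].
Proof.
have [|||W hP] := @Phi_exists3 (e 5) (e 4) (e 3) _ _ _ (@e_free 5 4 3 isT isT);
  try by rewrite pairing6; coords; ring.
have [sW rp] := is_Phi_symplectic hP.
exists W; split.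
- apply: (Zset_intro charFp sW rp); rewrite ?col_cols3; try by split; coords.
  rewrite /herm /nrm !vec3E; coords.
  rewrite !(mulr0, mul0r, mul1r, mulr1, addr0, add0r, subr0, sub0r) expr0n gtn_eqF //.
  by rewrite oppr0 expr0n gtn_eqF // !mul0r !addr0.
- move=> /Yset_up0/(_ (col_in_W3 2%:R rp)); rewrite col_cols3 => -[_ _]; coords => /eqP.
  by rewrite oner_eq0.
move=> z [Iz /TsetP/TE_elim[_ W1 _ _]].
have : e 5 \in W 1 by apply/(mem_W1 _ rp); exists 1; rewrite scale1r !col_cols3.
rewrite W1 => /vlineP[k E]; have E' l := congr1 (fun v => coord6 v l) E.
move: (E' 5%N) (E' 6%N); case: z {Iz W1 E E'} => [[x y]|] /=; rewrite /fvec; coords.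
  rewrite !(mulr0, mulr1, addr0, add0r) => + k0; rewrite -k0 mul0r => /eqP.
  by rewrite oner_eq0.
by rewrite mulr0 => /eqP; rewrite oner_eq0.
Qed.

End Classification.

(** * Morphisms between sets of flags *)

Section FlagSets.
Variable F : closedFieldType.

Definition same_flag n k (C C' : 'M[F]_(n, k)) :=
  exists b, [/\ C' = C *m b, uptri b & b \in unitmx].

Lemma same_flag_represents n k (C C' : 'M[F]_(n, k)) W :
  same_flag C C' -> represents C W <-> represents C' W.
Proof.
move=> [b [-> ub ib]]; split; first by move=> rC; exact: uptri_represents.
have it' : invmx b \in unitmx by rewrite unitmx_inv.
by move/uptri_represents/(_ (uptri_invmx ub ib) it'); rewrite -mulmxA mulmxV // mulmx1.
Qed.

Lemma same_flag_rank n k (C C' : 'M[F]_(n, k)) : same_flag C C' -> \rank C = \rank C'.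
Proof. by move=> [b [-> _ ib]]; rewrite mxrankMfree // row_free_unit. Qed.

(* A morphism between sets of flags, given locally by the polynomial maps
   [psi i] on the open sets where [psi i] has full rank. *)
Definition flag_map n1 k1 n2 k2 (S1 : set 'M[F]_(n1, k1)) (S2 : set 'M[F]_(n2, k2))
    (I : Type) (psi : I -> 'M[F]_(n1, k1) -> 'M[F]_(n2, k2)) :=
  [/\ forall i, polymap (psi i),
      forall i D b, uptri b -> b \in unitmx -> same_flag (psi i D) (psi i (D *m b)),
      forall C, S1 C -> \rank C = k1 -> exists i, \rank (psi i C) = k2 &
      forall i C, S1 C -> \rank C = k1 -> \rank (psi i C) = k2 -> S2 (psi i C)].

(** Formulas with different indices give different matrices, so the correspondence is a relation
    over all representatives and indices. Composing with the formulas of the other direction shows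
    that it is single valued both ways. *)
Lemma flag_set_isomorphic n1 k1 n2 k2 (S1 : set 'M[F]_(n1, k1)) (S2 : set 'M[F]_(n2, k2))
    (I J : Type) (psi : I -> 'M[F]_(n1, k1) -> 'M[F]_(n2, k2))
    (chi : J -> 'M[F]_(n2, k2) -> 'M[F]_(n1, k1)) :
  uptri_invariant S1 -> uptri_invariant S2 ->
  flag_map S1 S2 psi -> flag_map S2 S1 chi ->
  (forall i j C, S1 C -> \rank C = k1 -> \rank (psi i C) = k2 ->
     \rank (chi j (psi i C)) = k1 -> same_flag C (chi j (psi i C))) ->
  (forall i j B, S2 B -> \rank B = k2 -> \rank (chi j B) = k1 ->
     \rank (psi i (chi j B)) = k2 -> same_flag B (psi i (chi j B))) ->
  isomorphic (subvar (flag_set S1)) (subvar (flag_set S2)).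
Proof.
move=> inv1 inv2 [ppsi epsi expsi S2psi] [pchi echi exchi S1chi] cyc1 cyc2.
apply: (@isomorphic_flag _ _ _ _ _ _ _ (fun W V =>
  exists C i, [/\ S1 C, represents C W & represents (psi i C) V])).
- apply: polynomially_related_flag => W C AW rC.
  have SC := (flag_set_inv inv1 rC).1 AW.
  have [i ri] := expsi C SC (represents_rank rC).
  exists (psi i); split=> // [D b rD ri' ub ib|W' D AW' rD rk].
    by have [b' [E ub' ib']] := epsi i D b ub ib; exists b'.
  have SD := (flag_set_inv inv1 rD).1 AW'.
  exists (flag_of rk); first exact: represents_flag_of.
  split; first by exists (psi i D);
    [exact: S2psi SD (represents_rank rD) rk|exact: represents_flag_of].
  by exists D, i; split=> //; exact: represents_flag_of.
- apply: polynomially_related_flag => V B AV rB.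
  have SB := (flag_set_inv inv2 rB).1 AV.
  have [j rj] := exchi B SB (represents_rank rB).
  exists (chi j); split=> // [D b rD rj' ub ib|V' D AV' rD rk].
    by have [b' [E ub' ib']] := echi j D b ub ib; exists b'.
  have SD := (flag_set_inv inv2 rD).1 AV'; have rkD := represents_rank rD.
  have S1D := S1chi j D SD rkD rk.
  exists (flag_of rk); first exact: represents_flag_of.
  split; first by exists (chi j D) => //; exact: represents_flag_of.
  have [i ri] := expsi _ S1D rk.
  exists (chi j D), i; split=> //; first exact: represents_flag_of.
  by apply: (same_flag_represents _ (cyc2 i j D SD rkD rk ri)).1.
- move=> W V V' _ _ _ [C [i [SC rC rV]]] [C' [i' [SC' rC' rV']]].
  have rkC := represents_rank rC; have rkB := represents_rank rV.
  have SB := S2psi i C SC rkC rkB; have [j rj] := exchi _ SB rkB.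
  have /(represents_uptri rC') [b [E ub ib]] :=
    (same_flag_represents W (cyc1 i j C SC rkC rkB rj)).1 rC.
  have e := epsi i' C' b ub ib.
  have rk2 : \rank (psi i' (chi j (psi i C))) = k2.
    by rewrite E -(same_flag_rank e) (represents_rank rV').
  have r1 := (same_flag_represents V (cyc2 i' j _ SB rkB rj rk2)).1 rV.
  have r2 := (same_flag_represents V' e).1 rV'.
  by rewrite E in r1; exact: represents_inj r1 r2.
move=> W W' V _ _ _ [C [i [SC rC rV]]] [C' [i' [SC' rC' rV']]].
have rkC := represents_rank rC; have rkB := represents_rank rV.
have SB := S2psi i C SC rkC rkB; have [j rj] := exchi _ SB rkB.
have [b [E ub ib]] := represents_uptri rV rV'.
have e := echi j (psi i C) b ub ib; rewrite -E in e.
have r1 := (same_flag_represents W (cyc1 i j C SC rkC rkB rj)).1 rC.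
have rj' : \rank (chi j (psi i' C')) = k1 by rewrite -(same_flag_rank e).
have r2 := (same_flag_represents W' (cyc1 i' j C' SC' (represents_rank rC') (represents_rank rV')
  rj')).1 rC'.
exact: represents_inj ((same_flag_represents W e).1 r1) r2.
Qed.

Lemma closed_polyfuns n k (I : Type) (f : I -> 'M[F]_(n, k) -> F) :
  (forall i, polyfun (f i)) -> closed ([set C : 'M[F]_(n, k) | forall i,
    f i C = 0] : set (affine F n k)).
Proof.
move=> pf; rewrite -openC; apply/open_affineP => C nC.
have [i ni] : exists i, f i C != 0.
  by apply: contrapT => n0; apply: nC => i; apply: contrapT => /eqP ni; apply: n0; exists i.
by exists (f i); split=> // y /eqP fy h; apply: fy.
Qed.

Lemma closed_flag_set n k (S : set 'M[F]_(n, k)) (K : set (affine F n k)) :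
  closed K -> uptri_invariant S -> (forall C, \rank C = k -> S C <-> K C) ->
  closed (flag_set S).
Proof.
move=> /closed_openC/open_affineP oK inv h; rewrite -openC; apply: open_flagP => W C rC nC.
have [f [pf fC hf]] : exists f : 'M[F]_(n, k) -> F,
    [/\ polyfun f, f C != 0 & forall y, f y != 0 -> ~ K y].
  by apply: oK => KC; apply: nC; exists C => //; apply/(h C (represents_rank rC)).
exists f; split=> // C' W' rC' /hf nK /(flag_set_inv inv rC') SC'; apply: nK.
exact/(h C' (represents_rank rC')).
Qed.

Lemma flag_set_setT n k : flag_set (@setT 'M[F]_(n, k)) = [set: flag_variety F n k].
Proof. by apply/seteqP; split=> // W _; have [C rC] := flag_represented W; exists C. Qed.

Lemma isomorphic_flag_setT n k : isomorphic (subvar (flag_set (@setT 'M[F]_(n,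
  k)))) (flag_variety F n k).
Proof. by rewrite flag_set_setT; exact: isomorphic_setT. Qed.

Lemma irreducible_flag_setT n k : (k <= n)%N -> irreducible (flag_set (@setT 'M[F]_(n, k))).
Proof.
move=> kn; have -> : flag_set (@setT 'M[F]_(n, k)) = flag_set (setT `&` @full_rank F n k).
  apply/seteqP; split=> W [C _ rC]; exists C => //; split=> //; exact: represents_rank rC.
apply: irreducible_flag_set => [C [] //|].
apply: irreducible_openI; [exact: irreducible_affine|exact: open_full_rank|].
by exists (pid_mx k : 'M[F]_(n, k)); split=> //; rewrite /full_rank /= rank_pid_mx.
Qed.

Lemma uptri_cols2 n (C : 'M[F]_(n, 2)) (b : 'M_2) : uptri b ->
  col 0 (C *m b) = b 0 0 *: col 0 C /\
  col 1 (C *m b) = b 0 1 *: col 0 C + b 1 1 *: col 1 C.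
Proof.
move=> ub; have e j : col j (C *m b) = b 0 j *: col 0 C + b 1 j *: col 1 C.
  apply/colP => i; rewrite !mxE !big_ord_recl big_ord0 addr0 !(mulrC (C i _)).
  by congr (_ + b _ _ * C _ _); apply: val_inj.
by rewrite !e (ub 1 0) // scale0r addr0.
Qed.

Lemma uptri_diag2 (b : 'M[F]_2) : uptri b -> b \in unitmx -> b 0 0 != 0 /\ b 1 1 != 0.
Proof.
move=> ub; rewrite unitmxE unitfE -det_tr det_trig; last first.
  by apply/is_trig_mxP => i j ij; rewrite mxE ub.
rewrite !big_ord_recl big_ord0 mulr1 !mxE mulf_eq0 negb_or => /andP[h0 h1].
by split=> //; rewrite (_ : 1 = lift ord0 ord0) //; apply: val_inj.
Qed.

Lemma ord2P (P : 'I_2 -> Prop) : P 0 -> P 1 -> forall i, P i.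
Proof.
move=> h0 h1 [[|[|//]] lti].
- by have -> : Ordinal lti = 0 by apply: val_inj.
- by have -> : Ordinal lti = 1 by apply: val_inj.
Qed.

Lemma same_flag2 n (C C' : 'M[F]_(n, 2)) a b d : a != 0 -> d != 0 ->
  col 0 C' = a *: col 0 C -> col 1 C' = b *: col 0 C + d *: col 1 C -> same_flag C C'.
Proof.
move=> a0 d0 e0 e1; pose t : 'M[F]_2 := \matrix_(i, j) [:: [:: a; b]`_j; [:: 0; d]`_j]`_i.
have tE : ((t 0 0 = a) * (t 0 1 = b) * (t 1 0 = 0) * (t 1 1 = d))%type by rewrite !mxE.
have ut : uptri t by apply: ord2P; apply: ord2P => // _; rewrite tE.
have [c0 c1] := uptri_cols2 C ut.
exists t; split=> //.
  apply/matrixP => i j.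
  suff e : col j C' = col j (C *m t) by have /colP/(_ i) := e; rewrite !mxE.
  by move: j; apply: ord2P; rewrite ?c0 ?c1 ?e0 ?e1 !tE.
rewrite unitmxE unitfE -det_tr det_trig; last first.
  by apply/is_trig_mxP => i j ij; rewrite mxE ut.
rewrite !big_ord_recl big_ord0 mulr1 !mxE mulf_eq0 negb_or a0 /=; exact: d0.
Qed.

Lemma same_flag1 n (C C' : 'M[F]_(n, 1)) a : a != 0 -> C' = a *: C -> same_flag C C'.
Proof.
move=> a0 ->; exists a%:M; split; first by rewrite mul_mx_scalar.
  by move=> i j; rewrite !ord1.
by rewrite unitmxE det_scalar unitfE expf_neq0.
Qed.

Lemma uptri1 n (C : 'M[F]_(n, 1)) (b : 'M_1) : b \in unitmx ->
  C *m b = b 0 0 *: C /\ b 0 0 != 0.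
Proof.
move=> ib; have e : b = (b 0 0)%:M by apply/matrixP => i j; rewrite !ord1 mxE.
by split; [rewrite {1}e mul_mx_scalar|move: ib; rewrite {1}e unitmxE det_scalar unitfE expr1].
Qed.

Lemma rank1P n (C : 'M[F]_(n, 1)) : \rank C = 1 <-> C != 0.
Proof.
rewrite rank_injP; split=> [h|C0 a].
  apply/eqP => C0; have /matrixP/(_ 0 0) : (1%:M : 'cV[F]_1) = 0 by apply: h; rewrite C0 mul0mx.
  by rewrite !mxE => /eqP; rewrite oner_eq0.
have -> : a = (a 0 0)%:M by apply/matrixP => i j; rewrite !ord1 mxE.
rewrite mul_mx_scalar => /eqP; rewrite scaler_eq0 (negPf C0) orbF => /eqP ->.
by apply/matrixP => i j; rewrite !mxE mul0rn.
Qed.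

Lemma mul_cols2 n (C : 'M[F]_(n, 2)) (a : 'cV[F]_2) :
  C *m a = a 0 0 *: col 0 C + a 1 0 *: col 1 C.
Proof.
apply/colP => i; rewrite !mxE !big_ord_recl big_ord0 addr0 !(mulrC (C i _)).
by congr (_ * C _ _ + a _ _ * C _ _); apply: val_inj.
Qed.

Lemma rank2P n (C : 'M[F]_(n, 2)) : \rank C = 2 <->
  forall x y, x *: col 0 C + y *: col 1 C = 0 -> x = 0 /\ y = 0.
Proof.
rewrite rank_injP; split=> [h x y E|h a].
  pose a : 'cV[F]_2 := \col_i [:: x; y]`_i.
  have /colP a0 : a = 0 by apply: h; rewrite mul_cols2 !mxE.
  by move: (a0 0) (a0 1); rewrite !mxE.
by rewrite mul_cols2 => /h[z0 z1]; apply/colP; apply: ord2P; rewrite mxE.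
Qed.

End FlagSets.

(** * Subsets of Y as sets of flags in three-space *)

Section Isomorphisms.
Variable F : closedFieldType.

Lemma same_flag_refl n k (C : 'M[F]_(n, k)) : same_flag C C.
Proof.
exists 1%:M; rewrite mulmx1 unitmx1; split=> // i j ji.
by rewrite mxE -val_eqE /= gtn_eqF.
Qed.

Lemma same_flagM n m k (A : 'M[F]_(m, n)) (C C' : 'M[F]_(n, k)) :
  same_flag C C' -> same_flag (A *m C) (A *m C').
Proof. by move=> [b [-> ub ib]]; exists b; rewrite mulmxA. Qed.

Lemma same_flag3 n (C C' : 'M[F]_(n, 3)) a b d x y z :
  a != 0 -> d != 0 -> z != 0 -> col 0 C' = a *: col 0 C ->
  col 1 C' = b *: col 0 C + d *: col 1 C ->
  col 2%:R C' = x *: col 0 C + y *: col 1 C + z *: col 2%:R C -> same_flag C C'.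
Proof. by move=> a0 d0 z0 e0 e1 e2; exact: uptri_ex a0 d0 z0 e0 e1 e2. Qed.

Lemma col_row3 n (a : 'cV[F]_n) (B : 'M[F]_(n, 2)) : let C : 'M_(n, 3) := row_mx a B in
  [/\ col 0 C = a, col 1 C = col 0 B & col 2%:R C = col 1 B].
Proof.
split; apply/colP => i; rewrite mxE.
- by rewrite (_ : 0 = lshift 2 (0 : 'I_1)) ?(@row_mxEl _ n 1 2) //; apply: val_inj.
- by rewrite (_ : 1 = rshift 1 (0 : 'I_2)) ?(@row_mxEr _ n 1 2) ?mxE //; apply: val_inj.
- by rewrite (_ : 2%:R = rshift 1 (1 : 'I_2)) ?(@row_mxEr _ n 1 2) ?mxE //; apply: val_inj.
Qed.

Lemma col_row21 n (B : 'M[F]_(n, 2)) (v : 'cV[F]_n) : let C : 'M_(n, 3) := row_mx B v in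
  [/\ col 0 C = col 0 B, col 1 C = col 1 B & col 2%:R C = v].
Proof.
split; apply/colP => i; rewrite mxE.
- by rewrite (_ : 0 = lshift 1 (0 : 'I_2)) ?(@row_mxEl _ n 2 1) ?mxE //; apply: val_inj.
- by rewrite (_ : 1 = lshift 1 (1 : 'I_2)) ?(@row_mxEl _ n 2 1) ?mxE //; apply: val_inj.
- by rewrite (_ : 2%:R = rshift 2 (0 : 'I_1)) ?(@row_mxEr _ n 2 1) //; apply: val_inj.
Qed.

Lemma col_row2 n (a b : 'cV[F]_n) : let C : 'M_(n, 2) := row_mx a b in
  col 0 C = a /\ col 1 C = b.
Proof.
split; apply/colP => i; rewrite mxE.
- by rewrite (_ : 0 = lshift 1 (0 : 'I_1)) ?(@row_mxEl _ n 1 1) //; apply: val_inj.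
- by rewrite (_ : 1 = rshift 1 (0 : 'I_1)) ?(@row_mxEr _ n 1 1) //; apply: val_inj.
Qed.

Lemma col_inj n k (A B : 'M[F]_(n, k)) : (forall j, col j A = col j B) -> A = B.
Proof. by move=> h; apply/matrixP => i j; have /colP/(_ i) := h j; rewrite !mxE. Qed.

Lemma polymap_col n k n' k' (h : 'M[F]_(n, k) -> 'M[F]_(n', k')) j :
  polymap h -> polymap (fun A => col j (h A)).
Proof. by move=> ph i i'; apply: polyfun_ext (ph i j) => A; rewrite mxE. Qed.

Section Lower.
Implicit Types C : 'M[F]_(3 + 3, 3).

Lemma SY_lower C : SY C -> C = lower (dsubmx C) /\ dsubmx C \in unitmx.
Proof.
move=> [rC uC]; have CE : C = lower (dsubmx C).
  have z : usubmx C = 0.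
    by apply/matrixP => i j; rewrite [RHS]mxE; exact: (up0_col C j).1 (uC j) i.
  by rewrite /lower -z (@vsubmxK _ 3 3).
by split=> //; apply: lower_unit; rewrite -CE.
Qed.

Lemma rank_lower (G : 'M[F]_3) : \rank (lower G) = 3 <-> \rank G = 3.
Proof.
rewrite !rank_injP; split=> h a ha; apply: h.
  by rewrite /lower (@mul_col_mx _ 3 3) ha mul0mx (@col_mx0 _ 3 3).
move: ha; rewrite /lower (@mul_col_mx _ 3 3) -(@col_mx0 _ 3 3 1).
by move/(@eq_col_mx _ 3 3 1) => [].
Qed.

Lemma SY_of_lower (G : 'M[F]_3) : \rank G = 3 -> SY (lower G).
Proof.
by move=> rG; split=> [|j]; [exact/rank_lower|apply/up0_col => i; rewrite /lower col_mxKu mxE].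
Qed.

Lemma polymap_lower n k (h : 'M[F]_(n, k) -> 'M[F]_3) :
  polymap h -> polymap (fun A => lower (h A)).
Proof. by move=> ph; apply: (@polymap_col_mx _ n k 3 3); first exact: polymap_const. Qed.

Lemma isomorphic_SY_flag3 : isomorphic (subvar (flag_set (@SY F))) (flag_variety F 3 3).
Proof.
apply: isomorphic_trans (isomorphic_flag_setT F 3 3).
apply: (@flag_set_isomorphic F 6 3 3 3 (@SY F) setT unit unit (fun _ => @dsubmx F 3 3 3) (fun _ =>
  @lower F)).
- exact: SY_inv.
- by [].
- split=> // [_||].
  + move=> i j; apply: (@polyfun_ext F 6 3 (fun A : 'M_(6, 3) => A (@rshift 3 3 i) j)).
      by move=> A; rewrite mxE.
    exact: polyfun_entry.
  + by move=> _ D b ub ib; exists b; split=> //; rewrite mul_dsub_mx.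
  + by move=> C /SY_lower[_ uC] _; exists tt; apply: mxrank_unit.
- split=> // [_|_ D b ub ib|G _ rG|_ G _ rG _].
  + exact/polymap_lower/polymap_id.
  + by exists b; split=> //; rewrite /lower (@mul_col_mx _ 3 3) mul0mx.
  + by exists tt; apply/rank_lower.
  + exact: SY_of_lower.
- by move=> _ _ C /SY_lower[E _] _ _ _; rewrite -E; exact: same_flag_refl.
- by move=> _ _ G _ _ _ _; rewrite /lower (@col_mxKd _ 3 3); exact: same_flag_refl.
Qed.

Definition lo C : 'M[F]_(3, 2) := mxsub (@rshift 3 3) (widen_ord (leqnSn 2)) C.

Lemma col_lo C : col 0 (lo C) = col 0 (dsubmx C) /\ col 1 (lo C) = col 1 (dsubmx C).
Proof. by split; apply/colP => i; rewrite !mxE; congr (C _ _); apply: val_inj. Qed.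

Lemma lo_uptri C b : uptri b -> b \in unitmx -> same_flag (lo C) (lo (C *m b)).
Proof.
move=> ub ib; have [b0 b1 _] := uptri_diag ub ib.
have [l0 l1] := col_lo C; have [l0' l1'] := col_lo (C *m b).
have [c0 c1 _] := uptri_cols (dsubmx C) ub.
apply: (@same_flag2 _ _ _ _ (b 0 0) (b 0 1) (b 1 1)) => //.
  by rewrite l0' l0 -c0 mul_dsub_mx.
by rewrite l1' l0 l1 -c1 mul_dsub_mx.
Qed.

Lemma lo_lower (B : 'M[F]_(3, 2)) v : lo (lower (row_mx B v)) = B.
Proof.
have [l0 l1] := col_lo (lower (row_mx B v)); have [c0 c1 _] := col_row21 B v.
by apply/col_inj; apply: ord2P; rewrite ?l0 ?l1 /lower (@col_mxKd _ 3 3).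
Qed.

Lemma rank_complete (B : 'M[F]_(3, 2)) : \rank B = 2 ->
  exists i : 'I_3, \rank (row_mx B (delta_mx i 0) : 'M_3) = 3.
Proof.
move=> rB; apply: contrapT => no.
have d2 : \dim (span_cols B 2) = 2 by rewrite -(represents_flag_of rB) // flag_dim.
suff : (fullv <= span_cols B 2)%VS by move=> /dimvS; rewrite d2 dimvf.
suff h (i : 'I_3) : delta_mx i 0 \in span_cols B 2.
  apply/subvP => v _; rewrite (vec3P v).
  have -> : vec3 (v 0 0) (v 1 0) (v 2%:R 0) = \sum_(i < 3) v i 0 *: delta_mx i 0.
    apply/colP => i; rewrite -vec3P summxE (bigD1 i) //= big1 ?addr0.
      by rewrite !mxE !eqxx mulr1.
    by move=> j ji; rewrite !mxE eq_sym (negPf ji) mulr0.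
  by apply: memv_suml => i _; exact: memvZ.
apply: contrapT => /negP ni; apply: no; exists i; apply/rank3P => x y z.
have [-> -> ->] := col_row21 B (delta_mx i 0) => E.
have sB a b : a *: col 0 B + b *: col 1 B \in span_cols B 2.
  by rewrite span_cols2 memv_add // memvZ // memv_line.
have [z0|z0] := eqVneq z 0.
  by move: E; rewrite z0 scale0r addr0 => /(rank2P B).1 -/(_ rB)[].
case/negP: ni; have -> : delta_mx i 0 = (- x / z) *: col 0 B + (- y / z) *: col 1 B.
  apply: (scalerI z0); rewrite scalerDr !scalerA !(mulrC z) !divfK // !scaleNr.
  by apply/eqP; rewrite -opprD -addr_eq0 addrC E.
exact: sB.
Qed.

(** A full flag in three-space is determined by its line and plane. The inverse appends a standard
    basis vector, and the three choices cover everything. With the Hermitian condition as [S] this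
    describes the intersection of Y and Z. *)
Lemma isomorphic_SY_flag2 (S : set 'M[F]_(3, 2)) : uptri_invariant S ->
  isomorphic (subvar (flag_set [set C | SY C /\ S (lo C)])) (subvar (flag_set S)).
Proof.
move=> inv; apply: (@flag_set_isomorphic F 6 3 3 2 _ S unit 'I_3 (fun _ => lo)
  (fun i B => lower (row_mx B (delta_mx i 0)))) => //.
- move=> C b [SC hC] ub ib; split; first exact: SY_inv.
  by have [b' [-> ub' ib']] := lo_uptri C ub ib; exact: inv.
- split=> // [_|_ D b|C [SC hC] rC|_ C [] //].
  + exact/polymap_mxsub/polymap_id.
  + exact: lo_uptri.
  + exists tt; have [CE uC] := SY_lower SC; have [l0 l1] := col_lo C.
    have /rank3P rG := mxrank_unit uC; apply/rank2P => x y; rewrite l0 l1 => E.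
    by have [|-> -> _] := rG x y 0; rewrite ?scale0r ?addr0.
- split.
  + move=> i; apply: polymap_lower; apply: (@polymap_row_mx _ 3 2 3 2 1); first exact: polymap_id.
    exact: polymap_const.
  + move=> i D b ub ib; have [b0 b1] := uptri_diag2 ub ib; have [c0 c1] := uptri_cols2 D ub.
    have [d0 d1 d2] := col_row21 D (delta_mx i 0);
      have [e0 e1 e2] := col_row21 (D *m b) (delta_mx i 0).
    have [t [E ut it]] : same_flag (row_mx D (delta_mx i 0) : 'M_3) (row_mx (D *m b) (delta_mx i
      0)).
      apply: (@same_flag3 _ _ _ (b 0 0) (b 0 1) (b 1 1) 0 0 1);
        rewrite ?oner_neq0 ?d0 ?d1 ?d2 ?e0 ?e1 ?e2 //.
      by rewrite !scale0r scale1r !add0r.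
    by exists t; split=> //; rewrite E /lower (@mul_col_mx _ 3 3) mul0mx.
  + by move=> B _ /rank_complete[i ri]; exists i; apply/rank_lower.
  + by move=> i B SB rB /rank_lower rG; split; [exact: SY_of_lower|rewrite lo_lower].
- move=> _ i C [SC hC] rC _ /rank_lower rk; have [CE uC] := SY_lower SC.
  have [l0 l1] := col_lo C; have [e0 e1 e2] := col_row21 (lo C) (delta_mx i 0).
  set G := (dsubmx (C : 'M_(3 + 3, 3))) in CE uC l0 l1;
    pose a : 'cV[F]_3 := invmx G *m delta_mx i 0.
  have ha : delta_mx i 0 = a 0 0 *: col 0 G + a 1 0 *: col 1 G + a 2%:R 0 *: col 2%:R G :> 'cV_3.
    by rewrite -mul_cols3 mulmxA mulmxV // mul1mx.
  have a2 : a 2%:R 0 != 0.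
    apply/eqP => z; have [|_ _ /eqP] := (rank3P _).1 rk (- a 0 0) (- a 1 0) 1;
      last by rewrite oner_eq0.
    by rewrite e0 e1 e2 l0 l1 ha z scale0r addr0 scale1r !scaleNr addrACA !addNr addr0.
  have [t [E ut it]] : same_flag G (row_mx (lo C) (delta_mx i 0)).
    apply: (@same_flag3 _ _ _ 1 0 1 (a 0 0) (a 1 0) (a 2%:R 0)); rewrite ?oner_neq0 ?e0 ?e1 ?e2 //.
      by rewrite scale1r.
    by rewrite scale0r scale1r add0r.
  by exists t; split=> //; rewrite E CE /lower (@mul_col_mx _ 3 3) mul0mx.
- by move=> _ i B _ _ _ _; rewrite lo_lower; exact: same_flag_refl.
Qed.

End Lower.

End Isomorphisms.

(** * T_zeta as a set of flags in three-space *)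

Section Tsurface.
Variable F : closedFieldType.
Variables (p : nat) (f g w h k1 k2 : 'cV[F]_6).
Hypothesis TB : Tbasis p f g w h k1 k2.
Local Notation E := (basis6 f g w h k1 k2).

Let uE : E \in unitmx. Proof. exact: basis6_unit TB. Qed.

Definition vmid : 'M[F]_(6, 3) := cols3 (e 2) (e 3) (e 4).

Lemma vmidE (b : 'cV[F]_3) : vmid *m b = b 0 0 *: e 2 + b 1 0 *: e 3 + b 2%:R 0 *: e 4.
Proof. by rewrite mul_cols3 !col_cols3. Qed.

Lemma coord6_vmid (b : 'cV[F]_3) : ((coord6 (vmid *m b) 1 = 0) * (coord6 (vmid *m b) 2 = b 0 0) *
  (coord6 (vmid *m b) 3 = b 1 0) * (coord6 (vmid *m b) 4 = b 2%:R 0) *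
  (coord6 (vmid *m b) 5 = 0) * (coord6 (vmid *m b) 6 = 0))%type.
Proof. by rewrite vmidE; coords; rewrite !(mulr0, mulr1, addr0, add0r). Qed.

Lemma vmid_inj (b : 'cV[F]_3) : vmid *m b = 0 -> b = 0.
Proof.
move=> H; have H' k := congr1 (fun v => coord6 v k) H.
move: (H' 2%N) (H' 3%N) (H' 4%N); rewrite !coord6_vmid !coord60 => h2 h3 h4.
by apply/colP; apply: ord3P; rewrite [RHS]mxE.
Qed.

(* The coefficients of [f] are eliminated from the second and third column. *)
Definition Tproj (C : 'M[F]_(6, 3)) : 'M[F]_(3, 2) := \matrix_(k, j)
  (coord6 (invmx E *m col 0 C) 1 * coord6 (invmx E *m col (lift ord0 j) C) k.+2 -
   coord6 (invmx E *m col (lift ord0 j) C) 1 * coord6 (invmx E *m col 0 C) k.+2).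

Lemma TprojE (T : 'M[F]_(6, 3)) j k : Tproj (E *m T) k j =
  coord6 (col 0 T) 1 * coord6 (col (lift ord0 j) T) k.+2 -
  coord6 (col (lift ord0 j) T) 1 * coord6 (col 0 T) k.+2.
Proof. by rewrite mxE !col_mul !mulmxA !mulVmx // !mul1mx. Qed.

Definition Tlift (B : 'M[F]_(3, 2)) : 'M[F]_(6, 3) := E *m row_mx (e 1) (vmid *m B).

Lemma TliftE (B : 'M[F]_(3, 2)) (T := row_mx (e 1) (vmid *m B) : 'M[F]_(6, 3)) :
  [/\ col 0 T = e 1, col 1 T = vmid *m col 0 B & col 2%:R T = vmid *m col 1 B].
Proof. by have [] := col_row3 (e 1) (vmid *m B); rewrite !col_mul. Qed.

Lemma lift01 : (lift ord0 (0 : 'I_2) = 1) * (lift ord0 (1 : 'I_2) = 2%:R :> 'I_3).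
Proof. by split; apply: val_inj. Qed.

Lemma Tproj_lift B : Tproj (Tlift B) = B.
Proof.
have [t0 t1 t2] := TliftE B.
apply/matrixP => k j; rewrite TprojE; move: j; apply: ord2P; rewrite ?lift01 ?t0 ?t1 ?t2;
  move: k; apply: ord3P; rewrite !coord6e // !coord6_vmid !mxE !(mul1r, mulr0, mul0r, subr0) //.
Qed.

(* Passing to [W_2/<f> <= W_3/<f>] in the three-space [<f, g, w, h>/<f>] turns
   [T_zeta] into the flags [(V_1, V_2)] whose plane contains the line of [g]. *)
Definition T0 : set 'M[F]_(3, 2) := [set B | B 1 0 * B 2%:R 1 = B 2%:R 0 * B 1 1].

Lemma Tform_col0 (T : 'M[F]_(6, 3)) : Tform T ->
  col 0 T = coord6 (col 0 T) 1 *: e 1 /\ coord6 (col 0 T) 1 != 0.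
Proof.
move=> [rT h0 _ _]; have c : col 0 T = coord6 (col 0 T) 1 *: e 1.
  by apply: coord6Pe; coords; rewrite ?mulr1 ?mulr0 // h0.
split=> //; apply/eqP => z; have [|/eqP] := (rank3P T).1 rT 1 0 0; last by rewrite oner_eq0.
by rewrite c z !scale0r scaler0 !addr0.
Qed.

Lemma Tform_col (T : 'M[F]_(6, 3)) j (a := coord6 (col 0 T) 1) : Tform T ->
  a *: col (lift ord0 j) T = coord6 (col (lift ord0 j) T) 1 *: col 0 T + vmid *m col j (Tproj (E *m
    T)).
Proof.
move=> fT; have [c0 a0] := Tform_col0 fT; have [rT h0 h56 hm] := fT.
set c := col (lift ord0 j) T; have [h5 h6] : coord6 c 5 = 0 /\ coord6 c 6 = 0 := h56 _.
have t k : Tproj (E *m T) k j = a * coord6 c k.+2.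
  by rewrite TprojE (h0 k.+2) ?mulr0 ?subr0 //; case: k => -[|[|[|]]].
rewrite c0 -/a; apply: coord6Pe; rewrite coord6D !coord6Z coord6e // coord6_vmid ?h5 ?h6 /=.
- by ring.
- by rewrite mxE t; ring.
- by rewrite mxE t; ring.
- by rewrite mxE t; ring.
- by ring.
- by ring.
Qed.

Lemma Tproj_rank C : TE f g w h k1 k2 C -> \rank (Tproj C) = 2.
Proof.
move=> [T fT ->]; have [c0 a0] := Tform_col0 fT; have [rT _ _ _] := fT.
have := (Tform_col 0 fT, Tform_col 1 fT); rewrite !lift01 => -[t1 t2].
apply/rank2P => x y H; set a := coord6 (col 0 T) 1 in a0 t1 t2.
have [|_ /eqP + /eqP] := (rank3P T).1 rT (- (x * coord6 (col 1 T) 1 + y * coord6 (col 2%:R T) 1))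
  (x * a) (y * a).
  transitivity (vmid *m (x *: col 0 (Tproj (E *m T)) + y *: col 1 (Tproj (E *m T))));
    last by rewrite H mulmx0.
  by rewrite -!(scalerA _ a) t1 t2 mulmxDr -!scalemxAr; apply: coord6Pe; coords; ring.
by rewrite !mulf_eq0 (negPf a0) !orbF => /eqP -> /eqP ->.
Qed.

Lemma Tproj_T0 C : TE f g w h k1 k2 C -> T0 (Tproj C).
Proof.
move=> [T fT ->]; have [rT h0 h56 hm] := fT; rewrite /T0 /= !TprojE !lift01.
rewrite (h0 3%N isT) (h0 4%N isT) !mulr0 !subr0 mulrACA [RHS]mulrACA; congr (_ * _).
by rewrite hm mulrC.
Qed.

Lemma Tlift_TE B : T0 B -> \rank B = 2 -> TE f g w h k1 k2 (Tlift B).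
Proof.
move=> tB /rank2P rB; exists (row_mx (e 1) (vmid *m B)) => //.
have [t0 t1 t2] := TliftE B; split.
- apply/rank3P => x y z; rewrite t0 t1 t2 !scalemxAr -addrA -mulmxDr => H.
  have x0 : x = 0.
    have := congr1 (fun v => coord6 v 1) H; rewrite coord6D coord6Z coord6e // coord6_vmid coord60.
    by rewrite mulr1 addr0.
  by move: H; rewrite x0 scale0r add0r => /vmid_inj/rB[].
- by move=> k /andP[k1' k6]; rewrite t0 coord6e ?k6 ?(ltnW k1') // gtn_eqF.
- by apply: ord3P; rewrite ?t0 ?t1 ?t2 ?coord6_vmid // !coord6e.
- by rewrite t1 t2 !coord6_vmid !mxE tB mulrC.
Qed.

Lemma polymap_coord n k n' k' (L : 'M[F]_(6, n')) (M : 'M[F]_(n, k) -> 'M[F]_(n', k')) j l :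
  polymap M -> polyfun (fun A => coord6 (L *m col j (M A)) l).
Proof. by move=> pM; apply: polymapM; [exact: polymap_const|exact: polymap_col]. Qed.

Lemma Tproj_uptri D b : uptri b -> b \in unitmx -> same_flag (Tproj D) (Tproj (D *m b)).
Proof.
move=> ub ib; have [c0 c1 c2] := uptri_cols D ub; have [b0 b1 b2] := uptri_diag ub ib.
apply: (same_flag2 (a := (b 0 0 * b 1 1)) (b := (b 0 0 * b 1 2%:R)) (d := (b 0 0 * b 2%:R 2%:R)));
  rewrite ?mulf_neq0 //.
  apply/colP => k; rewrite !mxE !lift01 c0 c1 !mulmxDr -!scalemxAr !coord6D !coord6Z; ring.
apply/colP => k; rewrite !mxE !lift01 c0 c2 !mulmxDr -!scalemxAr !coord6D !coord6Z; ring.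
Qed.

Lemma Tlift_uptri B b : uptri b -> b \in unitmx -> same_flag (Tlift B) (Tlift (B *m b)).
Proof.
move=> ub ib; have [c0 c1] := uptri_cols2 B ub; have [b0 b1] := uptri_diag2 ub ib.
apply: same_flagM; have [t0 t1 t2] := TliftE B; have [s0 s1 s2] := TliftE (B *m b).
apply: (same_flag3 (a := 1) (b := 0) (d := b 0 0) (x := 0) (y := b 0 1) (z := b 1 1));
  rewrite ?oner_neq0 ?t0 ?t1 ?t2 ?s0 ?s1 ?s2 //.
- by rewrite scale1r.
- by rewrite scale0r add0r c0 scalemxAr.
- by rewrite scale0r add0r c1 mulmxDr !scalemxAr.
Qed.

Lemma Tlift_proj C : TE f g w h k1 k2 C -> same_flag C (Tlift (Tproj C)).
Proof.
move=> [T fT ->]; apply: same_flagM; have [c0 a0] := Tform_col0 fT.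
have [t0 t1 t2] := TliftE (Tproj (E *m T)).
have := (Tform_col 0 fT, Tform_col 1 fT); rewrite !lift01 => -[e1 e2].
set a := coord6 (col 0 T) 1 in a0 c0 e1 e2.
apply: (same_flag3 (a := a^-1) (b := - coord6 (col 1 T) 1) (d := a) (x := - coord6 (col 2%:R T) 1)
  (y := 0) (z := a));
  rewrite ?invr_neq0 ?t0 ?t1 ?t2 //.
- by rewrite {1}c0 scalerA mulVf // scale1r.
- by rewrite e1 scaleNr addrA addNr add0r.
- by rewrite e2 scale0r addr0 scaleNr addrA addNr add0r.
Qed.

(** The freedom in [S] makes one pair of formulas serve T_zeta itself ([S = T0]) and its
    intersections with Y and Z. *)
Lemma isomorphic_TE (S : set 'M[F]_(3, 2)) : uptri_invariant S -> S `<=` T0 ->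
  isomorphic (subvar (flag_set [set C | TE f g w h k1 k2 C /\ S (Tproj C)])) (subvar (flag_set S)).
Proof.
move=> inv sST; apply: (@flag_set_isomorphic F 6 3 3 2 _ S unit unit (fun _ => Tproj) (fun _ =>
  Tlift)) => //.
- move=> C b [TC SC] ub ib; split; first exact: TE_inv.
  by have [b' [-> ub' ib']] := Tproj_uptri C ub ib; exact: inv.
- split=> // [_||C [TC _] _|_ C [] //].
  + apply: polymap_mx => k j; apply: polyfunB; apply: polyfunM; apply: polymap_coord;
    exact: polymap_id.
  + by move=> _ D b; exact: Tproj_uptri.
  + by exists tt; exact: Tproj_rank.
- split=> // [_|_ D b|B SB rB|_ B SB rB _].
  + apply: polymapM; first exact: polymap_const.
    apply: (@polymap_row_mx _ 3 2 6 1 2); first exact: polymap_const.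
    by apply: polymapM; [exact: polymap_const|exact: polymap_id].
  + exact: Tlift_uptri.
  + exists tt; have [T [rT _ _ _] ->] := Tlift_TE (sST _ SB) rB.
    by rewrite eqmxMfull // row_full_unit.
  + by split; [exact: Tlift_TE (sST _ SB) rB|rewrite Tproj_lift].
- by move=> _ _ C [TC _] _ _ _; exact: Tlift_proj.
- by move=> _ _ B _ _ _ _; rewrite Tproj_lift; exact: same_flag_refl.
Qed.

End Tsurface.

(** * Projective lines of flags in three-space *)

Section Lines.
Variable F : closedFieldType.

(** The equation puts the columns of [B] into the image of [E], which therefore is V_2; V_1 is an
    arbitrary line in this plane. *)
Lemma isomorphic_line (E : 'M[F]_(3, 2)) (E' : 'M[F]_(2, 3)) : E' *m E = 1%:M ->
  isomorphic (subvar (flag_set [set B : 'M[F]_(3, 2) | B = E *m (E' *m B)])) (proj_space F 1).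
Proof.
move=> EE; apply: isomorphic_trans (isomorphic_flag_setT F 2 1).
apply: (@flag_set_isomorphic F 3 2 2 1 _ setT unit 'I_2 (fun _ B => E' *m col 0 B)
  (fun i l => E *m row_mx l (delta_mx i 0))) => //.
- by move=> C b SC _ _; rewrite /= !mulmxA -[E *m E' *m C]mulmxA -SC.
- split=> // [_|_ D b ub ib|B SB rB].
  + by apply: polymapM; [exact: polymap_const|exact/polymap_col/polymap_id].
  + have [-> _] := uptri_cols2 D ub; have [b0 _] := uptri_diag2 ub ib.
    by apply: (same_flag1 b0); rewrite scalemxAr.
  + exists tt; apply/rank1P; apply/eqP => z.
    have [|/eqP] := (rank2P B).1 rB 1 0; last by rewrite oner_eq0.
    have -> : col 0 B = E *m (E' *m col 0 B) by rewrite -!col_mul -SB.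
    by rewrite z mulmx0 scaler0 scale0r addr0.
- split.
  + move=> i; apply: polymapM; first exact: polymap_const.
    by apply: (@polymap_row_mx _ 2 1 2 1 1); [exact: polymap_id|exact: polymap_const].
  + move=> i D b _ ib; have [-> b0] := uptri1 D ib; apply: same_flagM.
    have [d0 d1] := col_row2 D (delta_mx i 0); have [s0 s1] := col_row2 (b 0 0 *: D) (delta_mx i 0).
    apply: (same_flag2 (a := b 0 0) (b := 0) (d := 1)); rewrite ?oner_neq0 // ?s0 ?s1 ?d0 ?d1 //.
    by rewrite scale0r scale1r add0r.
  + move=> l _ /rank1P l0.
    have [i ri] : exists i : 'I_2, \rank (row_mx l (delta_mx i 0) : 'M_2) = 2.
      have [z|z] := eqVneq (l 0 0) 0; [exists 0|exists 1]; apply/rank2P => x y.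
        have [-> ->] := col_row2 l (delta_mx 0 0) => /colP H; move: (H 0) (H 1); rewrite !mxE /=.
        have l1 : l 1 0 != 0.
          by apply: contra l0 => /eqP z1; apply/eqP/colP; apply: ord2P; rewrite mxE.
        rewrite z !mulr0 !mulr1 add0r addr0 => -> /eqP; rewrite mulf_eq0 (negPf l1) orbF.
        by move=> /eqP.
      have [-> ->] := col_row2 l (delta_mx 1 0) => /colP H; move: (H 0) (H 1); rewrite !mxE /=.
      rewrite !mulr0 addr0 => /eqP; rewrite mulf_eq0 (negPf z) orbF => /eqP ->.
      by rewrite mul0r add0r mulr1.
    exists i; apply/rank_injP => a; rewrite -mulmxA => H; apply: (rank_injP _).1 ri _ _.
    by rewrite -[LHS]mul1mx -EE -mulmxA H mulmx0.
  + by move=> i l _ _ _; rewrite /= !mulmxA -[E *m E' *m E]mulmxA EE mulmx1.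
- move=> _ i B SB rB _ rk; rewrite /= in SB.
  have rM : \rank (E' *m B) = 2.
    by apply/rank_injP => a H; apply: (rank_injP B).1 rB _ _;
      rewrite SB -!mulmxA (mulmxA E') H mulmx0.
  have uM : E' *m B \in unitmx by rewrite -row_free_unit /row_free rM.
  pose a : 'cV[F]_2 := invmx (E' *m B) *m delta_mx i 0.
  have ha : delta_mx i 0 = a 0 0 *: col 0 (E' *m B) + a 1 0 *: col 1 (E' *m B) :> 'cV_2.
    by rewrite -[LHS]mul1mx -(mulmxV uM) -mulmxA -/a mul_cols2.
  rewrite {1}SB; apply: same_flagM; have [s0 s1] := col_row2 (E' *m col 0 B) (delta_mx i 0).
  have a1 : a 1 0 != 0.
    apply/eqP => z; have [|_ /eqP] := (rank2P _).1 rk (- a 0 0) 1; last by rewrite oner_eq0.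
    rewrite !col_mul s0 s1 ha z scale0r addr0 -!col_mul scale1r.
    by rewrite !col_mul scaleNr !scalemxAr addNr.
  apply: (same_flag2 (a := 1) (b := a 0 0) (d := a 1 0)); rewrite ?oner_neq0 // ?s0 ?s1 //.
  by rewrite scale1r col_mul.
- move=> _ i l _ _ _ _; rewrite col_mul mulmxA EE mul1mx.
  by have [-> _] := col_row2 l (delta_mx i 0); exact: same_flag_refl.
Qed.

Lemma uptri_entries2 n (B : 'M[F]_(n, 2)) (b : 'M_2) i : uptri b ->
  (B *m b) i 0 = b 0 0 * B i 0 /\ (B *m b) i 1 = b 0 1 * B i 0 + b 1 1 * B i 1.
Proof.
by move=> /(uptri_cols2 B)[/colP/(_ i) c0 /colP/(_ i) c1]; move: c0 c1; rewrite ![in LHS]mxE !mxE.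
Qed.

Lemma row2E n (a b : 'cV[F]_n) i (C := row_mx a b : 'M_(n, 2)) : C i 0 = a i 0 /\ C i 1 = b i 0.
Proof. by have [/colP/(_ i) c0 /colP/(_ i) c1] := col_row2 a b; rewrite -c0 -c1 !mxE. Qed.

(** Here V_1 is fixed as the line of the first basis vector and V_2 varies; the coordinates of
    V_2/V_1 are 2 x 2 minors. *)
Definition L0 : set 'M[F]_(3, 2) := [set B | B 1 0 = 0 /\ B 2%:R 0 = 0].

Definition embed2 (l : 'cV[F]_2) : 'cV[F]_3 := vec3 0 (l 0 0) (l 1 0).

Lemma isomorphic_L0 : isomorphic (subvar (flag_set L0)) (proj_space F 1).
Proof.
apply: isomorphic_trans (isomorphic_flag_setT F 2 1).
apply: (@flag_set_isomorphic F 3 2 2 1 L0 setT unit unit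
  (fun _ B => \col_(i < 2) (B 0 0 * B (lift ord0 i) 1 - B (lift ord0 i) 0 * B 0 1))
  (fun _ l => row_mx (vec3 1 0 0) (embed2 l))) => //.
- move=> B b [h1 h2] ub ib; rewrite /L0 /= (uptri_entries2 B 1 ub).1 (uptri_entries2 B 2%:R ub).1.
  by rewrite h1 h2 !mulr0.
- split=> // [_|_ D b ub ib|B [h1 h2] rB].
  + apply: polymap_mx => i _; apply: polyfunB; apply: polyfunM; exact: polyfun_entry.
  + have c i := uptri_entries2 D i ub; have [b0 b1] := uptri_diag2 ub ib.
    apply: (same_flag1 (a := b 0 0 * b 1 1)); first by rewrite mulf_neq0.
    by apply/colP => i; rewrite [LHS]mxE [RHS]mxE [X in _ = _ * X]mxE !(c _).1 !(c _).2; ring.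
  + exists tt; apply/rank1P; apply/eqP => /colP z; move: (z 0) (z 1);
    rewrite !mxE !lift01 h1 h2 !mul0r !subr0.
    move=> z1 z2; have [|_ /eqP] := (rank2P B).1 rB (B 0 1) (- B 0 0).
      apply/colP; apply: ord3P; rewrite !mxE ?h1 ?h2 ?mulr0 ?mulNr ?z1 ?z2 ?oppr0 ?addr0 //.
      by rewrite mulrC subrr.
    rewrite oppr_eq0 => /eqP b00; have [|/eqP] := (rank2P B).1 rB 1 0; last by rewrite oner_eq0.
    by apply/colP; apply: ord3P; rewrite !mxE ?h1 ?h2 ?b00 !mul0r mulr0 addr0.
- split=> // [_|_ D b _ ib|l _ /rank1P l0|].
  + apply: (@polymap_row_mx _ 2 1 3 1 1); first exact: polymap_const.
    move=> i j; move: i; apply: ord3P.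
    * by apply: (@polyfun_ext F 2 1 (fun=> 0)); [move=> A; rewrite mxE|exact: polyfun_const].
    * by apply: (@polyfun_ext F 2 1 (fun A => A 0 0)); [move=> A; rewrite mxE|exact: polyfun_entry].
    * by apply: (@polyfun_ext F 2 1 (fun A => A 1 0)); [move=> A; rewrite mxE|exact: polyfun_entry].
  + have [-> b0] := uptri1 D ib.
    have [d0 d1] := col_row2 (vec3 1 0 0) (embed2 D).
    have [s0 s1] := col_row2 (vec3 1 0 0) (embed2 (b 0 0 *: D)).
    apply: (same_flag2 (a := 1) (b := 0) (d := b 0 0));
      rewrite ?oner_neq0 // ?s0 ?s1 ?d0 ?d1 ?scale1r //.
    by rewrite scale0r add0r; apply/colP; apply: ord3P; rewrite !mxE /= ?mulr0.
  + exists tt; apply/rank2P => x y; have [-> ->] := col_row2 (vec3 1 0 0) (embed2 l) => /colP H.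
    move: (H 0) (H 1) (H 2%:R); rewrite !mxE /= !mulr0 !mulr1 addr0 !add0r => -> /eqP y0 /eqP y1.
    split=> //; apply/eqP; apply: contraT => yn; case/eqP: l0; apply/colP; apply: ord2P;
      rewrite [RHS]mxE.
      by move: y0; rewrite mulf_eq0 (negPf yn) => /eqP.
    by move: y1; rewrite mulf_eq0 (negPf yn) => /eqP.
  + by move=> _ l _ _ _; rewrite /L0 /= !(row2E _ _ _).1 !mxE.
- move=> _ _ B [h1 h2] rB _ _.
  set l := (X in embed2 X); have [s0 s1] := col_row2 (vec3 1 0 0) (embed2 l).
  have b0 : B 0 0 != 0.
    apply/eqP => z; have [|/eqP] := (rank2P B).1 rB 1 0; last by rewrite oner_eq0.
    by apply/colP; apply: ord3P; rewrite !mxE ?h1 ?h2 ?z !mul0r mulr0 addr0.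
  apply: (same_flag2 (a := (B 0 0)^-1) (b := - B 0 1) (d := B 0 0)); rewrite ?invr_neq0 // ?s0 ?s1.
    by apply/colP; apply: ord3P; rewrite !mxE /= ?h1 ?h2 ?mulr0 // mulVf.
  apply/colP; apply: ord3P; rewrite !mxE /= ?lift01 ?h1 ?h2 ?mulr0 ?mul0r ?subr0 ?add0r //.
  by rewrite mulNr mulrC addNr.
- move=> _ _ l _ _ _ _; set l' := (X in same_flag _ X).
  suff -> : l' = l by exact: same_flag_refl.
  apply/colP => i; rewrite /l' mxE !(row2E _ _ _).1 !(row2E _ _ _).2 !mxE /= mulr0 subr0 mul1r.
  by move: i; apply: ord2P.
Qed.

End Lines.

(** * Irreducibility *)

Section Irreducibility.
Variable F : closedFieldType.

(** The parametrisation may take values of smaller rank; these are removed by intersecting its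
    irreducible image with the open set of matrices of full rank. *)
Lemma irreducible_flag_param n' k' n k (H : set (affine F 3 1))
    (h : 'M[F]_(3, 1) -> 'M[F]_(n', k') -> 'M[F]_(n, k)) (S : set 'M[F]_(n, k)) :
  irreducible H -> (forall v, polymap (h^~ v)) -> (forall m, polymap (h m)) ->
  (forall m v, H m -> \rank (h m v) = k -> S (h m v)) ->
  (forall C, S C -> \rank C = k -> exists m v, H m /\ C = h m v) ->
  (exists2 C, S C & \rank C = k) -> irreducible (flag_set S).
Proof.
move=> iH ph1 ph2 hS Sh [C0 S0 r0].
pose A : set (affine F n k) := [set (h m v : affine F n k) | m in H & v in [set: affine F n' k']].
have -> : flag_set S = flag_set (A `&` @full_rank F n k).
  apply/seteqP; split=> W [C SC rC]; exists C => //.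
    have rk := represents_rank rC; have [m [v [Hm E]]] := Sh C SC rk.
    by split=> //; rewrite E; exists m => //; exists v.
  by case: SC => [[m Hm [v _ E]] rk]; rewrite -E; apply: hS => //; rewrite E.
apply: irreducible_flag_set => [C [] //|].
apply: irreducible_openI; last 1 first.
- exists C0; split=> //; have [m [v [Hm ->]]] := Sh C0 S0 r0.
  by exists m => //; exists v.
- apply: irreducible_image2 => //; last exact: irreducible_affine.
  + move=> v U oU; exact: (@open_polymap F 3 1 n k (h^~ v) U (ph1 v) oU).
  + move=> m U oU; exact: (@open_polymap F n' k' n k (h m) U (ph2 m) oU).
- exact: open_full_rank.
Qed.

(** The equation says that the last two rows of [B] form a matrix of determinant zero, that is, a
    column times a row. Both factors and the first row are free parameters, so the base of the
    family is the single point 0. *)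
Lemma irreducible_T0 : irreducible (flag_set (@T0 F)).
Proof.
pose h (m : 'M[F]_(3, 1)) (P : 'M[F]_(3 + 2, 2)) : 'M[F]_(3, 2) :=
  row_mx (vec3 1 0 0) (col 0 (usubmx P)) *m dsubmx P.
have hE m P i j : h m P i j = (i == 0)%:R * dsubmx P 0 j + usubmx P i 0 * dsubmx P 1 j.
  have [c0 c1] := row2E (vec3 1 0 0) (col 0 (usubmx P)) i.
  rewrite [LHS]mxE !big_ord_recl big_ord0 addr0.
  have -> : lift ord0 ord0 = 1 :> 'I_2 by apply: val_inj.
  rewrite c0 c1 [in LHS]mxE [col _ _ _ _]mxE; congr (_ * _ + _).
  by move: i {c0 c1}; apply: ord3P.
apply: (@irreducible_flag_param _ _ _ _ [set 0] h).
- exact: irreducible_set1.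
- by move=> v; exact: polymap_const.
- move=> m; apply: polymapM.
    apply: (@polymap_row_mx _ _ _ 3 1 1); first exact: polymap_const.
    by move=> i j; apply: (@polyfun_ext F (3 + 2) 2 (fun A => A (lshift 2 i) 0)); [move=> A;
      rewrite !mxE|exact: polyfun_entry].
  by move=> i j; apply: (@polyfun_ext F (3 + 2) 2 (fun A => A (rshift 3 i) j)); [move=> A;
    rewrite !mxE|exact: polyfun_entry].
- by move=> m P _ _; rewrite /T0 /= !hE /=; ring.
- move=> B tB _; rewrite /T0 /= in tB.
  have [y1 [y2 [n0 [n1 [e1 e2 e3 e4]]]]] : exists y1 y2 n0 n1,
      [/\ B 1 0 = n0 * y1, B 2%:R 0 = n0 * y2, B 1 1 = n1 * y1 & B 2%:R 1 = n1 * y2].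
    have [z1|z1] := eqVneq (B 1 0) 0; last first.
      exists (B 1 0), (B 2%:R 0), 1, (B 1 1 / B 1 0); rewrite !mul1r divfK //; split=> //.
      by apply: (mulfI z1); rewrite tB; field.
    have [z2|z2] := eqVneq (B 2%:R 0) 0; last first.
      exists (B 1 0), (B 2%:R 0), 1, (B 2%:R 1 / B 2%:R 0); rewrite !mul1r divfK //; split=> //.
      by apply: (mulfI z2); rewrite -tB z1; ring.
    by exists (B 1 1), (B 2%:R 1), 0, 1; rewrite !mul0r !mul1r.
  pose N : 'M[F]_2 := \matrix_(i, j) [:: B 0 j; [:: n0; n1]`_j]`_i.
  exists 0, (col_mx (row_mx (vec3 0 y1 y2) 0) N); split=> //.
  have us : usubmx (col_mx (row_mx (vec3 0 y1 y2) 0) N : 'M_(3 + 2,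
    1 + 1)) = row_mx (vec3 0 y1 y2) 0.
    by rewrite col_mxKu.
  have ds : dsubmx (col_mx (row_mx (vec3 0 y1 y2) 0) N : 'M_(3 + 2, 1 + 1)) = N by rewrite col_mxKd.
  apply/matrixP => i j; rewrite hE us ds (row2E _ _ _).1 !mxE.
  move: i j; apply: ord3P; apply: ord2P; rewrite /= ?mul1r ?mul0r ?add0r ?addr0 // mulrC //.
- exists (row_mx (vec3 1 0 0) (vec3 0 1 0)).
    by rewrite /T0 /= !(row2E _ _ _).1 !(row2E _ _ _).2 !vec3E mulr0 mul0r.
  apply/rank2P => x y; have [-> ->] := col_row2 (vec3 1 0 0) (vec3 0 1 0 : 'cV[F]_3) => /colP H.
  by move: (H 0) (H 1); rewrite !mxE /= !mulr0 !mulr1 addr0 add0r.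
Qed.

Definition cross (m q : 'cV[F]_3) : 'cV[F]_3 :=
  vec3 (m 1 0 * q 2%:R 0 - m 2%:R 0 * q 1 0) (m 2%:R 0 * q 0 0 - m 0 0 * q 2%:R 0)
       (m 0 0 * q 1 0 - m 1 0 * q 0 0).

Lemma minors_cross (B : 'M[F]_(3, 2)) : minors B = cross (col 0 B) (col 1 B).
Proof.
have [d1 d2 d3] := detB_formula B; rewrite minorsE d1 d2 d3 /cross !mxE.
by congr vec3; ring.
Qed.

(** The factor is the determinant of (m, q, r). *)
Lemma cross_cross (m q r : 'cV[F]_3) : exists c, cross (cross m q) (cross m r) = c *: m.
Proof.
exists (m 0 0 * (q 1 0 * r 2%:R 0 - q 2%:R 0 * r 1 0) + m 1 0 * (q 2%:R 0 * r 0 0 - q 0 0 * r 2%:R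
  0) +
  m 2%:R 0 * (q 0 0 * r 1 0 - q 1 0 * r 0 0)).
by rewrite [in RHS](vec3P m); apply/colP; apply: ord3P; rewrite [RHS]mxE /cross !vec3E; ring.
Qed.

(** By (a × b) × q = (a·q) b - (b·q) a, vectors dual to the columns, up to sign, recover them from
    their cross product. *)
Lemma rank2_cross (B : 'M[F]_(3, 2)) : \rank B = 2 -> exists q r,
  B = row_mx (cross (minors B) q) (cross (minors B) r).
Proof.
move=> rB; have /row_freeP[R hR] : row_free B^T by rewrite /row_free mxrank_tr rB.
have h i j : B 0 i * R 0 j + B 1 i * R 1 j + B 2%:R i * R 2%:R j = (i == j)%:R.
  move/matrixP/(_ i j): hR; rewrite !mxE !big_ord_recl big_ord0 addr0 !mxE addrA => <-.
  by congr (_ + B _ _ * R _ _ + B _ _ * R _ _); apply: val_inj.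
exists (- col 1 R), (col 0 R); apply: col_inj.
have [c0 c1] := col_row2 (cross (minors B) (- col 1 R)) (cross (minors B) (col 0 R)).
have key q : cross (minors B) q = (B 0 0 * q 0 0 + B 1 0 * q 1 0 + B 2%:R 0 * q 2%:R 0) *: col 1 B -
    (B 0 1 * q 0 0 + B 1 1 * q 1 0 + B 2%:R 1 * q 2%:R 0) *: col 0 B.
  have sc (a b : F) (x y : 'cV[F]_3) i : (a *: x - b *: y) i 0 = a * x i 0 - b * y i 0.
    by rewrite !mxE.
  by rewrite minors_cross; apply/colP; apply: ord3P; rewrite sc /cross !vec3E ![col _ _ _ _]mxE;
    ring.
have rN i : (- col 1 R) i 0 = - R i 1 by rewrite !mxE.
have r0 i : col 0 R i 0 = R i 0 by rewrite mxE.
apply: ord2P; rewrite ?c0 ?c1 key ?rN ?r0 ?mulrN -?opprD !h /=.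
  by rewrite oppr0 scale0r scaleN1r opprK add0r.
by rewrite scale0r subr0 scale1r.
Qed.

Lemma polymap_crossl q : polymap (fun m => cross m q).
Proof.
move=> i j; rewrite (ord1 j); move: i; apply: ord3P;
  apply: (@polyfun_ext F 3 1 (fun m : 'cV_3 => _));
  first [by move=> m; rewrite /cross vec3E; reflexivity | 
  apply: polyfunB; apply: polyfunM; first [exact: polyfun_entry | exact: polyfun_const]].
Qed.

Lemma polymap_crossr n k m (q : 'M[F]_(n, k) -> 'cV[F]_3) : polymap q ->
  polymap (fun A => cross m (q A)).
Proof.
move=> pq i j; rewrite (ord1 j); move: i; apply: ord3P; apply: (@polyfun_ext F n k (fun m : 'M_(n,
  k) => _));
  first [by move=> A; rewrite /cross vec3E; reflexivity | 
  apply: polyfunB; apply: polyfunM; first [exact: pq | exact: polyfun_const]].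
Qed.

(* [W_1] and [W_2] are spanned by vectors orthogonal to [m], hence of the form
   [m x q]. *)
Definition Zparam (m : 'cV[F]_3) (v : 'M[F]_(3 + 1, 3)) : 'M[F]_(6, 3) :=
  @block_mx F 3 3 2 1 0 (dsubmx v 0 0 *: m)
    (row_mx (cross m (col 0 (usubmx v))) (cross m (col 1 (usubmx v)))) (col 2%:R (usubmx v)).

Lemma Zparam_SZ' m v : \rank (Zparam m v) = 3 -> SZ' (Zparam m v) /\
  exists c, nrm (col 0 (Zparam m v)) (col 1 (Zparam m v)) = c *: m.
Proof.
rewrite /Zparam block_cols3; set al := dsubmx v 0 0; set q := col 0 (usubmx v);
  set r := col 1 (usubmx v); set u := col 2%:R _.
have [-> ->] := col_row2 (cross m q) (cross m r) => rk; split; last first.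
  rewrite !col_cols3; have [c hc] := cross_cross m q r; exists c; rewrite -hc.
  have [s0 s1] := col_row2 (cross m q) (cross m r).
  by have := nrm_minors (row_mx (cross m q) (cross m r)); rewrite minors_cross s0 s1.
split=> //; rewrite ?col_cols3; [|exact: up0_stack|exact: up0_stack].
have z x : pairing (stack 0 (cross m x)) (stack (al *: m) u) = 0.
  by rewrite pairing6 !coord6_stack /cross !vec3E !mxE; ring.
have z' x : pairing (stack (al *: m) u) (stack 0 (cross m x)) = 0 by rewrite pairingC z oppr0.
apply/isotropicP; apply: ord3P; apply: ord3P; rewrite !col_cols3 ?pairing_self //;
  by apply: pairing_up0; exact: up0_stack.
Qed.

Lemma polymap_Zparaml v : polymap (Zparam^~ v).
Proof.
apply: (@polymap_col_mx _ 3 1 3 3).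
  apply: (@polymap_row_mx _ 3 1 3 2 1); first exact: polymap_const.
  move=> i j; apply: (@polyfun_ext F 3 1 (fun m => dsubmx v 0 0 * m i j)); first by move=> m;
    rewrite [RHS]mxE.
  by apply: polyfunM; [exact: polyfun_const|exact: polyfun_entry].
apply: (@polymap_row_mx _ 3 1 3 2 1); last exact: polymap_const.
by apply: (@polymap_row_mx _ 3 1 3 1 1); exact: polymap_crossl.
Qed.

Lemma polymap_Zparamr m : polymap (Zparam m).
Proof.
have pu j : polymap (fun v : 'M[F]_(3 + 1, 3) => col j (usubmx v)).
  by move=> i l; apply: (@polyfun_ext F (3 + 1) 3 (fun v => v (lshift 1 i) j)); [move=> v;
    rewrite !mxE|exact: polyfun_entry].
apply: (@polymap_col_mx _ (3 + 1) 3 3 3).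
  apply: (@polymap_row_mx _ (3 + 1) 3 3 2 1); first exact: polymap_const.
  move=> i j; apply: (@polyfun_ext F (3 + 1) 3 (fun v => v (rshift 3 0) 0 * m i j)).
    by move=> v; rewrite !mxE.
  by apply: polyfunM; [exact: polyfun_entry|exact: polyfun_const].
apply: (@polymap_row_mx _ (3 + 1) 3 3 2 1) => //.
by apply: (@polymap_row_mx _ (3 + 1) 3 3 1 1); exact: polymap_crossr.
Qed.

Section Zfamily.
(** [H] is the parameter cone of normal vectors and [Q] the resulting condition. The scalar in [HQ]
    may be 0, as the cross product of two parameter vectors can degenerate, and the Hermitian cone
    omits 0; hence the asymmetry with [QH]. *)
Variables (H : set (affine F 3 1)) (Q : 'cV[F]_3 -> Prop).
Hypotheses (iH : irreducible H) (HQ : forall c m, H m -> Q (c *: m)).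
Hypothesis QH : forall m, m != 0 -> Q m -> H m.

Lemma irreducible_Zfamily (S : set 'M[F]_(6, 3)) :
  (forall C, S C <-> SZ' C /\ Q (nrm (col 0 C) (col 1 C))) ->
  (exists2 C, S C & \rank C = 3) -> irreducible (flag_set S).
Proof.
move=> SE; apply: (@irreducible_flag_param _ _ _ _ H Zparam) => //.
- exact: polymap_Zparaml.
- exact: polymap_Zparamr.
- by move=> m v Hm rk; apply/SE; have [SC [c ->]] := Zparam_SZ' rk; split=> //; exact: HQ.
move=> C /SE[SC QC] _; have [s [u [B [nB n0 CE]]]] := SZ_normal SC.
have [q [r BE]] := rank2_cross (rank_minors n0).
exists (minors B), (col_mx (row_mx q (row_mx r u)) (row_mx s%:M 0) : 'M_(3 + 1, 1 + 2)).
split; first by apply: QH => //; rewrite -nB.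
have [c0 c1 c2] := col_row3 q (row_mx r u); have [d0 d1] := col_row2 r u.
rewrite /Zparam (@col_mxKu _ 3 1) (@col_mxKd _ 3 1) c0 c1 c2 d0 d1 -BE [LHS]CE.
congr (@block_mx F 3 3 2 1 0 (_ *: _) B u).
by rewrite (_ : 0 = lshift 2 (0 : 'I_1)) ?(@row_mxEl _ 1 1 2) ?mxE //; apply: val_inj.
Qed.

Lemma irreducible_Z0family : (exists2 B : 'M[F]_(3, 2), Q (minors B) & \rank B = 2) ->
  irreducible (flag_set [set B : 'M[F]_(3, 2) | Q (minors B)]).
Proof.
pose h (m : 'cV[F]_3) (v : 'M[F]_(3, 2)) : 'M[F]_(3,
  2) := row_mx (cross m (col 0 v)) (cross m (col 1 v)).
move=> ne; apply: (@irreducible_flag_param _ _ _ _ H h) => //.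
- by move=> v; apply: (@polymap_row_mx _ 3 1 3 1 1); exact: polymap_crossl.
- move=> m; apply: (@polymap_row_mx _ 3 2 3 1 1); apply: polymap_crossr;
  exact/polymap_col/polymap_id.
- move=> m v Hm _; have [s0 s1] := col_row2 (cross m (col 0 v)) (cross m (col 1 v)).
  by rewrite /= minors_cross s0 s1; have [c ->] := cross_cross m (col 0 v) (col 1 v); exact: HQ.
move=> B QB rB; have [q [r BE]] := rank2_cross rB; exists (minors B), (row_mx q r); split.
  apply: QH => //; apply/eqP => z; have /rank2P/(_ 1 0)[|/eqP] := rB; last by rewrite oner_eq0.
  have [c0 _] := col_row2 (cross (minors B) q) (cross (minors B) r).
  have -> : col 0 B = cross (minors B) q by rewrite {1}BE.
  rewrite z scale0r addr0 scale1r; apply/colP; apply: ord3P;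
    rewrite /cross !vec3E !mxE !mul0r subr0 //.
by have [c0 c1] := col_row2 q r; rewrite /h c0 c1.
Qed.

End Zfamily.

End Irreducibility.

(** * Closedness *)

Section ClosedSets.
Variable F : closedFieldType.

Lemma polyfun_herm p : polyfun (@herm F p).
Proof.
by repeat first [exact: polyfun_entry | apply: polyfunD | apply: polyfunM | apply: polyfunX].
Qed.

Lemma polymap_vec3 n k (a b c : 'M[F]_(n, k) -> F) :
  polyfun a -> polyfun b -> polyfun c -> polymap (fun A => vec3 (a A) (b A) (c A)).
Proof.
move=> pa pb pc i j; rewrite (ord1 j); move: i; apply: ord3P.
- by apply: (@polyfun_ext F n k a) => // A; rewrite vec3E.
- by apply: (@polyfun_ext F n k b) => // A; rewrite vec3E.
- by apply: (@polyfun_ext F n k c) => // A; rewrite vec3E.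
Qed.

Lemma polyfun_coord6 n k (M : 'M[F]_(n, k) -> 'M[F]_(6, 3)) j l :
  polymap M -> polyfun (fun A => coord6 (col j (M A)) l).
Proof. by move=> pM; exact: polymap_col. Qed.

Lemma polymap_nrm : polymap (fun C : 'M[F]_(6, 3) => nrm (col 0 C) (col 1 C)).
Proof.
by apply: polymap_vec3; apply: polyfunB; apply: polyfunM; apply: polyfun_coord6; exact: polymap_id.
Qed.

Lemma polymap_minors : polymap (@minors F).
Proof.
have pe i j : polyfun (fun B : 'M[F]_(3, 2) => col j B i 0) by apply: polymap_col;
  exact: polymap_id.
have pc : polymap (fun B : 'M[F]_(3, 2) => cross (col 0 B) (col 1 B)).
  by apply: polymap_vec3; apply: polyfunB; apply: polyfunM; exact: pe.
by move=> i j; apply: polyfun_ext (pc i j) => B; rewrite minors_cross.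
Qed.

Lemma closed_zero n k (f : 'M[F]_(n, k) -> F) : polyfun f ->
  closed ([set C | f C = 0] : set (affine F n k)).
Proof.
move=> pf; have -> : [set C | f C = 0] = [set C | forall _ : unit, f C = 0].
  by apply/seteqP; split=> C h //; exact: h tt.
exact: closed_polyfuns.
Qed.

Lemma closed_up0 j : closed ([set C : 'M[F]_(6, 3) | up0 (col j C)] : set (affine F 6 3)).
Proof.
have -> : [set C : 'M[F]_(6, 3) | up0 (col j C)] =
    [set C | coord6 (col j C) 1 = 0] `&` [set C | coord6 (col j C) 2 = 0] `&` [set C | coord6 (col
      j C) 3 = 0].
  by apply/seteqP; split=> C => [[]|[[]]].
by do ![apply: closedI]; apply: closed_zero; apply: polyfun_coord6; exact: polymap_id.
Qed.

Lemma closed_isotropic : closed ([set C | isotropic C] : set (affine F 6 3)).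
Proof.
have -> : [set C : 'M[F]_(6, 3) | isotropic C] =
    [set C | forall ij : 'I_3 * 'I_3, (C^T *m Jmx F *m C) ij.1 ij.2 = 0].
  apply/seteqP; split=> C /= h; first by move=> ij; rewrite h mxE.
  by apply/matrixP => i j; rewrite (h (i, j)) mxE.
apply: closed_polyfuns => ij; apply: polymapM; last exact: polymap_id.
by apply: polymapM; [exact/polymap_tr/polymap_id|exact: polymap_const].
Qed.

Lemma SY_isotropic (C : 'M[F]_(6, 3)) : SY C -> isotropic C.
Proof. by move=> [_ uC]; apply/isotropicP => i j; exact: pairing_up0. Qed.

Lemma closed_flag_SY : closed (flag_set (@SY F)).
Proof.
apply: (@closed_flag_set F 6 3 _ ([set C | up0 (col 0 C)] `&` [set C | up0 (col 1 C)] `&`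
    [set C | up0 (col 2%:R C)])).
- by do ![apply: closedI]; exact: closed_up0.
- exact: SY_inv.
- by move=> C rC; split=> [[_ uC]|[[u0 u1] u2]]; [split; [split|]; exact: uC|split=> //;
  exact: ord3P].
Qed.

Lemma closed_flag_SZ p : p \in [pchar F] -> closed (flag_set (@SZ F p)).
Proof.
move=> charFp; apply: (@closed_flag_set F 6 3 _ ([set C | isotropic C] `&` [set C | up0 (col 0 C)]
  `&`
    [set C | up0 (col 1 C)] `&` [set C | herm p (nrm (col 0 C) (col 1 C)) = 0])).
- do ![apply: closedI]; first [exact: closed_isotropic|exact: closed_up0|idtac].
  apply: closed_zero; apply: (@polyfun_comp F 6 3 3 1 (fun C => nrm (col 0 C) (col 1 C))).
    exact: polymap_nrm.
  exact: polyfun_herm.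
- exact: SZ_inv.
- by move=> C rC; split=> [[[]]|[[[]]]].
Qed.

Lemma closed_flag_TE p f g w h k1 k2 : Tbasis p f g w h k1 k2 ->
  closed (flag_set (TE f g w h k1 k2 : set 'M[F]_(6, 3))).
Proof.
move=> TB; have uE := basis6_unit TB; set E := basis6 f g w h k1 k2 in uE.
have [T [hT pT]] : exists T : 'M[F]_(6, 3) -> 'M[F]_(6, 3), (forall C,
  T C = invmx E *m C) /\ polymap T.
  by exists (mulmx (invmx E)); split=> //; apply: polymapM;
    [exact: polymap_const|exact: polymap_id].
apply: (@closed_flag_set F 6 3 _ ([set C | forall k : 'I_5, coord6 (col 0 (T C)) k.+2 = 0] `&`
   [set C | forall jk : 'I_3 * bool, coord6 (col jk.1 (T C)) (5 + jk.2) = 0] `&`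
   [set C | coord6 (col 1 (T C)) 3 * coord6 (col 2%:R (T C)) 4 -
            coord6 (col 2%:R (T C)) 3 * coord6 (col 1 (T C)) 4 = 0])).
- do ![apply: closedI].
  + by apply: closed_polyfuns => k; exact: polyfun_coord6.
  + by apply: closed_polyfuns => k; exact: polyfun_coord6.
  + by apply: closed_zero; apply: polyfunB; apply: polyfunM; exact: polyfun_coord6.
- exact: TE_inv.
move=> C rC; split=> [[T' [_ h0 h56 hm] CE]|[[h0 h56] /eqP]].
  have TC : T C = T' by rewrite hT CE mulmxA mulVmx // mul1mx.
  split; last by rewrite /= TC hm subrr.
  split=> /=; rewrite TC; first by move=> k; apply: h0; case: k => k /=.
  by move=> [j []]; have [] := h56 j.
rewrite subr_eq0 => /eqP hm; exists (T C); last by rewrite hT mulmxA mulmxV // mul1mx.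
split=> //.
- by rewrite hT eqmxMfull // row_full_unit unitmx_inv.
- case=> [|[|k]] // /andP[_ hk]; exact: (h0 (Ordinal (hk : (k < 5)%N))).
- by move=> j; split; [exact: (h56 (j, false))|exact: (h56 (j, true))].
Qed.

Lemma T0_inv : uptri_invariant (@T0 F).
Proof.
move=> B b; rewrite /T0 /= => tB ub _.
rewrite !(uptri_entries2 B _ ub).1 !(uptri_entries2 B _ ub).2 !mulrDr.
congr (_ + _); first by ring.
by rewrite mulrACA tB; ring.
Qed.

Lemma closed_flag_T0 : closed (flag_set (@T0 F)).
Proof.
apply: (@closed_flag_set F 3 2 _ [set B | B 1 0 * B 2%:R 1 - B 2%:R 0 * B 1 1 = 0]).
- apply: closed_zero; apply: polyfunB; apply: polyfunM; exact: polyfun_entry.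
- exact: T0_inv.
- by move=> B _; rewrite /T0 /=; split=> [->|/eqP]; [rewrite subrr|rewrite subr_eq0 => /eqP].
Qed.

Lemma row_zero_inv l : uptri_invariant [set B : 'M[F]_(3, 2) | forall j, B l j = 0].
Proof.
move=> B b; rewrite /= => h ub _.
by apply: ord2P; rewrite ?(uptri_entries2 B _ ub).1 ?(uptri_entries2 B _ ub).2 !h !mulr0 ?addr0.
Qed.

Lemma closed_row_zero l : closed (flag_set [set B : 'M[F]_(3, 2) | forall j, B l j = 0]).
Proof.
apply: (@closed_flag_set F 3 2 _ [set B | forall j, B l j = 0]) => //; last exact: row_zero_inv.
by apply: closed_polyfuns => j; exact: polyfun_entry.
Qed.

Lemma minors_uptri (B : 'M[F]_(3, 2)) b : uptri b -> minors (B *m b) = (b 0 0 * b 1 1) *: minors B.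
Proof.
move=> ub; have [c0 c1] := uptri_cols2 B ub; rewrite !minors_cross c0 c1.
by apply/colP; apply: ord3P; rewrite [RHS]mxE /cross !vec3E !mxE; ring.
Qed.

Lemma herm_inv p : uptri_invariant [set B : 'M[F]_(3, 2) | herm p (minors B) = 0].
Proof. by move=> B b /= hB ub _; rewrite minors_uptri // hermZ hB mulr0. Qed.

Lemma closed_herm p : closed (flag_set [set B : 'M[F]_(3, 2) | herm p (minors B) = 0]).
Proof.
apply: (@closed_flag_set F 3 2 _ [set B | herm p (minors B) = 0]) => //; last exact: herm_inv.
apply: closed_zero; apply: (@polyfun_comp F 3 2 3 1 (@minors F)); first exact: polymap_minors.
exact: polyfun_herm.
Qed.

Lemma closed_flag11 : closed (flag_set [set l : 'M[F]_(2, 1) | l 1 0 = 0]).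
Proof.
apply: (@closed_flag_set F 2 1 _ [set l | l 1 0 = 0]) => //.
  by apply: closed_zero; exact: polyfun_entry.
by move=> l b /= h _ ib; have [-> _] := uptri1 l ib; rewrite mxE h mulr0.
Qed.

Lemma closed_Phi S : closed (flag_set S) -> closed (@Phi_set F S).
Proof. by move=> cS; exact: closed_Phi_set cS _. Qed.

Lemma Phi_setI S S' : uptri_invariant S' ->
  @Phi_set F S `&` Phi_set S' = Phi_set (S `&` S').
Proof.
move=> inv; apply/seteqP; split=> W.
  move=> [[C SC hP] /Phi_setP[_ hW]]; exists C => //; split=> //.
  by have [_ rp] := is_Phi_symplectic hP; apply/(flag_set_inv inv rp).
by move=> [C [SC SC'] hP]; split; exists C.
Qed.

End ClosedSets.

(** * Big cells and dimensions *)

Section FlagCharts.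
Variable F : closedFieldType.

Section Denominators.
Variables (n k d : nat) (b : 'M[F]_(n, k) -> F) (a : 'M[F]_(n, k) -> 'M[F]_(d, 1)).
Hypotheses (pb : polyfun b) (pa : polymap a).

(** The ring of polynomial functions with powers of [b] as denominators; the coordinates of a big
    cell are of this kind. *)
Definition fractional (f : 'M[F]_(n, k) -> F) := exists N g, polyfun g /\
  forall C, b C != 0 -> g C = b C ^+ N * f C.

Lemma fractional_const c : fractional (fun=> c).
Proof. by exists 0%N, (fun=> c); split=> [|C _]; [exact: polyfun_const|rewrite expr0 mul1r]. Qed.

Lemma fractionalD f g : fractional f -> fractional g -> fractional (fun C => f C + g C).
Proof.
move=> [N [f' [pf hf]]] [N' [g' [pg hg]]].
exists (N + N')%N, (fun C => b C ^+ N' * f' C + b C ^+ N * g' C); split.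
  by apply: polyfunD; apply: polyfunM => //; exact: polyfunX.
by move=> C bC; rewrite hf // hg // exprD; ring.
Qed.

Lemma fractionalM f g : fractional f -> fractional g -> fractional (fun C => f C * g C).
Proof.
move=> [N [f' [pf hf]]] [N' [g' [pg hg]]].
exists (N + N')%N, (fun C => f' C * g' C); split; first exact: polyfunM.
by move=> C bC; rewrite hf // hg // exprD; ring.
Qed.

Lemma fractional_comp f : polyfun f -> fractional (fun C => f ((b C)^-1 *: a C)).
Proof.
move=> [P hP]; pose v C : 'I_(d * 1) -> F := fun i => mxvec ((b C)^-1 *: a C) 0 i.
have fv i : fractional (fun C => v C i).
  case/mxvec_indexP: i => i j; exists 1%N, (fun C => a C i j); split=> // C bC.
  by rewrite /v mxvecE mxE mulrA expr1 mulfV // mul1r.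
have fX i l : fractional (fun C => v C i ^+ l).
  elim: l => [|l IH]; first exact: fractional_const.
  have [N [g [pg hg]]] := fractionalM (fv i) IH.
  by exists N, g; split=> // C bC; rewrite hg // exprS.
have fprod (r : seq 'I_(d * 1)) (m : 'X_{1..d * 1}) : fractional (fun C => \prod_(i <- r) v C i ^+
  m i).
  elim: r => [|i r IH].
    by have [N [g [pg hg]]] := fractional_const 1; exists N, g; split=> // C bC;
      rewrite hg // big_nil.
  have [N [g [pg hg]]] := fractionalM (fX i (m i)) IH.
  by exists N, g; split=> // C bC; rewrite hg // big_cons.
have fsum (r : seq 'X_{1..d * 1}) : fractional (fun C => \sum_(m <- r) P@_m * \prod_i v C i ^+ m i).
  elim: r => [|m r IH].
    by have [N [g [pg hg]]] := fractional_const 0; exists N, g; split=> // C bC;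
      rewrite hg // big_nil.
  have [N [g [pg hg]]] := fractionalD (fractionalM (fractional_const P@_m) (fprod (index_enum _)
    m)) IH.
  by exists N, g; split=> // C bC; rewrite hg // big_cons.
have [N [g [pg hg]]] := fsum (msupp P).
by exists N, g; split=> // C bC; rewrite hg // hP /peval mevalE.
Qed.

End Denominators.

Lemma open_flag_ex n k (f : 'M[F]_(n, k) -> F) : polyfun f ->
  open ([set W | exists2 C, represents C W & f C != 0] : set (flag_variety F n k)).
Proof.
move=> pf; apply: open_flagP => W C rC [C' rC' fC'].
have [t [E ut it]] := represents_uptri rC rC'.
exists (fun X => f (X *m t)); split; last first.
- by move=> X W' rX fX; exists (X *m t) => //; exact: uptri_represents.
- by rewrite -E.
- by apply: polyfun_comp pf; apply: polymapM; [exact: polymap_id|exact: polymap_const].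
Qed.

(** Where [b] is nonzero, each flag has the normal form [s] at the point a/b. Injectivity of [s]
    makes the coordinates well defined, closed sets are pulled back along [s] to polynomial
    conditions, and clearing denominators shows that polynomial conditions on coordinates define
    open sets. *)
Lemma flag_chart_le n k d (S : set 'M[F]_(n, k)) : uptri_invariant S ->
  (forall C, S C -> \rank C = k -> exists b a (s : 'M[F]_(d, 1) -> 'M[F]_(n, k)),
    [/\ polyfun b /\ polymap a, polymap s, b C != 0,
        forall C', S C' -> \rank C' = k -> b C' != 0 -> same_flag C' (s ((b C')^-1 *: a C')) &
        forall v v', same_flag (s v) (s v') -> v = v']) ->
  forall m, closed_chain (subvar (flag_set S)) m -> (m <= d)%N.
Proof.
move=> inv chart; apply: (@chart_chain_le F) => x.
have [C SC rC] := mem_set_val x.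
have [b [a [s [[pb pa] ps bC cov inj]]]] := chart C SC (represents_rank rC).
pose phi (y : subvar (flag_set S)) : 'M[F]_(d, 1) := xget 0 [set v | represents (s v) (val y)].
pose U : set (subvar (flag_set S)) := [set y | exists2 C', represents C' (val y) & b C' != 0].
have phiE y C' : represents C' (val y) -> b C' != 0 -> phi y = (b C')^-1 *: a C'.
  move=> rC' bC'; have SC' := (flag_set_inv inv rC').1 (mem_set_val y).
  have rs := (same_flag_represents _ (cov C' SC' (represents_rank rC') bC')).1 rC'.
  rewrite /phi; case: xgetP => [v _ rv|/(_ _ rs)//].
  exact: inj (represents_uptri rv rs).
have sphi y : U y -> represents (s (phi y)) (val y).
  move=> [C' rC' bC']; rewrite (phiE y C') //.
  have SC' := (flag_set_inv inv rC').1 (mem_set_val y).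
  exact: (same_flag_represents _ (cov C' SC' (represents_rank rC') bC')).1 rC'.
exists U, phi; split.
- by apply/open_subvar; exists [set W | exists2 C', represents C' W & b C' != 0] => //;
  exact: open_flag_ex.
- by exists C.
- move=> f pf; have [N [g [pg hg]]] := fractional_comp pb pa pf.
  apply/open_subvar; exists [set W | exists2 C', represents C' W & b C' * g C' != 0].
    by apply: open_flag_ex; exact: polyfunM.
  move=> y; split=> [[[C' rC' bC'] /= fy]|[C' rC']].
    exists C' => //; rewrite (phiE y C') // in fy.
    by rewrite hg // !mulf_neq0 // expf_neq0.
  rewrite mulf_eq0 negb_or => /andP[bC']; rewrite hg // mulf_eq0 negb_or => /andP[_ fC'].
  by split; [exists C'|rewrite /= (phiE y C')].
move=> K z /closed_openC/open_subvar[V oV hV] Uz nKz.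
have [V' oV' hV'] := open_flag_preimage oV.
have := open_polymap ps oV' => /open_affineP/(_ (phi z))[|f [pf fz hf]].
  by apply/(hV' _ _ (sphi z Uz)); exact/hV.
exists f; split=> // y Uy Ky; apply: contrapT => /eqP fy.
have : V (val y) by apply/(hV' _ _ (sphi y Uy)); exact: hf.
by move/hV; apply.
Qed.

(* The big cell of the fourfold [SZ']. *)
Definition Zcell (v : 'M[F]_(4, 1)) : 'M[F]_(6, 3) :=
  let x := v 0 0 in let y := v 1 0 in let z := v 2%:R 0 in let t := v 3%:R 0 in
  cols3 (stack 0 (vec3 1 x y)) (stack 0 (vec3 0 1 z)) (stack (t *: vec3 (x * z - y) (- z) 1) (vec3
    0 0 1)).

Lemma ord4P (P : 'I_4 -> Prop) : P 0 -> P 1 -> P 2%:R -> P 3%:R -> forall i, P i.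
Proof.
move=> h0 h1 h2 h3 [[|[|[|[|//]]]] lti].
- by have -> : Ordinal lti = 0 by apply: val_inj.
- by have -> : Ordinal lti = 1 by apply: val_inj.
- by have -> : Ordinal lti = 2%:R by apply: val_inj.
- by have -> : Ordinal lti = 3%:R by apply: val_inj.
Qed.

Lemma polymap_stack n k (g h : 'M[F]_(n, k) -> 'cV[F]_3) :
  polymap g -> polymap h -> polymap (fun A => stack (g A) (h A)).
Proof. exact: (@polymap_col_mx _ n k 3 3 1). Qed.

Lemma polymap_Zcell : polymap Zcell.
Proof.
have pe i : polyfun (fun v : 'M[F]_(4, 1) => v i 0) by exact: polyfun_entry.
have pc c : polyfun (fun _ : 'M[F]_(4, 1) => c) by exact: polyfun_const.
apply: (@polymap_row_mx _ 4 1 6 1 2).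
  by apply: polymap_stack; [exact: polymap_const|exact: polymap_vec3].
apply: (@polymap_row_mx _ 4 1 6 1 1).
  by apply: polymap_stack; [exact: polymap_const|exact: polymap_vec3].
apply: polymap_stack; last exact: polymap_const.
pose t (v : 'M[F]_(4, 1)) := v 3%:R 0.
have pv : polymap (fun v : 'M[F]_(4, 1) => vec3 (v 0 0 * v 2%:R 0 - v 1 0) (- v 2%:R 0) 1).
  by apply: polymap_vec3 => //; [apply: polyfunB => //; exact: polyfunM|exact: polyfunN].
move=> i j; apply: (@polyfun_ext F 4 1 (fun v => t v * vec3 (v 0 0 * v 2%:R 0 - v 1 0) (- v 2%:R 0)
  1 i j)).
  by move=> v; rewrite [RHS]mxE.
by apply: polyfunM; [exact: pe|exact: pv].
Qed.

Lemma Zcell_inj v v' : same_flag (Zcell v) (Zcell v') -> v = v'.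
Proof.
move=> [b [E ub ib]]; have [c0 c1 c2] := uptri_cols (Zcell v) ub.
rewrite -E !col_cols3 in c0 c1 c2.
have k0 i := congr1 (fun w => coord6 w i) c0.
have k1 i := congr1 (fun w => coord6 w i) c1.
have k2 i := congr1 (fun w => coord6 w i) c2.
move: (k0 4%N) (k0 5%N) (k0 6%N); rewrite !coord6Z !coord6_stack !vec3E mulr1 => <-.
rewrite !mul1r => ex ey.
move: (k1 4%N) (k1 5%N) (k1 6%N); rewrite !coord6D !coord6Z !coord6_stack !vec3E mulr0 addr0 mulr1.
move=> <-; rewrite !mul0r !add0r mulr1 => <-; rewrite mul1r => ez.
move: (k2 4%N) (k2 5%N) (k2 6%N) (k2 3%N);
  rewrite !coord6D !coord6Z !coord6_stack !vec3E !mulr0 !addr0 mulr1.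
move=> <-; rewrite !mul0r !add0r mulr1 => <-; rewrite mul0r add0r mulr1 => <-.
rewrite ![(0 : 'cV_3) _ _]mxE !mulr0 !add0r mul1r ![(_ *: _ : 'cV_3) _ _]mxE !vec3E !mulr1 => et.
by apply/colP; apply: ord4P.
Qed.

End FlagCharts.

(** * The fourfold of flags with W_2 in <e_4, e_5, e_6> *)

Section BigCellZ.
Variable F : closedFieldType.
Implicit Types C : 'M[F]_(6, 3).

Local Notation D C i j := (coord6 (col j C) (4 + i)).

(** With the entry [D C 0 0], [Zminor] and [Zdet] are the leading principal minors of the lower
    block; their nonvanishing is the condition for column reduction to a unipotent lower triangular
    block. *)
Definition Zminor C := D C 0 0 * D C 1 1 - D C 1 0 * D C 0 1.

Definition Zdet C :=
  (D C 0 1 * D C 1 2%:R - D C 0 2%:R * D C 1 1) * D C 2 0 -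
  (D C 0 0 * D C 1 2%:R - D C 0 2%:R * D C 1 0) * D C 2 1 + Zminor C * D C 2 2%:R.

Definition Zdenom C := D C 0 0 * Zminor C * Zdet C.

(* The numerators of the four coordinates of [Zcell], over [Zdenom]. *)
Definition Zcoord C : 'M[F]_(4, 1) := \col_(i < 4)
  [:: D C 1 0 * Zminor C * Zdet C; D C 2 0 * Zminor C * Zdet C;
      (D C 0 0 * D C 2 1 - D C 2 0 * D C 0 1) * D C 0 0 * Zdet C;
      coord6 (col 2%:R C) 3 * Zminor C * Zminor C * D C 0 0]`_i.

Lemma polyfun_D i (j : 'I_3) : polyfun (fun C => D C i j).
Proof. by apply: polyfun_coord6; exact: polymap_id. Qed.

Ltac polyf := repeat first [exact: polyfun_D | exact: polyfun_coord6 (@polymap_id _ _ _)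
  | apply: polyfunD | apply: polyfunN | apply: polyfunM].

Lemma polyfun_Zdenom : polyfun Zdenom.
Proof. by rewrite /Zdenom /Zdet /Zminor; polyf. Qed.

Lemma polymap_Zcoord : polymap Zcoord.
Proof. by apply: polymap_mx; apply: ord4P => j /=; rewrite /Zdet /Zminor; polyf. Qed.

Lemma Zcell_cover C : SZ' C -> Zdenom C != 0 -> same_flag C (Zcell ((Zdenom C)^-1 *: Zcoord C)).
Proof.
move=> SC; have [s [u [B [nB n0 CE]]]] := SZ_normal SC.
have [d1 d2 d3] := detB_formula B.
have DE : ((D C 0 0 = B 0 0) * (D C 1 0 = B 1 0) * (D C 2 0 = B 2%:R 0) *
  (D C 0 1 = B 0 1) * (D C 1 1 = B 1 1) * (D C 2 1 = B 2%:R 1) *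
  (D C 0 2%:R = u 0 0) * (D C 1 2%:R = u 1 0) * (D C 2 2%:R = u 2%:R 0))%type.
  by rewrite CE block_cols3 !col_cols3 !coord6_stack !mxE.
have UE : ((coord6 (col 2%:R C) 1 = (s * (B 1 0 * B 2%:R 1 - B 2%:R 0 * B 1 1))%R) *
    (coord6 (col 2%:R C) 2 = (- s * (B 0 0 * B 2%:R 1 - B 2%:R 0 * B 0 1))%R) *
    (coord6 (col 2%:R C) 3 = (s * Zminor C)%R))%type.
  rewrite /Zminor !DE CE block_cols3 !col_cols3 !coord6_stack minorsE d1 d2 d3 ![(_ *: _ : 'cV_3) _
    _]mxE !vec3E.
  by rewrite mulrN mulNr.
have [[U01 U02 U03] [U11 U12 U13]] : up0 (col 0 C) /\ up0 (col 1 C) by case: SC.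
rewrite /Zdenom !mulf_eq0 !negb_or => /andP[/andP[b0 m0] dt].
have mE : Zminor C = B 0 0 * B 1 1 - B 1 0 * B 0 1 by rewrite /Zminor !DE.
have dE : Zdet C = (B 0 1 * u 1 0 - u 0 0 * B 1 1) * B 2%:R 0 -
    (B 0 0 * u 1 0 - u 0 0 * B 1 0) * B 2%:R 1 + (B 0 0 * B 1 1 - B 1 0 * B 0 1) * u 2%:R 0.
  by rewrite /Zdet !DE mE.
set v := _ *: Zcoord C.
have vE : ((v 0 0 = D C 1 0 / D C 0 0) * (v 1 0 = D C 2 0 / D C 0 0) *
   (v 2%:R 0 = ((D C 0 0 * D C 2 1 - D C 2 0 * D C 0 1) / Zminor C)%R) *
   (v 3%:R 0 = (s * Zminor C * Zminor C / Zdet C)%R))%type.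
  by rewrite /v /Zdenom ![(_ *: _ : 'cV_4) _ _]mxE ![Zcoord _ _ _]mxE /= UE; do !split; field;
    rewrite ?b0 ?m0 ?dt.
rewrite !DE in vE b0; rewrite mE in vE m0; rewrite dE in vE dt; rewrite mE in UE.
have eqc w w' : coord6 w 1 = coord6 w' 1 -> coord6 w 2 = coord6 w' 2 -> coord6 w 3 = coord6 w' 3 ->
  coord6 w 4 = coord6 w' 4 -> coord6 w 5 = coord6 w' 5 -> coord6 w 6 = coord6 w' 6 ->
    w = w' :> 'cV[F]_6 := @coord6Pe F w w'.
apply: (@same_flag3 F 6 _ _ (B 0 0)^-1 (- B 0 1 / Zminor C) (B 0 0 / Zminor C)
   ((B 0 1 * u 1 0 - u 0 0 * B 1 1) / Zdet C) (- (B 0 0 * u 1 0 - u 0 0 * B 1 0) / Zdet C) (Zminor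
     C / Zdet C));
  rewrite ?mE ?dE ?mulf_neq0 ?invr_neq0 // col_cols3.
- apply: eqc; rewrite coord6Z coord6_stack ?U01 ?U02 ?U03 ?[(0 : 'cV_3) _ _]mxE ?mulr0 // vec3E.
  + by rewrite DE mulVf.
  + by rewrite DE vE mulrC.
  + by rewrite DE vE mulrC.
- apply: eqc; rewrite coord6D !coord6Z coord6_stack ?U01 ?U02 ?U03 ?U11 ?U12 ?U13 ?[(0 : 'cV_3) _
  _]mxE ?mulr0 ?addr0 // vec3E !DE ?vE.
  + by field.
  + by field.
  + by field.
apply: eqc; rewrite !coord6D !coord6Z coord6_stack ?U01 ?U02 ?U03 ?U11 ?U12 ?U13 ?[(_ *: _ : 'cV_3)
  _ _]mxE vec3E ?DE ?UE ?vE.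
- by field; rewrite ?b0 ?m0 ?dt.
- by field; rewrite ?b0 ?m0 ?dt.
- by field; rewrite ?b0 ?m0 ?dt.
- by field; rewrite ?b0 ?m0 ?dt.
- by field; rewrite ?b0 ?m0 ?dt.
- by field; rewrite ?b0 ?m0 ?dt.
Qed.

End BigCellZ.

Section DimensionZ.
Variable F : closedFieldType.
Implicit Types C : 'M[F]_(6, 3).

Let chart C := exists b a (s : 'M[F]_(4, 1) -> 'M[F]_(6, 3)),
    [/\ polyfun b /\ polymap a, polymap s, b C != 0,
        forall C', SZ' C' -> \rank C' = 3 -> b C' != 0 -> same_flag C' (s ((b C')^-1 *: a C')) &
        forall v v', same_flag (s v) (s v') -> v = v'].

(* Symplectic matrices preserving [<e_4, e_5, e_6>]; they move any point of
   [SZ'] into the big cell. *)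
Definition parabolic (M T : 'M[F]_3) : 'M[F]_(3 + 3) := block_mx M^T 0 (T *m M^T) (invmx M).

Lemma parabolic_unit M T : M \in unitmx -> parabolic M T \in unitmx.
Proof.
by move=> uM; rewrite unitmxE det_lblock det_tr unitrM -!unitmxE uM unitmx_inv.
Qed.

Lemma parabolic_symplectic M T : M \in unitmx -> T^T = T ->
  (parabolic M T)^T *m Jmx F *m parabolic M T = Jmx F.
Proof.
move=> uM sT; rewrite /parabolic tr_block_mx trmx_mul !trmxK sT trmx0 /Jmx !mulmx_block.
rewrite !(mulmx0, mul0mx, add0r, addr0, mulmx1, mulmxN, mulNmx) -trmx_mul mulmxV // trmx1.
by rewrite !mulmxA addNr.
Qed.

Lemma usubmx_parabolic M T k (C : 'M[F]_(3 + 3, k)) :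
  usubmx (parabolic M T *m C) = M^T *m usubmx C.
Proof. by rewrite -{1}[C]vsubmxK /parabolic mul_block_col mul0mx addr0 col_mxKu. Qed.

Lemma dsubmx_parabolic M T k (C : 'M[F]_(3 + 3, k)) :
  dsubmx (parabolic M T *m C) = T *m M^T *m usubmx C + invmx M *m dsubmx C.
Proof. by rewrite -{1}[C]vsubmxK /parabolic mul_block_col col_mxKd. Qed.

Lemma parabolic_SZ' M T C : M \in unitmx -> T^T = T -> SZ' C -> SZ' (parabolic M T *m C).
Proof.
move=> uM sT [rC iC u0 u1].
have up j : up0 (col j C) -> up0 (col j (parabolic M T *m C)).
  move=> /(up0_col (C : 'M_(3 + 3, 3))) h; apply/(up0_col (_ : 'M_(3 + 3, 3))) => i.
  by rewrite usubmx_parabolic mxE big1 // => l _; rewrite h mulr0.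
split; [|idtac|exact: up|exact: up].
  by rewrite eqmxMfull // row_full_unit parabolic_unit.
rewrite /isotropic trmx_mul -!mulmxA (mulmxA _ (Jmx F)) (mulmxA _ (parabolic M T)).
by rewrite parabolic_symplectic // mulmxA.
Qed.

Lemma chart_parabolic M T C : M \in unitmx -> T^T = T ->
  chart (parabolic M T *m C) -> chart C.
Proof.
move=> uM sT [b [a [s [[pb pa] ps bC cov inj]]]]; set Q := parabolic M T in bC *.
have uQ : Q \in unitmx by exact: parabolic_unit.
have pQ : polymap (fun C => Q *m C) by apply: polymapM; [exact: polymap_const|exact: polymap_id].
exists (fun C => b (Q *m C)), (fun C => a (Q *m C)), (fun v => invmx Q *m s v); split=> //.
- by split; [exact: polyfun_comp pb|exact: polymap_comp pa].
- by apply: polymapM => //; exact: polymap_const.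
- move=> C' SC' rC' bC'; have SQ := parabolic_SZ' uM sT SC'.
  have rQ : \rank (Q *m C') = 3 by case: SQ.
  by have := same_flagM (invmx Q) (cov _ SQ rQ bC'); rewrite mulmxA mulVmx // mul1mx.
- move=> v v' h; apply: inj; have := same_flagM Q h.
  by rewrite !mulmxA mulmxV // !mul1mx.
Qed.

Lemma chart_cell C : Zdenom C != 0 -> chart C.
Proof.
move=> bC; exists (@Zdenom F), (@Zcoord F), (@Zcell F); split=> //.
- by split; [exact: polyfun_Zdenom|exact: polymap_Zcoord].
- exact: polymap_Zcell.
- by move=> C' SC' _; exact: Zcell_cover.
- exact: Zcell_inj.
Qed.

(** Two moves: an invertible completion of [B] makes the lower halves of the first two columns
    standard, and a shear repairs a vanishing third minor. *)
Lemma chart_SZ' C : SZ' C -> chart C.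
Proof.
move=> SC; have [s [u [B [nB n0 CE]]]] := SZ_normal SC.
have [i rM] := rank_complete (rank_minors n0); set M : 'M[F]_3 := row_mx B _ in rM.
have uM : M \in unitmx by rewrite -row_free_unit /row_free rM.
apply: (@chart_parabolic M 0 _ uM (trmx0 _ _ _)).
have [m0 m1 _] := col_row21 B (delta_mx i 0).
set C1 := _ *m C; have SC1 : SZ' C1 by exact: parabolic_SZ' (trmx0 _ _ _) SC.
have [r1 i1 _ _] := SC1.
have low : dsubmx (C1 : 'M_(3 + 3, 3)) = row_mx (invmx M *m B) (invmx M *m u).
  rewrite dsubmx_parabolic !mul0mx add0r CE /block_mx.
  by rewrite (@col_mxKd _ 3 3 3) (@mul_mx_row _ 3 3 2 1).
have lowc j : col j (invmx M *m B) = delta_mx (widen_ord (leqnSn 2) j) 0.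
  transitivity (invmx M *m col (widen_ord (leqnSn 2) j) M).
    rewrite col_mul; congr (_ *m _); move: j; apply: ord2P.
      by rewrite -m0; congr (col _ _); apply: val_inj.
    by rewrite -m1; congr (col _ _); apply: val_inj.
  by rewrite -col_mul mulVmx // col1.
have [l0 l1 l2] := col_row21 (invmx M *m B) (invmx M *m u).
pose w := invmx M *m u; pose al := dsubmx (C1 : 'M_(3 + 3, 3)).
have lowE j (k : 'I_3) : coord6 (col j C1) (3 + k.+1) = col j al k 0.
  by rewrite (@coord6_dsubmx F 3 C1 j k) [RHS]mxE.
have uE : [/\ up0 (col 0 C1) & up0 (col 1 C1)] by case: SC1.
have DE : ((coord6 (col 0 C1) 4 = 1) * (coord6 (col 0 C1) 5 = 0) * (coord6 (col 0 C1) 6 = 0) *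
  (coord6 (col 1 C1) 4 = 0) * (coord6 (col 1 C1) 5 = 1) * (coord6 (col 1 C1) 6 = 0) *
  (coord6 (col 2%:R C1) 4 = w 0 0) * (coord6 (col 2%:R C1) 5 = w 1 0) * (coord6 (col 2%:R C1) 6 = w
    2%:R 0))%type.
  have e j := (lowE j 0, lowE j 1, lowE j 2%:R).
  move: (e 0) (e 1) (e 2%:R); rewrite /al low l0 l1 l2 !lowc ![delta_mx _ _ _ _]mxE.
  by move=> [[e1 e2] e3] [[e4 e5] e6] [[e7 e8] e9]; do !split; assumption.
(* With the first two lower columns standard, the denominator is just the sixth coordinate of the
   third column. *)
have dC (C' : 'M[F]_(6, 3)) : col 0 C' = col 0 C1 -> col 1 C' = col 1 C1 ->
    Zdenom C' = coord6 (col 2%:R C') 6.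
  by rewrite /Zdenom /Zdet /Zminor => -> ->; rewrite !DE /=; ring.
have [x0|x0] := eqVneq (coord6 (col 2%:R C1) 6) 0; last by apply: chart_cell; rewrite dC.
have y0 : coord6 (col 2%:R C1) 3 != 0.
  have iso := (isotropicP C1).1 i1; case: uE => -[a1 a2 a3] [b1 b2 b3].
  have z1 : coord6 (col 2%:R C1) 1 = 0.
    have := iso 0 2%:R; rewrite pairing6 a1 a2 a3 !DE => z; apply: oppr_inj; rewrite oppr0 -z; ring.
  have z2 : coord6 (col 2%:R C1) 2 = 0.
    have := iso 1 2%:R; rewrite pairing6 b1 b2 b3 !DE => z; apply: oppr_inj; rewrite oppr0 -z; ring.
  apply/eqP => z3; have [|_ _ /eqP] := (rank3P C1).1 r1 (- w 0 0) (- w 1 0) 1;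
    last by rewrite oner_eq0.
  apply: coord6Pe; coords; rewrite ?a1 ?a2 ?a3 ?b1 ?b2 ?b3 ?z1 ?z2 ?z3 ?x0 ?DE; ring.
(* The shear adds the third coordinate to the sixth. In the third column the former is nonzero by
   isotropy and rank, the latter zero, so the denominator becomes nonzero. *)
pose T : 'M[F]_3 := delta_mx 2%:R 2%:R.
have sT : T^T = T by rewrite /T trmx_delta.
apply: (@chart_parabolic 1%:M T _ (unitmx1 _ _) sT).
set C2 := parabolic 1%:M T *m C1.
have us i' j : usubmx (C2 : 'M_(3 + 3, 3)) i' j = usubmx (C1 : 'M_(3 + 3, 3)) i' j.
  by rewrite usubmx_parabolic trmx1 mul1mx.
have ds i' j : dsubmx (C2 : 'M_(3 + 3, 3)) i' j =
    (T *m usubmx (C1 : 'M_(3 + 3, 3))) i' j + dsubmx (C1 : 'M_(3 + 3, 3)) i' j.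
  by rewrite dsubmx_parabolic trmx1 mulmx1 invmx1 mul1mx mxE.
have QE0 j : up0 (col j C1) -> col j C2 = col j C1.
  move=> /(up0_col (C1 : 'M_(3 + 3, 3))) z; apply/colP => k; rewrite [LHS]mxE [RHS]mxE.
  rewrite -[k](@splitK 3 3); case: (@fintype.split 3 3 k) => k' /=.
    by have := us k' j; rewrite ![usubmx _ _ _]mxE.
  have := ds k' j; rewrite [dsubmx C2 _ _]mxE [dsubmx C1 _ _]mxE => ->.
  by rewrite mxE big1 ?add0r // => l _; rewrite z mulr0.
apply: chart_cell; rewrite dC; [|by apply: QE0; case: uE|by apply: QE0; case: uE].
have e6 (C' : 'M[F]_(3 + 3, 3)) : coord6 (col 2%:R C') 6 = dsubmx C' 2%:R 2%:R := coord6_dsubmx C'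
  2%:R 2%:R.
have e3 (C' : 'M[F]_(3 + 3, 3)) : coord6 (col 2%:R C') 3 = usubmx C' 2%:R 2%:R := coord6_usubmx C'
  2%:R 2%:R.
rewrite e6 ds -e6 x0 addr0.
rewrite mxE (bigD1 2%:R) //= big1 ?addr0; last by move=> l nl; rewrite mxE (negPf nl) andbF mul0r.
by rewrite mxE !eqxx mul1r -e3.
Qed.

Lemma closed_chain_SZ' m : closed_chain (subvar (flag_set (@SZ' F))) m -> (m <= 4)%N.
Proof.
apply: flag_chart_le; first exact: SZ'_inv.
by move=> C SC _; exact: chart_SZ'.
Qed.

End DimensionZ.

(** * Irreducibility, closedness and dimension of the components *)

Section Dimensions.
Variables (F : closedFieldType).

Lemma closed_chain_isomorphic (X Y : fspace F) m :
  isomorphic X Y -> closed_chain X m -> closed_chain Y m.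
Proof. by move=> [f [g [fK gK [cf _] [cg _]]]]; exact: closed_chain_homeo fK gK cf cg. Qed.

Lemma irreducible_isomorphic_sub (X Y : fspace F) (A : set X) (B : set Y) :
  isomorphic (subvar A) (subvar B) -> irreducible B -> irreducible A.
Proof.
by move=> iAB /irreducible_subvar iB; apply/irreducible_subvar;
  exact: irreducible_isomorphic iAB iB.
Qed.

Lemma irreducible_Phi (S : set 'M[F]_(6, 3)) : (forall C, S C -> isotropic C) ->
  irreducible (flag_set S) -> irreducible (Phi_set S).
Proof. by move=> iS; apply: irreducible_isomorphic_sub; exact: trunc_isomorphic. Qed.

Lemma closed_chain0 (X : fspace F) (A : set X) : irreducible A -> closed_chain (subvar A) 0.
Proof.
move=> /irreducible_subvar iA; exists (fun _ => setT); split=> // i _.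
Qed.

Lemma mem_flag_set n k (S : set 'M[F]_(n, k)) C (rC : \rank C = k) :
  uptri_invariant S -> flag_set S (flag_of rC) <-> S C.
Proof. by move=> inv; apply: flag_set_inv => //; exact: represents_flag_of. Qed.

(** A point inside the line: all lower bounds for dimensions grow from this chain by proper
    inclusions. *)
Lemma closed_chain_P1 : closed_chain (proj_space F 1) 1.
Proof.
have i0 : \rank (delta_mx 0 0 : 'M[F]_(2, 1)) = 1 by rewrite mxrank_delta.
have i1 : \rank (delta_mx 1 0 : 'M[F]_(2, 1)) = 1 by rewrite mxrank_delta.
apply: closed_chain_isomorphic (isomorphic_flag_setT F 2 1) _.
apply: (@closed_chain_proper _ _ (flag_set [set l : 'M[F]_(2, 1) | l 1 0 = 0])).
- by move=> W [l _ rl]; exists l.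
- move=> /(_ (flag_of i1))[|l /= l0 rl]; first by exists (delta_mx 1 0) => //;
  exact: represents_flag_of.
  have [t [E _ it]] := represents_uptri rl (represents_flag_of i1).
  move/matrixP/(_ 1 0): E; have [-> _] := uptri1 l it; rewrite !mxE l0 mulr0 => /eqP.
  by rewrite oner_eq0.
- exact: closed_flag11.
- exact: irreducible_flag_setT.
apply: closed_chain0; have -> : flag_set [set l : 'M[F]_(2, 1) | l 1 0 = 0] = [set flag_of i0].
  apply/seteqP; split=> W; last first.
    by move=> ->; exists (delta_mx 0 0); [rewrite /= mxE|exact: represents_flag_of].
  move=> [l /= l0 rl]; have l00 : l 0 0 != 0.
    apply: contraTneq (eqxx (1 : nat)) => z; have /rank1P/eqP[] := represents_rank rl.
    by apply/colP; apply: ord2P; rewrite [RHS]mxE.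
  apply: represents_inj rl _.
  apply: (same_flag_represents _ (same_flag1 l00 _)).1 (represents_flag_of i0).
  by apply/colP; apply: ord2P; rewrite !mxE ?mulr1 // l0 mulr0.
exact: irreducible_set1.
Qed.

Definition e12 (i j : 'I_3) : 'M[F]_(3, 2) :=
  row_mx (delta_mx i 0 : 'cV_3) (delta_mx j 0 : 'cV_3).

Lemma e12E i j k : (e12 i j k 0 = (k == i)%:R) * (e12 i j k 1 = (k == j)%:R).
Proof. by split; rewrite /e12 ?(row2E _ _ _).1 ?(row2E _ _ _).2 mxE andbT. Qed.

Lemma rank_e12 i j : i != j -> \rank (e12 i j) = 2.
Proof.
move=> ij; apply/rank2P => x y /colP h; move: (h i) (h j).
rewrite ![(_ + _ : 'cV_3) _ _]mxE ![(_ *: _ : 'cV_3) _ _]mxE ![col _ _ _ _]mxE !e12E !eqxx.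
by rewrite [j == i]eq_sym (negPf ij) ![(0 : 'cV_3) _ _]mxE /= !(mulr0, mulr1) addr0 add0r.
Qed.

Definition row_zero l : set 'M[F]_(3, 2) := [set B | forall j, B l j = 0].

Lemma isomorphic_row_zero i j l : uniq [:: i; j; l] ->
  isomorphic (subvar (flag_set (row_zero l))) (proj_space F 1).
Proof.
rewrite /= !inE negb_or !andbT => /andP[/andP[ij il] jl].
have E : (e12 i j)^T *m e12 i j = 1%:M.
  apply/matrixP => a b; rewrite !mxE; under eq_bigr => k _ do rewrite mxE.
  rewrite (bigD1 i) //= (bigD1 j) /=; last by rewrite eq_sym.
  rewrite big1 ?addr0; last first.
    by move=> k /andP[ki kj]; move: a; apply: ord2P; rewrite e12E ?(negPf ki) ?(negPf kj) mul0r.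
  move: a b; apply: ord2P; apply: ord2P;
    rewrite !e12E ?eqxx ?[j == i]eq_sym ?(negPf ij) /= ?(mulr0, mul0r, mulr1) ?addr0 ?add0r //.
have -> : row_zero l = [set B : 'M[F]_(3, 2) | B = e12 i j *m ((e12 i j)^T *m B)].
  have mE B k c : (e12 i j *m ((e12 i j)^T *m B)) k c = (k == i)%:R * B i c + (k == j)%:R * B j c.
    rewrite mxE !big_ord_recl big_ord0 addr0; have ->
      : lift ord0 ord0 = 1 :> 'I_2 by apply: val_inj.
    have tE a : ((e12 i j)^T *m B) a c = \sum_k' e12 i j k' a * B k' c.
      by rewrite mxE; apply: eq_bigr => k' _; rewrite mxE.
    rewrite !e12E !tE; congr (_ * _ + _ * _).
      rewrite (bigD1 i) //= big1 ?addr0 ?e12E ?eqxx ?mul1r // => k' /negPf n.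
      by rewrite e12E n mul0r.
    rewrite (bigD1 j) //= big1 ?addr0 ?e12E ?eqxx ?mul1r // => k' /negPf n.
    by rewrite e12E n mul0r.
  apply/seteqP; split=> B /= hB.
    apply/matrixP => k c; rewrite mE; have [->|ki] := eqVneq k i.
      by rewrite (negPf ij) mul1r mul0r addr0.
    have [->|kj] := eqVneq k j; first by rewrite mul0r mul1r add0r.
    suff -> : k = l by rewrite hB !mul0r addr0.
    apply/eqP; move: ij il jl ki kj; move: i j l k {E mE hB}.
    by do 3!apply: ord3P; apply: ord3P.
  by move=> c; rewrite hB mE ![l == _]eq_sym (negPf il) (negPf jl) !mul0r addr0.
exact: isomorphic_line.
Qed.

Variable p : nat.
Hypothesis charFp : p \in [pchar F].

Let p_prime : prime p. Proof. by case/andP: charFp. Qed.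
Let p_gt0 : (0 < p)%N. Proof. exact: prime_gt0. Qed.

Lemma YsetE : Yset F = Phi_set (@SY F).
Proof. by apply/seteqP; split=> W /YsetP. Qed.

Lemma ZsetE : Zset F p = Phi_set (SZ p).
Proof. by apply/seteqP; split=> W /(ZsetP charFp). Qed.

Lemma TsetE z : Tset F p z = Phi_set (TZ p z).
Proof. by apply/seteqP; split=> W /TsetP. Qed.

Definition hermB : set 'M[F]_(3, 2) := [set B | herm p (minors B) = 0].

Lemma hconeQ c (m : 'cV[F]_3) : hcone p m -> herm p (c *: m) = 0.
Proof. by move=> [_ hm]; rewrite hermZ hm mulr0. Qed.

Lemma minors_e12 : minors (e12 0 1) = vec3 0 0 1 /\ minors (e12 1 2%:R) = vec3 1 0 0.
Proof.
by split; rewrite minors_cross /cross ![col _ _ _ _]mxE !e12E /= !(mulr0, mul0r, mulr1, subr0).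
Qed.

Lemma herm_vec3 (c : F) : herm p (vec3 0 0 c) = 0 /\ herm p (vec3 c 0 0) = 0.
Proof.
have z : 0 ^+ p = 0 :> F by rewrite expr0n gtn_eqF.
by split; rewrite /herm !vec3E exprS z !(mul0r, mulr0) !addr0.
Qed.

Lemma irreducible_hermB : irreducible (flag_set hermB).
Proof.
apply: (@irreducible_Z0family _ (hcone p) (fun m => herm p m = 0)) => //.
- exact: irreducible_hcone.
- exact: hconeQ.
- exists (e12 0 1); last exact: rank_e12.
  by rewrite minors_e12.1 (herm_vec3 _).1.
Qed.

Lemma SZ_witness : exists2 C : 'M[F]_(6, 3), SZ p C & \rank C = 3.
Proof.
have [W [/(ZsetP charFp)[C SC _] _ _]] := Z_witness charFp.
by exists C => //; case: SC => -[].
Qed.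

Lemma irreducible_SZ : irreducible (flag_set (@SZ F p)).
Proof.
apply: (@irreducible_Zfamily _ (hcone p) (fun m => herm p m = 0)) => //; last exact: SZ_witness.
- exact: irreducible_hcone.
- exact: hconeQ.
Qed.

Lemma irreducible_SZ' : irreducible (flag_set (@SZ' F)).
Proof.
apply: (@irreducible_Zfamily _ setT (fun _ => True)) => //.
- exact: irreducible_affine.
- by move=> C; split=> [|[]].
by have [C [SC _] rC] := SZ_witness; exists C.
Qed.

Lemma irreducible_Y : irreducible (Yset F).
Proof.
rewrite YsetE; apply: irreducible_Phi; first exact: SY_isotropic.
apply/irreducible_subvar; apply: irreducible_isomorphic (@isomorphic_SY_flag3 F) _.
by rewrite -(flag_set_setT F 3 3); exact: irreducible_flag_setT.
Qed.

Lemma irreducible_Z : irreducible (Zset F p).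
Proof. by rewrite ZsetE; apply: irreducible_Phi; [move=> C [[]]|exact: irreducible_SZ]. Qed.

Lemma irreducible_Z' : irreducible (Phi_set (@SZ' F)).
Proof. by apply: irreducible_Phi; [move=> C []|exact: irreducible_SZ']. Qed.

Lemma isomorphic_TZ z : Iinf p z -> isomorphic (subvar (Tset F p z)) (subvar (flag_set (@T0 F))).
Proof.
move=> Iz; have TB := TbasisP charFp Iz; rewrite TsetE.
apply: isomorphic_trans (trunc_isomorphic (fun C => @TE_isotropic _ _ _ _ _ _ _ _ TB C)) _.
have := isomorphic_TE TB (@T0_inv F) (fun _ => id).
congr (isomorphic (subvar (flag_set _)) _); apply/seteqP; split=> C; first by case.
by move=> TC; split=> //; exact: Tproj_T0 TB _ TC.
Qed.

Lemma irreducible_T z : Iinf p z -> irreducible (Tset F p z).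
Proof. by move=> Iz; apply: irreducible_isomorphic_sub (isomorphic_TZ Iz) _;
  exact: irreducible_T0. Qed.

Lemma closed_Y : closed (Yset F).
Proof. by rewrite YsetE; apply: closed_Phi; exact: closed_flag_SY. Qed.

Lemma closed_Z : closed (Zset F p).
Proof. by rewrite ZsetE; apply: closed_Phi; exact: closed_flag_SZ. Qed.

Lemma closed_T z : Iinf p z -> closed (Tset F p z).
Proof.
by move=> Iz; rewrite TsetE; apply: closed_Phi; exact: closed_flag_TE (TbasisP charFp Iz).
Qed.

Lemma SY_sub_SZ' : @SY F `<=` @SZ' F.
Proof. by move=> C SC; have iC := SY_isotropic SC; case: SC => rC uC. Qed.

Lemma closed_chain_Z' m : closed_chain (subvar (Phi_set (@SZ' F))) m -> (m <= 4)%N.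
Proof.
move/(closed_chain_isomorphic (trunc_isomorphic _)) => h; apply: (@closed_chain_SZ' F); apply: h.
by move=> C [].
Qed.

(** Y is proper in the irreducible fourfold because the latter also contains Z. *)
Lemma Yset_le3 m : closed_chain (subvar (Yset F)) m -> (m <= 3)%N.
Proof.
have [W [ZW nYW _]] := Z_witness charFp.
move=> /(@closed_chain_proper _ _ _ (Phi_set (@SZ' F))) h; apply: (@closed_chain_Z' m.+1); apply: h.
- by rewrite YsetE => W' [C /SY_sub_SZ' SC hP]; exists C.
- move=> /(_ W); apply: contra_not nYW; apply: contrapT.
  by move=> n; apply: n => h; apply: h; have /(ZsetP charFp)[C [SC _] hP] := ZW; exists C.
- exact: closed_Y.
- exact: irreducible_Z'.
Qed.

Lemma Zset_le3 m : closed_chain (subvar (Zset F p)) m -> (m <= 3)%N.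
Proof.
have [[W [YW nZW]] _] := Y_witnesses charFp.
move=> /(@closed_chain_proper _ _ _ (Phi_set (@SZ' F))) h; apply: (@closed_chain_Z' m.+1); apply: h.
- by rewrite ZsetE => W' [C [SC _] hP]; exists C.
- move=> h; apply: nZW; apply: h; move: YW => /YsetP[C /SY_sub_SZ' SC hP]; by exists C.
- exact: closed_Z.
- exact: irreducible_Z'.
Qed.

Lemma YZset_le2 m : closed_chain (subvar (Yset F `&` Zset F p)) m -> (m <= 2)%N.
Proof.
have [[W [YW nZW]] _] := Y_witnesses charFp.
move=> /(@closed_chain_proper _ _ _ (Yset F)) h; have := @Yset_le3 m.+1; apply; apply: h.
- by move=> W' [].
- by move=> /(_ W YW)[].
- by apply: closedI; [exact: closed_Y|exact: closed_Z].
- exact: irreducible_Y.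
Qed.

(** [T0] is proper and closed among all pairs (V_1, V_2) in three-space, and these are isomorphic to
    Y; the bound 3 is inherited without another chart. *)
Lemma T0_le2 m : closed_chain (subvar (flag_set (@T0 F))) m -> (m <= 2)%N.
Proof.
have inv : uptri_invariant (@setT 'M[F]_(3, 2)) by [].
have r12 : \rank (e12 1 2%:R) = 2 by exact: rank_e12.
move=> /(@closed_chain_proper _ _ _ (flag_set setT)) h.
suff : closed_chain (subvar (flag_set (@setT 'M[F]_(3, 2)))) m.+1.
  have := isomorphic_sym (isomorphic_SY_flag2 inv); set S := [set C | _].
  have -> : S = @SY F by apply/seteqP; split=> C => [[]|].
  move=> iso /(closed_chain_isomorphic iso) /(closed_chain_isomorphic (isomorphic_sym
    (trunc_isomorphic (@SY_isotropic F)))).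
  by rewrite -YsetE; exact: Yset_le3.
apply: h.
- by move=> W [C _ rC]; exists C.
- move=> /(_ (flag_of r12))[|]; first by exists (e12 1 2%:R) => //; exact: represents_flag_of.
  move=> B TB rB; have := (mem_flag_set r12 (@T0_inv F)).1; rewrite /T0 /= !e12E /= mulr1 mulr0.
  by move=> /(_ _)/eqP; rewrite oner_eq0 => h; apply: notF; apply: h; exists B.
- exact: closed_flag_T0.
- exact: irreducible_flag_setT.
Qed.

Lemma row_zero_chain i j l : uniq [:: i; j; l] -> closed_chain (subvar (flag_set (row_zero l))) 1.
Proof.
by move/isomorphic_row_zero/isomorphic_sym/closed_chain_isomorphic; apply; exact: closed_chain_P1.
Qed.

(** The plane with normal vector (0, 0, 1) satisfies the Hermitian equation, so the projective line
    of flags through it is a proper closed subset. *)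
Lemma hermB_chain : closed_chain (subvar (flag_set hermB)) 2.
Proof.
have r12 : \rank (e12 1 2%:R) = 2 by exact: rank_e12.
apply: (@closed_chain_proper _ _ (flag_set (row_zero 2%:R))).
- move=> W [B h rB]; exists B => //; rewrite /hermB /= minors_cross /cross.
  rewrite ![col _ _ _ _]mxE !h !mulr0 !mul0r subrr.
  exact: (herm_vec3 _).1.
- move=> /(_ (flag_of r12))[|B hB rB].
    by apply/(mem_flag_set r12 (@herm_inv F p)); rewrite /= minors_e12.2 (herm_vec3 _).2.
  have := (mem_flag_set r12 (@row_zero_inv F 2%:R)).1; rewrite /= => /(_ _)/(_ 1).
  rewrite e12E => h; have /eqP := h (ex_intro2 _ _ B hB rB); by rewrite oner_eq0.
- exact: closed_row_zero.
- exact: irreducible_hermB.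
- by apply: (@row_zero_chain 0 1).
Qed.

Lemma SYZ_E : @SY F `&` SZ p = [set C | SY C /\ hermB (lo C)].
Proof.
have nE C : SY C -> nrm (col 0 C) (col 1 C) = minors (lo C).
  move=> SC; have [CE _] := SY_lower SC; have [l0 l1] := col_lo C.
  rewrite -nrm_minors l0 l1; congr nrm; rewrite {1}CE /lower /stack.
    by apply/colP => i; rewrite mxE -[i](@splitK 3 3); case: (@fintype.split 3 3 i) => i' /=;
      rewrite ?(@col_mxEu _ 3 3) ?(@col_mxEd _ 3 3) !mxE.
  by apply/colP => i; rewrite mxE -[i](@splitK 3 3); case: (@fintype.split 3 3 i) => i' /=;
      rewrite ?(@col_mxEu _ 3 3) ?(@col_mxEd _ 3 3) !mxE.
apply/seteqP; split=> C; first by move=> [SC [_ h]]; split=> //; rewrite /hermB /= -nE.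
by move=> [SC h]; split=> //; split; [exact: SY_sub_SZ'|rewrite nE].
Qed.

Lemma isomorphic_YZ : isomorphic (subvar (Yset F `&` Zset F p)) (subvar (flag_set hermB)).
Proof.
rewrite YsetE ZsetE Phi_setI; last exact: SZ_inv.
apply: isomorphic_trans (trunc_isomorphic _) _; first by move=> C [/SY_isotropic].
by rewrite SYZ_E; apply: isomorphic_SY_flag2; exact: herm_inv.
Qed.

Lemma has_dim_YZ : has_dim (subvar (Yset F `&` Zset F p)) 2.
Proof.
split; last exact: YZset_le2.
by apply: closed_chain_isomorphic (isomorphic_sym isomorphic_YZ) _; exact: hermB_chain.
Qed.

Lemma has_dim_Y : has_dim (subvar (Yset F)) 3.
Proof.
split; last exact: Yset_le3.
have [[W [YW nZW]] _] := Y_witnesses charFp.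
apply: (@closed_chain_proper _ _ (Yset F `&` Zset F p)).
- by move=> W' [].
- by move=> /(_ W YW)[].
- by apply: closedI; [exact: closed_Y|exact: closed_Z].
- exact: irreducible_Y.
- exact: has_dim_YZ.1.
Qed.

Lemma has_dim_Z : has_dim (subvar (Zset F p)) 3.
Proof.
split; last exact: Zset_le3.
have [W [ZW nYW _]] := Z_witness charFp.
apply: (@closed_chain_proper _ _ (Yset F `&` Zset F p)).
- by move=> W' [].
- by move=> /(_ W ZW)[].
- by apply: closedI; [exact: closed_Y|exact: closed_Z].
- exact: irreducible_Z.
- exact: has_dim_YZ.1.
Qed.

Lemma TE_cols f g w h k1 k2 (C : 'M[F]_(6, 3)) (B := Tproj f g w h k1 k2 C) :
  Tbasis p f g w h k1 k2 -> TE f g w h k1 k2 C ->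
  exists a x, [/\ a != 0, col 0 C = a *: f &
    forall j, a *: col (lift ord0 j) C = x j *: f + (B 0 j *: g + B 1 j *: w + B 2%:R j *: h)].
Proof.
move=> TB [T fT CE]; have [c0 a0] := Tform_col0 fT.
exists (coord6 (col 0 T) 1), (fun j => coord6 (col 0 T) 1 * coord6 (col (lift ord0 j) T) 1);
  split=> //.
  by rewrite CE col_mul {1}c0 -scalemxAr !basis6_e.
move=> j; rewrite /B CE !col_mul scalemxAr (Tform_col TB j fT) mulmxDr {1}c0.
rewrite -!scalemxAr scalerA mulrC basis6_e; congr (_ + _).
by rewrite vmidE !mulmxDr -!scalemxAr !basis6_e ![col _ (Tproj _ _ _ _ _ _ _) _ _]mxE.
Qed.

(** * Intersections of T_zeta with Y and Z *)

Section Intersections.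
Variable z : option (F * F).
Hypothesis Iz : Iinf p z.

Let TB := TbasisP charFp Iz.
Local Notation f := (Tf p z).
Local Notation g := (Tg z).
Local Notation w := (Tw z).
Local Notation h := (Th z).
Local Notation k1 := (Tk1 z).
Local Notation k2 := (Tk2 z).
Local Notation B C := (Tproj f g w h k1 k2 C).

Lemma up0_TE C j : TZ p z C -> up0 (col (lift ord0 j) C) <-> B C 1 j = 0.
Proof.
move=> TC; have [a [x [a0 _ /(_ j) cE]]] := TE_cols TB TC.
have uu y b c : up0 (y *: f + (b *: g + c *: h)).
  by apply: up0D; [|apply: up0D]; apply: up0Z; [exact: Tb_upf TB|exact: Tb_upg TB|exact: Tb_uph TB].
have E : a *: col (lift ord0 j) C = B C 1 j *: w + (x j *: f + (B C 0 j *: g + B C 2%:R j *: h)).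
  by rewrite cE; apply: coord6Pe; coords; ring.
split=> [u|b0].
  by apply: (up0_w charFp TB (uu (x j) (B C 0 j) (B C 2%:R j))); rewrite -E; exact: up0Z.
rewrite -[col _ C]scale1r -(mulVf a0) -scalerA E b0 scale0r add0r; exact/up0Z/uu.
Qed.

(** The rows of the projected matrix are the coordinates along [g], [w], [h]. For a flag in Y the
    [w] coordinate vanishes, so V_2 = <g, h> is fixed and V_1 is free. *)
Lemma TE_SY : TZ p z `&` @SY F = [set C | TZ p z C /\ row_zero 1 (B C)].
Proof.
apply/seteqP; split=> C.
  by move=> [TC [rC uC]]; split=> // j; exact/(up0_TE j TC).
move=> [TC h0]; split=> //; split.
  have [T [rT _ _ _] ->] := TC; by rewrite eqmxMfull // row_full_unit (basis6_unit TB).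
have [a [x [_ c0 _]]] := TE_cols TB TC.
apply: ord3P; first by rewrite c0; apply: up0Z; exact: Tb_upf TB.
  by rewrite -lift01; apply/(up0_TE _ TC).
by rewrite -lift01; apply/(up0_TE _ TC).
Qed.

(** For a flag in Z the vector spanning V_1 has no [w] component, and by [Tb_herm] no [h] component;
    V_1 = <g> is fixed and V_2 is free. *)
Lemma TE_SZ : TZ p z `&` SZ p = [set C | TZ p z C /\ @L0 F (B C)].
Proof.
have key C : TZ p z C -> B C 1 0 = 0 -> herm p (nrm (col 0 C) (col 1 C)) = 0 <-> B C 2%:R 0 = 0.
  move=> TC b0; have [a [x [a0 c0 /(_ 0) c1]]] := TE_cols TB TC;
    rewrite lift01 b0 scale0r addr0 in c1.
  have := Tb_herm TB (B C 0 0) (B C 2%:R 0); rewrite c0.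
  have -> : col 1 C = (a^-1 * x 0) *: f + a^-1 *: (B C 0 0 *: g + B C 2%:R 0 *: h).
    by rewrite -scalerA -scalerDr -c1 scalerA mulVf // scale1r.
  by rewrite nrm_uptri mulfV // scale1r.
apply/seteqP; split=> C.
  move=> [TC [[rC iC u0 u1] hC]]; have b0 : B C 1 0 = 0 by apply/(up0_TE _ TC); rewrite lift01.
  by split=> //; split=> //; exact/(key C TC b0).
move=> [TC [b0 b2]]; split=> //; split; last exact/(key C TC b0).
have [a [x [_ c0 _]]] := TE_cols TB TC.
split.
- have [T [rT _ _ _] ->] := TC; by rewrite eqmxMfull // row_full_unit (basis6_unit TB).
- exact: TE_isotropic TB _ TC.
- by rewrite c0; apply: up0Z; exact: Tb_upf TB.
- by rewrite -lift01; apply/(up0_TE _ TC).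
Qed.

Lemma isomorphic_YT : isomorphic (subvar (Yset F `&` Tset F p z)) (proj_space F 1).
Proof.
rewrite setIC YsetE TsetE Phi_setI; last exact: SY_inv.
apply: isomorphic_trans (trunc_isomorphic _) _; first by move=> C [_ /SY_isotropic].
apply: isomorphic_trans (isomorphic_row_zero (_ : uniq [:: 0; 2%:R; 1])) => //.
rewrite TE_SY; apply: (isomorphic_TE TB); first exact: row_zero_inv.
by move=> M hM; rewrite /T0 /= !hM !mul0r mulr0.
Qed.

Lemma isomorphic_ZT : isomorphic (subvar (Zset F p `&` Tset F p z)) (proj_space F 1).
Proof.
rewrite setIC ZsetE TsetE Phi_setI; last exact: SZ_inv.
apply: isomorphic_trans (trunc_isomorphic _) _; first by move=> C [_ [[]]].
apply: isomorphic_trans (@isomorphic_L0 F).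
rewrite TE_SZ; apply: (isomorphic_TE TB).
  move=> M b [h1 h2] ub _; rewrite /L0 /= (uptri_entries2 M 1 ub).1 (uptri_entries2 M 2%:R ub).1.
  by rewrite h1 h2 !mulr0.
by move=> M [h1 h2]; rewrite /T0 /= h1 h2 !mul0r.
Qed.

Lemma has_dim_T : has_dim (subvar (Tset F p z)) 2.
Proof.
split; last by move=> m /(closed_chain_isomorphic (isomorphic_TZ Iz)); exact: T0_le2.
have [W [TW nYW _]] := TE_not_YZ charFp TB.
apply: (@closed_chain_proper _ _ (Yset F `&` Tset F p z)).
- by move=> W' [].
- by move=> /(_ W)[|//]; exact/TsetP.
- by apply: closedI; [exact: closed_Y|exact: closed_T].
- exact: irreducible_T.
by apply: closed_chain_isomorphic (isomorphic_sym isomorphic_YT) _; exact: closed_chain_P1.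
Qed.

End Intersections.

End Dimensions.

(** * Blowing-up *)

Section BlowUp.
Variable F : closedFieldType.

Definition qpair (v : subvar (@nonzero_pairs F)) : (flag F 3 1 * flag F 2 1)%type :=
  (flag_of (set_valP v).1, flag_of (set_valP v).2).

Definition represents2 (v : 'M[F]_(3 + 2, 1)) (q : flag F 3 1 * flag F 2 1) :=
  represents (usubmx v) q.1 /\ represents (dsubmx v) q.2.

Lemma qpairP (v : subvar (@nonzero_pairs F)) q : qpair v = q <-> represents2 (val v) q.
Proof.
split=> [<-|[h1 h2]]; first by split; exact: represents_flag_of.
case: q h1 h2 => q1 q2 /= h1 h2; congr (_, _).
  by apply: represents_inj h1; exact: represents_flag_of.
by apply: represents_inj h2; exact: represents_flag_of.
Qed.

Lemma represents2_nonzero v q : represents2 v q -> nonzero_pairs v.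
Proof. by move=> [/represents_rank h1 /represents_rank h2]. Qed.

Lemma represents2_ex q : exists v, represents2 v q.
Proof.
have [z rz] := flag_represented q.1; have [l rl] := flag_represented q.2.
by exists (col_mx z l); rewrite /represents2 col_mxKu col_mxKd.
Qed.

Lemma represents2_scale (z : 'cV[F]_3) (l : 'cV[F]_2) c d q : c != 0 -> d != 0 ->
  represents2 (col_mx z l) q <-> represents2 (col_mx (c *: z) (d *: l)) q.
Proof.
move=> c0 d0; rewrite /represents2 !col_mxKu !col_mxKd.
have e1 := same_flag_represents q.1 (same_flag1 c0 (erefl (c *: z))).
have e2 := same_flag_represents q.2 (same_flag1 d0 (erefl (d *: l))).
by split=> -[/e1 h1 /e2 h2].
Qed.

Lemma represents2_uniq v v' q : represents2 v q -> represents2 v' q ->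
  exists c d, [/\ c != 0, d != 0 & v' = col_mx (c *: usubmx v) (d *: dsubmx v)].
Proof.
move=> [h1 h2] [h1' h2'].
have [t [E1 _ it]] := represents_uptri h1 h1'; have [t' [E2 _ it']] := represents_uptri h2 h2'.
have [e1 c0] := uptri1 (usubmx v) it; have [e2 d0] := uptri1 (dsubmx v) it'.
by exists (t 0 0), (t' 0 0); split=> //; rewrite -e1 -e2 -E1 -E2 vsubmxK.
Qed.

Lemma polymap_usubmx : polymap (fun v : 'M[F]_(3 + 2, 1) => usubmx v).
Proof.
by move=> i j; apply: (@polyfun_ext F (3 + 2) 1 (fun v => v (lshift 2 i) j)); [move=> v;
  rewrite mxE|exact: polyfun_entry].
Qed.

Lemma polymap_dsubmx : polymap (fun v : 'M[F]_(3 + 2, 1) => dsubmx v).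
Proof.
by move=> i j; apply: (@polyfun_ext F (3 + 2) 1 (fun v => v (rshift 3 i) j)); [move=> v;
  rewrite mxE|exact: polyfun_entry].
Qed.

Lemma open_nonzero_pairs : open (@nonzero_pairs F).
Proof.
have -> : @nonzero_pairs F = (fun v : 'M[F]_(3 + 2, 1) => usubmx v) @^-1` (@full_rank F 3 1) `&`
   (fun v : 'M[F]_(3 + 2, 1) => dsubmx v) @^-1` (@full_rank F 2 1) by [].
apply: openI.
  exact: open_polymap polymap_usubmx (@open_full_rank F 3 1).
exact: open_polymap polymap_dsubmx (@open_full_rank F 2 1).
Qed.

(** The classical equation of the blowing-up at [1 : 0 : 0]: the last two coordinates of the point
    are proportional to those of the line. *)
Definition incident (v : 'M[F]_(3 + 2, 1)) : Prop :=
  usubmx v 1 0 * dsubmx v 1 0 = usubmx v 2%:R 0 * dsubmx v 0 0.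

Definition incidence : set (P2xP1 F) :=
  [set q : flag F 3 1 * flag F 2 1 | exists2 v, represents2 v q & incident v].

Lemma scolE n (a : F) (x : 'cV[F]_n) i : (a *: x) i 0 = a * x i 0.
Proof. by rewrite mxE. Qed.

Lemma incidenceP v q : represents2 v q -> incidence q <-> incident v.
Proof.
move=> rv; split=> [[v' rv' iv']|]; last by exists v.
have [c [d [c0 d0 ->]]] := represents2_uniq rv' rv.
by rewrite /incident !col_mxKu !col_mxKd !scolE mulrACA [RHS]mulrACA iv'.
Qed.

Definition Lmx : 'M[F]_(2, 3) := \matrix_(i, j) (j == lift ord0 i)%:R.

Lemma LmxE (z : 'cV[F]_3) i : (Lmx *m z) i 0 = z (lift ord0 i) 0.
Proof.
rewrite mxE (bigD1 (lift ord0 i)) //= big1 ?addr0; first by rewrite mxE eqxx mul1r.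
by move=> j /negPf nj; rewrite mxE nj mul0r.
Qed.

Lemma Lmx_incident v : dsubmx v != 0 ->
  incident v <-> exists c, Lmx *m usubmx v = c *: dsubmx v.
Proof.
move=> l0; rewrite /incident; set z := usubmx v; set l := dsubmx v in l0 *; split; last first.
  move=> [c /colP h]; move: (h 0) (h 1); rewrite !LmxE !lift01 !mxE => -> ->; ring.
move=> h; have [z0|n0] := eqVneq (l 0 0) 0; last first.
  exists (z 1 0 / l 0 0); apply/colP; apply: ord2P; rewrite LmxE lift01 scolE ?divfK //.
  by apply: (mulIf n0); rewrite -h; field.
have n1 : l 1 0 != 0.
  by apply: contraNneq l0 => z1; apply/eqP/colP; apply: ord2P; rewrite [RHS]mxE.
exists (z 2%:R 0 / l 1 0); apply/colP; apply: ord2P; rewrite LmxE lift01 scolE ?divfK //.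
by apply: (mulIf n1); rewrite h z0; field.
Qed.

Lemma linfun_Lmx (z : 'cV[F]_3) : linfun (mulmx Lmx : 'cV[F]_3 -> 'cV[F]_2) z = Lmx *m z.
Proof. by rewrite lfunE. Qed.

Lemma projection_graphP v q : represents2 v q ->
  projection_graph Lmx q <-> incident v /\ Lmx *m usubmx v != 0.
Proof.
move=> [h1 h2]; have l0 : dsubmx v != 0 by apply/rank1P; exact: represents_rank h2.
have colid n (a : 'cV[F]_n) : col 0 a = a by apply/colP => i; rewrite mxE.
rewrite /projection_graph /= h1 // h2 // !span_cols1 limg_line linfun_Lmx !colid.
rewrite (Lmx_incident l0); split=> [E|[[c E] n0]].
  have /vlineP[c Ec] : Lmx *m usubmx v \in <[dsubmx v]>%VS by rewrite -E memv_line.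
  split; first by exists c.
  apply/eqP => z; have := memv_line (dsubmx v); rewrite -E z => /vlineP[k].
  by rewrite scaler0 => /eqP; rewrite (negPf l0).
rewrite E; apply/vspaceP => u; have c0 : c != 0 by apply: contraNneq n0 => c0; rewrite E c0 scale0r.
apply/vlineP/vlineP => -[k ->]; first by exists (k * c); rewrite scalerA.
by exists (k / c); rewrite scalerA divfK.
Qed.

Lemma closed_incidence : closed incidence.
Proof.
rewrite -openC; apply/(open_subvar (A := @nonzero_pairs F)).
exists [set v : 'M[F]_(3 + 2, 1) | usubmx v 1 0 * dsubmx v 1 0 - usubmx v 2%:R 0 * dsubmx v 0 0 !=
  0].
  apply: open_polyfun; apply: polyfunB; apply: polyfunM;
    first [exact: polymap_usubmx|exact: polymap_dsubmx].
move=> x; have rx := (qpairP x _).1 erefl.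
by rewrite /= subr_eq0; split=> [n|/eqP n /(incidenceP rx)//]; apply/eqP => h; apply: n;
  apply/(incidenceP rx).
Qed.

Lemma poly_nonroot (r : {poly F}) : r != 0 -> exists2 t, t != 0 & r.[t] != 0.
Proof.
move=> r0; have r1 : r * 'X != 0 by rewrite mulf_neq0 ?polyX_eq0.
have [x] := closed_nonrootP (r * 'X) r1.
by rewrite /root hornerM hornerX mulf_eq0 negb_or => /andP[rx x0]; exists x.
Qed.

Lemma closure_graph : closure (projection_graph Lmx) = incidence.
Proof.
apply/seteqP; split.
  apply: closure_min; first exact: closed_incidence.
  move=> q; have [v rv] := represents2_ex q; move=> /(projection_graphP rv)[iv _].
  exact/(incidenceP rv).
move=> q iq; apply: contrapT => nq.
have [v rv] := represents2_ex q; have iv := (incidenceP rv).1 iq.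
have oU : open (~` closure (projection_graph Lmx)) by apply: closed_openC; exact: closed_closure.
have /open_subvar[V oV hV] := oU.
have hV' v' q' : represents2 v' q' -> V v' -> ~ closure (projection_graph Lmx) q'.
  move=> rv' Vv'; have nz := represents2_nonzero rv'.
  have <- : qpair (elt nz) = q' by exact/qpairP.
  exact: (hV (elt nz)).2 Vv'.
have Vv : V v.
  have nz := represents2_nonzero rv; apply: (hV (elt nz)).1.
  have qE : qpair (elt nz) = q by exact/qpairP.
  by suff : ~ closure (projection_graph Lmx) (qpair (elt nz)) by []; rewrite qE.
have Lz0 : Lmx *m usubmx v = 0.
  apply/eqP; apply: contrapT => /negP n; apply: nq; apply: subset_closure.
  exact/(projection_graphP rv).
have z0 : usubmx v != 0 by apply/rank1P; exact: represents_rank rv.1.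
have l0 : dsubmx v != 0 by apply/rank1P; exact: represents_rank rv.2.
(* The points [(z + t (0, l), l)] with [t != 0] lie on the graph. *)
pose c t : 'M[F]_(3 + 2, 1) := col_mx (usubmx v + t *: embed2 (dsubmx v)) (dsubmx v).
have [g [pg gv hg]] := (open_affineP V).1 oV v Vv.
have [|r hr] := @polyfun_curve F (3 + 2) 1 c g _ pg.
  move=> i j; rewrite -[i](@splitK 3 2); case: (@fintype.split 3 2 i) => i' /=.
    exists ((usubmx v i' j)%:P + 'X * (embed2 (dsubmx v) i' j)%:P) => t.
    by rewrite /c col_mxEu [LHS]mxE [X in _ + X = _]mxE hornerD hornerM hornerX !hornerC.
  by exists ((dsubmx v i' j)%:P) => t; rewrite /c col_mxEd hornerC.
have c0 : c 0 = v by rewrite /c scale0r addr0 vsubmxK.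
have r0 : r != 0 by apply: contraNneq gv => r0; rewrite -c0 hr r0 horner0.
have [t t0 rt] := poly_nonroot r0.
have Lc : Lmx *m usubmx (c t) = t *: dsubmx v.
  rewrite /c col_mxKu mulmxDr Lz0 add0r -scalemxAr; congr (_ *: _).
  by apply/colP => i; rewrite LmxE; move: i; apply: ord2P; rewrite lift01 mxE.
have Ln0 : Lmx *m usubmx (c t) != 0 by rewrite Lc scaler_eq0 negb_or t0.
have n1 : \rank (usubmx (c t)) = 1 by apply/rank1P; apply: contraNneq Ln0 => ->; rewrite mulmx0.
have n2 : \rank (dsubmx (c t)) = 1 by rewrite /c col_mxKd; exact/rank1P.
have rc : represents2 (c t) (flag_of n1, flag_of n2) by split; exact: represents_flag_of.
apply: (hV' _ _ rc); first by apply: hg; rewrite hr.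
apply: subset_closure; apply/(projection_graphP rc); split=> //.
apply/Lmx_incident; first by rewrite /c col_mxKd.
by exists t; rewrite Lc /c col_mxKd.
Qed.

(* The image of [V_2] in [F^3/<e_0> = F^2], for [V_2] containing [e_0]. *)
Definition Bpsi (B : 'M[F]_(3, 2)) : 'cV[F]_2 :=
  \col_(i < 2) (B 0 0 * B (lift ord0 i) 1 - B (lift ord0 i) 0 * B 0 1).

Definition Bpair (B : 'M[F]_(3, 2)) : 'M[F]_(3 + 2, 1) := col_mx (col 0 B) (Bpsi B).

(* [V_2] is spanned by [V_1] and [e_0] unless [V_1 = <e_0>], near which it is
   spanned by [V_1] and [(0, l)]. *)
Definition Bflag (j : bool) (v : 'M[F]_(3 + 2, 1)) : 'M[F]_(3, 2) :=
  row_mx (usubmx v) (if j then embed2 (dsubmx v) else vec3 1 0 0).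

Lemma Bpair_uptri B b q : uptri b -> b \in unitmx ->
  represents2 (Bpair B) q <-> represents2 (Bpair (B *m b)) q.
Proof.
move=> ub ib; have [b0 b1] := uptri_diag2 ub ib.
rewrite (represents2_scale _ _ q b0 (mulf_neq0 b0 b1)).
suff -> : Bpair (B *m b) = col_mx (b 0 0 *: col 0 B) ((b 0 0 * b 1 1) *: Bpsi B) by [].
congr col_mx; first by have [] := uptri_cols2 B ub.
apply/colP => i; rewrite [LHS]mxE [RHS]mxE [X in _ = _ * X]mxE.
by rewrite !(uptri_entries2 B _ ub).1 !(uptri_entries2 B _ ub).2; ring.
Qed.

Lemma Bflag_scale j (z : 'cV[F]_3) (l : 'cV[F]_2) c d : c != 0 -> d != 0 ->
  same_flag (Bflag j (col_mx z l)) (Bflag j (col_mx (c *: z) (d *: l))).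
Proof.
move=> c0 d0; rewrite /Bflag !col_mxKu !col_mxKd.
pose a := if j then d else 1; have a0 : a != 0 by rewrite /a; case: (j) => //; exact: oner_neq0.
apply: (same_flag2 (a := c) (b := 0) (d := a)) => //.
  by rewrite (col_row2 _ _).1 (col_row2 _ _).1.
rewrite (col_row2 _ _).2 (col_row2 _ _).2 scale0r add0r /a; case: (j).
  by apply/colP; apply: ord3P; rewrite !mxE /= ?mulr0.
by rewrite scale1r.
Qed.

Lemma col0_neq0 (B : 'M[F]_(3, 2)) : \rank B = 2 -> col 0 B != 0.
Proof.
move=> rB; apply/eqP => z; have [|/eqP] := (rank2P B).1 rB 1 0; last by rewrite oner_eq0.
by rewrite z scaler0 scale0r addr0.
Qed.

Lemma Bpsi_neq0 (B : 'M[F]_(3, 2)) : T0 B -> \rank B = 2 -> Bpsi B != 0.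
Proof.
move=> tB rB; apply/eqP => /colP z; move: (z 0) (z 1); rewrite /Bpsi !mxE !lift01 => z1 z2.
have [q [r BE]] := rank2_cross rB.
case/eqP: (col0_neq0 rB); rewrite BE (col_row2 _ _).1.
have -> : minors B = 0.
  rewrite minors_cross /cross ![col _ _ _ _]mxE.
  apply/colP; apply: ord3P; rewrite vec3E [RHS]mxE.
  - by rewrite tB subrr.
  - by apply: oppr_inj; rewrite oppr0 -z2; ring.
  - by rewrite -z1; ring.
by apply/colP; apply: ord3P; rewrite /cross !vec3E !mxE !mul0r subrr.
Qed.

Lemma Bpair_incident B : T0 B -> incident (Bpair B).
Proof.
move=> tB; rewrite /incident /Bpair col_mxKu col_mxKd ![col _ _ _ _]mxE ![Bpsi _ _ _]mxE !lift01.
by apply/eqP; rewrite -subr_eq0; apply/eqP; rewrite /T0 /= in tB;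
  transitivity (B 0 0 * (B 1 0 * B 2%:R 1 - B 2%:R 0 * B 1 1)); [ring|rewrite tB subrr mulr0].
Qed.

Lemma Bflag_T0 j v : incident v -> T0 (Bflag j v).
Proof.
by rewrite /T0 /Bflag /= !(row2E _ _ _).1 !(row2E _ _ _).2; case: j;
  rewrite ?vec3E ?mulr0 // !vec3E.
Qed.

Lemma Bflag_pair j B : T0 B -> \rank B = 2 -> \rank (Bflag j (Bpair B)) = 2 ->
  same_flag B (Bflag j (Bpair B)).
Proof.
move=> tB rB; rewrite /Bflag /Bpair col_mxKu col_mxKd; case: j => rk.
  have E : embed2 (Bpsi B) = - B 0 1 *: col 0 B + B 0 0 *: col 1 B.
    by apply/colP; apply: ord3P; rewrite vec3E ?[Bpsi _ _ _]mxE !mxE ?lift01; ring.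
  have b0 : B 0 0 != 0.
    apply/eqP => z; have [|_ /eqP] := (rank2P _).1 rk (B 0 1) 1; last by rewrite oner_eq0.
    by rewrite (col_row2 _ _).1 (col_row2 _ _).2 E z scale0r addr0 scale1r scaleNr subrr.
  apply: (same_flag2 (a := 1) (b := - B 0 1) (d := B 0 0)); rewrite ?oner_neq0 //.
    by rewrite (col_row2 _ _).1 scale1r.
  by rewrite (col_row2 _ _).2.
(* By [T0] the last two rows are dependent, and [rk] keeps V_1 away from the line of the first basis
   vector; hence the second column minus k times the first is a multiple of that vector. *)
have [k [k1 k2]] : exists k, B 1 1 = k * B 1 0 /\ B 2%:R 1 = k * B 2%:R 0.
  have [z1|n1] := eqVneq (B 1 0) 0; last first.
    exists (B 1 1 / B 1 0); rewrite divfK //; split=> //.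
    by apply: (mulfI n1); rewrite tB; field.
  have [z2|n2] := eqVneq (B 2%:R 0) 0; last first.
    exists (B 2%:R 1 / B 2%:R 0); rewrite divfK //; split=> //.
    by apply: (mulfI n2); rewrite -tB z1; ring.
  have [|_ /eqP] := (rank2P _).1 rk 1 (- B 0 0); last first.
    rewrite oppr_eq0 => /eqP z0; case/eqP: (col0_neq0 rB); apply/colP; apply: ord3P;
      by rewrite !mxE.
  rewrite (col_row2 _ _).1 (col_row2 _ _).2.
  by apply/colP; apply: ord3P; rewrite !mxE /= ?z1 ?z2; ring.
pose m := B 0 1 - k * B 0 0.
have E : m *: vec3 1 0 0 = - k *: col 0 B + col 1 B.
  by apply/colP; apply: ord3P; rewrite !mxE /= ?k1 ?k2 /m; ring.
have m0 : m != 0.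
  apply/eqP => z; have [|_ /eqP] := (rank2P B).1 rB (- k) 1; last by rewrite oner_eq0.
  by rewrite scale1r -E z scale0r.
apply: (same_flag2 (a := 1) (b := m^-1 * - k) (d := m^-1)); rewrite ?oner_neq0 ?invr_neq0 //.
  by rewrite (col_row2 _ _).1 scale1r.
by rewrite (col_row2 _ _).2 -scalerA -scalerDr -E scalerA mulVf // scale1r.
Qed.

Lemma Bpair_flag j v q : represents2 v q -> incident v -> \rank (Bflag j v) = 2 ->
  represents2 (Bpair (Bflag j v)) q.
Proof.
move=> rv iv rk; have z0 : usubmx v != 0 by apply/rank1P; exact: represents_rank rv.1.
have l0 : dsubmx v != 0 by apply/rank1P; exact: represents_rank rv.2.
have c0 : col 0 (Bflag j v) = usubmx v by rewrite (col_row2 _ _).1.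
suff [d d0 E] : exists2 d, d != 0 & Bpsi (Bflag j v) = d *: dsubmx v.
  rewrite /Bpair E c0 -[usubmx v]scale1r.
  by apply: (represents2_scale (usubmx v) (dsubmx v) q (oner_neq0 F) d0).1; rewrite vsubmxK.
have iv' := (Lmx_incident l0).1 iv.
have pE i : Bpsi (Bflag j v) i 0 = usubmx v 0 0 * (Bflag j v) (lift ord0 i) 1 -
   usubmx v (lift ord0 i) 0 * (Bflag j v) 0 1.
  by rewrite mxE /Bflag !(row2E _ _ _).1.
case: j rk c0 pE => rk c0 pE.
  (* The second column is (0, l), so the minors are z_0 l. If z_0 vanished, z would be a multiple of
     (0, l), against the rank. *)
  exists (usubmx v 0 0).
    apply/eqP => z; have [c E] := iv'.
    have [|_ /eqP] := (rank2P _).1 rk (-1) c.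
      rewrite c0 (col_row2 _ _).2; apply/colP; apply: ord3P; rewrite [RHS]mxE.
      - by rewrite [LHS]mxE !scolE vec3E z !mulr0 addr0.
      - have /colP/(_ 0) := E; rewrite LmxE lift01 scolE => h.
        by rewrite [LHS]mxE !scolE vec3E h mulN1r addNr.
      - have /colP/(_ 1) := E; rewrite LmxE lift01 scolE => h.
        by rewrite [LHS]mxE !scolE vec3E h mulN1r addNr.
    move=> cz; case/eqP: z0; apply/colP; move/colP: E; rewrite (eqP cz) => h.
    by apply: ord3P; rewrite [RHS]mxE //; [have := h 0|have := h 1];
      rewrite LmxE lift01 scolE mul0r.
  by apply/colP => i; rewrite pE /Bflag !(row2E _ _ _).2 [RHS]mxE; move: i; apply: ord2P;
    rewrite lift01 vec3E ?vec3E mulr0 subr0.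
(* The second column is (1, 0, 0), so the minors are - (z_1, z_2) = - c l. *)
have [c E] := iv'; exists (- c).
  rewrite oppr_eq0; apply/eqP => cz; move: E; rewrite cz scale0r => /colP h.
  have [|/eqP] := (rank2P _).1 rk 1 (- usubmx v 0 0); last by rewrite oner_eq0.
  rewrite c0 (col_row2 _ _).2; apply/colP; apply: ord3P; rewrite [RHS]mxE.
  - by rewrite [LHS]mxE !scolE vec3E mul1r mulr1 subrr.
  - have := h 0; rewrite LmxE lift01 [X in _ = X -> _]mxE => h'.
    by rewrite [LHS]mxE !scolE vec3E h' !mulr0 addr0.
  - have := h 1; rewrite LmxE lift01 [X in _ = X -> _]mxE => h'.
    by rewrite [LHS]mxE !scolE vec3E h' !mulr0 addr0.
apply/colP => i; rewrite pE /Bflag !(row2E _ _ _).2.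
rewrite scaleNr -E [RHS]mxE LmxE vec3E mulr1.
by move: i; apply: ord2P; rewrite lift01 vec3E mulr0 sub0r.
Qed.

Lemma polymap_Bpair : polymap Bpair.
Proof.
apply: (@polymap_col_mx _ 3 2 3 2); first exact/polymap_col/polymap_id.
by apply: polymap_mx => i _; apply: polyfunB; apply: polyfunM; exact: polyfun_entry.
Qed.

Lemma polymap_Bflag j : polymap (Bflag j).
Proof.
apply: (@polymap_row_mx _ (3 + 2) 1 3 1 1); first exact: polymap_usubmx.
case: j; last exact: polymap_const.
by apply: polymap_vec3; [exact: polyfun_const|exact: polymap_dsubmx|exact: polymap_dsubmx].
Qed.

Lemma Bflag_ex v : nonzero_pairs v -> exists j, \rank (Bflag j v) = 2.
Proof.
move=> [/rank1P z0 /rank1P l0].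
have [Lz|Lz] := eqVneq (Lmx *m usubmx v) 0; [exists true|exists false]; apply/rank2P => x y;
  rewrite (col_row2 _ _).1 (col_row2 _ _).2 => /colP h.
  have zi i : usubmx v (lift ord0 i) 0 = 0 by rewrite -LmxE Lz mxE.
  have y0 : y = 0.
    apply/eqP; apply: contraNT l0 => yn; apply/eqP/colP => i; rewrite [RHS]mxE.
    have := h (lift ord0 i); rewrite [LHS]mxE !scolE zi mulr0 add0r [RHS]mxE => /eqP.
    rewrite mulf_eq0 (negPf yn) => /eqP <-.
    by move: i {h}; apply: ord2P; rewrite lift01 vec3E.
  split=> //; apply/eqP; apply: contraNT z0 => xn; apply/eqP/colP.
  apply: ord3P; rewrite [RHS]mxE; [|by rewrite -lift01 zi|by rewrite -lift01 zi].
  have := h 0; rewrite [LHS]mxE !scolE y0 mul0r addr0 [RHS]mxE => /eqP.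
  by rewrite mulf_eq0 (negPf xn) => /eqP.
have x0 : x = 0.
  apply/eqP; apply: contraNT Lz => xn; apply/eqP/colP => i; rewrite LmxE [RHS]mxE.
  have := h (lift ord0 i); rewrite [LHS]mxE !scolE [RHS]mxE.
  have -> : vec3 1 0 0 (lift ord0 i) 0 = 0 :> F by move: i {h}; apply: ord2P; rewrite lift01 vec3E.
  by rewrite mulr0 addr0 => /eqP; rewrite mulf_eq0 (negPf xn) => /eqP.
split=> //; have := h 0; rewrite [LHS]mxE !scolE x0 mul0r add0r vec3E mulr1 => ->.
by rewrite mxE.
Qed.

Lemma isomorphic_T0_incidence :
  isomorphic (subvar (flag_set (@T0 F))) (subvar incidence).
Proof.
apply: (@isomorphic_related F 3 2 (3 + 2) 1 (@full_rank F 3 2) (@nonzero_pairs F) _ _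
   (@flag_quot F 3 2) qpair (@open_full_rank F 3 2) open_nonzero_pairs _ _
   (fun W q => exists2 B, represents B W & represents2 (Bpair B) q)).
- move=> W AW; have [B rB] := flag_represented W; have tB := (flag_set_inv (@T0_inv F) rB).1 AW.
  have rk := represents_rank rB.
  have nzP D : T0 D -> \rank D = 2 -> nonzero_pairs (Bpair D).
    move=> tD rD; split; rewrite /Bpair ?col_mxKu ?col_mxKd; apply/rank1P.
      exact: col0_neq0.
    exact: Bpsi_neq0.
  exists (@elt _ (@full_rank F 3 2) B rk), Bpair; split.
  + exact/flag_quotP.
  + exact: polymap_Bpair.
  + exact: nzP.
  + move=> D D' hD e.
    have rD := (flag_quotP D _).1 erefl; have rD' := (flag_quotP D' _).1 (esym e).
    have [b [DE ub ib]] := represents_uptri rD rD'.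
    have rq := (qpairP (elt hD) _).1 erefl.
    have rq' := (Bpair_uptri (val D) (qpair (elt hD)) ub ib).1 rq; rewrite -DE in rq'.
    by exists (represents2_nonzero rq'); apply/qpairP.
  + move=> D hD AD; have rD := (flag_quotP D _).1 erefl; have rq := (qpairP (elt hD) _).1 erefl.
    have tD := (flag_set_inv (@T0_inv F) rD).1 AD.
    by split; [apply/(incidenceP rq); exact: Bpair_incident|exists (val D)].
- move=> q iq; have [v rv] := represents2_ex q; have nz := represents2_nonzero rv.
  have [j rj] := Bflag_ex nz.
  exists (elt nz), (Bflag j); split.
  + exact/qpairP.
  + exact: polymap_Bflag.
  + exact: rj.
  + move=> D D' hD e.
    have rD := (qpairP D _).1 erefl; have rD' := (qpairP D' _).1 (esym e).
    have [c [d [c0 d0 E]]] := represents2_uniq rD rD'.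
    have := Bflag_scale j (usubmx (val D)) (dsubmx (val D)) c0 d0; rewrite -E vsubmxK => sf.
    have rq := (same_flag_represents _ sf).1 ((flag_quotP (elt hD) _).1 erefl).
    by exists (represents_rank rq); apply/flag_quotP.
  + move=> D hD AD; have rD := (qpairP D _).1 erefl; have rq := (flag_quotP (elt hD) _).1 erefl.
    have iD := (incidenceP rD).1 AD.
    split; first by exists (Bflag j (val D)) => //; exact: Bflag_T0.
    by exists (Bflag j (val D)) => //; exact: Bpair_flag.
- move=> W q q' _ _ _ [B rB h] [B' rB' h'].
  have [b [E ub ib]] := represents_uptri rB rB'.
  have h2 := (Bpair_uptri B q ub ib).1 h; rewrite -E in h2.
  have := (qpairP (elt (represents2_nonzero h2)) q).2 h2.
  by have /qpairP -> : represents2 (val (elt (represents2_nonzero h2))) q' by [].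
move=> W W' q AW AW' _ [B rB h] [B' rB' h'].
have tB := (flag_set_inv (@T0_inv F) rB).1 AW; have tB' := (flag_set_inv (@T0_inv F) rB').1 AW'.
have [j rj] := Bflag_ex (represents2_nonzero h).
have [c [d [c0 d0 E]]] := represents2_uniq h h'.
have := Bflag_scale j (usubmx (Bpair B)) (dsubmx (Bpair B)) c0 d0; rewrite -E vsubmxK => sf.
have rj' : \rank (Bflag j (Bpair B')) = 2 by rewrite -(same_flag_rank sf).
have s1 := Bflag_pair tB (represents_rank rB) rj;
  have s2 := Bflag_pair tB' (represents_rank rB') rj'.
apply: represents_inj ((same_flag_represents W sf).1 ((same_flag_represents W s1).1 rB)) _.
exact/(same_flag_represents W' s2).
Qed.

Lemma iso_blowup_T0 (X : fspace F) : isomorphic X (subvar (flag_set (@T0 F))) ->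
  exists z : proj_space F 2, iso_blowup z X.
Proof.
move=> iX; have r1 : \rank (vec3 1 0 0 : 'cV[F]_3) = 1.
  by apply/rank1P/eqP => /colP/(_ 0); rewrite vec3E mxE => /eqP; rewrite oner_eq0.
exists (flag_of r1), Lmx; split.
  rewrite (represents_flag_of r1) // span_cols1; apply/vspaceP => v; rewrite memv_ker linfun_Lmx.
  have -> : col 0 (vec3 1 0 0) = vec3 1 0 0 :> 'cV[F]_3 by apply/colP => i; rewrite mxE.
  apply/eqP/vlineP => [Lv|[k ->]].
    exists (v 0 0); rewrite [LHS]vec3P; have e i : v (lift ord0 i) 0 = 0 by rewrite -LmxE Lv mxE.
    have [e1 e2] : v 1 0 = 0 /\ v 2%:R 0 = 0 by move: (e 0) (e 1); rewrite !lift01.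
    by apply/colP; apply: ord3P; rewrite scolE !vec3E ?e1 ?e2 ?mulr0 ?mulr1.
  apply/colP => i; rewrite LmxE scolE [RHS]mxE.
  by move: i; apply: ord2P; rewrite lift01 vec3E mulr0.
rewrite closure_graph; apply: isomorphic_trans iX _; exact: isomorphic_T0_incidence.
Qed.

End BlowUp.

(** * The irreducible components and the complete statement *)

Lemma flag_components (F : closedFieldType) (p : nat) (charFp : p \in [pchar F])
    (C : set (flag_variety F 6 6)) :
  irreducible_component (FlagFV F p) C <->
  [\/ C = Yset F, C = Zset F p | exists2 z, Iinf p z & C = Tset F p z].
Proof.
have [s hs] := finite_Iinf charFp.
(* One index type for all candidates: the boolean distinguishes Y from Z, the option runs through
   the T_zeta. *)
pose D (i : bool + option (F * F)) : set (flag6 F) :=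
  match i with inl true => Yset F | inl false => Zset F p | inr z => Tset F p z end.
pose r : seq (bool + option (F * F)) := inl true :: inl false :: map inr s.
have rP i : i \in r <-> if i is inr z then Iinf p z else True.
  rewrite /r !inE; case: i => [[]|z] //=.
  by rewrite mem_map ?hs // => x y [].
have [YnZ YnT] := Y_witnesses charFp; have [W [ZW nYW nTW]] := Z_witness charFp.
rewrite (@irreducible_components_of _ _ r D).
- split=> [[[[]|z] []]|].
  + by move=> _ ->; constructor 1.
  + by move=> _ ->; constructor 2.
  + by move=> /rP Iz ->; constructor 3; exists z.
  case=> [->|->|[z Iz ->]]; [exists (inl true)|exists (inl false)|exists (inr z)];
    by split=> //; exact/rP.
- case=> [[]|z] /rP Ii; [exact: closed_Y|exact: closed_Z|exact: closed_T].
- case=> [[]|z] /rP Ii; [exact: irreducible_Y|exact: irreducible_Z|exact: irreducible_T].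
- move=> i j /rP Ii /rP Ij sub.
  case: i j Ii Ij sub => [[]|z] [[]|z'] //= Ii Ij sub.
  + by have [V [YV []]] := YnZ; exact: sub.
  + by have [V [YV /(_ z')[]]] := YnT; split=> //; exact: sub.
  + by case: nYW; exact: sub.
  + by case: (nTW z'); split=> //; exact: sub.
  + have [V [/TsetP TV nYV _]] := TE_not_YZ charFp (TbasisP charFp Ii).
    by case: nYV; exact: sub.
  + have [V [/TsetP TV _ nZV]] := TE_not_YZ charFp (TbasisP charFp Ii).
    by case: nZV; exact: sub.
  + have [V [/TsetP TV _ _]] := TE_not_YZ charFp (TbasisP charFp Ii).
    congr inr; apply: contrapT => n; have := Tset_disjoint charFp Ii Ij n.
    by move=> /seteqP[+ _] => /(_ V); apply; split=> //; exact: sub.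
rewrite (FlagFV_union charFp); apply/seteqP; split=> V.
  case=> [YV|ZV|[z Iz TV]]; [exists (inl true)|exists (inl false)|exists (inr z)];
    by split=> //; exact/rP.
by case=> -[[]|z] [/rP Ii DV]; [constructor 1|constructor 2|constructor 3; exists z].
Qed.

Lemma Z0E (F : closedFieldType) (p : nat) (charFp : p \in [pchar F]) :
  Z0 F p = flag_set (@hermB F p).
Proof.
apply/seteqP; split=> W [B].
  by move=> [/(admissibleP charFp)[_ hB] rB]; exists B.
move=> hB rB; exists B; split=> //; apply/(admissibleP charFp).
by split=> //; exact: represents_rank rB.
Qed.

Theorem mainTheorem2 (p : nat) (p_prime : prime p) (F : closedFieldType)
    (iota : {rmorphism 'F_p -> F})
    (F_alg : forall x : F, algebraicOver iota x) :
  (* the irreducible components *)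
  (forall C : set (flag_variety F 6 6),
     irreducible_component (FlagFV F p) C <->
     [\/ C = Yset F, C = Zset F p |
         exists2 zeta : option (F * F), Iinf p zeta & C = Tset F p zeta]) /\
  (* the structure of Y, Z and T_zeta *)
  (isomorphic (subvar (Yset F)) (flag_variety F 3 3) /\ has_dim (subvar (Yset F)) 3) /\
  has_dim (subvar (Zset F p)) 3 /\
  (forall zeta : option (F * F), Iinf p zeta ->
     (exists z : proj_space F 2, iso_blowup z (subvar (Tset F p zeta))) /\
     has_dim (subvar (Tset F p zeta)) 2) /\
  (* (a) *)
  (forall zeta zeta' : option (F * F), Iinf p zeta -> Iinf p zeta' ->
     zeta <> zeta' -> Tset F p zeta `&` Tset F p zeta' = set0) /\
  (* (b) *)
  (Yset F `&` Zset F p = Zlow F p /\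
   closed (Z0 F p) /\
   isomorphic (subvar (Yset F `&` Zset F p)) (subvar (Z0 F p)) /\
   has_dim (subvar (Yset F `&` Zset F p)) 2) /\
  (* (c) *)
  (Yset F `&` Tset F p None =
     [set W : flag F 6 6 | Yset F W /\ W 1%N = <[e 4]>%VS] /\
   isomorphic (subvar (Yset F `&` Tset F p None)) (proj_space F 1)) /\
  (forall x y : F, Iset p (x, y) ->
     Yset F `&` Tset F p (Some (x, y)) =
       [set W : flag F 6 6 | Yset F W /\
          W 1%N = <[x ^+ p *: e 4 + y ^+ p *: e 5 + e 6]>%VS] /\
     isomorphic (subvar (Yset F `&` Tset F p (Some (x, y)))) (proj_space F 1)) /\
  (* (d) *)
  (Zset F p `&` Tset F p None = Tinf_low F /\
   isomorphic (subvar (Zset F p `&` Tset F p None)) (proj_space F 1)) /\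
  (forall x y : F, Iset p (x, y) ->
     Zset F p `&` Tset F p (Some (x, y)) = Txy_low F p x y /\
     isomorphic (subvar (Zset F p `&` Tset F p (Some (x, y)))) (proj_space F 1)) /\
  (* (e) *)
  (exists W : flag F 6 6,
     is_Phi (cols3 (e 4) (e 5) (e 6)) W /\
     Yset F `&` Zset F p `&` Tset F p None = [set W]) /\
  (forall x y : F, Iset p (x, y) ->
     exists W : flag F 6 6,
       is_Phi (cols3 (x ^+ p *: e 4 + y ^+ p *: e 5 + e 6)
                     (- y *: e 4 + e 5) (e 4)) W /\
       Yset F `&` Zset F p `&` Tset F p (Some (x, y)) = [set W]).
Proof.
have charFp : p \in [pchar F] by apply: (rmorph_pchar iota); exact: pchar_Fp.
have TB z (Iz : Iinf p z) := TbasisP charFp Iz.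
have Iinfty : Iinf (F := F) p None by [].
have hYT z (Iz : Iinf p z) : Yset F `&` Tset F p z =
    [set W : flag F 6 6 | Yset F W /\ W 1%N = <[Tf p z]>%VS].
  apply/seteqP; split=> W [YW].
    by move=> /TsetP TW; exact: (Y_TE (TB z Iz) W).1 (conj YW TW).
  by move=> W1; have [_ TW] := (Y_TE (TB z Iz) W).2 (conj YW W1); split=> //; exact/TsetP.
have hZT z (Iz : Iinf p z) : Zset F p `&` Tset F p z = Tlow (Tf p z) (Tg z) (Tw z) (Th z).
  apply/seteqP; split=> W; first by move=> [ZW /TsetP TW]; exact/(Z_TE charFp (TB z Iz)).
  by move=> /(Z_TE charFp (TB z Iz))[ZW TW]; split=> //; exact/TsetP.
have hYZT z (Iz : Iinf p z) : exists W : flag F 6 6,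
    is_Phi (cols3 (Tf p z) (Tg z) (Th z)) W /\ Yset F `&` Zset F p `&` Tset F p z = [set W].
  have [W [hP hW]] := YZ_TE charFp (TB z Iz); exists W; split=> //.
  apply/seteqP; split=> W'; first by move=> [YZ /TsetP TW]; exact/hW.
  by move=> /hW[YZ TW]; split=> //; exact/TsetP.
split; first by move=> C; exact: flag_components.
split.
  split; last exact: has_dim_Y charFp.
  rewrite YsetE; apply: isomorphic_trans (trunc_isomorphic (@SY_isotropic F)) _.
  exact: isomorphic_SY_flag3.
split; first exact: has_dim_Z.
split.
  move=> z Iz; split; last exact: has_dim_T.
  by apply: iso_blowup_T0; exact: isomorphic_TZ.
split; first exact: Tset_disjoint.
split.
  split; first by apply/seteqP; split=> W /(YZsetP charFp).
  rewrite (Z0E charFp); split; first exact: closed_herm.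
  by split; [exact: isomorphic_YZ|exact: has_dim_YZ].
split; first by split; [exact: hYT|exact: isomorphic_YT].
split; first by move=> x y Ixy; split; [exact: (hYT (Some (x, y)))|exact: isomorphic_YT].
split; first by split; [exact: hZT|exact: isomorphic_ZT].
split; first by move=> x y Ixy; split; [exact: (hZT (Some (x, y)))|exact: isomorphic_ZT].
split; first exact: (hYZT None).
by move=> x y Ixy; exact: (hYZT (Some (x, y))).
Qed.
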